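(* There exists a deterministic fully dynamic algorithm which, on an $n$-node graph undergoing edge insertions and deletions (starting from the empty graph), maintains a $1.999999$-approximate maximum matching with worst-case update time $O(m^{3/8})$, where $m$ is the number of edges.
   Context: A dynamic graph $G=(V,E)$ on a fixed node set $V$ with $|V|=n$ starts empty and undergoes a sequence of edge updates (insertions and deletions). A dynamic matching algorithm maintains a matching $M$ of the current graph; it is $\alpha$-approximate if after every update $\mu(G)\le \alpha\cdot |M|$, where $\mu(G)$ is the maximum matching size of the current graph. Its worst-case update time is the maximum time spent processing any single update. *)

(* Defs.v *)
From HB Require Import structures.
From mathcomp Require Import all_boot all_order all_algebra.
From mathcomp Require Import reals exp.

Set Implicit Arguments.
Unset Strict Implicit.
Unset Printing Implicit Defensive.

Import Order.TTheory GRing.Theory Num.Theory.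

(* Graphs on the fixed node set 'I_n, given by their edge sets; every edge is
   a two-element set of nodes (an invariant of [legal] updates). *)

Definition graph (n : nat) := {set {set 'I_n}}.

Definition is_matching n (E M : graph n) : bool := (M \subset E) && trivIset M.

Definition mu n (E : graph n) : nat :=
  \max_(M : graph n | is_matching E M) #|M|.

Inductive update (n : nat) :=
  | Insert of 'I_n & 'I_n
  | Delete of 'I_n & 'I_n.

Definition legal n (E : graph n) (a : update n) : bool :=
  match a with
  | Insert u v => (u != v) && ([set u; v] \notin E)
  | Delete u v => [set u; v] \in E
  end.

Definition apply n (E : graph n) (a : update n) : graph n :=
  match a with
  | Insert u v => [set u; v] |: E
  | Delete u v => E :\ [set u; v]
  end.

(* Word RAM with w-bit words.  A program is a fixed finite piece of code over
   registers and a random-access memory of words; it depends neither on the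
   number of nodes nor on w.  All arithmetic is modulo 2 ^ w, and every
   instruction and every branch test takes one unit of time. *)

Definition reg := nat.

Record state := State { regs : reg -> nat; mem : nat -> nat }.

Definition state0 : state := State (fun=> 0) (fun=> 0).

Definition upd (f : nat -> nat) (i x : nat) : nat -> nat :=
  fun j => if j == i then x else f j.

Definition set_reg (s : state) (x : reg) (a : nat) : state :=
  State (upd (regs s) x a) (mem s).

Definition set_mem (s : state) (i a : nat) : state :=
  State (regs s) (upd (mem s) i a).

Inductive binop :=
  | Add | Sub | Mul | Div | Mod | And | Or | Xor | Shl | Shr | Ltn | Eqn.

Definition eval_op (w : nat) (o : binop) (a b : nat) : nat :=
  (match o with
   | Add => a + b
   | Sub => a + (2 ^ w - b)
   | Mul => a * b
   | Div => a %/ b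
   | Mod => a %% b
   | And => Nat.land a b
   | Or => Nat.lor a b
   | Xor => Nat.lxor a b
   | Shl => a * 2 ^ b
   | Shr => a %/ 2 ^ b
   | Ltn => a < b
   | Eqn => a == b
   end) %% 2 ^ w.

Inductive program :=
  | Skip
  | Const (x : reg) (k : nat)
  | Op (o : binop) (x y z : reg)
  | Read (x y : reg)
  | Write (x y : reg)
  | Seq (p q : program)
  | If (x : reg) (p q : program)
  | While (x : reg) (p : program).

(* [exec w p s s' t]: on w-bit words, p started in s halts in s' after t steps. *)
Inductive exec (w : nat) : program -> state -> state -> nat -> Prop :=
  | ExecSkip s : exec w Skip s s 1
  | ExecConst x k s : exec w (Const x k) s (set_reg s x (k %% 2 ^ w)) 1
  | ExecOp o x y z s :
      exec w (Op o x y z) s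
        (set_reg s x (eval_op w o (regs s y) (regs s z))) 1
  | ExecRead x y s : exec w (Read x y) s (set_reg s x (mem s (regs s y))) 1
  | ExecWrite x y s : exec w (Write x y) s (set_mem s (regs s x) (regs s y)) 1
  | ExecSeq p q s1 s2 s3 t1 t2 :
      exec w p s1 s2 t1 -> exec w q s2 s3 t2 -> exec w (Seq p q) s1 s3 (t1 + t2)
  | ExecIfTrue x p q s s' t :
      regs s x != 0 -> exec w p s s' t -> exec w (If x p q) s s' t.+1
  | ExecIfFalse x p q s s' t :
      regs s x = 0 -> exec w q s s' t -> exec w (If x p q) s s' t.+1
  | ExecWhileTrue x p s1 s2 s3 t1 t2 :
      regs s1 x != 0 -> exec w p s1 s2 t1 -> exec w (While x p) s2 s3 t2 ->
      exec w (While x p) s1 s3 (t1 + t2).+1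
  | ExecWhileFalse x p s : regs s x = 0 -> exec w (While x p) s s 1.

Lemma exec_det w p s s1 s2 t1 t2 :
  exec w p s s1 t1 -> exec w p s s2 t2 -> s1 = s2 /\ t1 = t2.
Proof.
move=> H; elim: H s2 t2 => {p s s1 t1};
  try by intros; match goal with E : exec _ _ _ _ _ |- _ => inversion E end.
- move=> p q s1 s2 s3 t1 t2 _ IH1 _ IH2 s4 t4 H; inversion H; subst.
  match goal with E : exec _ p _ _ _ |- _ => have [? ?] := IH1 _ _ E end; subst.
  by match goal with E : exec _ q _ _ _ |- _ => have [-> ->] := IH2 _ _ E end.
- move=> x p q s s' t /eqP nz _ IH s2 t2 H; inversion H; subst => //.
  by match goal with E : exec _ p _ _ _ |- _ => have [-> ->] := IH _ _ E end.
- move=> x p q s s' t z _ IH s2 t2 H; inversion H; subst.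
    by match goal with N : is_true (regs s x != 0) |- _ => move/eqP: N end.
  by match goal with E : exec _ q _ _ _ |- _ => have [-> ->] := IH _ _ E end.
- move=> x p s1 s2 s3 t1 t2 /eqP nz _ IH1 _ IH2 s4 t4 H; inversion H; subst => //.
  match goal with E : exec _ p _ _ _ |- _ => have [? ?] := IH1 _ _ E end; subst.
  by match goal with E : exec _ (While x p) _ _ _ |- _ =>
    have [-> ->] := IH2 _ _ E end.
- move=> x p s z s2 t2 H; inversion H; subst => //.
  by match goal with N : is_true (regs s x != 0) |- _ => move/eqP: N end.
Qed.

(* Calling convention: to process an update, the program is run once on the
   current memory and registers, with n in register 0, 1 (insertion) or
   0 (deletion) in register 1 and the end points in registers 2 and 3. *)
Definition input n (a : update n) (s : state) : state :=
  let: (b, u, v) := match a with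
                    | Insert u v => (1, u, v)
                    | Delete u v => (0, u, v)
                    end in
  set_reg (set_reg (set_reg (set_reg s 0 n) 1 b) 2 (val u)) 3 (val v).

(* [reachable w n p E s]: some legal sequence of updates leads from the empty
   graph to E, and p from the blank state to s. *)
Inductive reachable (w n : nat) (p : program) : graph n -> state -> Prop :=
  | ReachStart : reachable w p set0 state0
  | ReachStep E s a s' t :
      reachable w p E s -> legal E a -> exec w p (input a s) s' t ->
      reachable w p (apply E a) s'.

(* Register 4 points to the array of mates: its entry v is u + 1 when v is
   matched to u, and 0 when v is unmatched. *)
Definition stores n (s : state) (M : graph n) : Prop :=
  forall v : 'I_n,
    match mem s (regs s 4 + v) with
    | k.+1 => exists2 u : 'I_n, val u = k & [set v; u] \in M
    | 0 => is_true (v \notin cover M)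
    end.

Definition maintains_matching (R : realType) (alpha : R) (w n : nat)
    (p : program) : Prop :=
  forall (E : graph n) (s : state) (a : update n),
    reachable w p E s -> legal E a ->
    exists s' t, exec w p (input a s) s' t /\
      exists M : graph n,
        [/\ stores s' M, is_matching (apply E a) M
          & ((mu (apply E a))%:R <= alpha * #|M|%:R :> R)%R].

(* The time bound is in terms of the number m of edges at the time of the
   update, counting the edge that is inserted or deleted; so m > 0. *)
Definition update_time_le (R : realType) (f : nat -> R) (w n : nat)
    (p : program) : Prop :=
  forall (E : graph n) (s : state) (a : update n) (s' : state) (t : nat),
    reachable w p E s -> legal E a -> exec w p (input a s) s' t ->
    (t%:R <= f (maxn #|E| #|apply E a|))%R.

(* Words of at least (c + 1) * log2 (n + 2) bits. *)
Definition word_size_ok (c w n : nat) : bool := n.+2 ^ c.+1 <= 2 ^ w.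

(* Main.v *)
(** The algorithm keeps a sparse subgraph H of the current graph G in which the
    degree sums of edges of H are at most about B, while the degree sums of
    edges of G outside H are at least about B, where B is of order m^(1/8).
    A matching of H without augmenting paths of length at most five is then
    smaller than a maximum matching of G by a factor bounded away from 2.

    All work is local.  A change of H rebuilds the matching by an exhaustive
    search of O(B^3) steps around the changed edge.  A change of a degree in H
    is propagated along a chain of alternating removals and insertions; the
    degrees along the chain move by a constant fraction of B every other step,
    so chains have constant length.  Before the degree of a vertex drops, B^3
    edges at this vertex are inspected in round-robin order, and every update
    also inspects a constant number of edges of G in round-robin order.  Hence
    a violated edge is near the front of its queues, which bounds the violation
    by a small fraction of B unless a vertex has degree above B^4; there are so
    few such vertices that they do not matter. *)
From HB Require Import structures.
From Stdlib Require Import FunctionalExtensionality.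
From mathcomp Require Import all_boot zify.

Set Implicit Arguments.
Unset Strict Implicit.
Unset Printing Implicit Defensive.

(** * Augmenting paths of length at most five *)

(** The degree bounds alone give factor 2: charge every edge of an optimal matching with twice the
    threshold, and the matched vertices can just pay. The improvement is a stability argument. If
    almost nothing of this budget is wasted, then almost every matched edge has an end whose
    H-neighbours are mostly free vertices of tiny degree, and the optimal matching would have to
    cover many times more free vertices than it can.

    The exponent balances two errors. The queue of a vertex with d incident edges turns over after
    about d / B^3 decrements, which is at most B / Q, with Q a large constant, if d is at most B^4 /
    Q. As m is at most of order (B / Q)^8, only about B^4 / Q^7 vertices have larger d. They matter
    only if the matching is small; then such a vertex has so many neighbours that one near the end
    of its queue is free, of tiny H-degree and itself unexceptional, so that the small violation at
    this edge shows that the vertex has H-degree about B.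

    Since B changes with m, edges have been checked against outdated thresholds; the position of an
    edge in the global queue bounds how outdated. *)

Section Augment.
Variables (T : finType) (h : rel T).
Hypothesis h_sym : symmetric h.
Hypothesis h_irr : irreflexive h.
Implicit Types (f g : T -> T) (K S : {set T}).

(** A matching is an involution whose fixed points are the free vertices. Flipping a path then
    changes function values, and components of a symmetric difference become sets closed under two
    involutions. *)
Definition mtch f := involutive f /\ forall x, f x != x -> h x (f x).

Definition aug1 f u v := [&& f u == u, f v == v, u != v & h u v].
Definition aug3 f u a v :=
  [&& f u == u, f v == v, u != v, f a != a, h u a & h (f a) v].
(** The other inequalities follow: [c] differs from [f a] because [h] is irreflexive, and moved
    vertices differ from the two fixed ends. *)
Definition aug5 f u a c v :=
  [&& f u == u, f v == v, u != v, f a != a, f c != c, c != a, h u a,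
      h (f a) c & h (f c) v].

(** [X] exempts ends of paths: it holds the vertices that have been freed but not yet searched
    from. *)
Definition no_aug f (X : pred T) := forall u v, ~~ X u -> ~~ X v ->
  [/\ ~~ aug1 f u v, forall a, ~~ aug3 f u a v & forall a c, ~~ aug5 f u a c v].

Lemma aug1C f u v : aug1 f u v = aug1 f v u.
Proof. by rewrite /aug1 h_sym [u == v]eq_sym andbCA. Qed.

Lemma aug3_rev f u a v : involutive f -> aug3 f u a v -> aug3 f v (f a) u.
Proof.
move=> fI /and5P[fu fv uv fa /andP[ua bv]].
by rewrite /aug3 fI fu fv eq_sym uv eq_sym fa /= [h v _]h_sym bv h_sym ua.
Qed.

Lemma aug5_rev f u a c v :
  involutive f -> aug5 f u a c v -> aug5 f v (f c) (f a) u.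
Proof.
move=> fI /and5P[fu fv uv fa /and5P[fc ca ua bc dv]].
rewrite /aug5 !fI fu fv [v == u]eq_sym uv [c == _]eq_sym fc [a == _]eq_sym fa /=.
by rewrite (inj_eq (inv_inj fI)) eq_sym ca [h v _]h_sym dv [h c _]h_sym bc h_sym ua.
Qed.

Definition nfix f := #|[set x | f x == x]|.
Definition diff f g := [set x | f x != g x].
Definition match2 f u v := fun x => if x == u then v else if x == v then u else f x.
Definition rmv f a := fun x => if (x == a) || (x == f a) then x else f x.

Lemma match2P f u v : mtch f -> f u = u -> f v = v -> u != v -> h u v ->
  mtch (match2 f u v) /\ nfix f = (nfix (match2 f u v)).+2.
Proof.
move=> [fI fh] fu fv uv huv; rewrite /match2; split; [split|].
- move=> x; case: (eqVneq x u) => [->|xu]; first by rewrite [v == u]eq_sym (negPf uv) eqxx.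
  case: (eqVneq x v) => [->|xv]; first by rewrite eqxx.
  have /negPf-> : f x != u by apply: contra_neq xu => E; rewrite -[x]fI E fu.
  have /negPf-> : f x != v by apply: contra_neq xv => E; rewrite -[x]fI E fv.
  exact: fI.
- move=> x; case: (eqVneq x u) => [->|xu] //; case: (eqVneq x v) => [->|xv] //.
    by rewrite h_sym.
  exact: fh.
- rewrite /nfix (cardsD1 u) inE fu eqxx (cardsD1 v) !inE eq_sym uv fv eqxx /=.
  rewrite !add1n; congr _.+2; apply: eq_card => x; rewrite !inE.
  case: (eqVneq x u) => [->|xu]; first by rewrite andbF [v == u]eq_sym (negPf uv).
  by case: (eqVneq x v) => [->|xv] //=; rewrite (negPf uv).
Qed.

Lemma rmvP f a : mtch f -> f a != a ->
  mtch (rmv f a) /\ nfix (rmv f a) = (nfix f).+2.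
Proof.
move=> [fI fh] fa; rewrite /rmv; split; [split|].
- move=> x; case E : ((x == a) || (x == f a)); first by rewrite E.
  have [xa xb] : x <> a /\ x <> f a by move/norP: (negbT E) => [/eqP ? /eqP].
  rewrite (_ : (f x == a) || (f x == f a) = false) ?fI //.
  apply/norP; split; apply/eqP => E2; first by apply: xb; rewrite -E2 fI.
  by apply: xa; rewrite -[x]fI E2 fI.
- move=> x; case: ifP => _; first by rewrite eqxx.
  exact: fh.
- rewrite /nfix (cardsD1 a) (cardsD1 (f a)) !inE fa !eqxx orbT /= !eqxx.
  rewrite !add1n; congr _.+2; apply: eq_card => x; rewrite !inE.
  case: (eqVneq x a) => [->|xa] /=; first by rewrite andbF (negPf fa).
  by case: (eqVneq x (f a)) => [->|xb] //=; rewrite fI eq_sym (negPf fa).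
Qed.

Lemma flip1P f u v : mtch f -> aug1 f u v ->
  [/\ mtch (match2 f u v), nfix f = (nfix (match2 f u v)).+2
    & diff f (match2 f u v) \subset [set u; v]].
Proof.
move=> mf /and4P[/eqP fu /eqP fv uv huv].
have [m n] := match2P mf fu fv uv huv; split => //.
apply/subsetP => x; rewrite !inE /match2.
by case: (eqVneq x u) => //= xu; case: (eqVneq x v) => //= xv; rewrite eqxx.
Qed.

Definition flip3 f u a v := match2 (match2 f u a) (f a) v.
Definition flip5 f u a c v := match2 (match2 (match2 f u a) (f a) c) (f c) v.

Lemma mtch_eq f g : f =1 g -> mtch f -> mtch g.
Proof. by move=> E [fI fh]; split=> x; rewrite -!E; [exact: fI | exact: fh]. Qed.

Lemma nfix_eq f g : f =1 g -> nfix f = nfix g.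
Proof. by move=> E; apply: eq_card => x; rewrite !inE E. Qed.

Lemma flip3P f u a v : mtch f -> aug3 f u a v ->
  [/\ mtch (flip3 f u a v), nfix f = (nfix (flip3 f u a v)).+2
    & diff f (flip3 f u a v) \subset [set u; a; f a; v]].
Proof.
move=> mf /and5P[/eqP fu /eqP fv uv fa /andP[ua bv]].
have [fI fh] := mf.
have au : a != u by apply: contraNneq fa => ->; rewrite fu.
have av : a != v by apply: contraNneq fa => ->; rewrite fv.
have bu : f a != u by apply: contraNneq fa => E; rewrite -{2}[a]fI E fu.
have bv' : f a != v by apply: contraNneq fa => E; rewrite -{2}[a]fI E fv.
(* The matched edge is removed first, so that each later [match2] joins two free vertices. The
   number of fixed points goes up by two once and down by two twice. *)
have [m1 n1] := rmvP mf fa.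
have r_u : rmv f a u = u by rewrite /rmv fu; case: ifP.
have r_v : rmv f a v = v by rewrite /rmv fv; case: ifP.
have r_a : rmv f a a = a by rewrite /rmv eqxx.
have r_b : rmv f a (f a) = f a by rewrite /rmv eqxx orbT.
have ua' : u != a by rewrite eq_sym.
have [m2 n2] := match2P m1 r_u r_a ua' ua.
have e1 : match2 (rmv f a) u a (f a) = f a by rewrite /match2 (negPf bu) (negPf fa).
have e2 : match2 (rmv f a) u a v = v.
  by rewrite /match2 eq_sym (negPf uv) eq_sym (negPf av).
have [m3 n3] := match2P m2 e1 e2 bv' bv.
have E : match2 (match2 (rmv f a) u a) (f a) v =1 flip3 f u a v.
  move=> x; rewrite /flip3 /match2 /rmv.
  case: eqVneq => // x1; case: eqVneq => // x2; case: eqVneq => // x3.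
  by case: eqVneq.
split; first exact: mtch_eq E m3.
  by rewrite -(nfix_eq E); move: n2; rewrite n1 n3 => -[].
apply/subsetP => x; rewrite !inE /flip3 /match2.
case: (eqVneq x u) => //= ?; case: (eqVneq x a) => //= ?.
by case: (eqVneq x (f a)) => //= ?; case: (eqVneq x v) => //= ?; rewrite eqxx.
Qed.

Lemma flip5P f u a c v : mtch f -> aug5 f u a c v ->
  [/\ mtch (flip5 f u a c v), nfix f = (nfix (flip5 f u a c v)).+2
    & diff f (flip5 f u a c v) \subset [set u; a; f a; c; f c; v]].
Proof.
move=> mf /and5P[/eqP fu /eqP fv uv fa /and5P[fc ca ua bc dv]].
have [fI fh] := mf.
have nn x y : f y = y -> f x != x -> (x != y) * (f x != y).
  move=> fy fx; split; apply: contraNneq fx => E; first by rewrite E fy.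
  by rewrite -{2}[x]fI E fy.
have [au bu] := nn _ _ fu fa; have [av bv] := nn _ _ fv fa.
have [cu du] := nn _ _ fu fc; have [cv dv'] := nn _ _ fv fc.
have cb : c != f a by apply: contraTneq bc => ->; rewrite h_irr.
have da : f c != a by apply: contra_neq cb => <-; rewrite fI.
have db : f c != f a by rewrite (inj_eq (inv_inj fI)).
have [m1 n1] := rmvP mf fa.
have r1c : rmv f a c = f c by rewrite /rmv (negPf ca) (negPf cb).
have r1c' : rmv f a c != c by rewrite r1c.
have [m2 n2] := rmvP m1 r1c'.
have RE x : rmv (rmv f a) c x = if x \in [:: a; f a; c; f c] then x else f x.
  rewrite {1}/rmv r1c /rmv !inE; case: (eqVneq x c) => [->|]; first by rewrite !orbT.
  by case: (eqVneq x (f c)) => [->|]; rewrite ?orbT //= !orbF.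
set f2 := rmv (rmv f a) c in m2 n2 RE.
have e1 : f2 u = u by rewrite RE fu; case: ifP.
have e2 : f2 a = a by rewrite RE inE eqxx.
have ua' : u != a by rewrite eq_sym.
have [m3 n3] := match2P m2 e1 e2 ua' ua.
have e3 : match2 f2 u a (f a) = f a.
  by rewrite /match2 (negPf bu) (negPf fa) RE !inE eqxx orbT.
have e4 : match2 f2 u a c = c.
  by rewrite /match2 (negPf cu) (negPf ca) RE !inE eqxx !orbT.
have bc' : f a != c by rewrite eq_sym.
have [m4 n4] := match2P m3 e3 e4 bc' bc.
have e5 : match2 (match2 f2 u a) (f a) c (f c) = f c.
  by rewrite /match2 (negPf db) (negPf fc) (negPf du) (negPf da) RE !inE eqxx !orbT.
have e6 : match2 (match2 f2 u a) (f a) c v = v.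
  rewrite /match2 ![v == _]eq_sym (negPf bv) (negPf cv) (negPf uv) (negPf av) RE fv.
  by case: ifP.
have [m5 n5] := match2P m4 e5 e6 dv' dv.
have E : match2 (match2 (match2 f2 u a) (f a) c) (f c) v =1 flip5 f u a c v.
  move=> x; rewrite /flip5 /match2 RE !inE.
  case: (eqVneq x (f c)) => // ?; case: (eqVneq x v) => // ?.
  case: (eqVneq x (f a)) => // ?; case: (eqVneq x c) => // ?.
  by case: (eqVneq x u) => // ?; case: (eqVneq x a).
split; first exact: mtch_eq E m5.
  by rewrite -(nfix_eq E); move: n3; rewrite n2 n1 n4 n5 => -[].
apply/subsetP => x; rewrite !inE /flip5 /match2.
case: (eqVneq x u) => //= ?; case: (eqVneq x a) => //= ?.
case: (eqVneq x (f a)) => //= ?; case: (eqVneq x c) => //= ?.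
by case: (eqVneq x (f c)) => //= ?; case: (eqVneq x v) => //= ?; rewrite eqxx.
Qed.

(** Closed sets are the unions of components of the two matchings taken together, that is, of
    alternating paths and cycles. *)
Definition closed2 f g K := [forall x in K, (f x \in K) && (g x \in K)].
Definition fixin f K := #|[set x in K | f x == x]|.

Lemma closed2P f g K :
  reflect (forall x, x \in K -> f x \in K /\ g x \in K) (closed2 f g K).
Proof.
apply: (iffP forall_inP) => H x /H; first by move/andP.
by case=> -> ->.
Qed.

Lemma closed2D f g K S : involutive f -> involutive g ->
  closed2 f g K -> closed2 f g S -> closed2 f g (K :\: S).
Proof.
move=> fI gI /closed2P cK /closed2P cS; apply/closed2P => x /setDP[xK xS].
have [fK gK] := cK _ xK; rewrite !inE fK gK !andbT; split.
  by apply: contra xS => /cS[]; rewrite fI.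
by apply: contra xS => /cS[_]; rewrite gI.
Qed.

Lemma fixinD f K S : S \subset K -> fixin f K = fixin f S + fixin f (K :\: S).
Proof.
move=> SK; rewrite /fixin -(cardsID S [set x in K | f x == x]); congr (_ + _).
  apply: eq_card => x; rewrite !inE; case xS: (x \in S); rewrite ?andbF //=.
  by rewrite (subsetP SK) // andbT.
by apply: eq_card => x; rewrite !inE andbA.
Qed.

(** An indecomposable closed set is connected, so it contains at least [#|K| - 1] edges, while every
    fixed point is a missing edge end. *)
Lemma connected_fix f g K x0 : involutive f -> involutive g -> closed2 f g K ->
  x0 \in K ->
  (forall S, S \subset K -> closed2 f g S -> S != set0 -> S = K) ->
  fixin f K + fixin g K <= 2.
Proof.
move=> fI gI /closed2P cK x0K conn.
(* [ee k S] counts the ends of [k]-edges inside [S], so [P] says that [S] has at least [#|S| - 1]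
   edges, as a set grown along edges does. A largest such set cannot be left along an edge, so it is
   closed and equals [K]. *)
pose ee (k : T -> T) S := #|[set x in S | (k x \in S) && (k x != x)]|.
pose P (S : {set T}) := [&& S \subset K, x0 \in S & (#|S|).*2 <= ee f S + ee g S + 2].
have P0 : P [set x0].
  by rewrite /P sub1set x0K set11 cards1 leq_addl.
case: (arg_maxnP (fun S : {set T} => #|S|) P0) => S /and3P[SK xS leS] maxS.
have grow k (y : T) : involutive k -> y \in S -> k y \notin S ->
    (ee k S).+2 <= ee k (k y |: S).
  move=> kI yS kyS; rewrite /ee.
  have yk : y != k y by apply: contraNneq kyS => <-.
  set Z := [set x in k y |: S | _].
  rewrite (cardsD1 (k y) Z) (cardsD1 y (Z :\ k y)).
  have -> : k y \in Z by rewrite !inE kI eqxx yS orbT yk.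
  have -> : y \in Z :\ k y by rewrite !inE yk yS eqxx orbT eq_sym yk.
  rewrite !add1n !ltnS; apply: subset_leq_card; apply/subsetP => x.
  rewrite !inE => /and3P[xs kxS kx]; rewrite xs kxS kx !orbT !andbT.
  apply/andP; split; apply: contraNneq kyS => E; last by rewrite -E.
  by rewrite -E.
have mono k (y : T) : ee k S <= ee k (y |: S).
  apply: subset_leq_card; apply/subsetP => x; rewrite !inE => /and3P[-> -> ->].
  by rewrite !orbT.
have cS : closed2 f g S.
  apply/closed2P => y yS; have [fK gK] := cK _ (subsetP SK _ yS).
  split; apply/negPn/negP => nS.
    have: P (f y |: S).
      rewrite /P subUset sub1set fK SK !inE xS orbT cardsU1 nS /=.
      by have := grow f y fI yS nS; have := mono g (f y); lia.
    by move/maxS; rewrite cardsU1 nS; lia.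
  have: P (g y |: S).
    rewrite /P subUset sub1set gK SK !inE xS orbT cardsU1 nS /=.
    by have := grow g y gI yS nS; have := mono f (g y); lia.
  by move/maxS; rewrite cardsU1 nS; lia.
have SE : S = K by apply: conn => //; apply/set0Pn; exists x0.
have ef k : (forall x, x \in K -> k x \in K) -> ee k K + fixin k K = #|K|.
  move=> ck; rewrite /ee /fixin -(cardsID [set x | k x == x] K) addnC; congr (_ + _).
    by apply: eq_card => x; rewrite !inE.
  apply: eq_card => x; rewrite !inE; case xK: (x \in K); rewrite ?andbF //=.
  by rewrite ck // andbT.
have := ef f (fun x xK => (cK x xK).1); have := ef g (fun x xK => (cK x xK).2).
by rewrite SE in leS; move: leS; lia.
Qed.

(** Fixed points add up over a closed set and its complement. Hence a smallest closed set where [g]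
    has fewer fixed points than [f] is indecomposable: if a part does not gain, its complement does.
    With at most two fixed points in all, [g] then has none. *)
Lemma minimal_gain f g K0 : involutive f -> involutive g -> closed2 f g K0 ->
  fixin g K0 < fixin f K0 ->
  exists2 K : {set T}, K \subset K0 & [/\ closed2 f g K, fixin g K = 0, 0 < fixin f K,
    fixin f K <= 2 & forall S, S \subset K -> closed2 f g S -> S != set0 -> S = K].
Proof.
move=> fI gI c0 g0.
pose P (S : {set T}) := [&& S \subset K0, closed2 f g S & fixin g S < fixin f S].
have P0 : P K0 by rewrite /P subxx c0 g0.
case: (arg_minnP (fun S : {set T} => #|S|) P0) => K /and3P[KK cK gK] minK.
have conn S : S \subset K -> closed2 f g S -> S != set0 -> S = K.
  move=> SK cS Sn0; apply/eqP; rewrite eqEcard SK /=.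
  case: (ltnP (fixin g S) (fixin f S)) => [gS|leS].
    by apply: minK; rewrite /P cS gS (subset_trans SK KK).
  have: P (K :\: S).
    rewrite /P (subset_trans (subsetDl _ _) KK) closed2D //=.
    by move: gK; rewrite (fixinD f SK) (fixinD g SK); lia.
  move/minK; rewrite cardsD (setIidPr SK).
  have s0 : 0 < #|S| by rewrite card_gt0.
  by move: (subset_leq_card SK) s0; lia.
have : [set x in K | f x == x] != set0 by rewrite -card_gt0; move: gK; rewrite /fixin; lia.
case/set0Pn => x0; rewrite inE => /andP[x0K _].
have := connected_fix fI gI cK x0K conn.
by exists K => //; split => //; move: gK; lia.
Qed.

(* The alternating walk from an f-fixed point of an indecomposable closed set
   either ends after at most six vertices or visits eight distinct ones. *)
Lemma trace_aug f g K : involutive f -> mtch g -> closed2 f g K ->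
  fixin g K = 0 -> 0 < fixin f K ->
  (forall S, S \subset K -> closed2 f g S -> S != set0 -> S = K) ->
  (exists u v, [/\ aug1 f u v, g u != u, g v != v, #|K| = 2 & K = [set u; v]]) \/
  (exists u a v, [/\ aug3 f u a v, g u != u, g v != v, #|K| = 4 & K = [set u; a; f a; v]]) \/
  (exists u a c v, [/\ aug5 f u a c v, g u != u, g v != v, #|K| = 6
       & K = [set u; a; f a; c; f c; v]]) \/ 8 <= #|K|.
Proof.
move=> fI [gI gh] /closed2P cK g0 fpos conn.
have gn x : x \in K -> g x != x.
  move=> xK; apply/negP => gx.
  have : x \in [set x in K | g x == x] by rewrite inE xK gx.
  by move: g0 => /eqP; rewrite /fixin cards_eq0 => /eqP ->; rewrite inE.
have /set0Pn[x0] : [set x in K | f x == x] != set0 by rewrite -card_gt0.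
rewrite inE => /andP[x0K /eqP fx0].
have inj_g := inv_inj gI; have inj_f := inv_inj fI.
have [_ x1K] := cK _ x0K; set x1 := g x0 in x1K.
have gx1 : g x1 = x0 by rewrite /x1 gI.
have n10 : x1 != x0 by apply: gn.
have close (s : seq T) : {subset s <= K} -> s != [::] -> uniq s ->
    (forall x, x \in s -> (f x \in s) && (g x \in s)) -> K = [set x in s] /\ #|K| = size s.
  move=> sK s0 us cs; have E : [set x in s] = K.
    apply: conn.
    - by apply/subsetP => x; rewrite inE => /sK.
    - by apply/closed2P => x; rewrite !inE => /cs/andP.
    - by case: (s) s0 => // y s' _; apply/set0Pn; exists y; rewrite !inE eqxx.
  by split => //; rewrite -E cardsE; apply/card_uniqP.
have h01 : h x0 x1 by apply: gh; rewrite gn.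
case: (eqVneq (f x1) x1) => [fx1|fx1].
  left; exists x0, x1.
  have [|||x|KE sz] := close [:: x0; x1] => //.
  - by move=> x; rewrite !inE => /orP[]/eqP->.
  - by rewrite /= inE eq_sym n10.
  - by rewrite !inE => /orP[]/eqP->; rewrite ?fx0 ?fx1 ?gx1 !eqxx ?orbT.
  split; rewrite ?gn // /aug1 ?fx0 ?fx1 ?eqxx ?h01 1?eq_sym ?n10 //.
  by rewrite KE; apply/setP => x; rewrite !inE.
right.
have [x2K _] := cK _ x1K; set x2 := f x1 in x2K fx1.
have fx2 : f x2 = x1 by rewrite /x2 fI.
have n20 : x2 != x0 by apply: contra_neq n10 => E; rewrite -fx2 E fx0.
have [_ x3K] := cK _ x2K; set x3 := g x2 in x3K.
have gx3 : g x3 = x2 by rewrite /x3 gI.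
have n32 : x3 != x2 by apply: gn.
have n31 : x3 != x1 by rewrite (inj_eq inj_g).
have n30 : x3 != x0 by apply: contra_neq fx1 => E; rewrite -gx3 E.
have h23 : h x2 x3 by apply: gh; rewrite gn.
case: (eqVneq (f x3) x3) => [fx3|fx3].
  left; exists x0, x1, x3.
  have [|||x|KE sz] := close [:: x0; x1; x2; x3] => //.
  - by move=> x; rewrite !inE => /or4P[]/eqP->.
  - by rewrite /= !inE !negb_or !andbT; do ?[apply/andP; split]; rewrite eq_sym.
  - by rewrite !inE => /or4P[]/eqP->; rewrite -/x1 -/x2 -/x3 ?fx0 ?fx2 ?fx3 ?gx1 ?gx3 !eqxx ?orbT.
  split; rewrite ?gn // /aug3 -/x2 ?fx0 ?fx3 ?eqxx ?h01 ?h23 ?fx1 1?eq_sym ?n30 //.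
  by rewrite KE; apply/setP => x; rewrite !inE -!orbA.
right.
have [x4K _] := cK _ x3K; set x4 := f x3 in x4K fx3.
have fx4 : f x4 = x3 by rewrite /x4 fI.
have n40 : x4 != x0 by apply: contra_neq n30 => E; rewrite -fx4 E fx0.
have n41 : x4 != x1 by apply: contra_neq n32 => E; rewrite -fx4 E.
have n42 : x4 != x2 by rewrite (inj_eq inj_f).
have [_ x5K] := cK _ x4K; set x5 := g x4 in x5K.
have gx5 : g x5 = x4 by rewrite /x5 gI.
have n54 : x5 != x4 by apply: gn.
have n50 : x5 != x0 by apply: contra_neq n41 => E; rewrite -gx5 E.
have n51 : x5 != x1 by rewrite (inj_eq inj_g).
have n52 : x5 != x2 by apply: contra_neq fx3 => E; rewrite -gx5 E.
have n53 : x5 != x3 by rewrite (inj_eq inj_g).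
have h45 : h x4 x5 by apply: gh; rewrite gn.
case: (eqVneq (f x5) x5) => [fx5|fx5].
  left; exists x0, x1, x3, x5.
  have [|||x|KE sz] := close [:: x0; x1; x2; x3; x4; x5] => //.
  - by move=> x; rewrite !inE; do 5?[case/orP]; move/eqP=> ->.
  - by rewrite /= !inE !negb_or !andbT; do ?[apply/andP; split]; rewrite eq_sym.
  - by rewrite !inE; do 5?[case/orP]; move/eqP=> ->;
      rewrite -/x1 -/x2 -/x3 -/x4 -/x5 ?fx0 ?fx2 ?fx4 ?fx5 ?gx1 ?gx3 ?gx5 !eqxx ?orbT.
  split; rewrite ?gn //.
    by rewrite /aug5 -/x2 -/x4 fx0 fx5 !eqxx h01 h23 h45 fx1 fx3 n31 eq_sym n50.
  by rewrite KE; apply/setP => x; rewrite !inE -!orbA.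
right.
have [x6K _] := cK _ x5K; set x6 := f x5 in x6K fx5.
have fx6 : f x6 = x5 by rewrite /x6 fI.
have n60 : x6 != x0 by apply: contra_neq n50 => E; rewrite -fx6 E fx0.
have n61 : x6 != x1 by apply: contra_neq n52 => E; rewrite -fx6 E.
have n62 : x6 != x2 by rewrite (inj_eq inj_f).
have n63 : x6 != x3 by apply: contra_neq n54 => E; rewrite -fx6 E.
have n64 : x6 != x4 by rewrite (inj_eq inj_f).
have [_ x7K] := cK _ x6K; set x7 := g x6 in x7K.
have gx7 : g x7 = x6 by rewrite /x7 gI.
have n76 : x7 != x6 by apply: gn.
have n70 : x7 != x0 by apply: contra_neq n61 => E; rewrite -gx7 E.
have n71 : x7 != x1 by rewrite (inj_eq inj_g).
have n72 : x7 != x2 by apply: contra_neq n63 => E; rewrite -gx7 E.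
have n73 : x7 != x3 by rewrite (inj_eq inj_g).
have n74 : x7 != x4 by apply: contra_neq fx5 => E; rewrite -gx7 E.
have n75 : x7 != x5 by rewrite (inj_eq inj_g).
rewrite -[8]/(size [:: x0; x1; x2; x3; x4; x5; x6; x7]); rewrite -(@card_uniqP T _ _); last first.
  by rewrite /= !inE !negb_or !andbT; do ?[apply/andP; split]; rewrite eq_sym.
apply: subset_leq_card; apply/subsetP => x; rewrite !inE.
by do 7?[case/orP]; move/eqP=> ->.
Qed.

(** If [f] and [g] agreed at [x], the set of [x] and [f x] would be closed, hence all of [K], and
    there both would have the same fixed points. *)
Lemma indecomposable_diff f g K : involutive f -> involutive g ->
  closed2 f g K -> fixin g K = 0 -> 0 < fixin f K ->
  (forall S, S \subset K -> closed2 f g S -> S != set0 -> S = K) ->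
  K \subset diff f g.
Proof.
move=> fI gI /closed2P cK g0 f0 conn; apply/subsetP => x xK; rewrite inE.
apply/negP => /eqP fg; have [fxK _] := cK _ xK.
have E : [set x; f x] = K.
  apply: conn.
  - by apply/subsetP => y; rewrite !inE => /orP[]/eqP->.
  - apply/closed2P => y; rewrite !inE => /orP[]/eqP->.
      by rewrite -fg eqxx orbT.
    by rewrite fI {2 3}fg gI eqxx.
  - by apply/set0Pn; exists x; rewrite !inE eqxx.
have gx : g x != x.
  apply/negP => gx; have : x \in [set x in K | g x == x] by rewrite inE xK gx.
  by move: g0 => /eqP; rewrite /fixin cards_eq0 => /eqP ->; rewrite inE.
move: f0; rewrite /fixin card_gt0 => /set0Pn[y]; rewrite -E !inE.
by case/andP=> /orP[]/eqP->; rewrite ?fI fg ?(negPf gx) // eq_sym (negPf gx).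
Qed.

(* If every short augmenting path of f uses the free vertex v, then f has no two
   disjoint short augmenting paths, so none is left after augmenting along a
   shortest one: a further one would decompose the symmetric difference with f
   into two disjoint augmenting components of too large a total size. *)
Lemma augment_no_aug f f1 (X : pred T) v :
  mtch f -> mtch f1 -> f v = v -> (forall x, X x -> f x = x /\ f1 x = x) ->
  nfix f = (nfix f1).+2 -> no_aug f [pred x | X x || (x == v)] ->
  (forall u, ~~ X u -> aug1 f v u -> #|diff f f1| <= 2) ->
  (forall a u, ~~ X u -> aug3 f v a u -> #|diff f f1| <= 4) ->
  #|diff f f1| <= 6 -> no_aug f1 X.
Proof.
move=> mf mf1 fv fX nf na s2 s4 s6; have [fI _] := mf; have [f1I _] := mf1.
(* A short augmenting path of [f1] would yield such an [f2] by flipping; it changes at most six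
   values. *)
suff main f2 : mtch f2 -> (forall x, X x -> f2 x = x) -> nfix f1 = (nfix f2).+2 ->
    #|diff f1 f2| <= 6 -> False.
  have card_le (s : seq T) (Z : {set T}) : Z \subset [set x in s] -> #|Z| <= size s.
    by move/subset_leq_card/leq_trans; apply; rewrite cardsE card_size.
  move=> u w Xu Xw; split; [apply/negP => A | move=> a; apply/negP => A
                          | move=> a c; apply/negP => A].
  - have [m n d] := flip1P mf1 A; apply: main m _ n _.
      move=> x Xx; have [_ f1x] := fX _ Xx; rewrite /match2 f1x.
      case: eqVneq => [E|_]; first by move: Xu; rewrite -E Xx.
      by case: eqVneq => // E; move: Xw; rewrite -E Xx.
    apply: leq_trans (card_le [:: u; w] _ _) _ => //.
    by apply: subset_trans d _; apply/subsetP => x; rewrite !inE.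
  - have [m n d] := flip3P mf1 A; apply: main m _ n _.
      move=> x Xx; have [_ f1x] := fX _ Xx; apply/eqP/negPn/negP => ne.
      have : x \in diff f1 (flip3 f1 u a w) by rewrite inE f1x eq_sym.
      move/(subsetP d); rewrite !inE; case/and5P: A => _ _ _ fa _.
      case/orP => [/orP[/orP[]|]|] /eqP E.
      + by move: Xu; rewrite -E Xx.
      + by move: fa; rewrite -E f1x eqxx.
      + by move: fa; rewrite -{2}[a]f1I -E f1x eqxx.
      + by move: Xw; rewrite -E Xx.
    apply: leq_trans (card_le [:: u; a; f1 a; w] _ _) _ => //.
    by apply: subset_trans d _; apply/subsetP => x; rewrite !inE -!orbA.
  - have [m n d] := flip5P mf1 A; apply: main m _ n _.
      move=> x Xx; have [_ f1x] := fX _ Xx; apply/eqP/negPn/negP => ne.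
      have : x \in diff f1 (flip5 f1 u a c w) by rewrite inE f1x eq_sym.
      move/(subsetP d); rewrite !inE; case/and5P: A => _ _ _ fa /and5P[fc _ _ _ _].
      have nb y : f1 y != y -> x == f1 y -> False.
        by move=> fy /eqP E; move: fy; rewrite -{2}[y]f1I -E f1x eqxx.
      case/orP => [/orP[/orP[/orP[/orP[]|]|]|]|] E; try solve [case: (nb _ fa E) | case: (nb _ fc E)].
      + by move: Xu; rewrite -(eqP E) Xx.
      + by move: fa; rewrite -(eqP E) f1x eqxx.
      + by move: fc; rewrite -(eqP E) f1x eqxx.
      + by move: Xw; rewrite -(eqP E) Xx.
    apply: leq_trans (card_le [:: u; a; f1 a; c; f1 c; w] _ _) _ => //.
    by apply: subset_trans d _; apply/subsetP => x; rewrite !inE -!orbA.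
move=> mf2 f2X n2 d2; have [f2I _] := mf2.
have dsub : #|diff f f2| <= #|diff f f1| + 6.
  apply: leq_trans (leq_add (leqnn _) d2); apply: leq_trans (leq_card_setU _ _).
  apply: subset_leq_card; apply/subsetP => x; rewrite !inE.
  by case: (eqVneq (f x) (f1 x)) => // ->.
have fixT k : fixin k [set: T] = nfix k by apply: eq_card => x; rewrite !inE.
have cT : closed2 f f2 [set: T] by apply/closed2P => x _; rewrite !inE.
have gT : fixin f2 [set: T] < fixin f [set: T] by rewrite !fixT nf n2; lia.
(* A component that augments [f] is at least as large as the path already flipped, since that was a
   shortest one at [v]. If it avoids [v], it has at least eight vertices, as every short path of [f]
   ends in [v]. *)
have size_bound (K : {set T}) : closed2 f f2 K -> fixin f2 K = 0 -> 0 < fixin f K ->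
    (forall S, S \subset K -> closed2 f f2 S -> S != set0 -> S = K) ->
    (#|diff f f1| <= #|K|) && ((v \in K) || (8 <= #|K|)).
  move=> cK g0 f0 conn.
  have notX x : f2 x != x -> ~~ X x by apply: contra => /f2X/eqP.
  have NA u w : f2 u != u -> f2 w != w -> v != u -> v != w ->
      [/\ ~~ aug1 f u w, forall a, ~~ aug3 f u a w & forall a c, ~~ aug5 f u a c w].
    move=> fu fw vu vw; apply: na; rewrite /= negb_or notX //= eq_sym //.
  have [[u [w [A fu fw sz KE]]]|[[u [a [w [A fu fw sz KE]]]]|[[u [a [c [w [A fu fw sz KE]]]]]|ge8]]] :=
    trace_aug fI mf2 cK g0 f0 conn; last by rewrite ge8 orbT andbT; move: s6; lia.
  - case: (eqVneq v u) => [E|vu].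
      by rewrite sz (s2 w) ?notX ?E // KE !inE eqxx.
    case: (eqVneq v w) => [E|vw].
      by rewrite sz (s2 u) ?notX ?E // 1?aug1C // KE !inE eqxx orbT.
    by have [/negP[]] := NA _ _ fu fw vu vw.
  - case: (eqVneq v u) => [E|vu].
      by rewrite sz (s4 a w) ?notX ?E // KE !inE eqxx.
    case: (eqVneq v w) => [E|vw].
      by rewrite sz (s4 (f a) u) ?notX ?E //; [rewrite KE !inE eqxx !orbT | apply: aug3_rev].
    by have [_ /(_ a)/negP[]] := NA _ _ fu fw vu vw.
  - case: (eqVneq v u) => [E|vu].
      by rewrite sz s6 KE !inE E eqxx.
    case: (eqVneq v w) => [E|vw].
      by rewrite sz s6 KE !inE E eqxx !orbT.
    by have [_ _ /(_ a c)/negP[]] := NA _ _ fu fw vu vw.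
have [K1 _ [c1 g1 p1 b1 n1]] := minimal_gain fI f2I cT gT.
(* [f2] has four fixed points fewer than [f] and [K1] accounts for at most two of them, so a second
   augmenting component lies outside [K1]. *)
have cC : closed2 f f2 (~: K1) by rewrite -setTD; apply: closed2D.
have gC : fixin f2 (~: K1) < fixin f (~: K1).
  rewrite -setTD; have := fixinD f (subsetT K1); have := fixinD f2 (subsetT K1).
  by rewrite !fixT nf n2; lia.
have [K2 sK2 [c2 g2 p2 b2 n2']] := minimal_gain fI f2I cC gC.
have dis : [disjoint K1 & K2].
  by rewrite disjoint_sym; apply: disjointWl sK2 _; rewrite -setI_eq0 setIC setICr.
have := size_bound _ c1 g1 p1 n1; have := size_bound _ c2 g2 p2 n2'.
have /subset_leq_card : K1 :|: K2 \subset diff f f2.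
  by rewrite subUset !indecomposable_diff.
have -> : #|K1 :|: K2| = #|K1| + #|K2|.
  by rewrite cardsU (_ : K1 :&: K2 = set0) ?cards0 ?subn0 //; apply/eqP; rewrite setI_eq0.
(* The two components have at most [#|diff f f1| + 6] vertices together and each has at least
   [#|diff f f1|]. So neither has eight, and both contain [v], although they are disjoint. *)
move=> le /andP[l2 v2] /andP[l1 v1].
move: le dsub l1 l2; case/orP: v1 => v1; last by lia.
case/orP: v2 => v2; last by lia.
by move/pred0P/(_ v): dis; rewrite /= v1 v2.
Qed.

(** A path that ends in [v] can be read backwards from [v], so three failed searches from [v] lift
    its exemption. *)
Lemma no_aug_from f (X : pred T) v : mtch f ->
  no_aug f [pred x | X x || (x == v)] ->
  (forall u, ~~ X u -> ~~ aug1 f v u) -> (forall a u, ~~ X u -> ~~ aug3 f v a u) ->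
  (forall a c u, ~~ X u -> ~~ aug5 f v a c u) -> no_aug f X.
Proof.
move=> [fI _] na n1 n3 n5 u w Xu Xw.
case: (eqVneq u v) => [->|uv]; first by split=> *; [exact: n1|exact: n3|exact: n5].
case: (eqVneq w v) => [->|wv].
  split; first by rewrite aug1C n1.
    by move=> a; apply/negP => /(aug3_rev fI); apply/negP; apply: n3.
  by move=> a c; apply/negP => /(aug5_rev fI); apply/negP; apply: n5.
by apply: na; rewrite /= negb_or ?Xu ?Xw.
Qed.
End Augment.

(** * Degree-constrained sparsifiers *)

Section Sparsifier.
Variables (T : finType) (h : rel T).
Hypothesis h_sym : symmetric h.
Hypothesis h_irr : irreflexive h.

Definition nbr (U : {set T}) x := #|[set u in U | h x u]|.
Notation deg := (nbr [set: T]).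

Lemma nbrE U x : nbr U x = \sum_(u in U) h x u.
Proof.
rewrite /nbr -sum1_card (eq_bigl (fun u => (u \in U) && h x u)); last by move=> u; rewrite inE.
by rewrite big_mkcondr; apply: eq_bigr => u _; case: (h x u).
Qed.

Lemma double_count (U W : {set T}) : \sum_(u in U) nbr W u = \sum_(w in W) nbr U w.
Proof.
under eq_bigr => u _ do rewrite nbrE.
rewrite exchange_big; apply: eq_bigr => w _; rewrite nbrE.
by apply: eq_bigr => u _; rewrite h_sym.
Qed.

Lemma nbrS (U W : {set T}) x : U \subset W -> nbr U x <= nbr W x.
Proof.
move=> s; apply: subset_leq_card; apply/subsetP => y; rewrite !inE => /andP[yU ->].
by rewrite (subsetP s).
Qed.

Lemma nbrU (U W : {set T}) x : [disjoint U & W] -> nbr (U :|: W) x = nbr U x + nbr W x.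
Proof.
move=> dj; rewrite /nbr -cardsUI [X in _ = X + _](_ : _ = #|[set u in U :|: W | h x u]|).
  rewrite (_ : _ :&: _ = set0) ?cards0 ?addn0 //; apply/setP => u; rewrite !inE.
  by move/pred0P/(_ u): dj => /=; case: (u \in U); case: (u \in W); rewrite ?andbF.
by apply: eq_card => u; rewrite !inE andb_orl.
Qed.

Lemma nbr_gt0 (U : {set T}) x y : y \in U -> h x y -> 0 < nbr U x.
Proof. by move=> yU hxy; rewrite card_gt0; apply/set0Pn; exists y; rewrite inE yU. Qed.

Variables (f g : T -> T) (b1 b2 : nat).
Hypothesis mf : mtch h f.
Hypothesis na : no_aug h f xpred0.
Hypothesis gI : involutive g.
Hypothesis P1 : forall x y, h x y -> deg x + deg y <= b1.
Hypothesis P2 : forall x, g x != x -> ~~ h x (g x) -> b2 <= deg x + deg (g x).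
Hypothesis b2_le : b2 <= b1.
Hypothesis b1_large : 4000 <= b1.
Hypothesis b2_close : 3999 * b1 <= 4000 * b2.

Let fI : involutive f := mf.1.
Let fh x : f x != x -> h x (f x) := mf.2 x.

Let F := [set x | f x == x].
Let nF := nbr F.
Let gF a := [&& g a != a, f (g a) == g a & h a (g a)].
(** The end of a matched edge that sees free vertices. If both ends do, they see the same single
    free vertex; the tie goes to the end that [g] joins to a free vertex inside [h], so that no
    vertex of [B] is joined in this way, and otherwise to the smaller rank. *)
Let A := [set a | [&& f a != a, 0 < nF a & [|| nF (f a) == 0, gF a
                 | ~~ gF (f a) && (enum_rank a < enum_rank (f a))]]].
Let B := [set b | f b \in A].
Let C := [set c | [&& f c != c, c \notin A & c \notin B]].

Let NF_in x u : u \in F -> h x u -> 0 < nF x. Proof. exact: nbr_gt0. Qed.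

Let NFP x : 0 < nF x -> exists2 u, u \in F & h x u.
Proof. by rewrite card_gt0 => /set0Pn[u]; rewrite inE => /andP[uF hu]; exists u. Qed.

(** Different free neighbours at the two ends of a matched edge form an augmenting path of length
    three. *)
Let free_eq3 a u u' : f a != a -> u \in F -> h a u -> u' \in F -> h (f a) u' -> u = u'.
Proof.
rewrite !inE => fa fu au fu' bu'; apply/eqP/negPn/negP => ne.
have [_ /(_ a)/negP[]] := na (u := u) (v := u') isT isT.
by rewrite /aug3 fu fu' ne fa h_sym au bu'.
Qed.

Let nF_le1 x : (forall u u', u \in F -> h x u -> u' \in F -> h x u' -> u = u') -> nF x <= 1.
Proof.
move=> H; rewrite leqNgt; apply/negP; rewrite /nF /nbr => /card_gt1P[u [u' [+ + ne]]].
by rewrite !inE => /andP[uF hu] /andP[uF' hu']; move/eqP: ne; apply; apply: H; rewrite ?inE.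
Qed.

Let nF_tri a : f a != a -> 0 < nF a -> 0 < nF (f a) -> nF a <= 1.
Proof.
move=> fa _ /NFP[w wF hw]; apply: nF_le1 => u u' uF hu uF' hu'.
by rewrite (free_eq3 fa uF hu wF hw) (free_eq3 fa uF' hu' wF hw).
Qed.

Let gF_excl a : f a != a -> gF a -> gF (f a) -> False.
Proof.
move=> fa /and3P[_ F1 h1] /and3P[_ F2 h2].
have E : g a = g (f a) by apply: (free_eq3 fa) => //; rewrite inE.
by move/negP: fa; apply; rewrite eq_sym; apply/eqP; apply: (inv_inj gI).
Qed.

Let A_moved a : a \in A -> f a != a. Proof. by rewrite inE => /andP[]. Qed.

Let AB x : x \in A -> x \in B -> False.
Proof.
rewrite !inE fI => /and3P[fa na1 c1] /and3P[_ na2 c2].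
move: c1 c2.
have E := gF_excl fa.
case g1 : (gF x); case g2 : (gF (f x)); try by case: (E g1 g2).
all: rewrite ?(gtn_eqF na1) ?(gtn_eqF na2) //=; by lia.
Qed.

Let cover w : w \notin F -> 0 < nF w -> (w \in A) || (w \in B).
Proof.
rewrite !inE fI => fw nw; rewrite fw nw /=.
have -> : w != f w by rewrite eq_sym.
rewrite /=.
case: (posnP (nF (f w))) => [_|nfw] //=; rewrite (gtn_eqF nw) /=.
case g1 : (gF w) => //=; case g2: (gF (f w)); rewrite ?orbT ?nfw //=.
rewrite ?nfw /=; case: ltngtP; rewrite ?orbT // => /val_inj/enum_rank_inj E.
by move: fw; rewrite -E eqxx.
Qed.

Let C_nF c : c \in C -> nF c = 0.
Proof.
rewrite inE => /and3P[fc cA cB]; apply/eqP; rewrite -leqn0 leqNgt; apply/negP => p.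
have : c \notin F by rewrite inE.
by move/cover/(_ p); rewrite (negPf cA) (negPf cB).
Qed.

Let fC c : (f c \in C) = (c \in C).
Proof.
rewrite ![_ \in C]inE ![_ \in B]inE fI [c == f c]eq_sym.
by rewrite [(f c \notin A) && _]andbC.
Qed.

Let FP x y : x \in F -> y \in F -> h x y -> False.
Proof.
rewrite !inE => fx fy hxy; have [/negP[]] := na (u := x) (v := y) isT isT.
by rewrite /aug1 fx fy hxy andbT /=; apply: contraTneq hxy => ->; rewrite h_irr.
Qed.

Let B_nF b : b \in B -> nF b <= 1.
Proof.
rewrite inE => bA; have fb := A_moved bA; rewrite fI eq_sym in fb.
case: (posnP (nF b)) => [-> //|nb]; apply: nF_tri => //.
by move: bA; rewrite inE => /and3P[].
Qed.

Let B_gF b : b \in B -> ~~ gF b.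
Proof.
rewrite !inE fI => /and3P[fb na1 c1]; apply/negP => g1.
have fb' : f b != b by rewrite eq_sym.
have : 0 < nF b by case/and3P: g1 => _ Fg hg; apply: NF_in hg; rewrite inE.
by move: c1; rewrite g1 /= orbF => /orP[/eqP-> //|g2]; case: (gF_excl fb' g1 g2).
Qed.

(** The edge is the middle of a path from a free neighbour of [f b] to one of [f b']. Having no
    augmenting path of length five forces all these free neighbours to coincide. *)
Let BB b b' : b \in B -> b' \in B -> h b b' -> nF (f b) <= 1.
Proof.
move=> bB bB' hbb; have bA : f b \in A by move: bB; rewrite inE.
have bA' : f b' \in A by move: bB'; rewrite inE.
have /NFP[w wF hw] : 0 < nF (f b') by move: bA'; rewrite inE => /and3P[].
have key u : u \in F -> h (f b) u -> u = w.
  move=> uF hu; apply/eqP/negPn/negP => ne.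
  have [_ _ /(_ (f b) b')/negP[]] := na (u := u) (v := w) isT isT.
  have /negPf E : b' != f b by apply/negP => /eqP E; apply: (AB bA); rewrite -E.
  move: (A_moved bA) (A_moved bA') uF wF; rewrite !fI !inE => n1 n2 fu fw.
  by rewrite /aug5 fI fu fw ne n1 eq_sym n2 E h_sym hu hbb.
by apply: nF_le1 => u u' uF hu uF' hu'; rewrite (key u) // (key u').
Qed.

(** The charge that [x] pays for its [g]-edge. Outside [h] both ends pay twice their degree. Inside
    [h] the amount [2 * b1] is paid by an end in [A]; without one, by the end in [C] if the other is
    in [B], and in equal parts by two ends of the same class. So free vertices pay for edges outside
    [h] only. *)
Let q x := if g x == x then 0 else if ~~ h x (g x) then 2 * deg x
  else if x \in A then 2 * b1
  else if x \in B then (if g x \in B then b1 else 0)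
  else if x \in C then (if g x \in B then 2 * b1 else if g x \in C then b1 else 0)
  else 0.

Let classes x : [|| x \in A, x \in B, x \in C | x \in F].
Proof. by rewrite [x \in C]inE [x \in F]inE; case: (x \in A); case: (x \in B); case: (f x == x). Qed.

Let AF x : x \in A -> x \in F -> False. Proof. by rewrite !inE => /andP[/negPf->]. Qed.
Let BF x : x \in B -> x \in F -> False.
Proof. by move=> /[!inE] /and3P[]; rewrite fI eq_sym => /negPf->. Qed.
Let CA x : x \in C -> x \in A -> False.
Proof. by rewrite inE => /and3P[_ /negPf->]. Qed.
Let CB x : x \in C -> x \in B -> False.
Proof. by rewrite inE => /and3P[_ _ /negPf->]. Qed.
Let CF x : x \in C -> x \in F -> False.
Proof. by rewrite inE => /and3P[fx _ _]; rewrite inE (negPf fx). Qed.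
Let F_nA x : x \in F -> ((x \in A) = false) * ((x \in B) = false) * ((x \in C) = false).
Proof.
move=> xF; split; [split|].
- by apply/negP => xA; apply: AF xA xF.
- by apply/negP => xA; apply: BF xA xF.
- by apply/negP => xA; apply: CF xA xF.
Qed.
Let B_nA x : x \in B -> ((x \in A) = false) * ((x \in C) = false).
Proof.
move=> xB; split; first by apply/negP => xA; apply: AB xA xB.
by apply/negP => xA; apply: CB xA xB.
Qed.
Let C_nA x : x \in C -> ((x \in A) = false) * ((x \in B) = false).
Proof.
move=> xB; split; first by apply/negP => xA; apply: CA xB xA.
by apply/negP => xA; apply: CB xB xA.
Qed.


(** The combinations inside [h] that nobody pays for do not occur: two free ends by maximality, an
    end in [C] and a free one because [C] sees no free vertex, an end in [B] and a free one by the
    tie-breaking rule in [A]. *)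
Let q_edge x : g x != x -> 2 * b2 <= q x + q (g x).
Proof.
move=> gx; rewrite /q gI [x == g x]eq_sym (negPf gx) [h (g x) x]h_sym.
case hx : (h x (g x)) => /=; last by rewrite -mulnDr leq_mul2l P2 ?hx.
have hx' : h (g x) x by rewrite h_sym.
have bb : 2 * b2 <= 2 * b1 by rewrite leq_mul2l b2_le.
have gx' : g (g x) != g x by rewrite gI eq_sym.
case/or4P: (classes x) => cx; case/or4P: (classes (g x)) => cg;
  rewrite ?cx ?cg ?(B_nA cx) ?(B_nA cg) ?(C_nA cx) ?(C_nA cg) ?(F_nA cx) ?(F_nA cg);
  try solve [exact: leq_trans bb (leq_addr _ _) | exact: leq_trans bb (leq_addl _ _)
            | by rewrite addnn -mul2n].
- case/negP: (B_gF cx); rewrite /gF gx hx andbT /=; by move: cg; rewrite !inE.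
- by have := NF_in cg hx; rewrite C_nF.
- case/negP: (B_gF cg); rewrite /gF gx' gI hx' andbT /=; by move: cx; rewrite !inE.
- by have := NF_in cx hx'; rewrite C_nF.
- by case: (FP cx cg hx).
Qed.

Let cf := #|[set x | f x != x]|.
Let cg := #|[set x | g x != x]|.

Let sum_q : b2 * cg <= \sum_x q x.
Proof.
have : 2 * b2 * cg <= \sum_(x | g x != x) (q x + q (g x)).
  rewrite mulnC /cg -sum_nat_const (eq_bigl (fun x => g x != x)); last by move=> x; rewrite inE.
  by apply: leq_sum => x; apply: q_edge.
rewrite big_split /= [X in _ <= _ + X](_ : _ = \sum_(x | g x != x) q x).
  have : \sum_(x | g x != x) q x <= \sum_x q x.
    by rewrite [X in _ <= X](bigID (fun x => g x != x)) /= leq_addr.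
  by lia.
rewrite [RHS](reindex_inj (inv_inj gI)) /=; apply: eq_bigl => x.
by rewrite gI eq_sym.
Qed.

Let sum4 (w : T -> nat) : \sum_x w x =
  \sum_(x in A) w x + \sum_(x in B) w x + \sum_(x in C) w x + \sum_(x in F) w x.
Proof.
rewrite [\sum_(x in A) _]big_mkcond [\sum_(x in B) _]big_mkcond.
rewrite [\sum_(x in C) _]big_mkcond [\sum_(x in F) _]big_mkcond -!big_split.
apply: eq_bigr => x _ /=.
case/or4P: (classes x) => cx; rewrite ?cx ?(B_nA cx) ?(C_nA cx) ?(F_nA cx) ?add0n ?addn0 //.
- have -> : (x \in B) = false by apply/negP; apply: AB.
  have -> : (x \in C) = false by apply/negP => c; apply: CA c cx.
  have -> : (x \in F) = false by apply/negP => c; apply: AF cx c.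
  by rewrite !addn0.
- have -> : (x \in F) = false by apply/negP => c; apply: BF cx c.
  by rewrite !addn0.
- have -> : (x \in F) = false by apply/negP => c; apply: CF cx c.
  by rewrite !addn0.
Qed.

Let deg4 x : deg x = nbr A x + nbr B x + nbr C x + nF x.
Proof.
rewrite /nF !nbrE (eq_bigl xpredT) ?sum4 //; by move=> u; rewrite inE.
Qed.

Let sumB (w : T -> nat) : \sum_(b in B) w b = \sum_(a in A) w (f a).
Proof.
rewrite [LHS](reindex_inj (inv_inj fI)) /=; apply: eq_bigl => x.
by rewrite inE fI.
Qed.

Let cardB : #|B| = #|A|.
Proof. by rewrite -!sum1_card sumB. Qed.

Let cfE : cf = 2 * #|A| + #|C|.
Proof.
have -> : cf = \sum_x (f x != x : nat).
  by rewrite /cf -sum1_card big_mkcond; apply: eq_bigr => x _; rewrite inE; case: eqP.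
rewrite sum4 [X in _ + X]big1; last by move=> x; rewrite inE => ->.
have -> : \sum_(x in A) (f x != x : nat) = #|A|.
  by rewrite -sum1_card; apply: eq_bigr => x /A_moved ->.
have -> : \sum_(x in B) (f x != x : nat) = #|B|.
  by rewrite -sum1_card; apply: eq_bigr => x; rewrite inE => /A_moved; rewrite fI eq_sym => ->.
have -> : \sum_(x in C) (f x != x : nat) = #|C|.
  by rewrite -sum1_card; apply: eq_bigr => x; rewrite inE => /andP[->].
by rewrite cardB; lia.
Qed.

(** These are the only free vertices with a charge. *)
Let Fn := [set u in F | (g u != u) && ~~ h u (g u)].
Let nx := nbr Fn.

Let nx_le w : nx w <= nF w.
Proof. by apply: nbrS; apply/subsetP => x; rewrite inE => /andP[]. Qed.

Let nx_deg w : nx w <= deg w. Proof. by apply: nbrS; apply: subsetT. Qed.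

Let deg_le x : f x != x -> deg x <= b1.
Proof. by move=> /fh/P1; lia. Qed.

(** The degrees of [Fn] are counted from the other side: these edges of [h] end in [A], apart from
    at most one for each vertex of [B]. *)
Let sumF : \sum_(x in F) q x <= 2 * \sum_(a in A) nx a + 2 * #|A|.
Proof.
have -> : \sum_(x in F) q x = \sum_(u in Fn) 2 * deg u.
  rewrite [RHS](eq_bigl (fun u => (u \in F) && ((g u != u) && ~~ h u (g u)))); last first.
    by move=> u; rewrite inE.
  rewrite big_mkcondr; apply: eq_bigr => u uF; rewrite /q !(F_nA uF).
  by case: eqP => //= _; case: (h u (g u)).
rewrite -big_distrr /= double_count (eq_bigl xpredT); last by move=> u; rewrite inE.
rewrite sum4 [X in _ + X]big1; last first.
  move=> x xF; apply/eqP; rewrite -leqn0; apply: leq_trans (nx_le x) _.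
  by rewrite leqNgt; apply/negP => /NFP[u uF]; apply: FP.
rewrite [X in _ + X + _]big1; last first.
  by move=> x /C_nF E; apply/eqP; rewrite -leqn0 -E; apply: nx_le.
have : \sum_(b in B) nx b <= \sum_(b in B) 1.
  by apply: leq_sum => b bB; apply: leq_trans (nx_le b) (B_nF bB).
by rewrite sum1_card cardB -/nx; lia.
Qed.

Let qA_le a : q a <= 2 * b1 \/ f a == a.
Proof.
case: (eqVneq (f a) a) => [|fa]; [by right|left]; rewrite /q.
by have := deg_le fa; do ![case: ifP => _]; lia.
Qed.

Let ell a := 2 * b1 - (q (f a) + 2 * nx a).

(** If the [g]-edge of [f a] is outside [h], the two terms are bounded by the degrees of a matched
    edge. If it goes to [B] inside [h], then [BB] leaves [a] at most one free neighbour. Otherwise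
    [f a] pays nothing. *)
Let ell_ge a : a \in A -> q (f a) + 2 * nx a <= 2 * b1.
Proof.
move=> aA; have fa := A_moved aA; have h1 := fh fa.
have bB : f a \in B by rewrite inE fI.
have := P1 h1; have := nx_deg a; rewrite /q !(B_nA bB) bB.
case: eqP => [_|_]; first by lia.
case: ifP => [_|/negbFE hb]; first by lia.
case: ifP => [gB|_]; last by lia.
have := BB bB gB hb; rewrite fI; have := nx_le a; by lia.
Qed.

Let ellE a : a \in A -> ell a + (q (f a) + 2 * nx a) = 2 * b1.
Proof. by move=> /ell_ge; rewrite /ell; lia. Qed.

Let L := \sum_(a in A) ell a.
Let LC := \sum_(c in C) (2 * b1 - q c).

Let sumA : L + \sum_(b in B) q b + 2 * \sum_(a in A) nx a = 2 * b1 * #|A|.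
Proof.
rewrite sumB big_distrr /= -!big_split /= [RHS]mulnC -sum_nat_const.
by apply: eq_bigr => a /ellE; lia.
Qed.

Let sumC : LC + \sum_(c in C) q c = 2 * b1 * #|C|.
Proof.
rewrite -big_split /= [RHS]mulnC -sum_nat_const; apply: eq_bigr => c cC.
by case: (qA_le c) => [|fc]; [lia | move: cC; rewrite inE fc].
Qed.

(** Up to the term [cf] and the closeness of [b1] and [b2] this is factor 2, with the wasted budget
    [L + LC] kept. What remains is that the waste cannot be small when [cg] is near [2 * cf]. *)
Let total : L + LC + b2 * cg <= 2 * b1 * cf + cf.
Proof.
have := sum_q; rewrite sum4.
have : \sum_(a in A) q a <= 2 * b1 * #|A|.
  rewrite mulnC -sum_nat_const; apply: leq_sum => a aA.
  by case: (qA_le a) => // fa; move: (A_moved aA); rewrite fa.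
by move: sumF sumA sumC; rewrite cfE; lia.
Qed.

Let sum_ge (S U : {set T}) c (w : T -> nat) : S \subset U ->
  (forall x, x \in S -> c <= w x) -> c * #|S| <= \sum_(x in U) w x.
Proof.
move=> SU cw; rewrite mulnC -sum_nat_const [X in _ <= X](bigID (mem S)) /=.
apply: leq_trans (leq_addr _ _).
rewrite [X in _ <= X](eq_bigl (mem S)); first exact: leq_sum.
by move=> x /=; case xS: (x \in S); rewrite ?andbF // (subsetP SU).
Qed.

Let LB : L = \sum_(b in B) ell (f b).
Proof. by rewrite sumB; apply: eq_bigr => a _; rewrite fI. Qed.

Let B1 := [set b in B | (g b != b) && ~~ h b (g b)].
Let B2 := [set b in B | [&& g b != b, h b (g b) & g b \in B]].
Let bad := [set b in B | (nx (f b) <= 1) && (q b <= b1)].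

Let bad_L : b1 * #|bad| <= 2 * L.
Proof.
have : (b1 - 2) * #|bad| <= L.
  rewrite LB; apply: sum_ge; first by apply/subsetP => x; rewrite inE => /andP[].
  move=> b; rewrite inE => /and3P[bB n1 qb].
  have bA : f b \in A by move: bB; rewrite inE.
  by have := ellE bA; rewrite fI; lia.
have : b1 * #|bad| <= (2 * (b1 - 2)) * #|bad| by rewrite leq_mul2r; apply/orP; right; lia.
by lia.
Qed.

Let B2_bad : B2 \subset bad.
Proof.
apply/subsetP => b; rewrite inE => /and4P[bB gb hb gB].
rewrite inE bB /q (negPf gb) hb /= (B_nA bB) bB gB leqnn andbT.
exact: leq_trans (nx_le _) (BB bB gB hb).
Qed.

Let sum_sub (S U : {set T}) (w : T -> nat) : S \subset U ->
  \sum_(x in S) w x <= \sum_(x in U) w x.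
Proof.
move=> SU; rewrite [X in _ <= X](bigID (mem S)) /=; apply: leq_trans (leq_addr _ _).
rewrite [X in _ <= X](eq_bigl (mem S)) //.
by move=> x /=; case xS: (x \in S); rewrite ?andbF // (subsetP SU).
Qed.

Let sumBq : \sum_(b in B) q b <= 2 * \sum_(b in B1) deg b + b1 * #|B2|.
Proof.
have -> : b1 * #|B2| = \sum_(b in B2) b1 by rewrite sum_nat_const mulnC.
rewrite big_distrr /=.
have e1 (S : {set T}) (w : T -> nat) : S \subset B ->
    \sum_(b in S) w b = \sum_(b in B) (if b \in S then w b else 0).
  move=> SB; rewrite -big_mkcondr; apply: eq_bigl => b.
  by case bS: (b \in S); rewrite ?andbF // (subsetP SB).
rewrite (e1 B1) ?(e1 B2); try by apply/subsetP => x; rewrite inE => /andP[].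
rewrite -big_split; apply: leq_sum => b bB /=.
rewrite [b \in B1]inE [b \in B2]inE bB /q !(B_nA bB) bB.
by case: eqP => //= _; case: (h b (g b)); rewrite ?addn0 //=; case: ifP.
Qed.

Let B1B : B1 \subset B. Proof. by apply/subsetP => x; rewrite inE => /andP[]. Qed.

(** The edges of [h] at [B1] are sorted by their other end. Few go to free vertices, those to [C]
    fit into the degrees of [C], those to [A] displace free neighbours there and so waste budget,
    and those inside [B] have a bad end. *)
Let sumB1 : 2 * \sum_(b in B1) deg b <= 12 * L + b1 * #|C| + 2 * #|A|.
Proof.
have -> : \sum_(b in B1) deg b =
   \sum_(b in B1) nbr A b + \sum_(b in B1) nbr B b + \sum_(b in B1) nbr C b + \sum_(b in B1) nF b.
  by rewrite -!big_split; apply: eq_bigr => b _; rewrite deg4.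
have sF : \sum_(b in B1) nF b <= #|A|.
  rewrite -cardB -sum1_card; apply: leq_trans (sum_sub _ B1B).
  by apply: leq_sum => b bB; apply: B_nF; apply: (subsetP B1B).
have sC : 2 * \sum_(b in B1) nbr C b <= b1 * #|C|.
  rewrite double_count.
  have : \sum_(c in C) nbr B1 c <= \sum_(c in C) deg c.
    by apply: leq_sum => c _; apply: nbrS; apply: subsetT.
  have E : \sum_(c in C) deg (f c) = \sum_(c in C) deg c.
    rewrite [RHS](reindex_inj (inv_inj fI)) /=; apply: eq_bigl => c.
    by rewrite fC.
  have : \sum_(c in C) (deg c + deg (f c)) <= b1 * #|C|.
    rewrite mulnC -sum_nat_const; apply: leq_sum => c; rewrite inE => /andP[fc _].
    exact/P1/fh.
  by rewrite big_split /= E; lia.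
have sA : 2 * \sum_(b in B1) nbr A b <= 4 * L.
  rewrite double_count !big_distrr /=; apply: leq_sum => a aA.
  have fa := A_moved aA; have bB : f a \in B by rewrite inE fI.
  have le1 : nbr B1 a + nx a <= deg a.
    rewrite /nx -nbrU; first by apply: nbrS; apply: subsetT.
    apply/pred0P => x /=; apply/negP => /andP[xB1 xFn].
    by apply: (BF (subsetP B1B _ xB1)); move: xFn; rewrite inE => /andP[].
  have := P1 (fh fa); have := ellE aA; rewrite /q !(B_nA bB) bB.
  case: eqP => [_|_]; first by lia.
  case: ifP => [_|/negbFE hb]; first by lia.
  case: ifP => [gB|_]; last by lia.
  have := BB bB gB hb; rewrite fI; have := nx_le a; by lia.
(* Let [b] in [B1] be adjacent to [b'] in [B]. If [b'] is not bad, it pays more than [b1], hence has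
   degree above [b1 / 2]; this leaves [b] a degree below [b1 / 2], so [b] is bad. *)
have sB : 2 * \sum_(b in B1) nbr B b <= 8 * L.
  have : \sum_(b in B1) nbr B b <= 2 * (b1 * #|bad|); last by move: bad_L; lia.
  have bd : \sum_(b in bad) deg b <= b1 * #|bad|.
    rewrite mulnC -sum_nat_const; apply: leq_sum => b; rewrite inE => /andP[bB _].
    by apply: deg_le; move: bB; rewrite inE => /A_moved; rewrite fI eq_sym.
  apply: leq_trans (_ : \sum_(b in bad) nbr B1 b + \sum_(b in bad) deg b <= _); last first.
    apply: leq_trans (_ : \sum_(b in bad) deg b + \sum_(b in bad) deg b <= _); last by lia.
    by rewrite leq_add2r; apply: leq_sum => b _; apply: nbrS; apply: subsetT.
  have badB : bad \subset B by apply/subsetP => x; rewrite inE => /andP[].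
  rewrite double_count (bigID (mem bad)) /=; apply: leq_add.
    rewrite (eq_bigl (mem bad)) // => x /=.
    by case xb: (x \in bad); rewrite ?andbF // (subsetP badB).
  rewrite [X in _ <= X]double_count.
  apply: leq_trans (_ : \sum_(w in B | w \notin bad) nbr bad w <= _).
    apply: leq_sum => b' /andP[bB' nb]; apply: subset_leq_card.
    apply/subsetP => b; rewrite inE => /andP[bB1 hbb]; rewrite inE hbb andbT.
    have /and3P[bB gb hb] : [&& b \in B, g b != b & ~~ h b (g b)] by move: bB1; rewrite inE.
    have hbb2 : h b b' by rewrite h_sym.
    have x1 := leq_trans (nx_le _) (BB bB bB' hbb2).
    have x2 := leq_trans (nx_le _) (BB bB' bB hbb).
    rewrite inE bB x1 /=; move: nb; rewrite inE bB' x2 /= => nb.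
    have := P1 hbb; move: nb; rewrite /q !(B_nA bB) !(B_nA bB') bB bB'.
    rewrite (negPf gb) hb; case: eqP => [|_] //.
    by case: ifP => _; [|case: ifP => _]; move: (deg b) (deg b') => dx dy; clear; lia.
  apply: leq_trans (_ : \sum_w nbr bad w <= _).
    by rewrite [X in _ <= X](bigID (fun w => (w \in B) && (w \notin bad))) /= leq_addr.
  by apply: eq_leq; apply: eq_bigl => x; rewrite inE.
by lia.
Qed.

(* Linearised Cauchy-Schwarz for the edges between S and Fn; p / (p + r) is the
   guess for the normalised degrees on the side of S. *)
Let cauchy (S : {set T}) p r : 0 < p + r ->
  (p + r) ^ 2 * \sum_(a in S) nx a <= b1 * (p ^ 2 * #|S| + r ^ 2 * #|Fn|).
Proof.
move=> pr; set s := \sum_(a in S) nx a; set m := p + r.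
have sE : s = \sum_(u in Fn) nbr S u by rewrite /s double_count.
have sq z t : 2 * (t * m * b1) * z <= m ^ 2 * (z * z) + t ^ 2 * b1 ^ 2.
  have [+ _] := nat_Cauchy (m * z) (t * b1); rewrite !expnMn -!mulnn.
  by move: m; clear => m; lia.
have k1 : 2 * (p * m * b1) * s <= m ^ 2 * \sum_(a in S) nx a * nx a + p ^ 2 * b1 ^ 2 * #|S|.
  rewrite [X in _ <= _ + X]mulnC -sum_nat_const !big_distrr /= -big_split /=.
  by apply: leq_sum => a _; apply: sq.
have k2 : 2 * (r * m * b1) * s <=
    m ^ 2 * \sum_(u in Fn) nbr S u * nbr S u + r ^ 2 * b1 ^ 2 * #|Fn|.
  rewrite sE [X in _ <= _ + X]mulnC -sum_nat_const !big_distrr /= -big_split /=.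
  by apply: leq_sum => a _; apply: sq.
(* Every edge between [S] and [Fn] contributes the degrees of its two ends, together at most
   [b1]. *)
have k3 : \sum_(a in S) nx a * nx a + \sum_(u in Fn) nbr S u * nbr S u <= b1 * s.
  have e1 : \sum_(a in S) nx a * nx a <= \sum_(a in S) \sum_(u in Fn) h a u * deg a.
    apply: leq_sum => a _; rewrite -big_distrl /= -nbrE leq_mul2l.
    by rewrite nx_deg orbT.
  have e2 : \sum_(u in Fn) nbr S u * nbr S u <= \sum_(a in S) \sum_(u in Fn) h a u * deg u.
    rewrite exchange_big; apply: leq_sum => u _ /=.
    rewrite -big_distrl /= (_ : \sum_(i in S) _ = nbr S u) ?leq_mul2l ?nbrS ?subsetT ?orbT //.
    by rewrite nbrE; apply: eq_bigr => a _; rewrite h_sym.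
  apply: leq_trans (leq_add e1 e2) _; rewrite -big_split /s big_distrr /=.
  apply: leq_sum => a _; rewrite -big_split /nx (nbrE Fn a) big_distrr /=.
  apply: leq_sum => u _; case hau: (h a u) => //=; rewrite !mul1n muln1; exact: P1.
have b1p : 0 < b1 by lia.
rewrite -(leq_pmul2l b1p).
have e3 : 2 * (p * m * b1) * s + 2 * (r * m * b1) * s = 2 * (b1 * (m ^ 2 * s)).
  by rewrite -mulnDl -mulnDr -!mulnDl -/m -mulnn; lia.
have := leq_mul (leqnn (m ^ 2)) k3.
rewrite mulnDr.
have -> : m ^ 2 * (b1 * s) = b1 * (m ^ 2 * s) by lia.
have -> : b1 * (b1 * (p ^ 2 * #|S| + r ^ 2 * #|Fn|)) = p ^ 2 * b1 ^ 2 * #|S| + r ^ 2 * b1 ^ 2 * #|Fn|.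
  by rewrite -mulnn; lia.
by move: k1 k2 e3; lia.
Qed.

Let CBs := [set c in C | [&& g c != c, h c (g c) & g c \in B]].
(** Here [f a] pays nothing, so budget is saved from waste only if [a] has about [b1] neighbours in
    [Fn]. *)
Let AV := [set a in A | [&& g (f a) != f a, h (f a) (g (f a)) & g (f a) \in C]].

Let CBs_le : #|CBs| <= #|AV|.
Proof.
rewrite -(card_in_imset (f := fun c => f (g c)) (D := mem CBs)); last first.
  by move=> x y _ _ E; apply: (inv_inj gI); apply: (inv_inj fI).
apply: subset_leq_card; apply/subsetP => _ /imsetP[c + ->].
rewrite inE => /and4P[cC gc hc gB]; rewrite inE fI gI cC h_sym hc eq_sym gc !andbT.
by move: gB; rewrite inE.
Qed.

(** A matched edge inside [C] with no end in [CBs] wastes at least [b1]: each end pays at most [b1]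
    or twice its degree, and the degrees sum to at most [b1]. The vertices of [CBs] are injected
    into [AV] through their [g]-mates. *)
Let sumCC : b1 * #|C| <= 2 * LC + 2 * (b1 * #|AV|).
Proof.
pose N := [set c in C | (c \notin CBs) && (f c \notin CBs)].
have NL : b1 * #|N| <= 2 * LC.
  have E : \sum_(c in C) (2 * b1 - q (f c)) = LC.
    rewrite /LC [RHS](reindex_inj (inv_inj fI)) /=; apply: eq_bigl => c.
    by rewrite fC.
  have -> : 2 * LC = \sum_(c in C) ((2 * b1 - q c) + (2 * b1 - q (f c))).
    by rewrite big_split /= E -/LC; lia.
  apply: sum_ge; first by apply/subsetP => x; rewrite inE => /andP[].
  move=> c; rewrite inE => /and3P[cC n1 n2].
  have fcC : f c \in C by rewrite fC.
  have fc : f c != c by move: cC; rewrite inE => /andP[].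
  have := P1 (fh fc).
  have one z : z \in C -> z \notin CBs -> q z <= b1 \/ q z = 2 * deg z.
    move=> zC; rewrite inE zC /= /q !(C_nA zC) zC.
    case: eqP => [_|gz] /=; first by left.
    case: (h z (g z)) => /=; last by right.
    by move/negPf->; left; case: ifP.
  have dc := deg_le fc; have dfc : deg (f c) <= b1 by apply: deg_le; rewrite fI eq_sym.
  by case: (one _ cC n1); case: (one _ fcC n2); move: dc dfc;
     move: (q c) (q (f c)) (deg c) (deg (f c)); clear; lia.
have : #|C| <= #|N| + (#|CBs| + #|CBs|).
  have -> : #|CBs| + #|CBs| = #|CBs| + #|f @: CBs|.
    by rewrite (card_imset _ (inv_inj fI)).
  apply: leq_trans (leq_add (leqnn _) (leq_card_setU _ _)).
  apply: leq_trans (leq_card_setU _ _); apply: subset_leq_card; apply/subsetP => c cC.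
  rewrite inE in_setU; case c1: (c \in CBs); rewrite ?orbT //=.
  case c2 : (f c \in CBs); last by rewrite inE cC c1 c2.
  by rewrite orbC (_ : c \in f @: CBs) //; apply/imsetP; exists (f c); rewrite ?fI.
move/(leq_mul (leqnn b1)); have := leq_mul (leqnn b1) CBs_le.
by rewrite !mulnDr; move: NL; lia.
Qed.

(** The guess 99 : 1 in [cauchy] leaves the coefficient 2 * 100^2 - 2 * 99^2 = 398. Up to waste,
    [AV] is therefore at most a 199th of [Fn]. *)
Let sumAV : 398 * (b1 * #|AV|) <= 2 * (b1 * #|Fn|) + 100 * 100 * L.
Proof.
have : 2 * b1 * #|AV| <= L + 2 * \sum_(a in AV) nx a.
  have AVA : AV \subset A by apply/subsetP => x; rewrite inE => /andP[].
  apply: leq_trans (_ : \sum_(a in AV) ell a + 2 * \sum_(a in AV) nx a <= _); last first.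
    by rewrite leq_add2r; apply: sum_sub.
  rewrite big_distrr -big_split /= [X in X <= _]mulnC -sum_nat_const; apply: leq_sum => a.
  rewrite inE => /and4P[aA gb hb gC]; have := ellE aA.
  have bB : f a \in B by rewrite inE fI.
  rewrite /q (negPf gb) hb /= !(B_nA bB) bB !(C_nA gC); by lia.
have := cauchy AV (p := 99) (r := 1) isT.
have -> : (99 + 1) ^ 2 = 100 * 100 by rewrite -mulnn.
rewrite -(mulnn 99).
rewrite exp1n mul1n mulnDr.
move: (\sum_(a in AV) nx a) L #|AV| #|Fn|; clear => s L v w; by lia.
Qed.

(** The guess 9 : 1 leaves 200 - 2 * 81 = 38. Up to waste and the contribution of [C], the set [Fn]
    is 19 times as large as [A]. *)
Let sumA9 : 38 * (b1 * #|A|) <= 2 * (b1 * #|Fn|) + 1500 * L + 100 * (b1 * #|C|) + 200 * #|A|.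
Proof.
have := cauchy A (p := 9) (r := 1) isT.
have -> : (9 + 1) ^ 2 = 100 by [].
have -> : 9 ^ 2 = 81 by [].
rewrite exp1n mul1n mulnDr.
have b2L : b1 * #|B2| <= 2 * L.
  by apply: leq_trans bad_L; rewrite leq_mul2l (subset_leq_card B2_bad) orbT.
move: sumA sumBq sumB1 b2L.
move: L #|A| #|C| #|Fn| #|B2| (\sum_(b in B1) deg b) (\sum_(b in B) q b) (\sum_(a in A) nx a).
by clear; lia.
Qed.

Theorem sparsifier_bound : 4000 * cg + cf <= 2 * (4000 * cf).
Proof.
rewrite leqNgt; apply/negP => lt.
have e1 : 3999 * (b1 * cg) <= 4000 * (b2 * cg).
  by have := leq_mul b2_close (leqnn cg); lia.
have e2 : 4000 * cf <= b1 * cf by rewrite leq_mul2r b1_large orbT.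
have e3 : 2 * (4000 * (b1 * cf)) <= 4000 * (b1 * cg) + b1 * cf.
  by have := leq_mul (leqnn b1) (ltnW lt); lia.
(* In units of [b1 * cf / 4000], the waste is at most one for the assumed size of [cg], two for [b2]
   in place of [b1], as [cg] is about [2 * cf], and one for the extra [cf] in [total]. *)
have e4 : 1000 * (L + LC) <= b1 * cf by move: total e1 e2 e3; lia.
have e5 : 10 * (b1 * cg) <= 21 * (b1 * cf) by move: total e1 e2; lia.
have e6 : b1 * #|Fn| <= b1 * cg.
  rewrite leq_mul2l; apply/orP; right; apply: subset_leq_card.
  by apply/subsetP => x; rewrite !inE => /and3P[].
have cf0 : 0 < b1 * cf.
  rewrite muln_gt0; apply/andP; split; first by lia.
  case: (posnP cf) => // z; move: e5 lt; rewrite z muln0 !muln0 leqn0 muln_eq0 /=.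
  by rewrite muln_eq0 (gtn_eqF (leq_trans _ b1_large)) //= => /eqP->.
have e7 : b1 * cf = 2 * (b1 * #|A|) + b1 * #|C| by rewrite cfE; lia.
have e8 : 2 * #|A| <= cf by rewrite cfE; lia.
(* [AV], and with it [C], is a small part of the matched vertices, so [A] has nearly half of them.
   Then [sumA9] needs more vertices in [Fn] than the bound [#|Fn| <= cg <= 2.1 * cf] allows. *)
move: sumAV sumA9 sumCC e2 e4 e5 e6 e7 e8 cf0.
move: (b1 * #|AV|) (b1 * #|Fn|) (b1 * #|A|) (b1 * #|C|) (b1 * cf) (b1 * cg) #|A| cf L LC.
by clear; lia.
Qed.
End Sparsifier.

(** * A structured language and its compilation to the word RAM *)

Require Import Defs.

(** The values of this language are exact natural numbers and its lists are sequences. The side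
    conditions in [safe] exclude overflow, so the analysis of the algorithm meets neither modular
    arithmetic nor addresses. *)
Inductive expr :=
  | EV of nat | EC of nat | EO of binop & expr & expr
  | ENxt of expr & expr | EFlg of expr & expr | ELen of expr
  | ECel of nat & expr.

Inductive stm :=
  | HSkip
  | HAsg of nat & expr
  | HCel of nat & expr & expr
  | HIns of expr & expr
  | HDel of expr & expr
  | HSeq of stm & stm
  | HIf of expr & stm & stm
  | HWhile of expr & stm.

Record hst := HSt { env : nat -> nat; lst : nat -> seq nat; cel : nat -> nat -> nat }.

Definition setv (s : hst) x a := HSt (upd (env s) x a) (lst s) (cel s).
Definition setl (s : hst) k l :=
  HSt (env s) (fun j => if j == k then l else lst s j) (cel s).
Definition setc (s : hst) t i a :=
  HSt (env s) (lst s) (fun u => if u == t then upd (cel s u) i a else cel s u).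

(** With the default 0 of [nth], the sentinel 0 follows the last entry, and the first entry follows
    the sentinel. *)
Definition nxt (s : seq nat) x := nth 0 s (index x (0 :: s)).

Definition hop (o : binop) a b : nat :=
  match o with
  | Add => a + b | Sub => a - b | Mul => a * b | Div => a %/ b | Mod => a %% b
  | Ltn => a < b | Eqn => a == b | _ => 0
  end.

Fixpoint eval (s : hst) e : nat :=
  match e with
  | EV x => env s x
  | EC c => c
  | EO o a b => hop o (eval s a) (eval s b)
  | ENxt k x => nxt (lst s (eval s k)) (eval s x)
  | EFlg k x => eval s x \in lst s (eval s k)
  | ELen k => size (lst s (eval s k))
  | ECel t i => cel s t (eval s i)
  end.

Section Machine.
Variables (n w : nat).

Definition opok (o : binop) a b : Prop :=
  match o with
  | Add => a + b < 2 ^ w | Mul => a * b < 2 ^ w | Sub => b <= a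
  | Div | Mod | Ltn | Eqn => True | _ => False
  end.

Fixpoint safe (s : hst) e : Prop :=
  match e with
  | EV x => x < 40
  | EC c => c < 2 ^ w
  | EO o a b => [/\ safe s a, safe s b & opok o (eval s a) (eval s b)]
  | ENxt k x => [/\ safe s k, safe s x, eval s k <= 2 * n
                  & eval s x \in 0 :: lst s (eval s k)]
  | EFlg k x => [/\ safe s k, safe s x, eval s k <= 2 * n & eval s x <= n * n]
  | ELen k => safe s k /\ eval s k <= 2 * n
  | ECel t i => [/\ safe s i, t < 2 & eval s i < n]
  end.

Inductive hexec : stm -> hst -> hst -> nat -> Prop :=
  | XSkip s : hexec HSkip s s 1
  | XAsg x e s : safe s e -> hexec (HAsg x e) s (setv s x (eval s e)) 1
  | XCel t i e s : safe s i -> safe s e -> t < 2 -> eval s i < n ->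
      hexec (HCel t i e) s (setc s t (eval s i) (eval s e)) 1
  | XIns k x s : safe s k -> safe s x -> eval s k <= 2 * n ->
      0 < eval s x <= n * n -> eval s x \notin lst s (eval s k) ->
      hexec (HIns k x) s
        (setl s (eval s k) (rcons (lst s (eval s k)) (eval s x))) 1
  | XDel k x s : safe s k -> safe s x -> eval s k <= 2 * n ->
      eval s x \in lst s (eval s k) ->
      hexec (HDel k x) s
        (setl s (eval s k) (rem (eval s x) (lst s (eval s k)))) 1
  | XSeq p q s1 s2 s3 t1 t2 : hexec p s1 s2 t1 -> hexec q s2 s3 t2 ->
      hexec (HSeq p q) s1 s3 (t1 + t2)
  | XIf e p q s s' t : safe s e ->
      hexec (if eval s e == 0 then q else p) s s' t -> hexec (HIf e p q) s s' t.+1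
  | XWhileT e p s1 s2 s3 t1 t2 : safe s1 e -> eval s1 e != 0 ->
      hexec p s1 s2 t1 -> hexec (HWhile e p) s2 s3 t2 ->
      hexec (HWhile e p) s1 s3 (t1 + t2).+1
  | XWhileF e p s : safe s e -> eval s e = 0 -> hexec (HWhile e p) s s 1.

(* Each list is a doubly linked circular list through the sentinel node 0; the
   arrays 0, 1, 2, 3 hold the successor, predecessor, membership flag and length. *)
Definition addr t k x := 2 * n + 4 * (k * (n * n).+1 + x) + t.

Definition Cadr t rk rx rd rt :=
  Seq (Op Mul rd rk 5) (Seq (Op Add rd rd rx) (Seq (Const rt 4) (Seq (Op Mul rd rd rt)
  (Seq (Const rt 2) (Seq (Op Mul rt rt 0) (Seq (Op Add rd rd rt) (Seq (Const rt t)
  (Op Add rd rd rt)))))))).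

(** The registers from [r] on serve as an evaluation stack; the variables of the source language are
    the registers below 40. A register is copied by adding zero. *)
Fixpoint comp e r : program :=
  match e with
  | EV x => Seq (Const r 0) (Op Add r x r)
  | EC c => Const r c
  | EO o a b => Seq (comp a r) (Seq (comp b r.+1) (Op o r r r.+1))
  | ENxt k x => Seq (comp k r) (Seq (comp x r.+1)
                  (Seq (Cadr 0 r r.+1 r.+2 r.+3) (Read r r.+2)))
  | EFlg k x => Seq (comp k r) (Seq (comp x r.+1)
                  (Seq (Cadr 2 r r.+1 r.+2 r.+3) (Read r r.+2)))
  | ELen k => Seq (comp k r) (Seq (Const r.+1 0)
                  (Seq (Cadr 3 r r.+1 r.+2 r.+3) (Read r r.+2)))
  | ECel t i => Seq (comp i r) (Seq (Const r.+1 t) (Seq (Op Mul r.+1 r.+1 0)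
                  (Seq (Op Add r r r.+1) (Read r r))))
  end.

Definition rld t rk rx rd := Seq (Cadr t rk rx 44 45) (Read rd 44).
Definition rst t rk rx rv := Seq (Cadr t rk rx 44 45) (Write 44 rv).

Fixpoint compile p : program :=
  match p with
  | HSkip => Skip
  | HAsg x e => Seq (comp e 40) (Seq (Const 41 0) (Op Add x 40 41))
  | HCel t i e => Seq (comp i 40) (Seq (comp e 41) (Seq (Const 42 t)
       (Seq (Op Mul 42 42 0) (Seq (Op Add 40 40 42) (Write 40 41)))))
  | HIns k x => Seq (comp k 40) (Seq (comp x 41) (Seq (Const 42 0)
       (Seq (rld 1 40 42 43) (Seq (rst 0 40 43 41) (Seq (rst 1 40 41 43)
       (Seq (rst 0 40 41 42) (Seq (rst 1 40 42 41) (Seq (Const 46 1)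
       (Seq (rst 2 40 41 46) (Seq (rld 3 40 42 43) (Seq (Op Add 43 43 46)
       (rst 3 40 42 43))))))))))))
  | HDel k x => Seq (comp k 40) (Seq (comp x 41) (Seq (Const 42 0)
       (Seq (rld 1 40 41 43) (Seq (rld 0 40 41 47) (Seq (rst 0 40 43 47)
       (Seq (rst 1 40 47 43) (Seq (rst 2 40 41 42) (Seq (Const 46 1)
       (Seq (rld 3 40 42 43) (Seq (Op Sub 43 43 46)
       (rst 3 40 42 43)))))))))))
  | HSeq p q => Seq (compile p) (compile q)
  | HIf e p q => Seq (comp e 40) (If 40 (compile p) (compile q))
  | HWhile e p => Seq (comp e 40) (While 40 (Seq (compile p) (comp e 40)))
  end.

Fixpoint ctime e : nat :=
  match e with
  | EV _ => 2 | EC _ => 1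
  | EO _ a b => ctime a + (ctime b + 1)
  | ENxt k x | EFlg k x => ctime k + (ctime x + 10)
  | ELen k => ctime k + 11
  | ECel _ i => ctime i + 4
  end.

(** A purely syntactic bound on the factor by which compilation lengthens a run; it does not depend
    on the number of iterations. *)
Fixpoint kost p : nat :=
  match p with
  | HSkip => 1
  | HAsg _ e => ctime e + 2
  | HCel _ i e => ctime i + ctime e + 4
  | HIns k x | HDel k x => ctime k + ctime x + 100
  | HSeq p q => kost p + kost q
  | HIf e p q => ctime e + 1 + kost p + kost q
  | HWhile e p => ctime e + 1 + kost p
  end.

(* Registers 0 and 5 hold n and n * n + 1 for the address computations. *)
Fixpoint wfs p : bool :=
  match p with
  | HAsg x _ => [&& x < 40, x != 0 & x != 5]
  | HSeq p q | HIf _ p q => wfs p && wfs q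
  | HWhile _ p => wfs p
  | _ => true
  end.

Definition link (nx pv : nat -> nat) : rel nat := fun a b => (nx a == b) && (pv b == a).

Record lrep (nx pv fl : nat -> nat) (ln : nat) (s : seq nat) : Prop := LRep {
  lr_uniq : uniq (0 :: s);
  lr_le : forall x, x \in s -> x <= n * n;
  lr_path : path (link nx pv) 0 (rcons s 0);
  lr_flag : forall x, x <= n * n -> fl x = (x \in s);
  lr_len : ln = size s }.

Record rep (h : hst) (s : state) : Prop := Rep {
  r_reg : forall x, x < 40 -> regs s x = env h x;
  r_bnd : forall x, x < 40 -> env h x < 2 ^ w;
  r_n : env h 0 = n;
  r_5 : env h 5 = (n * n).+1;
  r_cel : forall t i, t < 2 -> i < n -> mem s (t * n + i) = cel h t i;
  r_celb : forall t i, t < 2 -> i < n -> cel h t i < 2 ^ w;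
  r_lst : forall k, k <= 2 * n ->
    lrep (fun x => mem s (addr 0 k x)) (fun x => mem s (addr 1 k x))
         (fun x => mem s (addr 2 k x)) (mem s (addr 3 k 0)) (lst h k) }.

Hypothesis hw : 2 * n + 4 * ((2 * n).+1 * (n * n).+1) < 2 ^ w.

Lemma w_gt0 : 0 < 2 ^ w. Proof. by rewrite expn_gt0. Qed.

Lemma addr_lt t k x : t < 4 -> k <= 2 * n -> x <= n * n -> addr t k x < 2 ^ w.
Proof.
move=> t4 k2 xn; apply: leq_trans _ hw; rewrite /addr ltnS -addnA leq_add2l.
have : k * (n * n).+1 <= 2 * n * (n * n).+1 by rewrite leq_mul2r k2 orbT.
by rewrite mulSn; lia.
Qed.

Lemma addr_inj t k x t' k' x' : t < 4 -> t' < 4 -> x <= n * n -> x' <= n * n ->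
  (addr t k x == addr t' k' x') = [&& t == t', k == k' & x == x'].
Proof.
move=> t4 t4' xn xn'; apply/eqP/and3P => [E|[/eqP-> /eqP-> /eqP->]] //.
have [E1 ->] : k * (n * n).+1 + x = k' * (n * n).+1 + x' /\ t = t' by move: E; rewrite /addr; lia.
have E2 : (k * (n * n).+1 + x) %/ (n * n).+1 = (k' * (n * n).+1 + x') %/ (n * n).+1 by rewrite E1.
rewrite !divnMDl // !divn_small ?addn0 // in E2.
by split => //; apply/eqP => //; move: E1; rewrite E2; lia.
Qed.

Lemma addr_ge t k x : 2 * n <= addr t k x. Proof. by rewrite /addr; lia. Qed.

Lemma eval_opE o a b : a < 2 ^ w -> b < 2 ^ w -> opok o a b ->
  eval_op w o a b = hop o a b /\ hop o a b < 2 ^ w.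
Proof.
have w0 := w_gt0; have w1 : 1 < 2 ^ w by apply: leq_trans hw; rewrite !mulSn; lia.
case: o => //= al bl ok; rewrite /eval_op.
- by rewrite modn_small.
- have -> : a + (2 ^ w - b) = (a - b) + 2 ^ w by lia.
  by rewrite modnDr modn_small; lia.
- by rewrite modn_small.
- have lt : a %/ b < 2 ^ w by apply: leq_ltn_trans (leq_div _ _) al.
  by rewrite modn_small.
- have lt : a %% b < 2 ^ w by apply: leq_ltn_trans (leq_mod _ _) al.
  by rewrite modn_small.
- have lt : (a < b : nat) < 2 ^ w by case: (a < b).
  by rewrite modn_small.
- have lt : (a == b : nat) < 2 ^ w by case: (a == b).
  by rewrite modn_small.
Qed.

Lemma adr_exec s t k x rk rx rd rt : t < 4 -> k <= 2 * n -> x <= n * n ->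
  regs s 0 = n -> regs s 5 = (n * n).+1 -> regs s rk = k -> regs s rx = x ->
  rd != rx -> rd != rt -> rt != 0 -> rd != 0 ->
  exists2 s', exec w (Cadr t rk rx rd rt) s s' 9 & [/\ regs s' rd = addr t k x,
    forall z, z != rd -> z != rt -> regs s' z = regs s z & mem s' = mem s].
Proof.
move=> t4 k2 xn s0 s5 sk sx dx dt t0 d0.
have := addr_lt t4 k2 xn; rewrite /addr => lt.
have w0 := w_gt0; have w4 : 4 < 2 ^ w by apply: leq_trans hw; rewrite !mulSn; lia.
eexists.
  rewrite /Cadr; do 8?[apply: (@ExecSeq _ _ _ _ _ _ 1); first by constructor].
  by constructor.
have e1 : (rd == rt) = false by apply/negbTE.
have e2 : (rx == rd) = false by rewrite eq_sym; apply/negbTE.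
have e3 : (0 == rt) = false by rewrite eq_sym; apply/negbTE.
have e4 : (0 == rd) = false by rewrite eq_sym; apply/negbTE.
rewrite /set_reg /upd /= ?eqxx ?e1 ?e2 ?e3 ?e4.
rewrite s0 s5 sk sx /eval_op !modn_small //; try by lia.
by split; [lia | move=> z /negPf-> /negPf-> | ].
Qed.

Lemma lrep_nxt nx pv fl ln s x : lrep nx pv fl ln s -> x \in 0 :: s -> nx x = nxt s x.
Proof.
move=> R xs; have ix : index x (0 :: s) < size (0 :: s) by rewrite index_mem.
have := lr_path R => /(pathP 0)/(_ (index x (0 :: s))).
rewrite size_rcons => /(_ ix)/andP[/eqP].
rewrite -rcons_cons !nth_rcons ix nth_index // => -> _.
rewrite /nxt; case: ltngtP => // le; rewrite nth_default //; first exact: ltnW.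
by rewrite le.
Qed.

Lemma nxt_in s x : nxt s x \in 0 :: s.
Proof.
rewrite /nxt; case: (ltnP (index x (0 :: s)) (size s)) => le.
  by rewrite inE mem_nth ?orbT.
by rewrite nth_default // mem_head.
Qed.

Lemma lrep_size nx pv fl ln s : lrep nx pv fl ln s -> size s <= n * n.
Proof.
move=> R; have /= /andP[s0 us] := lr_uniq R.
have : size s <= size (iota 1 (n * n)).
  apply: uniq_leq_size us _ => x xs; rewrite mem_iota; have := lr_le R xs.
  by case: x xs => [xs|x _]; [rewrite xs in s0 | lia].
by rewrite size_iota.
Qed.

Lemma nn_lt : n * n < 2 ^ w.
Proof. by apply: leq_trans hw; rewrite ltnS !mulSn; lia. Qed.

Lemma rep_nodes h s k x : rep h s -> k <= 2 * n -> x \in 0 :: lst h k -> x <= n * n.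
Proof.
by move=> R k2; rewrite inE => /predU1P[-> //|xs]; apply: lr_le xs; apply: r_lst R _ k2.
Qed.

Lemma eval_lt h s e : rep h s -> safe h e -> eval h e < 2 ^ w.
Proof.
move=> R; elim: e => //=.
- by move=> x x40; apply: (r_bnd R).
- by move=> o a IHa b IHb [sa sb ok]; case: (eval_opE (IHa sa) (IHb sb) ok).
- move=> k _ x _ [_ _ k2 _]; apply: leq_ltn_trans nn_lt.
  exact: rep_nodes R k2 (nxt_in _ _).
- move=> k _ x _ _; apply: leq_ltn_trans (leq_b1 _) _.
  by apply: leq_trans hw; rewrite !mulSn; lia.
- move=> k _ [_ k2]; apply: leq_ltn_trans nn_lt.
  exact: lrep_size (r_lst R k2).
- by move=> t i _ [_ t2 i2]; apply: (r_celb R).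
Qed.

Definition same_low r (s s' : state) :=
  (forall x, x < r -> regs s' x = regs s x) /\ mem s' = mem s.

Lemma rep_same h s s' r : 40 <= r -> rep h s -> same_low r s s' -> rep h s'.
Proof.
move=> r40 R [E1 E2]; constructor; rewrite ?E2.
- by move=> x x40; rewrite E1 ?(leq_trans x40) // (r_reg R).
- exact: (r_bnd R).
- exact: (r_n R).
- exact: (r_5 R).
- exact: (r_cel R).
- exact: (r_celb R).
- exact: (r_lst R).
Qed.

Lemma rep_05 h s : rep h s -> regs s 0 = n /\ regs s 5 = (n * n).+1.
Proof. by move=> R; rewrite !(r_reg R) // (r_n R) (r_5 R). Qed.

Lemma comp_exec h e : forall r s, 40 <= r -> rep h s -> safe h e ->
  exists2 s', exec w (comp e r) s s' (ctime e) & regs s' r = eval h e /\ same_low r s s'.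
Proof.
have w0 := w_gt0; have w1 : 1 < 2 ^ w by apply: leq_trans hw; rewrite !mulSn; lia.
elim: e => [x|c|o a IHa b IHb|k IHk x IHx|k IHk x IHx|k IHk|t i IHi] r s r40 R /=.
- move=> x40; have xr : x < r by exact: leq_trans r40.
  eexists; first by apply: (@ExecSeq _ _ _ _ _ _ 1 1); constructor.
  rewrite /set_reg /upd /= !eqxx (ltn_eqF xr) (r_reg R) // /eval_op mod0n addn0.
  rewrite modn_small ?(r_bnd R) //; split => //; split => // y yr.
  by rewrite /= !(ltn_eqF yr).
- move=> cw; eexists; first by constructor.
  rewrite /set_reg /upd /= eqxx modn_small //; split => //; split => // y yr.
  by rewrite /= !(ltn_eqF yr).
- move=> [sa sb ok]; have [s1 X1 [v1 L1]] := IHa _ _ r40 R sa.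
  have R1 := rep_same r40 R L1.
  have [s2 X2 [v2 L2]] := IHb _ _ (leqW r40) R1 sb.
  eexists; first by apply: ExecSeq X1 (ExecSeq X2 _); constructor.
  rewrite /set_reg /upd /= eqxx v2 (L2.1 r) // v1.
  rewrite (eval_opE (eval_lt R sa) (eval_lt R sb) ok).1; split => //; split.
    by move=> y yr; rewrite /= (ltn_eqF yr) L2.1 ?L1.1 //; apply: leqW.
  by rewrite /= L2.2 L1.2.
- move=> [sk sx k2 xs]; have [s1 X1 [v1 L1]] := IHk _ _ r40 R sk.
  have R1 := rep_same r40 R L1.
  have [s2 X2 [v2 L2]] := IHx _ _ (leqW r40) R1 sx.
  have R2 := rep_same (leqW r40) R1 L2; have [r0 r5] := rep_05 R2.
  have v1' : regs s2 r = eval h k by rewrite L2.1.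
  have xn := rep_nodes R k2 xs.
  have [||||s3 X3 [v3 L3 M3]] := @adr_exec s2 0 _ _ r r.+1 r.+2 r.+3 isT k2 xn r0 r5 v1' v2;
    rewrite ?eqSS //; try by lia.
  eexists; first by apply: ExecSeq X1 (ExecSeq X2 (ExecSeq X3 _)); constructor.
  rewrite /set_reg /upd /= eqxx v3 M3.
  rewrite (lrep_nxt (r_lst R2 k2)) //; split => //; split.
    move=> y yr; rewrite /= (ltn_eqF yr) L3; try by lia.
    by rewrite L2.1 ?L1.1 //; apply: leqW.
  by rewrite /= ?M3 L2.2 L1.2.
- move=> [sk sx k2 xn]; have [s1 X1 [v1 L1]] := IHk _ _ r40 R sk.
  have R1 := rep_same r40 R L1.
  have [s2 X2 [v2 L2]] := IHx _ _ (leqW r40) R1 sx.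
  have R2 := rep_same (leqW r40) R1 L2; have [r0 r5] := rep_05 R2.
  have v1' : regs s2 r = eval h k by rewrite L2.1.
  have [||||s3 X3 [v3 L3 M3]] := @adr_exec s2 2 _ _ r r.+1 r.+2 r.+3 isT k2 xn r0 r5 v1' v2;
    rewrite ?eqSS //; try by lia.
  eexists; first by apply: ExecSeq X1 (ExecSeq X2 (ExecSeq X3 _)); constructor.
  rewrite /set_reg /upd /= eqxx v3 M3 (lr_flag (r_lst R2 k2) xn); split => //; split.
    move=> y yr; rewrite /= (ltn_eqF yr) L3; try by lia.
    by rewrite L2.1 ?L1.1 //; apply: leqW.
  by rewrite /= ?M3 L2.2 L1.2.
- move=> [sk k2]; have [s1 X1 [v1 L1]] := IHk _ _ r40 R sk.
  have R1 := rep_same r40 R L1.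
  pose s2 := set_reg s1 r.+1 (0 %% 2 ^ w).
  have L2 : same_low r.+1 s1 s2.
    by split => // y yr; rewrite /s2 /set_reg /upd /= (ltn_eqF yr).
  have R2 := rep_same (leqW r40) R1 L2; have [r0 r5] := rep_05 R2.
  have v1' : regs s2 r = eval h k by rewrite L2.1.
  have v2 : regs s2 r.+1 = 0 by rewrite /s2 /set_reg /upd /= eqxx mod0n.
  have [||||s3 X3 [v3 L3 M3]] := @adr_exec s2 3 _ 0 r r.+1 r.+2 r.+3 isT k2 isT r0 r5 v1' v2;
    rewrite ?eqSS //; try by lia.
  eexists; first by apply: ExecSeq X1 (@ExecSeq _ _ _ _ _ _ 1 _ _ (ExecSeq X3 _)); constructor.
  rewrite /set_reg /upd /= eqxx v3 M3 (lr_len (r_lst R2 k2)); split => //; split.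
    move=> y yr; rewrite /= (ltn_eqF yr) L3; try by lia.
    by rewrite L2.1 ?L1.1 //; apply: leqW.
  exact: L1.2.
- move=> [si t2 i2]; have [s1 X1 [v1 L1]] := IHi _ _ r40 R si.
  have R1 := rep_same r40 R L1; have [r0 r5] := rep_05 R1.
  have lt : t * n + eval h i < 2 ^ w.
    apply: leq_trans hw; have : t * n <= 1 * n by rewrite leq_mul2r; apply/orP; right; lia.
    by rewrite !mulSn; lia.
  eexists; first by apply: ExecSeq X1 (@ExecSeq _ _ _ _ _ _ 1 _ _ (@ExecSeq _ _ _ _ _ _ 1 _ _
     (@ExecSeq _ _ _ _ _ _ 1 1 _ _))); constructor.
  rewrite /set_reg /upd /= !eqxx (ltn_eqF (ltnSn r)) v1 /= r0.
  rewrite /eval_op (modn_small (m := t)); last by lia.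
  rewrite (modn_small (m := t * n)); last by lia.
  rewrite addnC (modn_small lt) (r_cel R1) //; split => //; split; last exact: L1.2.
  by move=> y yr; rewrite /= !(ltn_eqF yr) !(ltn_eqF (leqW yr)) L1.1.
Qed.

Lemma path_link_eq nx pv nx' pv' a s : path (link nx pv) a s ->
  {in belast a s, nx' =1 nx} -> {in s, pv' =1 pv} -> path (link nx' pv') a s.
Proof.
elim: s a => //= b s IH a /andP[/andP[na pb] ps] en ep.
rewrite /link en ?mem_head // ep ?mem_head // na pb /=.
by apply: IH ps _ _ => x xs; [apply: en | apply: ep]; rewrite inE xs orbT.
Qed.

Lemma uniq_last_belast (a : nat) s : uniq (a :: s) -> last a s \notin belast a s.
Proof. by rewrite lastI rcons_uniq => /andP[]. Qed.

(** The new entry goes between the last one and the sentinel, so the order of a list is the order of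
    a queue. *)
Lemma lrep_ins nx pv fl ln s x p : lrep nx pv fl ln s -> 0 < x <= n * n -> x \notin s ->
  p = pv 0 ->
  lrep (upd (upd nx p x) x 0) (upd (upd pv x p) 0 x) (upd fl x 1) ln.+1 (rcons s x).
Proof.
move=> [us le ps fls lns] /andP[x0 xn] xs pE.
have /andP[s0 us'] : (0 \notin s) && uniq s by [].
have plast : p = last 0 s.
  by move: ps; rewrite rcons_path pE => /andP[_ /andP[_ /eqP]].
have xnl : x != last 0 s.
  apply/eqP => E; have := mem_last 0 s; rewrite -E inE (gtn_eqF x0) (negPf xs) //.
constructor.
- by rewrite -rcons_cons rcons_uniq us inE negb_or xs !andbT -lt0n.
- by move=> y; rewrite mem_rcons inE => /predU1P[->|/le].
- rewrite !rcons_path last_rcons; apply/andP; split; last first.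
    by rewrite /link /upd !eqxx.
  apply/andP; split; last first.
    rewrite /link /upd plast !eqxx (gtn_eqF x0) [last 0 s == x]eq_sym (negPf xnl).
    by rewrite !eqxx.
  move: ps; rewrite rcons_path => /andP[ps _]; apply: path_link_eq ps _ _.
    move=> y yb; have ys : y \in 0 :: s by apply: mem_belast.
    rewrite /upd; case: eqP => [E|_].
      by move: ys; rewrite E inE (gtn_eqF x0) (negPf xs).
    case: eqP => // E; by move: (uniq_last_belast us); rewrite -plast -E yb.
  move=> y ys; rewrite /upd; case: eqP => [E|_]; first by move: s0; rewrite -E ys.
  by case: eqP => // E; move: xs; rewrite -E ys.
- move=> y yn; rewrite mem_rcons inE /upd; case: eqP => //= _; exact: fls.
- by rewrite size_rcons lns.
Qed.

Lemma lrep_del nx pv fl ln s x : lrep nx pv fl ln s -> x \in s ->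
  lrep (upd nx (pv x) (nx x)) (upd pv (nx x) (pv x)) (upd fl x 0) ln.-1 (rem x s).
Proof.
move=> [us le ps fls lns] xs.
have /andP[s0 us'] : (0 \notin s) && uniq s by [].
have x0 : x != 0 by apply: contraNneq s0 => <-.
constructor.
- rewrite /= rem_uniq // andbT; apply: contra s0; exact: mem_rem.
- by move=> y /mem_rem/le.
- case/splitPr: s / xs us ps us' s0 {le fls lns} => s1 s2 us ps us' s0.
  have remE : rem x (s1 ++ x :: s2) = s1 ++ s2.
    move: us'; rewrite cat_uniq => /and3P[_ /hasPn D _].
    have xs1 : x \notin s1 by apply: D; apply: mem_head.
    elim: (s1) xs1 => /= [|b s1' IH]; first by rewrite eqxx.
    by rewrite inE eq_sym => /norP[/negPf-> /IH->].
  rewrite remE rcons_cat cat_path.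
  move: ps; rewrite rcons_cat cat_path /= => /and3P[ps1 /andP[/eqP n1 /eqP p1] ps2].
  have U : uniq (0 :: s1 ++ x :: s2) by [].
  case E2 : (rcons s2 0) => [|q s3]; first by case: (s2) E2.
  move: ps2; rewrite E2 /= => /andP[/andP[/eqP nx_q /eqP pq] ps3].
  have q_in : q \in 0 :: s2 by rewrite -mem_rcons E2 mem_head.
  have U1 : uniq ((0 :: s1) ++ x :: s2) by [].
  have us3 : uniq (q :: s3) by rewrite -E2 rcons_uniq; move: U; rewrite /= mem_cat inE !negb_or cat_uniq /= => /andP[/and3P[_ _ ->] /and4P[_ _ _ ->]].
  have lastin : last 0 s1 \in 0 :: s1 by apply: mem_last.
  have dis y z : y \in 0 :: s1 -> z \in x :: s2 -> y != z.
    move=> ys zs; move: U1; rewrite cat_uniq => /and3P[_ /hasPn/(_ z zs) D _].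
    by apply: contraNneq D => <-.
  rewrite p1 nx_q; apply/and3P; split.
  + apply: path_link_eq ps1 _ _ => y ys; rewrite /upd; last first.
      case: eqP => // E; exfalso; move: q_in; rewrite -E inE => /predU1P[E0|y2].
        by move: s0; rewrite -E0 mem_cat ys.
      have ya : y \in 0 :: s1 by rewrite inE ys orbT.
      have yb : y \in x :: s2 by rewrite inE y2 orbT.
      by move: (dis y y ya yb); rewrite eqxx.
    case: eqP => // E; exfalso.
    have U2 : uniq (0 :: s1) by move: U1; rewrite cat_uniq => /and3P[].
    by move: (uniq_last_belast U2); rewrite -E ys.
  + by rewrite /link /upd !eqxx.
  + apply: path_link_eq ps3 _ _ => y ys; rewrite /upd; last first.
      case: eqP => // E; exfalso; by move: us3; rewrite -E /= ys.
    case: eqP => // E; exfalso.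
    have /rcons_inj[bE _] : rcons (belast q s3) (last q s3) = rcons s2 0 by rewrite -lastI E2.
    rewrite bE in ys; have yb : y \in x :: s2 by rewrite inE ys orbT.
    by move: (dis _ y lastin yb); rewrite -E eqxx.
- move=> y yn; rewrite mem_rem_uniq // inE /upd /=; case: eqP => //= _; exact: fls.
- by rewrite size_rem // lns.
Qed.

Lemma upd_addr (m : nat -> nat) t k x v t' k' x' : t < 4 -> t' < 4 ->
  x <= n * n -> x' <= n * n -> upd m (addr t k x) v (addr t' k' x') =
  if [&& t' == t, k' == k & x' == x] then v else m (addr t' k' x').
Proof. by move=> *; rewrite /upd addr_inj. Qed.

Lemma upd_addr_low (m : nat -> nat) t k x v i : i < 2 * n -> upd m (addr t k x) v i = m i.
Proof. by move=> lt; rewrite /upd ltn_eqF // (leq_trans lt) // addr_ge. Qed.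

Lemma rld_exec s t k x rk rx rd : t < 4 -> k <= 2 * n -> x <= n * n ->
  regs s 0 = n -> regs s 5 = (n * n).+1 -> regs s rk = k -> regs s rx = x ->
  44 != rx ->
  exists2 s', exec w (rld t rk rx rd) s s' 10 & [/\ regs s' rd = mem s (addr t k x),
    forall z, z != rd -> z != 44 -> z != 45 -> regs s' z = regs s z & mem s' = mem s].
Proof.
move=> t4 k2 xn s0 s5 sk sx nx.
have [s1 X1 [v1 L1 M1]] := @adr_exec s t k x rk rx 44 45 t4 k2 xn s0 s5 sk sx nx isT isT isT.
eexists; first by apply: (@ExecSeq _ _ _ _ _ _ 9 1) X1 _; constructor.
rewrite /set_reg /upd /= eqxx v1 M1; split => // z /negPf-> z4 z5.
by rewrite L1.
Qed.

Lemma rst_exec s t k x rk rx rv : t < 4 -> k <= 2 * n -> x <= n * n ->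
  regs s 0 = n -> regs s 5 = (n * n).+1 -> regs s rk = k -> regs s rx = x ->
  44 != rx -> rv != 44 -> rv != 45 ->
  exists2 s', exec w (rst t rk rx rv) s s' 10 &
    (forall z, z != 44 -> z != 45 -> regs s' z = regs s z) /\
    mem s' = upd (mem s) (addr t k x) (regs s rv).
Proof.
move=> t4 k2 xn s0 s5 sk sx nx v4 v5.
have [s1 X1 [v1 L1 M1]] := @adr_exec s t k x rk rx 44 45 t4 k2 xn s0 s5 sk sx nx isT isT isT.
eexists; first by apply: (@ExecSeq _ _ _ _ _ _ 9 1) X1 _; constructor.
by rewrite /set_mem /= v1 M1 L1.
Qed.

Lemma lrep_ext nx pv fl ln nx' pv' fl' ln' s : lrep nx pv fl ln s ->
  (forall x, x <= n * n -> [/\ nx' x = nx x, pv' x = pv x & fl' x = fl x]) -> ln' = ln ->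
  lrep nx' pv' fl' ln' s.
Proof.
move=> [us le ps fls lns] E ->; constructor => //.
  apply: path_link_eq ps _ _ => x.
    move/mem_belast; rewrite inE mem_rcons inE orbA orbb => xs.
    suff xn : x <= n * n by have [] := E _ xn.
    by case/predU1P: xs => [->|/le].
  rewrite mem_rcons inE => xs; suff xn : x <= n * n by have [] := E _ xn.
  by case/predU1P: xs => [->|/le].
by move=> x xn; have [_ _ ->] := E _ xn; apply: fls.
Qed.

Lemma rep_list h s s' k l : rep h s -> k <= 2 * n ->
  (forall x, x < 40 -> regs s' x = regs s x) ->
  (forall i, i < 2 * n -> mem s' i = mem s i) ->
  (forall t k' x, t < 4 -> k' != k -> x <= n * n ->
     mem s' (addr t k' x) = mem s (addr t k' x)) ->
  lrep (fun x => mem s' (addr 0 k x)) (fun x => mem s' (addr 1 k x))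
       (fun x => mem s' (addr 2 k x)) (mem s' (addr 3 k 0)) l ->
  rep (setl h k l) s'.
Proof.
move=> R k2 Er El Ek Rl; constructor => /=.
- by move=> x x40; rewrite Er // (r_reg R).
- exact: (r_bnd R).
- exact: (r_n R).
- exact: (r_5 R).
- move=> t i t2 i2; rewrite El ?(r_cel R) //.
  have : t * n <= 1 * n by rewrite leq_mul2r; apply/orP; right; lia.
  by lia.
- exact: (r_celb R).
- move=> k' k2'; case: eqP => [->|/eqP ne] //.
  by apply: lrep_ext (r_lst R k2') _ _ => [x xn|]; rewrite !Ek.
Qed.

Lemma ins_exec h s k x : rep h s -> safe h k -> safe h x -> eval h k <= 2 * n ->
  0 < eval h x <= n * n -> eval h x \notin lst h (eval h k) ->
  exists2 s', exec w (compile (HIns k x)) s s' (ctime k + ctime x + 83) &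
    rep (setl h (eval h k) (rcons (lst h (eval h k)) (eval h x))) s'.
Proof.
move=> R sk sx k2 x0n xs; have /andP[x0 xn] := x0n.
have w1 : 1 < 2 ^ w by apply: leq_trans hw; rewrite !mulSn; lia.
have [s1 X1 [v1 L1]] := comp_exec (isT : 40 <= 40) R sk.
have R1 := rep_same (isT : 40 <= 40) R L1.
have [s2 X2 [v2 L2]] := comp_exec (isT : 40 <= 41) R1 sx.
have R2 := rep_same (isT : 40 <= 41) R1 L2; have [r0 r5] := rep_05 R2.
have v1' : regs s2 40 = eval h k by rewrite L2.1.
pose s3 := set_reg s2 42 (0 %% 2 ^ w).
have X3 : exec w (Const 42 0) s2 s3 1 by constructor.
have v3 : regs s3 42 = 0 by rewrite /= mod0n.
set K := eval h k in v1' k2 xs *; set x' := eval h x in v2 x0n x0 xn xs *.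
have RL := r_lst R2 k2; have R3l := lr_path RL.
have [s4 X4 [v4 L4 M4]] := @rld_exec s3 1 K 0 40 42 43 isT k2 isT r0 r5 v1' v3 isT.
set p := mem s3 (addr 1 K 0) in v4.
have pn : p <= n * n.
  have : p = last 0 (lst h K) by move: R3l; rewrite rcons_path => /andP[_ /andP[_ /eqP]].
  move=> ->; apply: (rep_nodes R k2); exact: mem_last.
have [s5 X5 [L5 M5]] : exists2 s5, exec w (rst 0 40 43 41) s4 s5 10 & _ :=
  @rst_exec s4 0 K p 40 43 41 isT k2 pn (etrans (L4 0 isT isT isT) r0)
    (etrans (L4 5 isT isT isT) r5) (etrans (L4 40 isT isT isT) v1') v4 isT isT isT.
have [s6 X6 [L6 M6]] := @rst_exec s5 1 K x' 40 41 43 isT k2 xn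
    (etrans (L5 0 isT isT) (etrans (L4 0 isT isT isT) r0))
    (etrans (L5 5 isT isT) (etrans (L4 5 isT isT isT) r5))
    (etrans (L5 40 isT isT) (etrans (L4 40 isT isT isT) v1'))
    (etrans (L5 41 isT isT) (etrans (L4 41 isT isT isT) v2)) isT isT isT.
have C6 z : z != 43 -> z != 44 -> z != 45 -> regs s6 z = regs s3 z.
  by move=> z3 z4 z5; rewrite L6 // L5 // L4.
have [s7 X7 [L7 M7]] := @rst_exec s6 0 K x' 40 41 42 isT k2 xn
    (etrans (C6 0 isT isT isT) r0) (etrans (C6 5 isT isT isT) r5)
    (etrans (C6 40 isT isT isT) v1') (etrans (C6 41 isT isT isT) v2) isT isT isT.
have C7 z : z != 43 -> z != 44 -> z != 45 -> regs s7 z = regs s3 z.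
  by move=> z3 z4 z5; rewrite L7 // C6.
have [s8 X8 [L8 M8]] := @rst_exec s7 1 K 0 40 42 41 isT k2 isT
    (etrans (C7 0 isT isT isT) r0) (etrans (C7 5 isT isT isT) r5)
    (etrans (C7 40 isT isT isT) v1') (etrans (C7 42 isT isT isT) v3) isT isT isT.
pose s9 := set_reg s8 46 (1 %% 2 ^ w).
have X9 : exec w (Const 46 1) s8 s9 1 by constructor.
have v9 : regs s9 46 = 1 by rewrite /= modn_small.
have C9 z : z != 43 -> z != 44 -> z != 45 -> z != 46 -> regs s9 z = regs s3 z.
  by move=> z3 z4 z5 z6; rewrite /s9 /= /upd (negPf z6) L8 // C7.
have [s10 X10 [L10 M10]] := @rst_exec s9 2 K x' 40 41 46 isT k2 xn
    (etrans (C9 0 isT isT isT isT) r0) (etrans (C9 5 isT isT isT isT) r5)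
    (etrans (C9 40 isT isT isT isT) v1') (etrans (C9 41 isT isT isT isT) v2) isT isT isT.
have C10 z : z != 43 -> z != 44 -> z != 45 -> z != 46 -> regs s10 z = regs s3 z.
  by move=> z3 z4 z5 z6; rewrite L10 // C9.
have [s11 X11 [v11 L11 M11]] := @rld_exec s10 3 K 0 40 42 43 isT k2 isT
    (etrans (C10 0 isT isT isT isT) r0) (etrans (C10 5 isT isT isT isT) r5)
    (etrans (C10 40 isT isT isT isT) v1') (etrans (C10 42 isT isT isT isT) v3) isT.
pose s12 := set_reg s11 43 (eval_op w Add (regs s11 43) (regs s11 46)).
have X12 : exec w (Op Add 43 43 46) s11 s12 1 by constructor.
have C12 z : z != 43 -> z != 44 -> z != 45 -> z != 46 -> regs s12 z = regs s3 z.
  by move=> z3 z4 z5 z6; rewrite /s12 /= /upd (negPf z3) L11 // C10.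
have [s13 X13 [L13 M13]] := @rst_exec s12 3 K 0 40 42 43 isT k2 isT
    (etrans (C12 0 isT isT isT isT) r0) (etrans (C12 5 isT isT isT isT) r5)
    (etrans (C12 40 isT isT isT isT) v1') (etrans (C12 42 isT isT isT isT) v3) isT isT isT.
have v43 : regs s5 43 = p by rewrite L5 // v4.
have v41 : regs s4 41 = x' by rewrite L4.
have v42 : regs s6 42 = 0 by rewrite C6.
have v41' : regs s7 41 = x' by rewrite C7.
have M10E t k' y : t < 4 -> y <= n * n -> mem s10 (addr t k' y) =
  if [&& t == 2, k' == K & y == x'] then 1 else
  if [&& t == 1, k' == K & y == 0] then x' else
  if [&& t == 0, k' == K & y == x'] then 0 else
  if [&& t == 1, k' == K & y == x'] then p else
  if [&& t == 0, k' == K & y == p] then x' else mem s2 (addr t k' y).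
  move=> t4 yn; rewrite M10 upd_addr // v9 -[mem s9]/(mem s8) M8 upd_addr // v41'.
  by rewrite M7 upd_addr // v42 M6 upd_addr // v43 M5 upd_addr // v41 M4.
have lenE : mem s10 (addr 3 K 0) = size (lst h K) by rewrite M10E //= (lr_len RL).
have v12 : regs s12 43 = (size (lst h K)).+1.
  rewrite /s12 /= v11 lenE L11 // L10 // v9 /eval_op addn1 modn_small //.
  by have := lrep_size RL; have := hw; rewrite !mulSn; lia.
have M13E t k' y : t < 4 -> y <= n * n -> mem s13 (addr t k' y) =
  if [&& t == 3, k' == K & y == 0] then (size (lst h K)).+1 else mem s10 (addr t k' y).
  by move=> t4 yn; rewrite M13 upd_addr // v12 -[mem s12]/(mem s11) M11.
exists s13.
  rewrite (_ : _ + 83 = ctime k + (ctime x + (1 + (10 + (10 + (10 + (10 + (10 + (1 + (10 +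
     (10 + (1 + 10)))))))))))); last by lia.
  do 12?[apply: ExecSeq; first eassumption]; eassumption.
apply: rep_list R k2 _ _ _ _.
- move=> z z40; rewrite L13; try by lia.
  rewrite C12; try by lia.
  rewrite /s3 /= /upd ltn_eqF; last by lia.
  by rewrite L2.1 ?L1.1 // ltnW.
- move=> i i2; rewrite M13 upd_addr_low // -[mem s12]/(mem s11) M11 M10 upd_addr_low //.
  rewrite -[mem s9]/(mem s8) M8 upd_addr_low // M7 upd_addr_low // M6 upd_addr_low //.
  by rewrite M5 upd_addr_low // M4 -[mem s3]/(mem s2) L2.2 L1.2.
- move=> t k' y t4 /negPf ne yn; rewrite M13E // M10E // ne !andbF.
  by rewrite L2.2 L1.2.
- apply: lrep_ext (lrep_ins RL x0n xs (erefl _)) _ _.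
    move=> y yn; rewrite !M13E // !M10E // !eqxx /=.
    by rewrite -/p /upd; split.
  by rewrite M13E // !eqxx /= (lr_len RL).
Qed.

Lemma del_exec h s k x : rep h s -> safe h k -> safe h x -> eval h k <= 2 * n ->
  eval h x \in lst h (eval h k) ->
  exists2 s', exec w (compile (HDel k x)) s s' (ctime k + ctime x + 73) &
    rep (setl h (eval h k) (rem (eval h x) (lst h (eval h k)))) s'.
Proof.
move=> R sk sx k2 xs.
have w1 : 1 < 2 ^ w by apply: leq_trans hw; rewrite !mulSn; lia.
have [s1 X1 [v1 L1]] := comp_exec (isT : 40 <= 40) R sk.
have R1 := rep_same (isT : 40 <= 40) R L1.
have [s2 X2 [v2 L2]] := comp_exec (isT : 40 <= 41) R1 sx.
have R2 := rep_same (isT : 40 <= 41) R1 L2; have [r0 r5] := rep_05 R2.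
have v1' : regs s2 40 = eval h k by rewrite L2.1.
pose s3 := set_reg s2 42 (0 %% 2 ^ w).
have X3 : exec w (Const 42 0) s2 s3 1 by constructor.
have v3 : regs s3 42 = 0 by rewrite /= mod0n.
set K := eval h k in v1' k2 xs *; set x' := eval h x in v2 xs *.
have RL := r_lst R2 k2; have xn := lr_le RL xs.
have [s4 X4 [v4 L4 M4]] := @rld_exec s3 1 K x' 40 41 43 isT k2 xn r0 r5 v1' v2 isT.
have [s5 X5 [v5 L5 M5]] := @rld_exec s4 0 K x' 40 41 47 isT k2 xn (etrans (L4 0 isT isT isT) r0)
    (etrans (L4 5 isT isT isT) r5) (etrans (L4 40 isT isT isT) v1')
    (etrans (L4 41 isT isT isT) v2) isT.
have x_split : exists s1' s2', lst h K = s1' ++ x' :: s2' by case/splitPr: xs => a b; exists a, b.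
set p := mem s3 (addr 1 K x') in v4; set q := mem s4 (addr 0 K x') in v5.
have pn : p <= n * n.
  apply: (rep_nodes R k2); have [a [b E]] := x_split; move: (lr_path RL).
  rewrite E rcons_cat cat_path /= => /and3P[_ /andP[_ /eqP pE] _].
  rewrite (_ : p = last 0 a) //; have := mem_last 0 a.
  by rewrite !inE mem_cat => /orP[->|->]; rewrite ?orbT.
have qn : q <= n * n.
  apply: (rep_nodes R k2); rewrite /q M4 -[mem s3]/(mem s2).
  have xs0 : x' \in 0 :: lst h K by rewrite inE xs orbT.
  by rewrite (lrep_nxt RL xs0) nxt_in.
have C5 z : z != 43 -> z != 44 -> z != 45 -> z != 47 -> regs s5 z = regs s3 z.
  by move=> z3 z4 z5 z7; rewrite L5 // L4.
have v43 : regs s5 43 = p by rewrite L5 // v4.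
have [s6 X6 [L6 M6]] := @rst_exec s5 0 K p 40 43 47 isT k2 pn
    (etrans (C5 0 isT isT isT isT) r0) (etrans (C5 5 isT isT isT isT) r5)
    (etrans (C5 40 isT isT isT isT) v1') v43 isT isT isT.
have [s7 X7 [L7 M7]] := @rst_exec s6 1 K q 40 47 43 isT k2 qn
    (etrans (L6 0 isT isT) (etrans (C5 0 isT isT isT isT) r0))
    (etrans (L6 5 isT isT) (etrans (C5 5 isT isT isT isT) r5))
    (etrans (L6 40 isT isT) (etrans (C5 40 isT isT isT isT) v1'))
    (etrans (L6 47 isT isT) v5) isT isT isT.
have C7 z : z != 43 -> z != 44 -> z != 45 -> z != 47 -> regs s7 z = regs s3 z.
  by move=> z3 z4 z5 z7; rewrite L7 // L6 // C5.
have [s8 X8 [L8 M8]] := @rst_exec s7 2 K x' 40 41 42 isT k2 xn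
    (etrans (C7 0 isT isT isT isT) r0) (etrans (C7 5 isT isT isT isT) r5)
    (etrans (C7 40 isT isT isT isT) v1') (etrans (C7 41 isT isT isT isT) v2) isT isT isT.
pose s9 := set_reg s8 46 (1 %% 2 ^ w).
have X9 : exec w (Const 46 1) s8 s9 1 by constructor.
have v9 : regs s9 46 = 1 by rewrite /= modn_small.
have C9 z : z != 43 -> z != 44 -> z != 45 -> z != 46 -> z != 47 -> regs s9 z = regs s3 z.
  by move=> z3 z4 z5 z6 z7; rewrite /s9 /= /upd (negPf z6) L8 // C7.
have [s11 X11 [v11 L11 M11]] := @rld_exec s9 3 K 0 40 42 43 isT k2 isT
    (etrans (C9 0 isT isT isT isT isT) r0) (etrans (C9 5 isT isT isT isT isT) r5)
    (etrans (C9 40 isT isT isT isT isT) v1') (etrans (C9 42 isT isT isT isT isT) v3) isT.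
pose s12 := set_reg s11 43 (eval_op w Sub (regs s11 43) (regs s11 46)).
have X12 : exec w (Op Sub 43 43 46) s11 s12 1 by constructor.
have C12 z : z != 43 -> z != 44 -> z != 45 -> z != 46 -> z != 47 -> regs s12 z = regs s3 z.
  by move=> z3 z4 z5 z6 z7; rewrite /s12 /= /upd (negPf z3) L11 // C9.
have [s13 X13 [L13 M13]] := @rst_exec s12 3 K 0 40 42 43 isT k2 isT
    (etrans (C12 0 isT isT isT isT isT) r0) (etrans (C12 5 isT isT isT isT isT) r5)
    (etrans (C12 40 isT isT isT isT isT) v1') (etrans (C12 42 isT isT isT isT isT) v3) isT isT isT.
have v43' : regs s6 43 = p by rewrite L6.
have v42 : regs s7 42 = 0 by rewrite C7.
have M9E t k' y : t < 4 -> y <= n * n -> mem s9 (addr t k' y) =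
  if [&& t == 2, k' == K & y == x'] then 0 else
  if [&& t == 1, k' == K & y == q] then p else
  if [&& t == 0, k' == K & y == p] then q else mem s2 (addr t k' y).
  move=> t4 yn; rewrite -[mem s9]/(mem s8) M8 upd_addr // v42 M7 upd_addr // v43'.
  by rewrite M6 upd_addr // v5 M5 M4.
have lenE : mem s9 (addr 3 K 0) = size (lst h K) by rewrite M9E //= (lr_len RL).
have sz : size (lst h K) <= n * n := lrep_size RL.
have sz0 : 0 < size (lst h K) by case: (lst h K) xs.
have v12 : regs s12 43 = (size (lst h K)).-1.
  rewrite /s12 /= v11 lenE L11 // v9.
  have [-> _] := eval_opE (o := Sub) (leq_ltn_trans sz nn_lt) w1 sz0.
  by rewrite /= subn1.
have M13E t k' y : t < 4 -> y <= n * n -> mem s13 (addr t k' y) =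
  if [&& t == 3, k' == K & y == 0] then (size (lst h K)).-1 else mem s9 (addr t k' y).
  by move=> t4 yn; rewrite M13 upd_addr // v12 -[mem s12]/(mem s11) M11.
exists s13.
  rewrite (_ : _ + 73 = ctime k + (ctime x + (1 + (10 + (10 + (10 + (10 + (10 + (1 + (10 +
     (1 + 10))))))))))); last by lia.
  do 11?[apply: ExecSeq; first eassumption]; eassumption.
apply: rep_list R k2 _ _ _ _.
- move=> z z40; rewrite L13; try by lia.
  rewrite C12; try by lia.
  rewrite /s3 /= /upd ltn_eqF; last by lia.
  by rewrite L2.1 ?L1.1 // ltnW.
- move=> i i2; rewrite M13 upd_addr_low // -[mem s12]/(mem s11) M11.
  rewrite -[mem s9]/(mem s8) M8 upd_addr_low // M7 upd_addr_low // M6 upd_addr_low //.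
  by rewrite M5 M4 -[mem s3]/(mem s2) L2.2 L1.2.
- move=> t k' y t4 /negPf ne yn; rewrite M13E // M9E // ne !andbF.
  by rewrite L2.2 L1.2.
- have qE : q = mem s2 (addr 0 K x') by rewrite /q M4.
  apply: lrep_ext (lrep_del RL xs) _ _.
    move=> y yn; rewrite !M13E // !M9E // !eqxx /=.
    by rewrite -qE -[mem s2 (addr 1 K x')]/p /upd; split.
  by rewrite M13E // !eqxx /= (lr_len RL).
Qed.

(** The simulation costs a constant factor depending on the program text alone, which is what allows
    the final bound to be proved for the source language. *)
Theorem compile_exec p h h' t : hexec p h h' t -> wfs p -> forall s, rep h s ->
  exists s' t', [/\ exec w (compile p) s s' t', rep h' s' & t' <= kost p * t].
Proof.
elim=> {p h h' t} [h|x e h se|c i e h si se c2 ilt|k x h sk sx k2 x0 xs|k x h sk sx k2 xs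
  |p q h1 h2 h3 t1 t2 _ IH1 _ IH2|e p q h h' t se _ IH|e p h1 h2 h3 t1 t2 se ne _ IH1 _ IH2
  |e p h se ez] wf s R.
- by exists s, 1; split => //; constructor.
- have [s1 X1 [v1 L1]] := comp_exec (isT : 40 <= 40) R se.
  have ev := eval_lt R se.
  have [x40 [x0 x5]] : x < 40 /\ x != 0 /\ x != 5 by move: wf => /= /and3P[].
  eexists; exists (ctime e + (1 + 1)); split; last by rewrite muln1.
    by apply: ExecSeq X1 (ExecSeq _ _); constructor.
  rewrite /set_reg /upd /= v1 mod0n /eval_op addn0 modn_small //.
  constructor; rewrite /= /upd.
  + move=> y y40; case: eqP => // _; rewrite [y == 41]ltn_eqF ?(leq_trans y40) //.
    by rewrite L1.1 // (r_reg R).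
  + by move=> y y40; case: eqP => // _; apply: (r_bnd R).
  + by rewrite eq_sym (negPf x0) (r_n R).
  + by rewrite eq_sym (negPf x5) (r_5 R).
  + by rewrite L1.2; apply: (r_cel R).
  + exact: (r_celb R).
  + by rewrite L1.2; apply: (r_lst R).
- have [s1 X1 [v1 L1]] := comp_exec (isT : 40 <= 40) R si.
  have R1 := rep_same (isT : 40 <= 40) R L1.
  have [s2 X2 [v2 L2]] := comp_exec (isT : 40 <= 41) R1 se.
  have R2 := rep_same (isT : 40 <= 41) R1 L2; have [r0 r5] := rep_05 R2.
  have ev := eval_lt R se.
  have cn : c * n <= 1 * n by rewrite leq_mul2r; apply/orP; right; lia.
  have lt : eval h i + c * n < 2 ^ w by apply: leq_trans hw; rewrite !mulSn; lia.
  eexists; exists (ctime i + (ctime e + (1 + (1 + (1 + 1))))); split; last by rewrite /=; lia.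
    apply: ExecSeq X1 (ExecSeq X2 (ExecSeq _ (ExecSeq _ (ExecSeq _ _)))); constructor.
  rewrite /set_reg /upd /= v2 r0 (L2.1 40) // v1 /eval_op (modn_small (m := c)); last first.
    by apply: leq_trans hw; rewrite !mulSn; lia.
  rewrite (modn_small (m := c * n)) ?(modn_small lt); last by lia.
  constructor; rewrite /set_mem /= /upd.
  + move=> y y40; rewrite [y == 40]ltn_eqF // [y == 42]ltn_eqF ?(leq_trans y40) //.
    exact: (r_reg R2).
  + exact: (r_bnd R).
  + exact: (r_n R).
  + exact: (r_5 R).
  + move=> t' i' t2 i2; have E : (t' * n + i' == eval h i + c * n) = (t' == c) && (i' == eval h i).
      have c01 : (c == 0) || (c == 1) by lia.
      have t01 : (t' == 0) || (t' == 1) by lia.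
      by case/orP: c01 => /eqP ->; case/orP: t01 => /eqP ->; rewrite ?mul0n ?mul1n; lia.
    rewrite E; case: eqP => [->|_] /=; last exact: (r_cel R2).
    by rewrite /upd; case: eqP => // _; apply: (r_cel R2).
  + move=> t' i' t2 i2; case: eqP => [->|_]; last exact: (r_celb R).
    by rewrite /upd; case: eqP => // _; apply: (r_celb R).
  + move=> k k2; apply: lrep_ext (r_lst R2 k2) _ _ => [x xn|].
      by split; rewrite gtn_eqF //; apply: leq_trans (addr_ge _ _ _); lia.
    by rewrite gtn_eqF //; apply: leq_trans (addr_ge _ _ _); lia.
- have [s' X R'] := ins_exec R sk sx k2 x0 xs.
  by exists s'; eexists; split; [exact: X | exact: R' | rewrite /=; lia].
- have [s' X R'] := del_exec R sk sx k2 xs.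
  by exists s'; eexists; split; [exact: X | exact: R' | rewrite /=; lia].
- have /andP[w1 w2] : wfs p && wfs q by [].
  have [s1 [u1 [X1 R1 le1]]] := IH1 w1 _ R; have [s2 [u2 [X2 R2 le2]]] := IH2 w2 _ R1.
  exists s2, (u1 + u2); split => //=; first exact: ExecSeq X1 X2.
  by move: le1 le2; rewrite mulnDl !mulnDr; lia.
- have /andP[w1 w2] : wfs p && wfs q by [].
  have [s1 X1 [v1 L1]] := comp_exec (isT : 40 <= 40) R se.
  have R1 := rep_same (isT : 40 <= 40) R L1.
  case: eqP IH => [ez|/eqP ne] IH.
    have [s2 [u2 [X2 R2 le2]]] := IH w2 _ R1.
    exists s2, (ctime e + u2.+1); split => //=.
      by apply: ExecSeq X1 _; apply: ExecIfFalse X2; rewrite v1.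
    by move: le2; rewrite mulnS !mulnDl; lia.
  have [s2 [u2 [X2 R2 le2]]] := IH w1 _ R1.
  exists s2, (ctime e + u2.+1); split => //=.
    by apply: ExecSeq X1 _; apply: ExecIfTrue X2; rewrite v1.
  by move: le2; rewrite mulnS !mulnDl; lia.
- have [s1 X1 [v1 L1]] := comp_exec (isT : 40 <= 40) R se.
  have R1 := rep_same (isT : 40 <= 40) R L1.
  have [s2 [u2 [X2 R2 le2]]] := IH1 wf _ R1.
  have [s3 [u3 [X3 R3 le3]]] := IH2 wf _ R2.
  (* The induction hypothesis for the remaining iterations starts with an evaluation of the test. In
     the compiled loop this evaluation ends the body, so it is split off here and moved there. *)
  inversion X3 as [| | | | |pp qq a1 a2 a3 t3 t4 Y1 Y2 E1 E2 E3 E4| | | |]; subst.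
  exists s3, (ctime e + (u2 + t3 + t4).+1); split => //=.
    apply: ExecSeq X1 _; apply: ExecWhileTrue (ExecSeq X2 Y1) Y2; by rewrite v1.
  by move: le2 le3; rewrite /= mulnS !mulnDl !mulnDr; lia.
- have [s1 X1 [v1 L1]] := comp_exec (isT : 40 <= 40) R se.
  have R1 := rep_same (isT : 40 <= 40) R L1.
  exists s1, (ctime e + 1); split => //=; last by lia.
  by apply: ExecSeq X1 _; apply: ExecWhileFalse; rewrite v1.
Qed.
End Machine.

(** * Program logic and the local search for augmenting paths *)

Definition eadd := EO Add.
Definition esub := EO Sub.
Definition emul := EO Mul.
Definition elt := EO Ltn.
Definition eeq := EO Eqn.
Definition eneg e := eeq e (EC 0).
Definition epre e := esub e (EC 1).
Definition esuc e := eadd e (EC 1).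
Definition Mate := ECel 0.
Definition Dg := ECel 1.
Definition hk e := eadd (EV 0) e.
Notation "p ;; q" := (HSeq p q) (at level 61, right associativity).

(** A framing criterion: registers are allocated by level, so that code called from elsewhere leaves
    the lower registers of its callers alone. *)
Fixpoint lowmod l p : bool :=
  match p with
  | HAsg x _ => l <= x
  | HSeq p q | HIf _ p q => lowmod l p && lowmod l q
  | HWhile _ p => lowmod l p
  | _ => true
  end.

Definition agree l (s s' : hst) := forall x, x < l -> env s' x = env s x.

Lemma agree_trans l s1 s2 s3 : agree l s1 s2 -> agree l s2 s3 -> agree l s1 s3.
Proof. by move=> a b x xl; rewrite b // a. Qed.
Lemma agreeW l l' s s' : l' <= l -> agree l s s' -> agree l' s s'.
Proof. by move=> le a x xl; rewrite a // (leq_trans xl). Qed.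

Section Hoare.
Variables (n w : nat).
Hypothesis hw : 2 * n + 4 * ((2 * n).+1 * (n * n).+1) < 2 ^ w.

(** Total correctness with the running time as the second argument of the postcondition. *)
Definition run p s (Q : hst -> nat -> Prop) :=
  exists s' t, hexec n w p s s' t /\ Q s' t.

Lemma run_mono p s (Q Q' : hst -> nat -> Prop) :
  run p s Q -> (forall s' t, Q s' t -> Q' s' t) -> run p s Q'.
Proof. by move=> [s' [t [X q]]] H; exists s', t; split => //; apply: H. Qed.

Lemma run_skip s (Q : hst -> nat -> Prop) : Q s 1 -> run HSkip s Q.
Proof. by move=> q; exists s, 1; split => //; constructor. Qed.

Lemma run_asg x e s (Q : hst -> nat -> Prop) : safe n w s e ->
  Q (setv s x (eval s e)) 1 -> run (HAsg x e) s Q.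
Proof. by move=> se q; eexists; exists 1; split; [constructor|]. Qed.

Lemma run_cel t i e s (Q : hst -> nat -> Prop) : safe n w s i -> safe n w s e ->
  t < 2 -> eval s i < n -> Q (setc s t (eval s i) (eval s e)) 1 -> run (HCel t i e) s Q.
Proof. by move=> *; eexists; exists 1; split; [constructor|]. Qed.

Lemma run_ins k x s (Q : hst -> nat -> Prop) : safe n w s k -> safe n w s x ->
  eval s k <= 2 * n -> 0 < eval s x <= n * n -> eval s x \notin lst s (eval s k) ->
  Q (setl s (eval s k) (rcons (lst s (eval s k)) (eval s x))) 1 -> run (HIns k x) s Q.
Proof. by move=> *; eexists; exists 1; split; [constructor|]. Qed.

Lemma run_del k x s (Q : hst -> nat -> Prop) : safe n w s k -> safe n w s x ->
  eval s k <= 2 * n -> eval s x \in lst s (eval s k) ->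
  Q (setl s (eval s k) (rem (eval s x) (lst s (eval s k)))) 1 -> run (HDel k x) s Q.
Proof. by move=> *; eexists; exists 1; split; [constructor|]. Qed.

Lemma run_seq p q s (Q : hst -> nat -> Prop) :
  run p s (fun s1 t1 => run q s1 (fun s2 t2 => Q s2 (t1 + t2))) -> run (p ;; q) s Q.
Proof.
move=> [s1 [t1 [X1 [s2 [t2 [X2 q2]]]]]]; exists s2, (t1 + t2); split => //.
exact: XSeq X1 X2.
Qed.

Lemma run_if e p q s (Q : hst -> nat -> Prop) : safe n w s e ->
  run (if eval s e == 0 then q else p) s (fun s' t => Q s' t.+1) -> run (HIf e p q) s Q.
Proof. by move=> se [s' [t [X q2]]]; exists s', t.+1; split => //; constructor. Qed.

Lemma run_whileF e p s (Q : hst -> nat -> Prop) : safe n w s e -> eval s e = 0 ->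
  Q s 1 -> run (HWhile e p) s Q.
Proof. by move=> se ez q; exists s, 1; split => //; constructor. Qed.

Lemma run_whileT e p s (Q : hst -> nat -> Prop) : safe n w s e -> eval s e != 0 ->
  run p s (fun s1 t1 => run (HWhile e p) s1 (fun s2 t2 => Q s2 (t1 + t2).+1)) ->
  run (HWhile e p) s Q.
Proof.
move=> se ne [s1 [t1 [X1 [s2 [t2 [X2 q2]]]]]]; exists s2, (t1 + t2).+1; split => //.
exact: XWhileT se ne X1 X2.
Qed.

Lemma run_while (I : hst -> Prop) (m : hst -> nat) T e p s :
  (forall s1, I s1 -> safe n w s1 e /\ (eval s1 e != 0 ->
     run p s1 (fun s2 t => [/\ I s2, m s2 < m s1 & t <= T]))) ->
  I s -> run (HWhile e p) s (fun s2 t => [/\ I s2, eval s2 e = 0 & t <= m s * T.+1 + 1]).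
Proof.
move=> step; have [k] := ubnP (m s); elim: k s => // k IH s; rewrite ltnS => le Is.
have [se body] := step _ Is; case: (eqVneq (eval s e) 0) => [ez|ne].
  by apply: run_whileF => //; split => //; lia.
apply: run_whileT => //; apply: run_mono (body ne) _ => s1 t1 [I1 lt1 le1].
apply: run_mono (IH s1 (leq_trans lt1 le) I1) _ => s2 t2 [I2 ez2 le2]; split => //.
have : (m s1).+1 * T.+1 <= m s * T.+1 by rewrite leq_mul2r lt1 orbT.
by rewrite mulSn; lia.
Qed.

Lemma hexec_frame l p s s' t : hexec n w p s s' t -> lowmod l p -> agree l s s'.
Proof.
elim=> {p s s' t} //=.
- by move=> x e s _ le y yl; rewrite /= /upd ltn_eqF // (leq_trans yl).
- move=> p q s1 s2 s3 t1 t2 _ IH1 _ IH2 /andP[/IH1 a /IH2 b]; exact: agree_trans a b.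
- by move=> e p q s s' t _ _ IH /andP[a b]; apply: IH; case: eqP.
- move=> e p s1 s2 s3 t1 t2 _ _ _ IH1 _ IH2 lm.
  exact: agree_trans (IH1 lm) (IH2 lm).
Qed.

Lemma run_frame l p s (Q : hst -> nat -> Prop) : lowmod l p -> run p s Q ->
  run p s (fun s' t => Q s' t /\ agree l s s').
Proof.
move=> lm [s' [t [X q]]]; exists s', t; split => //; split => //.
exact: hexec_frame X lm.
Qed.

Lemma W_facts : [/\ 2 * n < 2 ^ w, n * n < 2 ^ w & 8 <= 2 ^ w].
Proof.
have le : n * n <= (2 * n).+1 * (n * n).+1 by rewrite mulSn; lia.
have := hw; split; try by lia.
have [|n0] := posnP n; last by apply: leq_trans hw; rewrite !mulSn; lia.
move=> n0; move: hw; rewrite n0 /=; case: (w) => [|[|[|w']]] // _.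
have : 0 < 2 ^ w' by rewrite expn_gt0.
by rewrite !expnS; lia.
Qed.

Notation found := 39.
(** The loop stops at the first success, when the body sets [found], and [x] then still holds the
    successful entry. Entries are positive, so [x = 0] means that the list is exhausted. *)
Definition ForS k x body :=
  HAsg x (ENxt k (EC 0)) ;;
  HWhile (emul (EV x) (eneg (EV found)))
    (body ;; HIf (EV found) HSkip (HAsg x (ENxt k (EV x)))).

Definition keeps l (s s' : hst) := [/\ agree l s s', lst s' = lst s & cel s' = cel s].

Lemma keeps_refl l s : keeps l s s. Proof. by []. Qed.
Lemma keeps_trans l s1 s2 s3 : keeps l s1 s2 -> keeps l s2 s3 -> keeps l s1 s3.
Proof.
by move=> [a1 l1 c1] [a2 l2 c2]; split; [exact: agree_trans a1 a2 | rewrite l2 | rewrite c2].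
Qed.
Lemma keepsW l l' s s' : l' <= l -> keeps l s s' -> keeps l' s s'.
Proof. by move=> le [a b c]; split => //; apply: agreeW le a. Qed.
Lemma keeps_setv l s x a : l <= x -> keeps l s (setv s x a).
Proof. by move=> le; split => // y yl; rewrite /= /upd ltn_eqF // (leq_trans yl). Qed.

Lemma nxt0 s : nxt s 0 = nth 0 s 0. Proof. by []. Qed.
Lemma nxt_nth s i : uniq (0 :: s) -> i < size s -> nxt s (nth 0 s i) = nth 0 s i.+1.
Proof.
move=> us lt; rewrite /nxt -[nth 0 s i]/(nth 0 (0 :: s) i.+1) index_uniq //.
Qed.

Lemma run_for k x body s K (P : nat -> Prop) (R : hst -> Prop) T :
  x < found -> env s found = 0 ->
  (forall s1, keeps x s s1 -> safe n w s1 k /\ eval s1 k = K) -> K <= 2 * n ->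
  uniq (0 :: lst s K) -> (forall e, e \in lst s K -> e < 2 ^ w) ->
  (forall s1 e, e \in lst s K -> keeps x s s1 -> env s1 x = e -> env s1 found = 0 ->
     run body s1 (fun s2 t => [/\ t <= T, keeps x.+1 s1 s2 &
        (env s2 found = 0 /\ ~ P e) \/ (env s2 found = 1 /\ R s2)])) ->
  run (ForS k x body) s (fun s2 t => [/\ t <= size (lst s K) * (T + 3) + 2, keeps x s s2 &
    (env s2 found = 0 /\ forall e, e \in lst s K -> ~ P e) \/
    [/\ env s2 found = 1, R s2 & env s2 x \in lst s K]]).
Proof.
move=> xf f0 ek K2 us lw bd; set l := lst s K in us lw bd *.
have [W2 Wn W8] := W_facts.
have [sk0 ek0] := ek s (keeps_refl _ _).
apply: run_seq; apply: run_asg; first by rewrite /= ek0 mem_head; split => //; lia.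
rewrite /= ek0 nxt0 -/l; set s0 := setv s x _.
have k0 : keeps x s s0 by apply: keeps_setv.
suff H j : forall i s1, i + j = size l -> keeps x s s1 -> env s1 x = nth 0 l i ->
    env s1 found = 0 -> (forall i', i' < i -> ~ P (nth 0 l i')) ->
    run (HWhile (emul (EV x) (eneg (EV found)))
         (body ;; HIf (EV found) HSkip (HAsg x (ENxt k (EV x))))) s1
      (fun s2 t => [/\ t <= j * (T + 3) + 1, keeps x s s2 &
    (env s2 found = 0 /\ forall e, e \in l -> ~ P e) \/
    [/\ env s2 found = 1, R s2 & env s2 x \in l]]).
  apply: run_mono (H (size l) 0 s0 _ k0 _ _ _) _ => //.
  - by rewrite /= /upd eqxx.
  - by rewrite /= /upd gtn_eqF.
  - by move=> s2 t [le kp r]; split => //; lia.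
elim: j => [|j IH] i s1 ij kp ex ef nP.
  have ex0 : env s1 x = 0 by rewrite ex nth_default // -ij addn0.
  apply: run_whileF; rewrite /= ?ex0 ?mul0n //.
    by do !split => //; rewrite ?ef /=; lia.
  split => //; left; split => // e el; rewrite -(nth_index 0 el); apply: nP.
  by move: ij; rewrite addn0 => ->; rewrite index_mem.
have il : i < size l by lia.
have el : nth 0 l i \in l by apply: mem_nth.
have e0 : nth 0 l i != 0 by apply: contraTneq us => E; rewrite /= -{1}E el.
have ew := lw _ el.
apply: run_whileT; rewrite /= ?ex ?ef ?eqxx ?muln1 //; first by do !split => //; lia.
apply: run_seq; apply: run_mono (bd _ _ el kp ex ef) _ => s2 t2 [le2 kp2 r2].
have kp2' : keeps x s s2 by apply: keeps_trans kp (keepsW (leqnSn x) kp2).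
have ex2 : env s2 x = nth 0 l i by have [a _ _] := kp2; rewrite a.
case: r2 => [[f2 nP2]|[f2 R2]].
  have [sk2 ek2] := ek _ kp2'; have [_ l2 _] := kp2'.
  apply: run_if; first by rewrite /=.
  rewrite /= f2 eqxx; apply: run_asg.
    by rewrite /= ek2 l2 -/l ex2 inE el orbT; split => //; lia.
  rewrite /= ek2 l2 -/l ex2 nxt_nth //; set s3 := setv s2 x _.
  apply: run_mono (IH i.+1 s3 _ _ _ _ _) _.
  - by lia.
  - exact: keeps_trans kp2' (keeps_setv _ _ (leqnn x)).
  - by rewrite /= /upd eqxx.
  - by rewrite /= /upd gtn_eqF.
  - move=> i'; rewrite ltnS leq_eqVlt => /predU1P[->|/nP] //.
  by move=> s4 t4 [le4 kp4 r4]; split => //; rewrite mulSn; lia.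
apply: run_if; first by rewrite /=.
rewrite /= f2 /=; apply: run_skip.
apply: run_whileF; rewrite /= ?f2 /= ?muln0 //.
  by do !split => //; rewrite ?muln0; lia.
by split => //; [rewrite mulSn; lia | right; split => //; rewrite ex2].
Qed.

(** * Exhaustive search for short augmenting paths from one vertex *)

Definition hT (L : nat -> seq nat) : rel 'I_n := fun x y => (val y).+1 \in L (n + val x).

Definition enc (c : nat -> nat) (f : 'I_n -> 'I_n) :=
  forall x : 'I_n, c x = if f x == x then 0 else (val (f x)).+1.

Record hwf (L : nat -> seq nat) (Z : nat) : Prop := HWf {
  hw_uniq : forall x : 'I_n, uniq (L (n + x));
  hw_node : forall (x : 'I_n) e, e \in L (n + x) -> exists2 y : 'I_n, e = y.+1 & hT L x y;
  hw_size : forall x : 'I_n, size (L (n + x)) <= Z;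
  hw_sym : symmetric (hT L);
  hw_irr : irreflexive (hT L) }.

(** Register 28 holds the start of the search, and register 29 a vertex that may not be the other
    end; the value [n] there forbids nothing. *)
Definition fix_end x := HAsg found (emul (eneg (Mate (epre (EV x))))
  (emul (eneg (eeq (epre (EV x)) (EV 29))) (eneg (eeq (epre (EV x)) (EV 28))))).
Definition fix1 := ForS (hk (EV 28)) 33 (fix_end 33).
Definition fix3 := ForS (hk (EV 28)) 33 (HAsg 34 (Mate (epre (EV 33))) ;;
  HIf (EV 34) (ForS (hk (epre (EV 34))) 35 (fix_end 35)) HSkip).
Definition fix5 := ForS (hk (EV 28)) 33 (HAsg 34 (Mate (epre (EV 33))) ;;
  HIf (EV 34) (ForS (hk (epre (EV 34))) 35 (HAsg 36 (Mate (epre (EV 35))) ;;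
    HIf (emul (EV 36) (eneg (eeq (EV 35) (EV 33))))
      (ForS (hk (epre (EV 36))) 37 (fix_end 37)) HSkip)) HSkip).
Definition matchS x y := HCel 0 (epre (EV x)) (EV y) ;; HCel 0 (epre (EV y)) (EV x).
(** The lengths are tried in increasing order because [augment_no_aug] needs a shortest path.
    Registers 32 to 37 hold the path, shifted by one, and its flip matches them in consecutive
    pairs. *)
Definition fixS :=
  HAsg found (EC 0) ;; HAsg 32 (esuc (EV 28)) ;; fix1 ;;
  HIf (EV found) (matchS 32 33) (fix3 ;;
  HIf (EV found) (matchS 32 33 ;; matchS 34 35) (fix5 ;;
  HIf (EV found) (matchS 32 33 ;; matchS 34 35 ;; matchS 36 37) HSkip)).

Section Fix.
Variables (L : nat -> seq nat) (Z : nat) (c0 : nat -> nat -> nat) (f : 'I_n -> 'I_n).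
Variables (v : 'I_n) (z : nat).
Hypothesis wf : hwf L Z.
Hypothesis ef : enc (c0 0) f.
Let h := hT L.

Let base s := [/\ lst s = L, cel s = c0, env s 0 = n, env s 28 = v & env s 29 = z].

Let base_keeps l s s' : 29 < l -> base s -> keeps l s s' -> base s'.
Proof.
move=> le [b1 b2 b3 b4 b5] [a e1 e2]; split; rewrite ?e1 ?e2 ?a //; by lia.
Qed.

Let n_lt : 2 * n < 2 ^ w /\ 8 <= 2 ^ w. Proof. by have [] := W_facts. Qed.

Let list_ok (x : 'I_n) : [/\ n + x <= 2 * n, uniq (0 :: L (n + x)) &
  forall e, e \in L (n + x) -> e < 2 ^ w].
Proof.
have [W1 W2] := n_lt; split; first by have := ltn_ord x; lia.
  rewrite /= (hw_uniq wf) andbT; apply/negP => /(hw_node wf)[y].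
  by [].
move=> e /(hw_node wf)[y -> _]; by have := ltn_ord y; lia.
Qed.

Let free_to (y : 'I_n) := [&& f y == y, val y != z & y != v].

Let end_run x (y : 'I_n) s : 32 < x < found -> base s -> env s x = y.+1 ->
  run (fix_end x) s (fun s' t => [/\ t <= 1, keeps x.+1 s s' & env s' found = free_to y]).
Proof.
move=> /andP[x32 x39] [b1 b2 b3 b4 b5] ex; have [W1 W2] := n_lt.
have yn := ltn_ord y.
have E : eval s (emul (eneg (Mate (epre (EV x))))
  (emul (eneg (eeq (epre (EV x)) (EV 29))) (eneg (eeq (epre (EV x)) (EV 28))))) = free_to y.
  rewrite /= ex b2 b4 b5 subn1 /= ef /free_to -(inj_eq val_inj y v) /=.
  by case: (f y == y); case: (val y == z); case: (val y == v).
apply: run_asg; last by rewrite E; split => //; apply: keeps_setv.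
rewrite /= ex subn1 /=; do !split => //; try by lia.
all: by do ![case: (_ == _)]; lia.
Qed.

Let key28 s : base s -> safe n w s (hk (EV 28)) /\ eval s (hk (EV 28)) = n + v.
Proof.
move=> [b1 b2 b3 b4 b5]; rewrite /= b3 b4; split => //; split => //.
by have [W1 W2] := n_lt; have := ltn_ord v; lia.
Qed.

Let keyx x (y : 'I_n) s : x < 40 -> base s -> env s x = y.+1 ->
  safe n w s (hk (epre (EV x))) /\ eval s (hk (epre (EV x))) = n + y.
Proof.
move=> x40 [b1 b2 b3 b4 b5] ex; have [W1 W2] := n_lt; have yn := ltn_ord y.
by rewrite /= b3 ex subn1 /=; do !split => //; lia.
Qed.

Let safe_mate x (y : 'I_n) s : x < 40 -> base s -> env s x = y.+1 ->
  safe n w s (Mate (epre (EV x))) /\ eval s (Mate (epre (EV x))) = if f y == y then 0 else (val (f y)).+1.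
Proof.
move=> x40 [b1 b2 b3 b4 b5] ex; have [W1 W2] := n_lt; have yn := ltn_ord y.
by rewrite /= b2 ex subn1 /= ef; do !split => //; lia.
Qed.

Let inner x k (y : 'I_n) s : 32 < x < found -> base s -> env s found = 0 ->
  (forall s1, keeps x s s1 -> safe n w s1 k /\ eval s1 k = n + y) ->
  run (ForS k x (fix_end x)) s (fun s' t => [/\ t <= 4 * Z + 2, keeps x s s' &
    (env s' found = 0 /\ forall u, h y u -> ~~ free_to u) \/
    (env s' found = 1 /\ exists u : 'I_n, [/\ env s' x = u.+1, h y u & free_to u])]).
Proof.
move=> xx bs f0 ek; have [k2 us lw] := list_ok y; have [b1 _ _ _ _] := bs.
have x39 : x < found by lia.
apply: run_mono (run_for (P := fun e => exists2 u : 'I_n, e = u.+1 & free_to u)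
  (R := fun s' => exists u : 'I_n, [/\ env s' x = u.+1, h y u & free_to u]) (T := 1) x39 f0 ek k2 _ _ _) _;
  rewrite ?b1 //.
  move=> s1 e /(hw_node wf)[u -> hyu] kp ex _.
  apply: run_mono (end_run (y := u) xx (base_keeps _ bs kp) ex) _; first by lia.
  move=> s2 t [le kp2 fe]; split => //; have [a2 _ _] := kp2.
  case fu : (free_to u) fe => fe; [right|left]; split => //.
    by exists u; split => //; rewrite a2.
  by case=> u' [/val_inj E] fu'; rewrite E fu' in fu.
move=> s2 t [le kp r]; split => //.
  by have := hw_size wf y; move: le; nia.
case: r => [[fe nP]|[fe R2 _]]; [left|by right]; split => // u hu.
by apply/negP => fu; apply: (nP _ hu); exists u.
Qed.

Lemma fix1_run s : base s -> env s found = 0 ->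
  run fix1 s (fun s' t => [/\ t <= 4 * Z + 2, keeps 33 s s' &
    (env s' found = 0 /\ forall u, h v u -> ~~ free_to u) \/
    (env s' found = 1 /\ exists u : 'I_n, [/\ env s' 33 = u.+1, h v u & free_to u])]).
Proof.
move=> bs f0; apply: inner => // s1 kp; apply: key28.
by apply: base_keeps bs kp.
Qed.

Let step3 (a : 'I_n) s' := (env s' found = 0 /\
    forall u, f a != a -> h (f a) u -> ~~ free_to u) \/
  (env s' found = 1 /\ exists u : 'I_n, [/\ f a != a, env s' 34 = (f a).+1, env s' 35 = u.+1,
      h (f a) u & free_to u]).

Let body3 (a : 'I_n) s : base s -> env s found = 0 -> env s 33 = a.+1 ->
  run (HAsg 34 (Mate (epre (EV 33))) ;;
    HIf (EV 34) (ForS (hk (epre (EV 34))) 35 (fix_end 35)) HSkip) s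
  (fun s' t => [/\ t <= 4 * Z + 4, keeps 34 s s' & step3 a s']).
Proof.
move=> bs f0 ea; have [sm em] := safe_mate (isT : 33 < 40) bs ea.
apply: run_seq; apply: run_asg => //; rewrite em; set s1 := setv s 34 _.
have kp1 : keeps 34 s s1 by apply: keeps_setv.
have bs1 : base s1 by apply: base_keeps bs kp1.
apply: run_if => //; rewrite /s1 /= -/s1.
case: (eqVneq (f a) a) => [fa|fa] /=.
  by apply: run_skip; split => //; [lia | left; split => //= u; rewrite fa eqxx].
apply: run_mono (inner (x := 35) (y := f a) (isT : 32 < 35 < 39) bs1 _ _) _ => //.
  move=> s2 kp2; have bs2 : base s2 by apply: base_keeps bs1 kp2.
  by have [a2 _ _] := kp2; apply: keyx; rewrite ?a2 //= (negPf fa).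
move=> s2 t [le kp2 r]; split; first by lia.
  by apply: keeps_trans kp1 _; apply: keepsW kp2.
case: r => [[fe nf]|[fe [u [eu hu fu]]]]; [left|right]; split => //.
  by move=> u _; apply: nf.
by exists u; split => //; have [a2 _ _] := kp2; rewrite a2 //= (negPf fa).
Qed.

Lemma fix3_run s : base s -> env s found = 0 ->
  run fix3 s (fun s' t => [/\ t <= Z * (4 * Z + 7) + 2, keeps 33 s s' &
    (env s' found = 0 /\ forall a u, h v a -> f a != a -> h (f a) u -> ~~ free_to u) \/
    (env s' found = 1 /\ exists a u : 'I_n, [/\ env s' 33 = a.+1, env s' 34 = (f a).+1,
       env s' 35 = u.+1, h v a & [/\ f a != a, h (f a) u & free_to u]])]).
Proof.
move=> bs f0; have [k2 us lw] := list_ok v; have [b1 _ _ _ _] := bs.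
apply: run_mono (run_for
  (P := fun e => exists a u : 'I_n, [/\ e = a.+1, f a != a, h (f a) u & free_to u])
  (R := fun s' => exists a u : 'I_n, [/\ env s' 33 = a.+1, env s' 34 = (f a).+1,
       env s' 35 = u.+1, h v a & [/\ f a != a, h (f a) u & free_to u]])
  (T := 4 * Z + 4) (isT : 33 < 39) f0 _ k2 _ _ _) _; rewrite ?b1 //.
- by move=> s1 kp; apply: key28; apply: base_keeps bs kp.
- move=> s1 e /(hw_node wf)[a -> hva] kp ea f1.
  apply: run_mono (body3 (base_keeps _ bs kp) f1 ea) _ => // s2 t [le kp2 r].
  split => //; case: r => [[fe nf]|[fe [u [fa e34 e35 hu fu]]]]; [left|right]; split => //.
    move=> [a' [u [[/val_inj <-] fa hu fu]]].
    by move/negP: (nf u fa hu).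
  by exists a, u; split => //; have [a2 _ _] := kp2; rewrite a2.
- move=> s2 t [le kp r]; split => //.
    by have := hw_size wf v; move: le; nia.
  case: r => [[fe nP]|[fe R2 _]]; [left|by right]; split => // a u hva fa hu.
  by apply/negP => fu; apply: (nP _ hva); exists a, u.
Qed.

Let step5 (a : 'I_n) s' := (env s' found = 0 /\
    forall c u, f a != a -> h (f a) c -> c != a -> f c != c -> h (f c) u -> ~~ free_to u) \/
  (env s' found = 1 /\ exists c u : 'I_n, [/\ f a != a, env s' 34 = (f a).+1, env s' 35 = c.+1,
      env s' 36 = (f c).+1 & env s' 37 = u.+1 /\ [/\
      h (f a) c, c != a, f c != c, h (f c) u & free_to u]]).

Let bodyc (a c : 'I_n) s : base s -> env s found = 0 -> env s 33 = a.+1 -> env s 35 = c.+1 ->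
  run (HAsg 36 (Mate (epre (EV 35))) ;;
    HIf (emul (EV 36) (eneg (eeq (EV 35) (EV 33))))
      (ForS (hk (epre (EV 36))) 37 (fix_end 37)) HSkip) s
  (fun s' t => [/\ t <= 4 * Z + 4, keeps 36 s s' & 
   (env s' found = 0 /\ forall u, c != a -> f c != c -> h (f c) u -> ~~ free_to u) \/
   (env s' found = 1 /\ exists u : 'I_n, [/\ env s' 36 = (f c).+1, env s' 37 = u.+1, c != a,
       f c != c & h (f c) u /\ free_to u])]).
Proof.
move=> bs f0 ea ec; have [sm em] := safe_mate (isT : 35 < 40) bs ec.
have [W1 W2] := n_lt.
apply: run_seq; apply: run_asg => //; rewrite em; set s1 := setv s 36 _.
have kp1 : keeps 36 s s1 by apply: keeps_setv.
have bs1 : base s1 by apply: base_keeps bs kp1.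
have [a1 _ _] := kp1.
have cn := ltn_ord (f c).
apply: run_if.
  rewrite /=; do !split => //; try by lia.
  rewrite /upd /= ec ea; case: (f c == c); case: (_ == _); rewrite ?muln1 ?muln0; by lia.
rewrite /= /upd /= ec ea eqSS (inj_eq val_inj).
case: (eqVneq (f c) c) => [fc|fc] /=.
  by apply: run_skip; split => //; [lia | left; split => // u _; rewrite fc eqxx].
case: (eqVneq c a) => [ca|ca]; rewrite ?muln0 ?muln1 /=.
  by apply: run_skip; split => //; [lia | left; split => // u; rewrite eqxx].
apply: run_mono (inner (x := 37) (y := f c) (isT : 32 < 37 < 39) bs1 _ _) _ => //.
  move=> s2 kp2; have bs2 : base s2 by apply: base_keeps bs1 kp2.
  by have [a2 _ _] := kp2; apply: keyx; rewrite ?a2 //= (negPf fc).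
move=> s2 t [le kp2 r]; split; first by lia.
  by apply: keeps_trans kp1 _; apply: keepsW kp2.
case: r => [[fe nf]|[fe [u [eu hu fu]]]]; [left|right]; split => //.
  by move=> u _ _; apply: nf.
by exists u; split => //; have [a2 _ _] := kp2; rewrite a2 //= (negPf fc).
Qed.

Let body5 (a : 'I_n) s : base s -> env s found = 0 -> env s 33 = a.+1 ->
  run (HAsg 34 (Mate (epre (EV 33))) ;;
    HIf (EV 34) (ForS (hk (epre (EV 34))) 35 (HAsg 36 (Mate (epre (EV 35))) ;;
    HIf (emul (EV 36) (eneg (eeq (EV 35) (EV 33))))
      (ForS (hk (epre (EV 36))) 37 (fix_end 37)) HSkip)) HSkip) s
  (fun s' t => [/\ t <= Z * (4 * Z + 7) + 4, keeps 34 s s' & step5 a s']).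
Proof.
move=> bs f0 ea; have [sm em] := safe_mate (isT : 33 < 40) bs ea.
apply: run_seq; apply: run_asg => //; rewrite em; set s1 := setv s 34 _.
have kp1 : keeps 34 s s1 by apply: keeps_setv.
have bs1 : base s1 by apply: base_keeps bs kp1.
apply: run_if => //; rewrite /s1 /= -/s1.
case: (eqVneq (f a) a) => [fa|fa] /=.
  by apply: run_skip; split => //; [lia | left; split => //= c u; rewrite fa eqxx].
have [k2 us lw] := list_ok (f a); have [b1 _ _ _ _] := bs1.
have f1 : env s1 found = 0 by [].
apply: run_mono (run_for
  (P := fun e => exists c u : 'I_n, [/\ e = c.+1, c != a, f c != c, h (f c) u & free_to u])
  (R := fun s' => exists c u : 'I_n, [/\ env s' 35 = c.+1, env s' 36 = (f c).+1,
       env s' 37 = u.+1, h (f a) c & [/\ c != a, f c != c, h (f c) u & free_to u]])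
  (T := 4 * Z + 4) (isT : 35 < 39) f1 _ k2 _ _ _) _; rewrite ?b1 //.
- move=> s2 kp2; have bs2 : base s2 by apply: base_keeps bs1 kp2.
  by have [a2 _ _] := kp2; apply: keyx; rewrite ?a2 //= (negPf fa).
- move=> s2 e /(hw_node wf)[c -> hc] kp2 ec f2.
  have [a2 _ _] := kp2.
  apply: run_mono (bodyc (a := a) (base_keeps _ bs1 kp2) f2 _ ec) _ => //; first by rewrite a2.
  move=> s3 t [le kp3 r]; split => //.
  case: r => [[fe nf]|[fe [u [e36 e37 ca fc [hu fu]]]]]; [left|right]; split => //.
    move=> [c' [u [[/val_inj <-] ca fc hu fu]]].
    by move/negP: (nf u ca fc hu).
  by exists c, u; split => //; have [a3 _ _] := kp3; rewrite a3.
move=> s2 t [le kp2 r]; split.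
- by have := hw_size wf (f a); move: le; nia.
- by apply: keeps_trans kp1 _; apply: keepsW kp2.
case: r => [[fe nf]|[fe [c [u [e35 e36 e37 hc [ca fc hu fu]]]] _]]; [left|right]; split => //.
  by move=> c u _ hc ca fc hu; apply/negP => fu; apply: (nf _ hc); exists c, u.
by exists c, u; split => //; have [a2 _ _] := kp2; rewrite a2 //= (negPf fa).
Qed.

Lemma fix5_run s : base s -> env s found = 0 ->
  run fix5 s (fun s' t => [/\ t <= Z * (Z * (4 * Z + 7) + 7) + 2, keeps 33 s s' &
    (env s' found = 0 /\ forall a c u, h v a -> f a != a -> h (f a) c -> c != a -> f c != c ->
       h (f c) u -> ~~ free_to u) \/
    (env s' found = 1 /\ exists a c u : 'I_n, [/\ env s' 33 = a.+1, env s' 34 = (f a).+1,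
       env s' 35 = c.+1, env s' 36 = (f c).+1 & env s' 37 = u.+1 /\ [/\ h v a, f a != a,
       h (f a) c, c != a & [/\ f c != c, h (f c) u & free_to u]]])]).
Proof.
move=> bs f0; have [k2 us lw] := list_ok v; have [b1 _ _ _ _] := bs.
apply: run_mono (run_for
  (P := fun e => exists a c u : 'I_n, e = a.+1 /\ [/\ f a != a, h (f a) c, c != a, f c != c &
     h (f c) u /\ free_to u])
  (R := fun s' => exists a c u : 'I_n, [/\ env s' 33 = a.+1, env s' 34 = (f a).+1,
       env s' 35 = c.+1, env s' 36 = (f c).+1 & env s' 37 = u.+1 /\ [/\ h v a, f a != a,
       h (f a) c, c != a & [/\ f c != c, h (f c) u & free_to u]]])
  (T := Z * (4 * Z + 7) + 4) (isT : 33 < 39) f0 _ k2 _ _ _) _; rewrite ?b1 //.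
- by move=> s1 kp; apply: key28; apply: base_keeps bs kp.
- move=> s1 e /(hw_node wf)[a -> hva] kp ea f1.
  apply: run_mono (body5 (base_keeps _ bs kp) f1 ea) _ => // s2 t [le kp2 r].
  split => //.
  case: r => [[fe nf]|[fe [c [u [fa e34 e35 e36 [e37 [hc ca fc hu fu]]]]]]]; [left|right]; split => //.
    move=> [a' [c [u [[/val_inj <-] [fa hc ca fc [hu fu]]]]]].
    by move/negP: (nf c u fa hc ca fc hu).
  by exists a, c, u; split => //; have [a2 _ _] := kp2; rewrite a2.
- move=> s2 t [le kp r]; split => //.
    by have := hw_size wf v; move: le; nia.
  case: r => [[fe nP]|[fe R2 _]]; [left|by right]; split => // a c u hva fa hc ca fc hu.
  by apply/negP => fu; apply: (nP _ hva); exists a, c, u; split => //; split.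
Qed.

Lemma matchS_run x y (a b : 'I_n) (g : 'I_n -> 'I_n) s : x < 40 -> y < 40 ->
  env s x = a.+1 -> env s y = b.+1 -> a != b -> enc (cel s 0) g ->
  run (matchS x y) s (fun s' t => [/\ t = 2, env s' = env s, lst s' = lst s,
    cel s' 1 = cel s 1 & enc (cel s' 0) (match2 g a b)]).
Proof.
move=> x40 y40 ex ey ab eg; have [W1 W2] := n_lt; have an := ltn_ord a; have bn := ltn_ord b.
apply: run_seq; apply: run_cel; rewrite /= ?ex ?ey ?subn1 //=.
  by do !split => //; lia.
apply: run_cel; rewrite /= ?ex ?ey ?subn1 //=.
  by do !split => //; lia.
split => // i /=; rewrite /upd /match2 (inj_eq val_inj i b) (inj_eq val_inj i a) eg.
case: (eqVneq i b) => [->|ib].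
  by rewrite [b == a]eq_sym (negPf ab) (negPf ab).
by case: (eqVneq i a) => [->|ia]; rewrite // eq_sym (negPf ab).
Qed.

Hypothesis mf : mtch h f.
Hypothesis fv : f v = v.
Let X := [pred x : 'I_n | val x == z].
Hypothesis vz : val v != z.
Hypothesis Xf : forall x, X x -> f x = x.
Hypothesis na : no_aug h f [pred x | X x || (x == v)].

Let card_seq (s : seq 'I_n) (U : {set 'I_n}) : U \subset [set x in s] -> #|U| <= size s.
Proof. by move/subset_leq_card/leq_trans; apply; rewrite cardsE card_size. Qed.

Let free_ends (u : 'I_n) : ~~ X u -> f u == u -> v != u -> free_to u.
Proof. by rewrite /free_to /= => -> -> /=; rewrite eq_sym. Qed.

(** A success at some length restores the absence of augmenting paths by [augment_no_aug], where the
    earlier failures show that the path is shortest. Three failures restore it by [no_aug_from]. *)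
Lemma fixS_run s : base s ->
  run fixS s (fun s' t => [/\ t <= 40 * Z.+1 ^ 3, lst s' = L, cel s' 1 = c0 1 &
    exists f', [/\ enc (cel s' 0) f', mtch h f', forall x, X x -> f' x = x &
      no_aug h f' X]]).
Proof.
move=> bs; have [W1 W2] := n_lt; have [fI _] := mf.
have hs := hw_sym wf; have hi := hw_irr wf; have vn := ltn_ord v.
have Tle : 4 * Z + 2 + (Z * (4 * Z + 7) + 2) + (Z * (Z * (4 * Z + 7) + 7) + 2) + 20 <= 40 * Z.+1 ^ 3.
  rewrite !expnS expn0 muln1; by nia.
move: bs => [b1 b2 b3 b4 b5]; apply: run_seq; apply: run_asg => //=; first by lia.
apply: run_seq; apply: run_asg => //=; first by rewrite /upd /= b4; split => //; lia.
rewrite /upd /= b4; set s1 := setv _ 32 _.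
have bs1 : base s1 by split.
have e32 : env s1 32 = v.+1 by rewrite /= /upd /= addn1.
have f1 : env s1 found = 0 by [].
apply: run_seq; apply: run_mono (fix1_run bs1 f1) _ => s2 t2 [le2 kp2 r2].
have [a2 l2 c2] := kp2; have bs2 : base s2 by apply: base_keeps bs1 kp2.
have e32' : env s2 32 = v.+1 by rewrite a2.
have [B1 B2 _ _ _] := bs2.
case: r2 => [[f2 n1]|[f2 [u [e33 hu fu]]]]; last first.
  apply: run_if => //; rewrite /= f2 /=; have /and3P[fu1 fu2 fu3] := fu.
  have vu : v != u by rewrite eq_sym.
  apply: run_mono (matchS_run (isT : 32 < 40) (isT : 33 < 40) e32' e33 vu _) _; first by rewrite B2.
  move=> s3 t3 [-> _ l3 c3 e3]; split; rewrite ?l3 ?c3 ?B2 //; first by move: le2 Tle; clear; lia.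
  have A1 : aug1 h f v u by rewrite /aug1 fv fu1 hu eqxx vu.
  have [m1 nf d1] := flip1P hs mf A1; have d2 : #|diff f (match2 f v u)| <= 2.
    by apply: (@card_seq [:: v; u]); apply: subset_trans d1 _; apply/subsetP => y; rewrite !inE.
  have fX x : X x -> match2 f v u x = x.
    move=> Xx; rewrite /match2; case: eqVneq => [E|_]; first by move: vz; rewrite -E (eqP (Xx : val x == z)) eqxx.
    by case: eqVneq => [E|_]; [move: fu2; rewrite -E (eqP (Xx : val x == z)) eqxx | apply: Xf].
  exists (match2 f v u); split => //.
  apply: (augment_no_aug hs hi mf m1 fv _ nf na).
  - by move=> x Xx; split; [apply: Xf | apply: fX].
  - by [].
  - by move=> *; apply: leq_trans d2 _.
  - exact: leq_trans d2 _.
have na1 u : ~~ X u -> ~~ aug1 h f v u.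
  by move=> Xu; apply/negP => /and4P[_ fu vu /n1/negP[]]; apply: free_ends.
apply: run_if => //; rewrite /= f2 /=.
apply: run_seq; apply: run_mono (fix3_run bs2 f2) _ => s3 t3 [le3 kp3 r3].
have [a3 l3 c3] := kp3; have bs3 : base s3 by apply: base_keeps bs2 kp3.
have e32'' : env s3 32 = v.+1 by rewrite a3.
have [B1' B2' _ _ _] := bs3.
case: r3 => [[f3 n3]|[f3 [a [u [e33 e34 e35 hva [fa hu fu]]]]]]; last first.
  apply: run_if => //; rewrite /= f3 /=; have /and3P[fu1 fu2 fu3] := fu.
  have va : v != a by apply: contraNneq fa => <-; rewrite fv.
  have au : f a != u by apply: contraNneq fa => E; rewrite -{2}[a]fI E (eqP fu1).
  apply: run_seq.
  apply: run_mono (matchS_run (isT : 32 < 40) (isT : 33 < 40) e32'' e33 va _) _; first by rewrite B2'.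
  move=> s4 t4 [-> E4 l4 c4 e4].
  apply: run_mono (matchS_run (x := 34) (y := 35) (a := f a) (b := u) isT isT _ _ au e4) _; rewrite ?E4 //.
  move=> s5 t5 [-> _ l5 c5 e5]; split; rewrite ?l5 ?l4 ?c5 ?c4 ?B2' //; first by move: le2 le3 Tle; clear; lia.
  have vu : v != u by rewrite eq_sym.
  have A3 : aug3 h f v a u by rewrite /aug3 fv fu1 hu eqxx vu fa hva.
  have [m1 nf d1] := flip3P hs mf A3; have d2 : #|diff f (flip3 f v a u)| <= 4.
    apply: (@card_seq [:: v; a; f a; u]); apply: subset_trans d1 _; apply/subsetP => y.
    by rewrite !inE -!orbA.
  have fX x : X x -> flip3 f v a u x = x.
    move=> Xx; apply/eqP/negPn/negP => ne.
    have : x \in diff f (flip3 f v a u) by rewrite inE (Xf Xx) eq_sym.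
    move/(subsetP d1); rewrite !inE => /orP[/orP[/orP[]|]|] /eqP E.
    - by move: vz; rewrite -E (eqP (Xx : val x == z)) eqxx.
    - by move: fa; rewrite -E (Xf Xx) eqxx.
    - by move: fa; rewrite -{2}[a]fI -E (Xf Xx) eqxx.
    - by move: fu2; rewrite -E (eqP (Xx : val x == z)) eqxx.
  exists (flip3 f v a u); split => //.
  apply: (augment_no_aug hs hi mf m1 fv _ nf na).
  - by move=> x Xx; split; [apply: Xf | apply: fX].
  - by move=> w' Xw A; move/negP: (na1 _ Xw).
  - by [].
  - exact: leq_trans d2 _.
have na3 a u : ~~ X u -> ~~ aug3 h f v a u.
  move=> Xu; apply/negP => /and5P[_ fu vu fa /andP[va au]].
  by move/negP: (n3 a u va fa au); apply; apply: free_ends.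
apply: run_if => //; rewrite /= f3 /=.
apply: run_seq; apply: run_mono (fix5_run bs3 f3) _ => s4 t4 [le4 kp4 r4].
have [a4 l4 c4] := kp4; have bs4 : base s4 by apply: base_keeps bs3 kp4.
have e32t : env s4 32 = v.+1 by rewrite a4.
have [B1t B2t _ _ _] := bs4.
case: r4 => [[f4 n5]|[f4 [a [c [u [e33 e34 e35 e36 [e37 [hva fa hc ca [fc hu fu]]]]]]]]]; last first.
  apply: run_if => //; rewrite /= f4 /=; have /and3P[fu1 fu2 fu3] := fu.
  have va : v != a by apply: contraNneq fa => <-; rewrite fv.
  have ac : f a != c by apply: contraTneq hc => ->; rewrite /h hi.
  have cu : f c != u by apply: contraNneq fc => E; rewrite -{2}[c]fI E (eqP fu1).
  apply: run_seq.
  apply: run_mono (matchS_run (isT : 32 < 40) (isT : 33 < 40) e32t e33 va _) _; first by rewrite B2t.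
  move=> s5 t5 [-> E5 l5 c5 e5]; apply: run_seq.
  apply: run_mono (matchS_run (x := 34) (y := 35) (a := f a) (b := c) isT isT _ _ ac e5) _; rewrite ?E5 //.
  move=> s6 t6 [-> E6 l6 c6 e6].
  apply: run_mono (matchS_run (x := 36) (y := 37) (a := f c) (b := u) isT isT _ _ cu e6) _; rewrite ?E6 ?E5 //.
  move=> s7 t7 [-> _ l7 c7 e7]; split; rewrite ?l7 ?l6 ?l5 ?c7 ?c6 ?c5 ?B2t //; first by move: le2 le3 le4 Tle; clear; lia.
  have vu : v != u by rewrite eq_sym.
  have A5 : aug5 h f v a c u by rewrite /aug5 fv fu1 hu eqxx vu fa fc ca hva hc.
  have [m1 nf d1] := flip5P hs hi mf A5; have d2 : #|diff f (flip5 f v a c u)| <= 6.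
    apply: (@card_seq [:: v; a; f a; c; f c; u]); apply: subset_trans d1 _; apply/subsetP => y.
    by rewrite !inE -!orbA.
  have fX x : X x -> flip5 f v a c u x = x.
    move=> Xx; apply/eqP/negPn/negP => ne.
    have : x \in diff f (flip5 f v a c u) by rewrite inE (Xf Xx) eq_sym.
    move/(subsetP d1); rewrite !inE => /orP[/orP[/orP[/orP[/orP[]|]|]|]|] /eqP E.
    - by move: vz; rewrite -E (eqP (Xx : val x == z)) eqxx.
    - by move: fa; rewrite -E (Xf Xx) eqxx.
    - by move: fa; rewrite -{2}[a]fI -E (Xf Xx) eqxx.
    - by move: fc; rewrite -E (Xf Xx) eqxx.
    - by move: fc; rewrite -{2}[c]fI -E (Xf Xx) eqxx.
    - by move: fu2; rewrite -E (eqP (Xx : val x == z)) eqxx.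
  exists (flip5 f v a c u); split => //.
  apply: (augment_no_aug hs hi mf m1 fv _ nf na).
  - by move=> x Xx; split; [apply: Xf | apply: fX].
  - by move=> w' Xw A; move/negP: (na1 _ Xw).
  - by move=> a' w' Xw A; move/negP: (na3 a' _ Xw).
  - by [].
apply: run_if => //; rewrite /= f4 /=; apply: run_skip.
split => //; rewrite ?B2t //; first by move: le2 le3 le4 Tle; clear; lia.
exists f; split; rewrite ?B2t //.
apply: (no_aug_from hs mf na na1 na3) => a c u Xu.
apply/negP => /and5P[_ fu vu fa /and5P[fc ca va ac cu]].
by move/negP: (n5 a c u va fa ac ca fc cu); apply; apply: free_ends.
Qed.
End Fix.
End Hoare.

(** * Updating the sparsifier *)

(** Every changed edge is at the vertex in register 21, so it suffices to free this vertex and its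
    mate. The former mate is searched from first, with the vertex barred as an end; then the vertex
    itself without restriction. *)
Definition rematchS :=
  HAsg 23 (Mate (EV 21)) ;;
  HIf (EV 23) (HCel 0 (EV 21) (EC 0) ;; HCel 0 (epre (EV 23)) (EC 0) ;;
               HAsg 28 (epre (EV 23)) ;; HAsg 29 (EV 21) ;; fixS) HSkip ;;
  HAsg 28 (EV 21) ;; HAsg 29 (EV 0) ;; fixS.
Definition addHS :=
  HIns (hk (EV 21)) (esuc (EV 22)) ;; HIns (hk (EV 22)) (esuc (EV 21)) ;; rematchS.
Definition remHS :=
  HDel (hk (EV 21)) (esuc (EV 22)) ;; HDel (hk (EV 22)) (esuc (EV 21)) ;; rematchS.

Section Graph.
Variables (n w : nat).
Hypothesis hw : 2 * n + 4 * ((2 * n).+1 * (n * n).+1) < 2 ^ w.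
Notation run := (run n w).
Notation hT := (@hT n).
Notation enc := (@enc n).
Notation hwf := (@hwf n).

Lemma no_aug_ext (T : finType) (h : rel T) f (X Y : pred T) :
  X =1 Y -> no_aug h f X -> no_aug h f Y.
Proof. by move=> E na u v; rewrite -!E; apply: na. Qed.

(* Unmatching p confines the short augmenting paths to p and its former mate,
   whatever happened to the edges at p. *)
Lemma unmatch_no_aug (T : finType) (h0 h : rel T) f p : 
  (forall x y, x != p -> y != p -> h0 x y = h x y) -> mtch h0 f -> no_aug h0 f xpred0 ->
  mtch h (rmv f p) /\ no_aug h (rmv f p) [pred x | (x == p) || (x == f p)].
Proof.
move=> E [fI fh] na.
have rE x : x != p -> x != f p -> rmv f p x = f x.
  by move=> xp xr; rewrite /rmv (negPf xp) (negPf xr).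
have mv x : rmv f p x != x -> [/\ x != p, x != f p, rmv f p x = f x, f x != p & f x != f p].
  rewrite /rmv; case: ifP => [_|/norP[xp xr] _]; first by rewrite eqxx.
  split => //; first by apply: contra_neq xr => <-; rewrite fI.
  by rewrite (inj_eq (inv_inj fI)).
split; first split.
- move=> x; rewrite /rmv; case E1 : ((x == p) || (x == f p)); first by rewrite E1.
  move/norP: (negbT E1) => [xp xr].
  have [fp fr] : f x != p /\ f x != f p.
    split; first by apply: contra_neq xr => <-; rewrite fI.
    by rewrite (inj_eq (inv_inj fI)).
  by rewrite (negPf fp) (negPf fr) fI.
- move=> x /[dup] ne /mv[xp xr e1 fp fr]; rewrite e1 -E //; apply: fh.
  by rewrite -e1.
move=> u v /norP[up ur] /norP[vp vr]; have [n1 n3 n5] := na u v isT isT.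
split.
- apply: contra n1; rewrite /aug1 !rE // => /and4P[-> -> -> /=].
  by rewrite E.
- move=> a; apply: contra (n3 a); rewrite /aug3 !(rE u) // !(rE v) //.
  move=> /and5P[-> -> -> /[dup] ra /mv[ap ar e1 fap far] /andP[h1 h2]].
  by rewrite -e1 ra e1 /= !E // h1 -e1 h2.
- move=> a c; apply: contra (n5 a c); rewrite /aug5 !(rE u) // !(rE v) //.
  move=> /and5P[-> -> -> /[dup] ra /mv[ap ar e1 fap far]].
  move=> /and5P[/[dup] rc /mv[cp cr e2 fcp fcr] -> h1 h2 h3].
  by rewrite -e1 -e2 ra rc e1 e2 /= !E // h1 -e1 -e2 h2 h3.
Qed.

Lemma rematch_run s Z (p : 'I_n) (h0 : rel 'I_n) f0 : hwf (lst s) Z ->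
  env s 0 = n -> env s 21 = p ->
  (forall x y, x != p -> y != p -> h0 x y = hT (lst s) x y) ->
  enc (cel s 0) f0 -> mtch h0 f0 -> no_aug h0 f0 xpred0 ->
  run rematchS s (fun s' t => [/\ t <= 90 * Z.+1 ^ 3, lst s' = lst s, cel s' 1 = cel s 1,
    agree 23 s s' & exists f', [/\ enc (cel s' 0) f', mtch (hT (lst s)) f' &
      no_aug (hT (lst s)) f' xpred0]]).
Proof.
move=> wf e0 e21 E ef mf na; have [W1 _ W8] := W_facts hw; have pn := ltn_ord p.
suff: run rematchS s (fun s' t => [/\ t <= 90 * Z.+1 ^ 3, lst s' = lst s, cel s' 1 = cel s 1
   & exists f', [/\ enc (cel s' 0) f', mtch (hT (lst s)) f' & no_aug (hT (lst s)) f' xpred0]]).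
  move/(run_frame (isT : lowmod 23 rematchS))/run_mono; apply.
  by move=> s' t [[a b c d] ag].
have P0 : 0 < Z.+1 ^ 3 by rewrite expn_gt0.
have [m1 na1] := unmatch_no_aug E mf na; have [fI _] := mf.
set h := hT (lst s) in wf E m1 na1 *; set g := rmv f0 p in m1 na1 *.
have gp : g p = p by rewrite /g /rmv eqxx.
have second s1 f1 : lst s1 = lst s -> cel s1 1 = cel s 1 -> agree 23 s s1 ->
    enc (cel s1 0) f1 -> mtch h f1 -> f1 p = p -> no_aug h f1 [pred x | x == p] ->
    run (HAsg 28 (EV 21) ;; HAsg 29 (EV 0) ;; fixS) s1 (fun s' t =>
      [/\ t <= 40 * Z.+1 ^ 3 + 2, lst s' = lst s, cel s' 1 = cel s 1 &
       exists f', [/\ enc (cel s' 0) f', mtch h f' & no_aug h f' xpred0]]).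
  move=> l1 c1 ag ef1 mf1 f1p na2.
  apply: run_seq; apply: run_asg => //; apply: run_seq; apply: run_asg => //.
  rewrite /= /upd /= !ag // e21 e0; set s2 := setv _ 29 _.
  have wf2 : hwf (lst s) Z by [].
  apply: run_mono (@fixS_run n w hw (lst s) Z (cel s1) f1 p n wf ef1 mf1 f1p _ _ _ s2 _) _.
  - by rewrite ltn_eqF.
  - by move=> x /= /eqP; have := ltn_ord x; lia.
  - by apply: no_aug_ext na2 => x /=; rewrite (ltn_eqF (ltn_ord x)).
  - by split; rewrite /s2 /= /upd /= ?ag ?l1 ?e0.
  move=> s3 t3 [le3 l3 c3 [f' [ef' mf' _ na']]]; split => //; first by lia.
    by rewrite c3.
  by exists f'; split => //; apply: no_aug_ext na' => x /=; rewrite (ltn_eqF (ltn_ord x)).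
apply: run_seq; apply: run_asg => /=; first by rewrite e21; split.
rewrite e21 ef; set s1 := setv s 23 _; apply: run_seq; apply: run_if => //; rewrite /= /upd /=.
case: (eqVneq (f0 p) p) => [fp|fp] /=.
  apply: run_skip; apply: run_mono (second s1 f0 _ _ _ _ _ _ _) _ => //.
  - by move=> x x23; rewrite /s1 /= /upd ltn_eqF.
  - case: m1 => gI gh; have ge : g =1 f0.
      by move=> x; rewrite /g /rmv fp; case: ifP => // /orP[]/eqP->.
    exact: mtch_eq ge (conj gI gh).
  - move: na1; rewrite fp => na1 u v Xu Xv; have := na1 u v; rewrite /= !orbb => /(_ Xu Xv).
    have ge x : g x = f0 x by rewrite /g /rmv fp; case: ifP => // /orP[]/eqP->.
    by move=> [n1 n3 n5]; split; [move: n1 | move=> a; move: (n3 a) | move=> a c; move: (n5 a c)];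
      rewrite /aug1 /aug3 /aug5 ?ge.
  by move=> s2 t2 [le2 a b c]; split => //; lia.
set r := f0 p in fp na1 s1 second *; have rn := ltn_ord r.
have e23 : env s1 23 = r.+1 by rewrite /s1 /= /upd /= (negPf fp).
have e21' : env s1 21 = p by [].
have [l1 c1 e0'] : [/\ lst s1 = lst s, cel s1 = cel s & env s1 0 = n] by [].
have ag1 : agree 23 s s1 by move=> x x23; rewrite /s1 /= /upd ltn_eqF.
have W0 : 0 < 2 ^ w by lia.
clearbody s1.
apply: run_seq; apply: run_cel; [by []|exact: W0|by []|by rewrite /= e21'|].
rewrite /= e21'; apply: run_seq; apply: run_cel; [|exact: W0|by []|by rewrite /= e23 subn1|].
  by rewrite /= e23; split => //; lia.
rewrite /= e23 subn1 /=; set s2 := setc _ 0 _ _.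
apply: run_seq; apply: run_asg; first by rewrite /= e23; do !split => //; lia.
rewrite /= e23 subn1 /=.
apply: run_seq; apply: run_asg => //; rewrite /= /upd /= e21'; set s3 := setv _ 29 _.
have eg : enc (cel s2 0) g.
  move=> x; rewrite /s2 /= /upd c1 (inj_eq val_inj x r) (inj_eq val_inj x p) ef /g /rmv -/r.
  case: (eqVneq x r) => [->|xr]; first by rewrite orbT eqxx.
  by case: (eqVneq x p) => [->|xp] /=; rewrite ?eqxx.
have gr : g r = r by rewrite /g /rmv -/r eqxx orbT.
have /(run_frame (isT : lowmod 30 fixS)) : run fixS s3 (fun s' t => [/\ t <= 40 * Z.+1 ^ 3,
    lst s' = lst s, cel s' 1 = cel s2 1 & exists f', [/\ enc (cel s' 0) f', mtch h f',
      forall x : 'I_n, val x == p -> f' x = x & no_aug h f' [pred x : 'I_n | val x == p]]]).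
  apply: (@fixS_run n w hw (lst s) Z (cel s2) g r p wf eg m1 gr).
  - by rewrite (inj_eq val_inj).
  - by move=> x /= /eqP/val_inj ->.
  - by apply: no_aug_ext na1 => x /=; rewrite (inj_eq val_inj).
  - by split; rewrite /s3 /= /upd /= ?e0'.
move/run_mono; apply => s4 t4 [[le4 l4 c4 [f1 [ef1 mf1 X1 na4]]] ag4].
have ag : agree 23 s s4.
  move=> x x23; rewrite ag4; last by lia.
  by rewrite /s3 /= /upd ![x == _]ltn_eqF ?ag1 //; lia.
apply: run_mono (second s4 f1 l4 _ ag ef1 mf1 _ _) _.
- by rewrite c4 /s2 /= c1.
- by apply: X1; rewrite eqxx.
- by apply: no_aug_ext na4 => x /=; rewrite (inj_eq val_inj).
- by move=> s5 t5 [le5 l5 c5 ex]; split => //; lia.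
Qed.

Definition addL (L : nat -> seq nat) (p q : nat) : nat -> seq nat := fun k =>
  if k == n + q then rcons (L k) p.+1 else if k == n + p then rcons (L k) q.+1 else L k.
Definition remL (L : nat -> seq nat) (p q : nat) : nat -> seq nat := fun k =>
  if k == n + q then rem p.+1 (L k) else if k == n + p then rem q.+1 (L k) else L k.

Definition minv (L : nat -> seq nat) (c : nat -> nat) :=
  exists f, [/\ enc c f, mtch (hT L) f & no_aug (hT L) f xpred0].

Lemma hT_ext L L' : L =1 L' -> hT L =2 hT L'.
Proof. by move=> E x y; rewrite /hT E. Qed.

Lemma hwf_ext L L' Z : L =1 L' -> hwf L Z -> hwf L' Z.
Proof.
move=> E [a b c d e]; constructor.
- by move=> x; rewrite -E.
- by move=> x y; rewrite -E => /b[z -> hz]; exists z; rewrite // /hT -E.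
- by move=> x; rewrite -E.
- by move=> x y; rewrite -!(hT_ext E).
- by move=> x; rewrite -(hT_ext E).
Qed.

Lemma hT_addL L (p q x y : 'I_n) : p != q ->
  hT (addL L p q) x y = [|| hT L x y, (x == p) && (y == q) | (x == q) && (y == p)].
Proof.
move=> pq; rewrite /hT /addL !eqn_add2l !(inj_eq val_inj).
case: (eqVneq x q) => [->|xq]; rewrite ?[q == p]eq_sym ?(negPf pq) /=.
  by rewrite mem_rcons inE eqSS (inj_eq val_inj) orbC.
by case: (eqVneq x p) => [->|xp]; rewrite ?mem_rcons ?inE ?eqSS ?(inj_eq val_inj) ?orbF // orbC.
Qed.

Lemma hT_remL L (p q x y : 'I_n) : uniq (L (n + p)) -> uniq (L (n + q)) -> p != q ->
  hT (remL L p q) x y = [&& hT L x y, ~~ ((x == p) && (y == q)) & ~~ ((x == q) && (y == p))].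
Proof.
move=> up uq pq; rewrite /hT /remL !eqn_add2l !(inj_eq val_inj).
case: (eqVneq x q) => [->|xq]; rewrite ?[q == p]eq_sym ?(negPf pq) /=.
  by rewrite mem_rem_uniq // inE eqSS (inj_eq val_inj) andbC.
case: (eqVneq x p) => [->|xp]; rewrite ?andbT //.
by rewrite mem_rem_uniq // inE eqSS (inj_eq val_inj) andbC.
Qed.

Lemma rematch_minv s Z (p : 'I_n) L : hwf (lst s) Z -> env s 0 = n -> env s 21 = p ->
  (forall x y, x != p -> y != p -> hT L x y = hT (lst s) x y) -> minv L (cel s 0) ->
  run rematchS s (fun s' t => [/\ t <= 90 * Z.+1 ^ 3, lst s' = lst s, cel s' 1 = cel s 1,
    agree 23 s s' & minv (lst s) (cel s' 0)]).
Proof.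
move=> wf e0 e21 E [f [ef mf na]].
apply: run_mono (rematch_run wf e0 e21 E ef mf na) _ => s' t [a b c d [f' f'P]].
by split => //; exists f'.
Qed.

Lemma addH_run s Z (p q : 'I_n) : hwf (addL (lst s) p q) Z -> env s 0 = n ->
  env s 21 = p -> env s 22 = q -> p != q -> ~~ hT (lst s) p q -> ~~ hT (lst s) q p ->
  minv (lst s) (cel s 0) ->
  run addHS s (fun s' t => [/\ t <= 100 * Z.+1 ^ 3, lst s' =1 addL (lst s) p q,
    cel s' 1 = cel s 1, agree 23 s s' & minv (lst s') (cel s' 0)]).
Proof.
move=> wf e0 e21 e22 pq hpq hqp mv; have [W1 W2 W8] := W_facts hw.
have pn := ltn_ord p; have qn := ltn_ord q.
have nn : n <= n * n by rewrite leq_pmulr //; lia.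
have P0 : 0 < Z.+1 ^ 3 by rewrite expn_gt0.
apply: run_seq; apply: run_ins; rewrite /= ?e0 ?e21 ?e22 ?addn1 //=; try by [do ?split; lia | lia].
apply: run_seq; apply: run_ins; rewrite /= ?e0 ?e21 ?e22 ?addn1 //=; try by [do ?split; lia | lia].
  by rewrite eqn_add2l (inj_eq val_inj) eq_sym (negPf pq).
set s2 := setl _ _ _.
have l2 : lst s2 =1 addL (lst s) p q.
  move=> k; rewrite /s2 /= /addL eqn_add2l (inj_eq val_inj) [q == p]eq_sym (negPf pq).
  by case: (eqVneq k (n + q)) => [->|_] //; case: (eqVneq k (n + p)) => [->|_].
have wf2 : hwf (lst s2) Z by apply: hwf_ext wf => k; rewrite l2.
apply: run_mono (rematch_minv (s := s2) (L := lst s) wf2 e0 e21 _ mv) _.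
  move=> x y xp yp; by rewrite (hT_ext l2) hT_addL // (negPf xp) (negPf yp) /= andbF !orbF.
move=> s3 t3 [le3 l3 c3 a3 m3]; split => //; first by lia.
  by move=> k; rewrite l3.
by rewrite l3.
Qed.

Lemma remH_run s Z (p q : 'I_n) : hwf (remL (lst s) p q) Z -> env s 0 = n ->
  env s 21 = p -> env s 22 = q -> p != q -> hT (lst s) p q -> hT (lst s) q p ->
  uniq (lst s (n + p)) -> uniq (lst s (n + q)) ->
  minv (lst s) (cel s 0) ->
  run remHS s (fun s' t => [/\ t <= 100 * Z.+1 ^ 3, lst s' =1 remL (lst s) p q,
    cel s' 1 = cel s 1, agree 23 s s' & minv (lst s') (cel s' 0)]).
Proof.
move=> wf e0 e21 e22 pq hpq hqp up uq mv; have [W1 W2 W8] := W_facts hw.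
have pn := ltn_ord p; have qn := ltn_ord q.
have P0 : 0 < Z.+1 ^ 3 by rewrite expn_gt0.
apply: run_seq; apply: run_del; rewrite /= ?e0 ?e21 ?e22 ?addn1 //=; try by [do ?split; lia | lia].
apply: run_seq; apply: run_del; rewrite /= ?e0 ?e21 ?e22 ?addn1 //=; try by [do ?split; lia | lia].
  by rewrite eqn_add2l (inj_eq val_inj) eq_sym (negPf pq).
set s2 := setl _ _ _.
have l2 : lst s2 =1 remL (lst s) p q.
  move=> k; rewrite /s2 /= /remL eqn_add2l (inj_eq val_inj) [q == p]eq_sym (negPf pq).
  by case: (eqVneq k (n + q)) => [->|_] //; case: (eqVneq k (n + p)) => [->|_].
have wf2 : hwf (lst s2) Z by apply: hwf_ext wf => k; rewrite l2.
apply: run_mono (rematch_minv (s := s2) (L := lst s) wf2 e0 e21 _ mv) _.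
  move=> x y xp yp; by rewrite (hT_ext l2) hT_remL // (negPf xp) (negPf yp) /= andbF !andbT.
move=> s3 t3 [le3 l3 c3 a3 m3]; split => //; first by lia.
  by move=> k; rewrite l3.
by rewrite l3.
Qed.
End Graph.

(** * Invariants of the sparsifier *)

(** A rotation of the list raises this by one for every entry that it does not move to the end. Up
    to deletions it counts the inspections since the entry was last inspected. *)
Definition behind (s : seq nat) e := size s - (index e s).+1.

Lemma behind_cons x s e : behind (x :: s) e = if x == e then size s else behind s e.
Proof. by rewrite /behind /=; case: eqP => _; rewrite ?subSS ?subn0. Qed.

Lemma behind_le s e : behind s e <= size s. Proof. exact: leq_subr. Qed.

Lemma behind_rcons s e z : e \in s -> behind (rcons s z) e = (behind s e).+1.
Proof.
move=> es; rewrite /behind -cats1 index_cat es size_cat /= addn1.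
by move: es; rewrite -index_mem; move: (index e s) (size s) => i k; lia.
Qed.

Lemma behind_rem s e z : e \in s -> e != z -> behind s e <= (behind (rem z s) e).+1.
Proof.
elim: s => // x s IH; rewrite inE behind_cons /= eq_sym => es ez.
have [xz|xz] := eqVneq x z.
  by move: es; rewrite xz [z == e]eq_sym (negPf ez) /= => _; apply: ltnW.
rewrite behind_cons; have [xe|xe] := eqVneq x e.
  have [zs|zs] := boolP (z \in s); first by rewrite size_rem // leqSpred.
  by rewrite rem_id.
by move: es; rewrite (negPf xe) /= => es; apply: IH.
Qed.

Definition rotL (L : nat -> seq nat) k := fun j => if j == k then rot 1 (L k) else L j.

Lemma rotL_perm L k j : perm_eq (rotL L k j) (L j).
Proof. by rewrite /rotL; case: eqP => [->|_] //; rewrite perm_rot. Qed.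

Lemma behind_rot s z e : uniq (z :: s) -> e \in z :: s -> e != z ->
  behind (rot 1 (z :: s)) e = (behind (z :: s) e).+1.
Proof.
move=> /= /andP[zs us]; rewrite inE => es ez; move: es; rewrite (negPf ez) /= => es.
by rewrite rot1_cons behind_rcons // behind_cons eq_sym (negPf ez).
Qed.

(** The lower threshold, about [(1 - 1 / Q) * b]. The gap between it and [b] keeps the correction
    chains short. *)
Definition lowf Q b := b - b %/ Q.

Lemma lowf_mono Q b b' : b <= b' -> lowf Q b <= lowf Q b'.
Proof.
move=> le; rewrite /lowf; have [Q0|Q0] := posnP Q; first by rewrite Q0 !divn0; lia.
suff H k : lowf Q b <= lowf Q (b + k) by rewrite -(subnKC le); apply: H.
elim: k => [|k IH]; first by rewrite addn0.
apply: leq_trans IH _; rewrite /lowf addnS.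
have : (b + k).+1 %/ Q <= ((b + k) %/ Q).+1.
  rewrite -addn1; apply: leq_trans (leq_div2r Q (_ : _ <= b + k + Q)) _; first by lia.
  by rewrite divnDr // divnn Q0 addn1.
by have := leq_div (b + k) Q; lia.
Qed.

(** A bound on the potential for one threshold implies it for every smaller one. Thresholds may thus
    be lowered at will, and the threshold 0 demands nothing. *)
Lemma pot_mono Q v v' d : v <= v' -> v ^ 3 * (lowf Q v - d) <= v' ^ 3 * (lowf Q v' - d).
Proof. by move=> le; rewrite leq_mul ?leq_exp2r // leq_sub2r // lowf_mono. Qed.

Section Inv.
Variables (n Q : nat).
Notation hT := (@hT n).
Notation hwf := (@hwf n).
Notation addL := (addL n).
Notation remL := (remL n).
Notation minv := (@minv n).
Implicit Types (L : nat -> seq nat) (x y p q : 'I_n).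

Definition arc L : rel 'I_n := fun x y => y.+1 \in L x.
Definition arcn x y := (x * n + y).+1.
Lemma arc_mem L x y : arc L x y = (y.+1 \in L x). Proof. by []. Qed.

(** Lists 0 to [n - 1] are the queues of neighbours in G, lists [n] to [2 * n - 1] hold the
    neighbours in H, and list [2 * n] is the global queue, in which each edge of G occurs in both
    directions. *)
Record str L : Prop := Str {
  st_u : forall k, k <= 2 * n -> uniq (0 :: L k);
  st_node : forall x e, e \in L x -> exists y : 'I_n, e = y.+1;
  st_hnode : forall x e, e \in L (n + x) -> exists y : 'I_n, e = y.+1;
  st_sym : symmetric (arc L);
  st_irr : irreflexive (arc L);
  st_sub : forall x y, hT L x y -> arc L x y;
  st_hsym : symmetric (hT L);
  st_arc : forall x y, (arcn x y \in L (2 * n)) = arc L x y;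
  st_arcn : forall e, e \in L (2 * n) -> exists x y, e = arcn x y }.

Lemma str_perm L L' : (forall k, k <= 2 * n -> perm_eq (L' k) (L k)) -> str L -> str L'.
Proof.
move=> E S; have gx x : x <= 2 * n by have := ltn_ord x; lia.
have hx x : n + x <= 2 * n by have := ltn_ord x; lia.
have EA x y : arc L' x y = arc L x y by rewrite /arc (perm_mem (E _ (gx x))).
have EH x y : hT L' x y = hT L x y by rewrite /hT (perm_mem (E _ (hx x))).
constructor.
- by move=> k k2; rewrite /= (perm_mem (E _ k2)) (perm_uniq (E _ k2)); apply: (st_u S).
- by move=> x e; rewrite (perm_mem (E _ (gx x))); apply: (st_node S).
- by move=> x e; rewrite (perm_mem (E _ (hx x))); apply: (st_hnode S).
- by move=> x y; rewrite !EA (st_sym S).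
- by move=> x; rewrite EA (st_irr S).
- by move=> x y; rewrite EA EH; apply: (st_sub S).
- by move=> x y; rewrite !EH (st_hsym S).
- by move=> x y; rewrite (perm_mem (E _ (leqnn _))) EA (st_arc S).
- by move=> e; rewrite (perm_mem (E _ (leqnn _))); apply: (st_arcn S).
Qed.

Lemma str_hwf L Z : str L -> (forall x, size (L (n + x)) <= Z) -> hwf L Z.
Proof.
move=> S sz; constructor => //.
- move=> x; have hx : n + x <= 2 * n by have := ltn_ord x; lia.
  by case/andP: (st_u S hx).
- by move=> x e xe; have [y E] := st_hnode S xe; exists y => //; rewrite /hT -E.
- exact: (st_hsym S).
- by move=> x; apply/negP => /(st_sub S); rewrite (st_irr S).
Qed.

Lemma key_low L p q x : addL L p q x = L x /\ remL L p q x = L x.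
Proof. by rewrite /addL /remL !ltn_eqF //; have := ltn_ord x; lia. Qed.

Lemma key_top L p q : addL L p q (2 * n) = L (2 * n) /\ remL L p q (2 * n) = L (2 * n).
Proof. by rewrite /addL /remL !gtn_eqF //; have := ltn_ord p; have := ltn_ord q; lia. Qed.

Lemma arc_addL L p q : arc (addL L p q) =2 arc L.
Proof. by move=> x y; rewrite /arc (key_low L p q x).1. Qed.
Lemma arc_remL L p q : arc (remL L p q) =2 arc L.
Proof. by move=> x y; rewrite /arc (key_low L p q x).2. Qed.

Lemma str_uniq L x : str L -> uniq (L (n + x)) /\ uniq (L x).
Proof.
move=> S; have xn := ltn_ord x.
have hx : n + x <= 2 * n by lia.
have gx : x <= 2 * n by lia.
by split; [case/andP: (st_u S hx) | case/andP: (st_u S gx)].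
Qed.

Lemma str_addL L p q : str L -> arc L p q -> ~~ hT L p q -> str (addL L p q).
Proof.
move=> S apq hpq; have pq : p != q by apply: contraTneq apq => ->; rewrite (st_irr S).
have hqp : ~~ hT L q p by rewrite (st_hsym S).
constructor.
- move=> k k2; have := st_u S k2; rewrite /addL.
  case: eqP => [->|_].
    by rewrite /= mem_rcons inE rcons_uniq => /andP[/negPf-> ->]; rewrite hqp.
  case: eqP => [->|_] //.
  by rewrite /= mem_rcons inE rcons_uniq => /andP[/negPf-> ->]; rewrite hpq.
- by move=> x e; rewrite (key_low L p q x).1; apply: (st_node S).
- move=> x e; rewrite /addL; case: eqP => _; last case: eqP => _; last exact: (st_hnode S).
    by rewrite mem_rcons inE => /predU1P[->|/(st_hnode S)] //; exists p.
  by rewrite mem_rcons inE => /predU1P[->|/(st_hnode S)] //; exists q.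
- by move=> x y; rewrite !arc_addL (st_sym S).
- by move=> x; rewrite arc_addL (st_irr S).
- move=> x y; rewrite arc_addL hT_addL // => /or3P[/(st_sub S)//|/andP[/eqP-> /eqP->]//|].
  by move=> /andP[/eqP-> /eqP->]; rewrite (st_sym S).
- move=> x y; rewrite !hT_addL // (st_hsym S); congr (_ || _).
  by case: (x == p); case: (x == q); case: (y == p); case: (y == q).
- by move=> x y; rewrite (key_top L p q).1 arc_addL (st_arc S).
- by move=> e; rewrite (key_top L p q).1; apply: (st_arcn S).
Qed.

Lemma str_remL L p q : str L -> p != q -> str (remL L p q).
Proof.
move=> S pq; have [up _] := str_uniq p S; have [uq _] := str_uniq q S.
constructor.
- move=> k k2; have := st_u S k2; rewrite /remL.
  have R e s : uniq (0 :: s) -> uniq (0 :: rem e s).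
    by move=> /= /andP[s0 us]; rewrite rem_uniq // andbT; apply: contra s0; apply: mem_rem.
  by case: eqP => _; [|case: eqP => _ //]; apply: R.
- by move=> x e; rewrite (key_low L p q x).2; apply: (st_node S).
- move=> x e; rewrite /remL; case: eqP => _; last case: eqP => _; last exact: (st_hnode S).
    by move/mem_rem/(st_hnode S).
  by move/mem_rem/(st_hnode S).
- by move=> x y; rewrite !arc_remL (st_sym S).
- by move=> x; rewrite arc_remL (st_irr S).
- by move=> x y; rewrite arc_remL hT_remL // => /andP[/(st_sub S)].
- move=> x y; rewrite !hT_remL // (st_hsym S); congr (_ && _).
  by case: (x == p); case: (x == q); case: (y == p); case: (y == q).
- by move=> x y; rewrite (key_top L p q).2 arc_remL (st_arc S).
- by move=> e; rewrite (key_top L p q).2; apply: (st_arcn S).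
Qed.

Lemma size_addL L p q x : p != q ->
  size (addL L p q (n + x)) = size (L (n + x)) + (x == p) + (x == q).
Proof.
move=> pq; rewrite /addL !eqn_add2l !(inj_eq val_inj).
case: (eqVneq x q) => [->|xq]; first by rewrite size_rcons eq_sym (negPf pq); lia.
by case: (eqVneq x p) => _; rewrite ?size_rcons; lia.
Qed.

Lemma size_remL L p q x : p != q -> hT L p q -> hT L q p ->
  size (remL L p q (n + x)) + (x == p) + (x == q) = size (L (n + x)).
Proof.
move=> pq hpq hqp; rewrite /remL !eqn_add2l !(inj_eq val_inj).
have R (l : seq nat) e : e \in l -> size (rem e l) + 1 = size l.
  by move=> el; rewrite size_rem // addn1 prednK //; case: l el.
have Rq : size (rem p.+1 (L (n + q))) + 1 = size (L (n + q)) := R _ _ hqp.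
have Rp : size (rem q.+1 (L (n + p))) + 1 = size (L (n + p)) := R _ _ hpq.
case: (eqVneq x q) => [->|xq]; first by rewrite [q == p]eq_sym (negPf pq) addn0.
by case: (eqVneq x p) => [->|_]; rewrite ?addn0.
Qed.

(** Either end may find the edge when it scans its own queue, so positions in both queues count.
    [sl] lends a position lost by a deletion until a rotation gives it back. *)
Definition rhs L (sl : 'I_n -> nat) x y :=
  behind (L x) y.+1 + behind (L y) x.+1 + sl x + sl y.

(* The vertex degrees c 1 lag behind the list sizes by the pending increments a
   and decrements b.  An edge of H has degree sum at most u; an edge outside H
   whose degree sum is too low for the threshold wl has to be in the front part
   of the queues that scan for such edges. *)
Record inv L (c : nat -> nat -> nat) (u wl : 'I_n -> 'I_n -> nat)
    (sl a b : 'I_n -> nat) : Prop := Inv {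
  i_str : str L;
  i_m : minv L (c 0);
  i_1 : forall x y, hT L x y -> c 1 x + c 1 y <= u x y;
  i_2 : forall x y, arc L x y -> ~~ hT L x y ->
    wl x y ^ 3 * (lowf Q (wl x y) - (c 1 x + c 1 y)) <= rhs L sl x y;
  i_b : forall x, size (L (n + x)) + b x = c 1 x + a x }.

Lemma inv_weak L c u u' wl wl' sl a b : inv L c u wl sl a b ->
  (forall x y, hT L x y -> u x y <= u' x y \/ c 1 x + c 1 y <= u' x y) ->
  (forall x y, arc L x y ->
    [\/ wl' x y <= wl x y, hT L x y | lowf Q (wl' x y) <= c 1 x + c 1 y]) ->
  inv L c u' wl' sl a b.
Proof.
move=> [S m J1 J2 J3] hu hw; constructor => //.
  by move=> x y h; case: (hu x y h) => //; apply: leq_trans (J1 _ _ h).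
move=> x y A nh; case: (hw x y A) => [le|h|le].
- exact: leq_trans (pot_mono _ _ le) (J2 _ _ A nh).
- by rewrite h in nh.
by move: le; rewrite -subn_eq0 => /eqP ->; rewrite muln0.
Qed.

Lemma inv_bound L c u wl sl a b Ub x : inv L c u wl sl a b ->
  (forall x y, u x y <= Ub) -> 3 <= Ub -> b x <= 3 -> a x <= 2 ->
  c 1 x <= Ub /\ size (L (n + x)) <= Ub + 2.
Proof.
move=> I hu U3 b3 a2; have := i_b I x; case E : (L (n + x)) => [|e s] /= bal.
  by lia.
have [y ey] : exists y : 'I_n, e = y.+1.
  by apply: (st_hnode (i_str I) (x := x)); rewrite E mem_head.
have h : hT L x y by rewrite /hT E ey mem_head.
by have := i_1 I h; have := hu x y; lia.
Qed.

Lemma inv_add L c c' u u' wl wl' sl a b a' b' p q : inv L c u wl sl a b ->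
  arc L p q -> ~~ hT L p q -> c' 1 = c 1 -> minv (addL L p q) (c' 0) ->
  c 1 p + c 1 q <= u' p q -> c 1 p + c 1 q <= u' q p ->
  (forall x y, hT L x y -> u x y <= u' x y) ->
  (forall x y, ~~ ((x == p) && (y == q)) -> ~~ ((x == q) && (y == p)) -> wl' x y <= wl x y) ->
  (forall x, b' x + a x + (x == p) + (x == q) = b x + a' x) ->
  inv (addL L p q) c' u' wl' sl a' b'.
Proof.
move=> I apq hpq cE m u1 u2 hu hwl hab; have S := i_str I.
have pq : p != q by apply: contraTneq apq => ->; rewrite (st_irr S).
constructor => //; first exact: str_addL.
- rewrite cE => x y; rewrite hT_addL // => /or3P[h|/andP[/eqP-> /eqP->]//|].
    by apply: leq_trans (i_1 I h) (hu _ _ h).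
  by move=> /andP[/eqP-> /eqP->]; rewrite addnC.
- rewrite cE => x y; rewrite arc_addL hT_addL // !negb_or => A /and3P[nh n1 n2].
  rewrite /rhs (key_low L p q x).1 (key_low L p q y).1.
  exact: leq_trans (pot_mono _ _ (hwl _ _ n1 n2)) (i_2 I A nh).
by move=> x; rewrite cE size_addL //; have := i_b I x; have := hab x; lia.
Qed.

(** The removed edge becomes subject to the lower bound without having any credit in the queues; its
    degree sum is required to be above the threshold already. *)
Lemma inv_rem L c c' u u' wl wl' sl a b a' b' p q : inv L c u wl sl a b ->
  hT L p q -> c' 1 = c 1 -> minv (remL L p q) (c' 0) ->
  lowf Q (wl' p q) <= c 1 p + c 1 q -> lowf Q (wl' q p) <= c 1 p + c 1 q ->
  (forall x y, ~~ ((x == p) && (y == q)) -> ~~ ((x == q) && (y == p)) -> u x y <= u' x y) ->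
  (forall x y, ~~ ((x == p) && (y == q)) -> ~~ ((x == q) && (y == p)) -> wl' x y <= wl x y) ->
  (forall x, b' x + a x = b x + a' x + (x == p) + (x == q)) ->
  inv (remL L p q) c' u' wl' sl a' b'.
Proof.
move=> I hpq cE m u1 u2 hu hwl hab; have S := i_str I.
have pq : p != q by apply: contraTneq (st_sub S hpq) => ->; rewrite (st_irr S).
have [up _] := str_uniq p S; have [uq _] := str_uniq q S.
constructor => //; first exact: str_remL.
- rewrite cE => x y; rewrite hT_remL // => /and3P[h n1 n2].
  by apply: leq_trans (i_1 I h) (hu _ _ n1 n2).
- rewrite cE => x y; rewrite arc_remL hT_remL // => A.
  case: (boolP ((x == p) && (y == q))) => [/andP[/eqP-> /eqP->] _|n1 /=].
    by move: u1; rewrite -subn_eq0 => /eqP ->; rewrite muln0.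
  case: (boolP ((x == q) && (y == p))) => [/andP[/eqP-> /eqP->] _|n2 /=].
    by rewrite addnC; move: u2; rewrite -subn_eq0 => /eqP ->; rewrite muln0.
  rewrite andbT => nh; rewrite /rhs (key_low L p q x).2 (key_low L p q y).2.
  exact: leq_trans (pot_mono _ _ (hwl _ _ n1 n2)) (i_2 I A nh).
have hqp : hT L q p by rewrite (st_hsym S).
move=> x; rewrite cE; move: (size_remL x pq hpq hqp) (i_b I x) (hab x); clear.
lia.
Qed.

Lemma arc_rotL L k x y : arc (rotL L k) x y = arc L x y.
Proof. by rewrite /arc (perm_mem (rotL_perm L k x)). Qed.
Lemma hT_rotL L k x y : hT (rotL L k) x y = hT L x y.
Proof. by rewrite /hT (perm_mem (rotL_perm L k _)). Qed.

Lemma rhs_rot L sl x z s p q : str L -> L x = z.+1 :: s -> arc L p q ->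
  ~~ ((p == x) && (q == z :> nat)) -> ~~ ((q == x) && (p == z :> nat)) ->
  rhs (rotL L x) sl p q = rhs L sl p q + ((p == x) || (q == x)).
Proof.
move=> S E A n1 n2; have [_ ux] := str_uniq x S; rewrite E in ux.
have key (r t : 'I_n) : arc L r t -> ~~ ((r == x) && (t == z :> nat)) ->
    behind (rotL L x r) t.+1 = behind (L r) t.+1 + (r == x).
  rewrite /arc /rotL (inj_eq val_inj); case: eqP => [->|_]; last by rewrite addn0.
  by rewrite E /= => tA tz; rewrite behind_rot ?eqSS // addn1.
rewrite /rhs (key p q) // (key q p) //; last by rewrite (st_sym S).
case: eqP => [E1|_]; case: eqP => [E2|_] /=; try lia.
by rewrite E1 E2 (st_irr S) in A.
Qed.

(** The arc moved to the end loses its credit, so its threshold is 0 until it has been checked. All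
    other arcs at [x] gain a position, which can repay a loan in [sl]. *)
Lemma inv_rot L c u wl wl' sl sl' a b x (z : 'I_n) s : inv L c u wl sl a b -> L x = z.+1 :: s ->
  (forall p q, ~~ ((p == x) && (q == z)) -> ~~ ((q == x) && (p == z)) -> wl' p q <= wl p q) ->
  wl' x z = 0 -> wl' z x = 0 ->
  (forall y, sl y <= sl' y + (y == x)) -> minv (rotL L x) (c 0) ->
  inv (rotL L x) c u wl' sl' a b.
Proof.
move=> I E hwl w1 w2 hsl m; have S := i_str I.
constructor => //.
- by apply: str_perm S => k _; apply: rotL_perm.
- by move=> p q; rewrite hT_rotL; apply: (i_1 I).
- move=> p q; rewrite arc_rotL hT_rotL => A nh.
  case: (boolP ((p == x) && (q == z))) => [/andP[/eqP-> /eqP->]|n1]; first by rewrite w1.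
  case: (boolP ((q == x) && (p == z))) => [/andP[/eqP-> /eqP->]|n2]; first by rewrite w2.
  apply: leq_trans (pot_mono _ _ (hwl _ _ n1 n2)) _; apply: leq_trans (i_2 I A nh) _.
  have := rhs_rot sl' S E A; rewrite !(inj_eq val_inj) => -> //.
  rewrite /rhs; have := hsl p; have := hsl q.
  case: eqP => [E1|_]; case: eqP => [E2|_] /=; try lia.
  by rewrite E1 E2 (st_irr S) in A.
move=> y; have /perm_size -> := rotL_perm L x (n + y); exact: (i_b I).
Qed.

Lemma inv_rot0 L c u wl sl sl' a b x : inv L c u wl sl a b -> L x = [::] ->
  (forall y, y != x -> sl y <= sl' y) -> inv L c u wl sl' a b.
Proof.
move=> [S m J1 J2 J3] E hsl; constructor => // p q A nh.
have [px qx] : p != x /\ q != x.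
  split; first by apply: contraTneq A => ->; rewrite /arc E.
  by apply: contraTneq A => ->; rewrite (st_sym S) /arc E.
apply: leq_trans (J2 _ _ A nh) _; rewrite /rhs; have := hsl _ px; have := hsl _ qx; lia.
Qed.

Lemma minv_perm L L' c : (forall k, perm_eq (L' k) (L k)) -> minv L c -> minv L' c.
Proof.
move=> E; have EH x y : hT L' x y = hT L x y by rewrite /hT (perm_mem (E _)).
move=> [f [ef [fI fh] na]]; exists f; split => //.
  by split => // x /fh; rewrite EH.
move=> u v Xu Xv; have [n1 n3 n5] := na u v Xu Xv.
by split; [move: n1 | move=> x; move: (n3 x) | move=> x y; move: (n5 x y)];
  rewrite /aug1 /aug3 /aug5 !EH.
Qed.
End Inv.

(** * Chains of degree corrections *)

Definition rotS k x :=
  HAsg x (ENxt k (EC 0)) ;; HIf (EV x) (HDel k (EV x) ;; HIns k (EV x)) HSkip.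

(** A pending increment is passed on if possible: an edge that would become too heavy leaves H, and
    its other end inherits a decrement. The counter is raised only if there is no such edge. *)
Definition incS :=
  HAsg 39 (EC 0) ;;
  ForS (hk (EV 16)) 19
    (HAsg 39 (elt (EV 6) (eadd (esuc (Dg (EV 16))) (Dg (epre (EV 19)))))) ;;
  HIf (EV 39)
    (HAsg 21 (EV 16) ;; HAsg 22 (epre (EV 19)) ;; remHS ;; HAsg 16 (EV 22) ;; HAsg 17 (EC 2))
    (HCel 1 (EV 16) (esuc (Dg (EV 16))) ;; HAsg 17 (EC 0)).

Definition scanS :=
  rotS (EV 16) 19 ;;
  HIf (EV 19)
    (HIf (emul (eneg (EFlg (hk (EV 16)) (EV 19)))
               (elt (eadd (Dg (EV 16)) (Dg (epre (EV 19)))) (esuc (EV 7))))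
      (HAsg 39 (EC 1)) (HAsg 18 (epre (EV 18))))
    (HAsg 18 (EC 0)).

(** Dually, a light edge found within [B ^ 3] inspections (the number in register 8) enters H, and
    its other end inherits an increment. If none is found, the inspections pay for lowering the
    counter. *)
Definition decS :=
  HAsg 39 (EC 0) ;; HAsg 18 (EV 8) ;;
  HWhile (emul (EV 18) (eneg (EV 39))) scanS ;;
  HIf (EV 39)
    (HAsg 21 (EV 16) ;; HAsg 22 (epre (EV 19)) ;; addHS ;; HAsg 16 (EV 22) ;; HAsg 17 (EC 1))
    (HCel 1 (EV 16) (epre (Dg (EV 16))) ;; HAsg 17 (EC 0)).

(* Register 17 is the pending change of the degree of the vertex in register
   16: 1 for an increment, 2 for a decrement, 0 for none. *)
Definition chainS := HWhile (EV 17) (HIf (eeq (EV 17) (EC 1)) incS decS).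

Section Chains.
Variables (n w : nat).
Hypothesis hw : 2 * n + 4 * ((2 * n).+1 * (n * n).+1) < 2 ^ w.
Notation run := (run n w).
Notation hT := (@hT n).
Notation hwf := (@hwf n).
Notation arc := (@arc n).
Notation inv := (@inv n).
Notation rhs := (@rhs n).
Implicit Types (L : nat -> seq nat) (x y p q : 'I_n).

Lemma rot_run s k (x : nat) K : x < 40 -> K <= 2 * n -> uniq (0 :: lst s K) ->
  (forall e, e \in lst s K -> e <= n * n) ->
  (forall s1, cel s1 = cel s -> (forall y : nat, y != x -> env s1 y = env s y) ->
     safe n w s1 k /\ eval s1 k = K) ->
  run (rotS k x) s (fun s' t =>
    s' = HSt (upd (env s) x (head 0 (lst s K))) (rotL (lst s) K) (cel s) /\ t <= 5).
Proof.
move=> x40 K2 us le ek; have [W1 W2 W8] := W_facts hw.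
have [sk Ek] := ek s erefl (fun _ _ => erefl).
apply: run_seq; apply: run_asg; first by rewrite /= Ek mem_head; split => //; lia.
rewrite /= Ek nxt0 nth0; set s1 := setv s x _.
have ek1 s2 : cel s2 = cel s -> env s2 = env s1 -> safe n w s2 k /\ eval s2 k = K.
  by move=> c2 e2; apply: ek => // y yx; rewrite e2 /s1 /= /upd (negPf yx).
have ex : env s1 x = head 0 (lst s K) by rewrite /s1 /= /upd eqxx.
have [sk1 Ek1] := ek1 s1 erefl erefl.
apply: run_if => //=; rewrite /= /upd eqxx.
case E : (lst s K) us le ex => [|z l] us le ex /=.
  apply: run_skip; split => //; rewrite /s1 E /setv; congr (HSt _ _ _).
  by apply: functional_extensionality => j; rewrite /rotL; case: eqP => // ->; rewrite E.
have z0 : z != 0 by move: us => /= /andP[]; rewrite inE negb_or eq_sym => /andP[].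
have zl : z \notin l by move: us => /= /and3P[].
have zn : z <= n * n by apply: le; rewrite mem_head.
have ls1 : lst s1 K = z :: l by rewrite /= E.
rewrite (negPf z0); apply: run_seq; apply: run_del; rewrite ?Ek1 //=; rewrite -/s1.
  by move: ex => /= ->; rewrite E mem_head.
have exz : upd (env s) x (head 0 (lst s K)) x = z by rewrite /upd eqxx E.
have [sk2 Ek2] := ek1 (setl s1 K (rem z (lst s K))) erefl erefl.
rewrite exz; apply: run_ins; rewrite ?Ek2 //= ?exz ?eqxx ?E /= ?eqxx //.
  by rewrite lt0n z0.
split => //; rewrite /setl /s1 /setv /= E; congr (HSt _ _ _).
apply: functional_extensionality => j; rewrite /rotL; case: (eqVneq j K) => // _.
by rewrite E rot1_cons.
Qed.

Lemma inv_incD Q L c c' u wl sl a b a' b' x : inv Q L c u wl sl a b -> c' 0 = c 0 ->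
  c' 1 = upd (c 1) x (c 1 x).+1 ->
  (forall y, hT L x y -> (c 1 x).+1 + c 1 y <= u x y /\ (c 1 x).+1 + c 1 y <= u y x) ->
  (forall y, b' y + a y = b y + a' y + (y == x)) -> inv Q L c' u wl sl a' b'.
Proof.
move=> I c0 c1 hh hab; have S := i_str I.
have ge (y : 'I_n) : c 1 y <= c' 1 y by rewrite c1 /upd; case: eqP => // ->.
constructor => //; first by rewrite c0; apply: (i_m I).
- move=> p q h; rewrite c1 /upd !(inj_eq val_inj).
  case: (eqVneq p x) => [E|px]; case: (eqVneq q x) => [E'|qx].
  + by move: (st_sub S h); rewrite E E' (st_irr S).
  + by rewrite E in h *; have [] := hh q h.
  + by rewrite E' (st_hsym S) in h *; rewrite addnC; have [] := hh p h.
  + exact: (i_1 I).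
- move=> p q A nh; apply: leq_trans (i_2 I A nh); rewrite leq_mul2l; apply/orP; right.
  by rewrite leq_sub2l // leq_add.
move=> y; rewrite c1 /upd (inj_eq val_inj); have := i_b I y; have := hab y.
by case: eqP => [->|_]; lia.
Qed.

(** Lowering the degree of [x] raises the potential of an arc at [x] by at most [B ^ 3], the credit
    that a complete scan provides. An arc whose degree sum exceeded [lowf Q B] still has potential 0
    afterwards. *)
Lemma inv_decD Q B L c c' u wl sl a b a' b' x : inv Q L c u wl sl a b -> c' 0 = c 0 ->
  c' 1 = upd (c 1) x (c 1 x).-1 -> 0 < c 1 x -> (forall p q, wl p q <= B) ->
  (forall p q, arc L p q -> ~~ hT L p q -> (p == x) || (q == x) ->
    lowf Q B < c 1 p + c 1 q \/
    wl p q ^ 3 * (lowf Q (wl p q) - (c 1 p + c 1 q)) + B ^ 3 <= rhs L sl p q) ->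
  (forall y, b' y + a y + (y == x) = b y + a' y) -> inv Q L c' u wl sl a' b'.
Proof.
move=> I c0 c1 pos wB hh hab; have S := i_str I.
constructor => //; first by rewrite c0; apply: (i_m I).
- move=> p q h; apply: leq_trans (i_1 I h); rewrite c1 /upd.
  by rewrite leq_add //; case: eqP => // ->; rewrite leq_pred.
- move=> p q A nh; case: (boolP ((p == x) || (q == x))) => [px|]; last first.
    by rewrite negb_or c1 /upd !(inj_eq val_inj) => /andP[/negPf-> /negPf->]; apply: (i_2 I).
  have E : c' 1 p + c' 1 q + 1 = c 1 p + c 1 q.
    rewrite c1 /upd !(inj_eq val_inj); case: (eqVneq p x) px => [E1|_] /=.
      case: eqP => [E'|_ _]; last by rewrite E1; lia.
      by move: A; rewrite E1 E' (st_irr S).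
    by move=> /eqP->; rewrite eqxx; lia.
  case: (hh _ _ A nh px) => [lt|le].
    have /eqP -> : lowf Q (wl p q) - (c' 1 p + c' 1 q) == 0.
      by rewrite subn_eq0; have := lowf_mono Q (wB p q); lia.
    by rewrite muln0.
  apply: leq_trans le; apply: leq_trans (_ : wl p q ^ 3 * (lowf Q (wl p q) - (c 1 p + c 1 q) + 1) <= _).
    by rewrite leq_mul2l; apply/orP; right; lia.
  by rewrite mulnDr muln1 leq_add2l leq_exp2r.
move=> y; rewrite c1 /upd (inj_eq val_inj); have := i_b I y; have := hab y.
by case: eqP => [->|_]; lia.
Qed.

Section Params.
Variables (Q Ub : nat) (u : 'I_n -> 'I_n -> nat) (sl : 'I_n -> nat).
Hypothesis hUb : forall x y, u x y <= Ub.
Hypothesis Ub3 : 3 <= Ub.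

Lemma addH_inv s p q wl wl' u' a b a' b' : inv Q (lst s) (cel s) u wl sl a b ->
  env s 0 = n -> env s 21 = p -> env s 22 = q ->
  (forall x, a x <= 2 /\ b x <= 3) ->
  arc (lst s) p q -> ~~ hT (lst s) p q ->
  cel s 1 p + cel s 1 q <= u' p q -> cel s 1 p + cel s 1 q <= u' q p ->
  (forall x y, hT (lst s) x y -> u x y <= u' x y) ->
  (forall x y, ~~ ((x == p) && (y == q)) -> ~~ ((x == q) && (y == p)) -> wl' x y <= wl x y) ->
  (forall x, b' x + a x + (x == p) + (x == q) = b x + a' x) ->
  run addHS s (fun s' t => [/\ t <= 100 * (Ub + 4) ^ 3, lst s' = addL n (lst s) p q,
    cel s' 1 = cel s 1, agree 23 s s' & inv Q (lst s') (cel s') u' wl' sl a' b']).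
Proof.
move=> I e0 e21 e22 ab A nh u1 u2 hu hwl hab; have S := i_str I.
have pq : p != q by apply: contraTneq A => ->; rewrite (st_irr S).
have nh' : ~~ hT (lst s) q p by rewrite (st_hsym S).
have wf : hwf (addL n (lst s) p q) (Ub + 3).
  apply: str_hwf; first exact: str_addL.
  move=> x; rewrite size_addL //; have [a2 b3] := ab x.
  have [_] := inv_bound I hUb Ub3 b3 a2.
  case: (eqVneq x p) => [->|_]; rewrite ?(negPf pq); [|case: (x == q)]; rewrite /=; lia.
apply: run_mono (addH_run hw wf e0 e21 e22 pq nh nh' (i_m I)) _.
move=> s' t [le /functional_extensionality E c1 ag m]; split => //.
  by move: le; rewrite -addnS.
by rewrite E; apply: inv_add I A nh c1 _ u1 u2 hu hwl hab; rewrite -E.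
Qed.

Lemma remH_inv s p q wl wl' u' a b a' b' : inv Q (lst s) (cel s) u wl sl a b ->
  env s 0 = n -> env s 21 = p -> env s 22 = q ->
  (forall x, a x <= 2 /\ b x <= 3) -> hT (lst s) p q ->
  lowf Q (wl' p q) <= cel s 1 p + cel s 1 q -> lowf Q (wl' q p) <= cel s 1 p + cel s 1 q ->
  (forall x y, ~~ ((x == p) && (y == q)) -> ~~ ((x == q) && (y == p)) -> u x y <= u' x y) ->
  (forall x y, ~~ ((x == p) && (y == q)) -> ~~ ((x == q) && (y == p)) -> wl' x y <= wl x y) ->
  (forall x, b' x + a x = b x + a' x + (x == p) + (x == q)) ->
  run remHS s (fun s' t => [/\ t <= 100 * (Ub + 4) ^ 3, lst s' = remL n (lst s) p q,
    cel s' 1 = cel s 1, agree 23 s s' & inv Q (lst s') (cel s') u' wl' sl a' b']).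
Proof.
move=> I e0 e21 e22 ab h u1 u2 hu hwl hab; have S := i_str I.
have pq : p != q by apply: contraTneq (st_sub S h) => ->; rewrite (st_irr S).
have h' : hT (lst s) q p by rewrite (st_hsym S).
have wf : hwf (remL n (lst s) p q) (Ub + 3).
  apply: str_hwf; first exact: str_remL.
  move=> x; have [a2 b3] := ab x; have [_] := inv_bound I hUb Ub3 b3 a2.
  by move: (size_remL x pq h h'); clear; lia.
have [up _] := str_uniq p S; have [uq _] := str_uniq q S.
apply: run_mono (remH_run hw wf e0 e21 e22 pq h h' up uq (i_m I)) _.
move=> s' t [le /functional_extensionality E c1 ag m]; split => //.
  by move: le; rewrite -addnS.
by rewrite E; apply: inv_rem I h c1 _ u1 u2 hu hwl hab; rewrite -E.
Qed.

Section Run.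
Variables (B : nat) (wl : 'I_n -> 'I_n -> nat) (a b : 'I_n -> nat).
Let low := lowf Q B.
Let gap := B %/ Q.
Hypothesis gap0 : 0 < gap.
Hypothesis Bu : forall x y, B <= u x y.
Hypothesis wB : forall x y, wl x y <= B.
Hypothesis b1 : forall x, b x <= 1.
Hypothesis W_Ub : 2 * Ub + 10 < 2 ^ w.
Hypothesis W_Y : B ^ 3 < 2 ^ w.

Definition params s := [/\ env s 0 = n, env s 6 = B, env s 7 = lowf Q B & env s 8 = B ^ 3].
Definition sameG L L' :=
  (forall k, k < n -> perm_eq (L' k) (L k)) /\ L' (2 * n) = L (2 * n).
Definition pa md x y := a y + ((md == 1) && (y == x)).
Definition pb md x y := b y + ((md == 2) && (y == x)).
(** While the chain from one end of a new edge runs, the other end waits with an increment pending.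
    The edge [q r] is too light to be removed by the chain, so the list of [q] stays nonempty and a
    decrement that reaches [q] finds a positive counter. *)
Definition prot L (c : nat -> nat -> nat) := forall q, a q <= 1 /\
  (a q = 1 -> exists2 r, hT L q r & c 1 q + c 1 r < lowf Q B).

Record chI s0 s x md : Prop := ChI {
  ch_x : env s 16 = x;
  ch_m : env s 17 = md;
  ch_md : md <= 2;
  ch_ag : agree 16 s0 s;
  ch_G : sameG (lst s0) (lst s);
  ch_I : inv Q (lst s) (cel s) u wl sl (pa md x) (pb md x);
  ch_a : forall q, a q <= 1;
  ch_p : md != 0 -> prot (lst s) (cel s) }.

(* Consecutive vertices of a chain have degree sums alternately at least B and
   at most B - gap, so the degrees along it move by at least gap every other step. *)
Definition cm s := let d := cel s 1 (env s 16) in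
  if env s 17 == 0 then 0 else if env s 17 == 1 then 2 * (d %/ gap) + 2
  else 2 * ((B - d) %/ gap) + 1.

Lemma sameG_trans L1 L2 L3 : sameG L1 L2 -> sameG L2 L3 -> sameG L1 L3.
Proof.
move=> [p1 e1] [p2 e2]; split; last by rewrite e2.
by move=> k kn; apply: perm_trans (p2 k kn) (p1 k kn).
Qed.
Lemma sameG_add L p q : sameG L (addL n L p q).
Proof.
split; last by rewrite (key_top L p q).1.
by move=> k kn; rewrite (key_low L p q (Ordinal kn)).1.
Qed.
Lemma sameG_rem L p q : sameG L (remL n L p q).
Proof.
split; last by rewrite (key_top L p q).2.
by move=> k kn; rewrite (key_low L p q (Ordinal kn)).2.
Qed.
Lemma sameG_rot L x : sameG L (rotL L x).
Proof.
split; first by move=> k _; apply: rotL_perm.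
by rewrite /rotL gtn_eqF // mul2n -addnn; apply: leq_trans (ltn_ord x) (leq_addr _ _).
Qed.

Lemma low_gap : low + gap = B.
Proof. by rewrite /low /lowf /gap subnK // leq_div. Qed.

Lemma chI_bounds s0 s x md : chI s0 s x md -> params s0 ->
  [/\ params s, forall y, pa md x y <= 2 /\ pb md x y <= 3 & forall y, cel s 1 y <= Ub].
Proof.
move=> C [e0 e6 e7 e8]; have ag := ch_ag C.
have ab y : pa md x y <= 2 /\ pb md x y <= 3.
  rewrite /pa /pb; have := b1 y; have := ch_a C y.
  by case: (md == 1); case: (md == 2); case: (y == x) => /=; lia.
split => //; first by split; rewrite ag.
by move=> y; have [a2 b3] := ab y; have [] := inv_bound (ch_I C) hUb Ub3 b3 a2.
Qed.

Lemma inc_run s0 s x : params s0 -> chI s0 s x 1 ->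
  run incS s (fun s' t => [/\ t <= 130 * (Ub + 4) ^ 3, exists x' md', chI s0 s' x' md' &
    cm s' < cm s]).
Proof.
move=> P0 C; have [[e0 e6 e7 e8] ab bd] := chI_bounds C P0; have [W1 W2 W8] := W_facts hw.
have xn := ltn_ord x; have S := i_str (ch_I C); have lg := low_gap.
have ex := ch_x C; have T0 : Ub + 4 <= (Ub + 4) ^ 3.
  by rewrite -{1}[Ub + 4]expn1 leq_exp2l //; lia.
have xk : n + x <= 2 * n by lia.
apply: run_seq; apply: run_asg => /=; first by lia.
set s1 := setv s 39 0.
have k1 : keeps 19 s s1 by apply: keeps_setv.
apply: run_seq; apply: run_mono (run_for hw (x := 19) (K := n + x) (T := 1)
  (P := fun e => exists2 r : 'I_n, e = r.+1 & B < (cel s 1 x).+1 + cel s 1 r)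
  (R := fun s' => exists2 r : 'I_n, env s' 19 = r.+1 & B < (cel s 1 x).+1 + cel s 1 r)
  isT _ _ xk _ _ _) _.
- by [].
- move=> s2 [ag2 _ _]; rewrite /= !ag2 //= /upd /= ex e0; split => //; split => //; lia.
- exact: st_u S _ xk.
- move=> e /(st_hnode S)[r ->]; have := ltn_ord r; lia.
- move=> s2 e es [ag2 l2 c2] e19 f2; have [r Er] := st_hnode S es; have rn := ltn_ord r.
  have [E6 E16] : env s2 6 = B /\ env s2 16 = x by rewrite !ag2 //= /upd /= ex e6.
  have V : eval s2 (elt (EV 6) (eadd (esuc (Dg (EV 16))) (Dg (epre (EV 19))))) =
    (B < (cel s 1 x).+1 + cel s 1 r).
    by rewrite /= c2 E6 E16 e19 Er subn1 addn1.
  apply: run_asg.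
    rewrite /= c2 E16 e19 Er subn1 /=; have := bd x; have := bd r => b2 b3.
    by do !split => //; lia.
  rewrite V; split => //; first by apply: keeps_setv.
  rewrite /= /upd /=; case: ltnP => lt; [right|left]; split => //; first by exists r; rewrite ?e19.
  by case=> r'; rewrite Er => -[/val_inj <-]; lia.
move=> s3 t3 [le3 kp3 res]; have [ag3 l3 c3] := keeps_trans k1 kp3.
have sz : size (lst s1 (n + x)) <= Ub + 2.
  by have [a2 b3] := ab x; have [] := inv_bound (ch_I C) hUb Ub3 b3 a2.
have E16 : env s3 16 = x by rewrite ag3.
have ag03 : agree 16 s0 s3 by apply: agree_trans (ch_ag C) (agreeW _ ag3).
have cmE : cm s = 2 * (cel s 1 x %/ gap) + 2 by rewrite /cm (ch_m C) ex.
have t3b : t3 <= 4 * (Ub + 4) ^ 3.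
  by apply: leq_trans le3 _; move: sz T0; clear; lia.
case: res => [[f3 none]|[f3 [r Er gt] mem]]; apply: run_if => //; rewrite /= f3 /=.
  apply: run_seq; apply: run_cel; rewrite /= ?E16 //.
    by do !split => //; rewrite ?c3; have := bd x; lia.
  apply: run_asg => //=; first by lia.
  set s4 := setc _ _ _ _; rewrite !add1n; split.
  - by move: t3b T0; clear; lia.
  - exists x, 0; constructor => //.
    + by move=> y y16; rewrite /= /upd ltn_eqF ?ag03 //; lia.
    + by rewrite /= l3; apply: (ch_G C).
    + rewrite /= l3; apply: inv_incD (ch_I C) _ _ _ _; rewrite /= ?c3 ?addn1 //.
        move=> y hy; have ny := none _ hy.
        have le : (cel s 1 x).+1 + cel s 1 y <= B by rewrite leqNgt; apply/negP => lt; apply: ny; exists y.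
        by split; apply: leq_trans le (Bu _ _).
      by move=> y; rewrite /pa /pb /=; lia.
    + exact: (ch_a C).
  have -> : cm (setv s4 17 0) = 0 by [].
  by rewrite cmE addn2.
have rh : hT (lst s) x r by rewrite Er in mem.
have rn := ltn_ord r.
apply: run_seq; apply: run_asg; rewrite /= ?E16 //; apply: run_seq; apply: run_asg.
  by rewrite /= /upd /= Er; do !split => //; lia.
rewrite /= /upd /= Er subn1 /=; set s4 := setv _ 22 _.
apply: run_seq.
have I4 : inv Q (lst s4) (cel s4) u wl sl (pa 1 x) (pb 1 x) by rewrite /= l3 c3; apply: (ch_I C).
have B1 : B <= cel s 1 x + cel s 1 r by lia.
apply: run_mono (remH_inv (s := s4) (p := x) (q := r) (wl' := wl) (u' := u)
  (a' := pa 2 r) (b' := pb 2 r) I4 _ _ _ ab _ _ _ _ _ _) _ => //.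
- by rewrite /= /upd /= ag3 // e0.
- by rewrite /= l3.
- by rewrite /= c3; apply: leq_trans B1; apply: leq_trans (lowf_mono Q (wB _ _)) _; rewrite leq_subr.
- by rewrite /= c3; apply: leq_trans B1; apply: leq_trans (lowf_mono Q (wB _ _)) _; rewrite leq_subr.
- by move=> y; rewrite /pa /pb /=; lia.
move=> s5 t5 [le5 l5 c5 ag5 I5].
have E22 : env s5 22 = r by rewrite ag5.
apply: run_seq; apply: run_asg => //=; apply: run_asg => /=; first by lia.
rewrite E22; split.
- by move: t3b le5 T0; clear; lia.
- exists r, 2; constructor => //.
  + move=> y y16; rewrite /= /upd !ltn_eqF ?ag5; try by lia.
    by rewrite /= /upd !ltn_eqF ?ag03 //; lia.
  + rewrite /= l5 /= l3; apply: sameG_trans (ch_G C) (sameG_rem _ _ _).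
  + exact: (ch_a C).
  + move=> _ q; have [a1 pr] := ch_p C isT q; split => // /pr[r' h lt]; exists r'; last first.
      by rewrite /= c5 /= c3.
    have [up _] := str_uniq x S; have [uq _] := str_uniq r S.
    rewrite /= l5 /= l3 hT_remL //; last first.
      by apply: contraTneq (st_sub S rh) => ->; rewrite (st_irr S).
    rewrite h /=; apply/andP; split; apply/negP => /andP[/eqP E1 /eqP E2]; move: lt; rewrite E1 E2;
      rewrite -/low; lia.
rewrite cmE /cm /= /upd /= c5 /= c3.
by rewrite addn1 addn2 !ltnS leq_mul2l /= leq_div2r //; lia.
Qed.

Definition wz x z p q := if ((p == x) && (q == z)) || ((p == z) && (q == x)) then 0 else wl p q.

(** State of a scan after [i] rotations: each arc at [x] outside H has gained [i] positions, unless
    it is known not to be light. *)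
Definition J2s s L x i := forall p q, arc L p q -> ~~ hT L p q -> (p == x) || (q == x) ->
  lowf Q B < cel s 1 p + cel s 1 q \/
  wl p q ^ 3 * (lowf Q (wl p q) - (cel s 1 p + cel s 1 q)) + i <= rhs L sl p q.

Record scI s x s' : Prop := ScI {
  sc_ag : agree 18 s s';
  sc_c : cel s' = cel s;
  sc_G : sameG (lst s) (lst s');
  sc_H : forall k, n <= k -> lst s' k = lst s k;
  sc_I : [/\ env s' 39 = 0, env s' 18 <= B ^ 3,
            inv Q (lst s') (cel s) u wl sl (pa 2 x) (pb 2 x)
          & J2s s (lst s') x (B ^ 3 - env s' 18)] \/
    (env s' 39 = 1 /\ exists z : 'I_n, [/\ env s' 19 = z.+1, arc (lst s') x z,
      ~~ hT (lst s') x z, cel s 1 x + cel s 1 z <= lowf Q B &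
      inv Q (lst s') (cel s) u (wz x z) sl (pa 2 x) (pb 2 x)]) }.

Lemma scan_step s0 s x s1 : params s0 -> chI s0 s x 2 -> scI s x s1 ->
  env s1 39 = 0 -> env s1 18 != 0 ->
  run scanS s1 (fun s2 t => [/\ scI s x s2,
    (if env s2 39 == 0 then env s2 18 else 0) < env s1 18 & t <= 12]).
Proof.
move=> P0 C SI f0 i0; have [[e0 e6 e7 e8] ab bd] := chI_bounds C P0.
have [W1 W2 W8] := W_facts hw; have xn := ltn_ord x; have ag := sc_ag SI; have cs := sc_c SI.
case: (sc_I SI) => [[_ iY I J2]|[f1]]; last by rewrite f0 in f1.
have S := i_str I; have E16 : env s1 16 = x by rewrite ag // (ch_x C).
have E0 : env s1 0 = n by rewrite ag.
have E7 : env s1 7 = lowf Q B by rewrite ag.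
have nn : n <= n * n by rewrite leq_pmulr //; lia.
have xk : x <= 2 * n by lia.
have lowB : lowf Q B <= B by rewrite leq_subr.
have BU : B <= Ub by apply: leq_trans (Bu x x) (hUb x x).
apply: run_seq; apply: run_mono (rot_run (x := 19) (K := x) isT xk (st_u S xk) _ _) _.
- by move=> e /(st_node S)[y ->]; have := ltn_ord y; lia.
- by move=> s2 _ e2; rewrite /= e2.
move=> s2 t2 [Es2 le2].
have ag2 : agree 18 s s2 by move=> y y18; rewrite Es2 /= /upd ltn_eqF ?ag //; lia.
have L2 : lst s2 = rotL (lst s1) x by rewrite Es2.
have [c2 E18 f2] : [/\ cel s2 = cel s, env s2 18 = env s1 18 & env s2 39 = 0].
  by rewrite Es2 /= cs /upd.
have G2 : sameG (lst s) (lst s2) by rewrite L2; apply: sameG_trans (sc_G SI) (sameG_rot _ _).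
have H2 k : n <= k -> lst s2 k = lst s k.
  by move=> nk; rewrite L2 /rotL gtn_eqF ?(sc_H SI) //; lia.
have E19 : env s2 19 = head 0 (lst s1 x) by rewrite Es2 /= /upd.
have [F0 F16 F7] : [/\ env s2 0 = n, env s2 16 = x & env s2 7 = lowf Q B].
  by rewrite !ag2 // (ch_x C).
clear Es2; apply: run_if => //; case E : (lst s1 x) E19 => [|e l] E19; rewrite /= E19 /=.
  have L1 : lst s2 = lst s1.
    rewrite L2; apply: functional_extensionality => j; rewrite /rotL.
    by case: eqP => // ->; rewrite E.
  apply: run_asg => //=; first by lia.
  split; [|by rewrite /= /upd /= f2 lt0n|by lia].
  constructor => //=.
    by move=> y y18; rewrite /= /upd ltn_eqF ?ag2.
  left; rewrite /= /upd /= f2; split => //; first by rewrite L1.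
  move=> p q; rewrite L1 => A _ /orP[]/eqP E1; move: A; first by rewrite E1 /arc E.
  by rewrite E1 (st_sym S) /arc E.
have [z Ez] : exists z : 'I_n, e = z.+1 by apply: (st_node S (x := x)); rewrite E mem_head.
have zn := ltn_ord z; rewrite Ez /= in E19 *; rewrite Ez in E.
have Ax : arc (lst s1) x z by rewrite /arc E mem_head.
have mv : minv n (rotL (lst s1) x) (cel s 0).
  by apply: minv_perm (i_m I) => k; apply: rotL_perm.
have Iz : inv Q (lst s2) (cel s) u (wz x z) sl (pa 2 x) (pb 2 x).
  rewrite L2; apply: inv_rot I E _ _ _ _ mv.
  - by move=> p q /negPf n1 /negPf n2; rewrite /wz n1 [(p == z) && _]andbC n2.
  - by rewrite /wz !eqxx.
  - by rewrite /wz !eqxx orbT.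
  - by move=> y; apply: leq_addr.
have hTz : (z.+1 \in lst s2 (n + x)) = hT (lst s) x z by rewrite H2 // leq_addr.
have hT2 : hT (lst s2) x z = hT (lst s) x z by rewrite -hTz.
have V : eval s2 (emul (eneg (EFlg (hk (EV 16)) (EV 19)))
   (elt (eadd (Dg (EV 16)) (Dg (epre (EV 19)))) (esuc (EV 7)))) =
   ~~ hT (lst s) x z && (cel s 1 x + cel s 1 z <= lowf Q B).
  rewrite /= F0 F16 F7 E19 c2 hTz subn1 addn1 /= ltnS.
  by case: (hT _ _ _); case: (_ <= _).
apply: run_if.
  rewrite /= F0 F16 F7 E19 c2 hTz subn1 /=; have := bd x; have := bd z => b2 b3.
  by do !split => //; try lia; do ?case: (_ < _); do ?case: (hT _ _ _); rewrite //=; lia.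
rewrite V; case: (boolP (~~ hT (lst s) x z && _)) => [/andP[nh le]|/nandP cond] /=.
  apply: run_asg => /=; first by lia.
  split; [|by rewrite /= /upd /= lt0n|by lia].
  constructor => //=; first by move=> y y18; rewrite /= /upd ltn_eqF ?ag2 //; lia.
  right; split => //; exists z; split => //; first by rewrite L2 arc_rotL.
  by rewrite hT2.
apply: run_asg => /=; first by rewrite E18; do !split => //; lia.
split; [|by rewrite /= /upd /= f2 /= E18; move: i0; clear; lia|by lia].
have cond' : hT (lst s2) x z \/ lowf Q B < cel s 1 x + cel s 1 z.
  by rewrite hT2; case: cond => [/negPn|]; [left|rewrite -ltnNge; right].
constructor => //=; first by move=> y y18; rewrite /= /upd ltn_eqF ?ag2.
have Sz := i_str Iz.
left; rewrite /= /upd /= f2 E18; split => //; first by lia.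
  apply: inv_weak Iz _ _ => [p q _|p q _]; first by left.
  case E2 : (((p == x) && (q == z)) || ((p == z) && (q == x))); last first.
    by apply: Or31; rewrite /wz E2.
  have := lowf_mono Q (wB p q); move/orP: E2 => [] /andP[/eqP-> /eqP->] lw2; case: cond' => [h|lt].
  - exact: Or32.
  - by apply: Or33; lia.
  - by apply: Or32; rewrite (st_hsym Sz).
  - by apply: Or33; lia.
move=> p q; rewrite L2 arc_rotL hT_rotL => A nh px.
case: (boolP (((p == x) && (q == z)) || ((q == x) && (p == z)))) => [pair|].
  left; case: cond' => [h|lt].
    move: nh; rewrite -(hT_rotL (lst s1) x p q) -L2.
    by case/orP: pair => /andP[/eqP-> /eqP->]; rewrite ?(st_hsym Sz z) h.
  by case/orP: pair => /andP[/eqP-> /eqP->]; rewrite // addnC.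
rewrite negb_or => /andP[n1 n2].
have := J2 _ _ A nh px; case=> [lt|le]; [by left|right].
have := rhs_rot sl S E A; rewrite !(inj_eq val_inj) => -> //; rewrite px /=.
by apply: leq_trans (leq_add le (leqnn 1)); rewrite -addnA leq_add2l; move: i0 iY; clear; lia.
Qed.

Lemma dec_run s0 s x : params s0 -> chI s0 s x 2 ->
  run decS s (fun s' t => [/\ t <= 130 * (Ub + 4) ^ 3, exists x' md', chI s0 s' x' md' &
    cm s' < cm s]).
Proof.
move=> P0 C; have [[e0 e6 e7 e8] ab bd] := chI_bounds C P0; have [W1 W2 W8] := W_facts hw.
have xn := ltn_ord x; have S := i_str (ch_I C); have lg := low_gap.
have ex := ch_x C; have T0 : (Ub + 4) <= (Ub + 4) ^ 3.
  by rewrite -{1}[Ub + 4]expn1 leq_exp2l //; lia.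
have BU : B <= Ub by apply: leq_trans (Bu x x) (hUb x x).
have BT : B ^ 3 <= (Ub + 4) ^ 3 by rewrite leq_exp2r //; lia.
have cmE : cm s = 2 * ((B - cel s 1 x) %/ gap) + 1 by rewrite /cm (ch_m C) ex.
apply: run_seq; apply: run_asg => /=; first by lia.
apply: run_seq; apply: run_asg => //=; rewrite /= /upd /= e8; set s2 := setv _ 18 _.
have I2 : scI s x s2.
  constructor => //; first by move=> y y18; rewrite /= /upd !ltn_eqF //; lia.
  left; rewrite /= /upd /= subnn; split => //; first exact: (ch_I C).
  by move=> p q A nh _; right; rewrite addn0; apply: (i_2 (ch_I C)).
apply: run_seq; apply: run_mono (@run_while n w hw (scI s x)
  (fun s' => if env s' 39 == 0 then env s' 18 else 0) 12 (emul (EV 18) (eneg (EV 39))) scanS s2 _ I2) _.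
  move=> s3 SI; split.
    case: (sc_I SI) => [[f3 i3 _ _]|[f3 _]]; rewrite /= f3 /=; do !split => //; lia.
  rewrite /=; case: (sc_I SI) => [[f3 i3 _ _]|[f3 _]]; rewrite f3 /= ?muln0 // muln1 => i0.
  by apply: run_mono (scan_step P0 C SI f3 i0) _.
move=> s3 t3 [SI z3 le3]; rewrite /= /upd /= in le3.
have t3b : t3 <= 13 * (Ub + 4) ^ 3 + 1 by move: le3 BT; clear; lia.
have ag3 := sc_ag SI; have c3 := sc_c SI.
have E16 : env s3 16 = x by rewrite ag3.
have E0 : env s3 0 = n by rewrite ag3.
have ag03 : agree 16 s0 s3 by apply: agree_trans (ch_ag C) (agreeW _ ag3).
have G3 : sameG (lst s0) (lst s3) := sameG_trans (ch_G C) (sc_G SI).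
case: (sc_I SI) => [[f3 i3 I3 J3]|[f3 [z [Ez Az nh le I3]]]]; apply: run_if => //; rewrite /= f3 /=.
  have i18 : env s3 18 = 0 by move: z3; rewrite /= f3 /= muln1.
  (* By the balance of list size and pending changes, the counter is positive if no increment waits
     at [x]; otherwise the protected edge makes the list nonempty, and the counter is positive
     again. *)
  have dx : 0 < cel s 1 x.
    have := i_b (ch_I C) x; rewrite /pa /pb /= eqxx /= addn0 => bal.
    have [a1 pr] := ch_p C isT x.
    case: (posnP (a x)) => [a0|a0]; first by lia.
    have [|r h _] := pr; first by lia.
    have : 0 < size (lst s (n + x)) by move: h; rewrite /hT; case: (lst s (n + x)).
    by move: bal a1; clear; lia.
  apply: run_seq; apply: run_cel; rewrite /= ?E16 //.
    by do !split => //; rewrite ?c3; lia.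
  apply: run_asg => //=; first by lia.
  set s4 := setc _ _ _ _; split.
  - by move: t3b T0; clear; lia.
  - exists x, 0; constructor => //.
    + by move=> y y16; rewrite /= /upd ltn_eqF ?ag03 //; lia.
    + rewrite /=; apply: (inv_decD (B := B) (x := x) I3) => //=; rewrite ?c3 ?subn1 //.
        by move: J3; rewrite i18 subn0.
      by move=> y; rewrite /pa /pb /=; lia.
    + exact: (ch_a C).
  have -> : cm (setv s4 17 0) = 0 by [].
  by rewrite cmE addn1.
have zn := ltn_ord z.
apply: run_seq; apply: run_asg; rewrite /= ?E16 //; apply: run_seq; apply: run_asg.
  by rewrite /= /upd /= Ez; do !split => //; lia.
rewrite /= /upd /= Ez subn1 /=; set s4 := setv _ 22 _.
have I4 : inv Q (lst s4) (cel s4) u (wz x z) sl (pa 2 x) (pb 2 x) by rewrite /= c3.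
have leB : cel s 1 x + cel s 1 z <= B by apply: leq_trans le (leq_subr _ _).
apply: run_seq; apply: run_mono (addH_inv (s := s4) (p := x) (q := z) (wl' := wl) (u' := u)
  (a' := pa 1 z) (b' := pb 1 z) I4 _ _ _ ab _ _ _ _ _ _ _) _ => //.
- by rewrite /= c3; apply: leq_trans leB (Bu _ _).
- by rewrite /= c3; apply: leq_trans leB (Bu _ _).
- by move=> p q /negPf n1 /negPf n2; rewrite /wz n1 n2.
- by move=> y; rewrite /pa /pb /=; lia.
move=> s5 t5 [le5 l5 c5 ag5 I5].
have E22 : env s5 22 = z by rewrite ag5.
apply: run_seq; apply: run_asg => //=; apply: run_asg => /=; first by lia.
rewrite E22; split.
- by move: t3b le5 T0; clear; lia.
- exists z, 1; constructor => //.
  + move=> y y16; rewrite /= /upd !ltn_eqF ?ag5; try by lia.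
    by rewrite /= /upd !ltn_eqF ?ag03 //; lia.
  + rewrite /= l5 /=; apply: sameG_trans G3 (sameG_add _ _ _).
  + exact: (ch_a C).
  + move=> _ q; have [a1 pr] := ch_p C isT q; split => // /pr[r' h lt]; exists r'; last first.
      by rewrite /= c5 /= c3.
    rewrite /= l5 /= hT_addL; last first.
      by apply: contraTneq Az => ->; rewrite (st_irr (i_str I3)).
    by move: h; rewrite /hT (sc_H SI) ?leq_addr // => ->.
(* The degree of [z] is at most [B - gap] minus that of [x], so its quotient by [gap] is smaller by
   at least one than that of [B] minus the degree of [x]. *)
rewrite cmE /cm /= /upd /= c5 /= c3 addn1 ltnS -[2 in X in X <= _]muln1 -mulnDr leq_mul2l /=.
have -> : cel s 1 z %/ gap + 1 = (cel s 1 z + gap) %/ gap by rewrite divnDr // divnn gap0.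
by apply: leq_div2r; rewrite -/low in le; lia.
Qed.

Lemma chain_run s x md M : params s -> env s 16 = x -> env s 17 = md ->
  (md == 1) || (md == 2) -> inv Q (lst s) (cel s) u wl sl (pa md x) (pb md x) ->
  prot (lst s) (cel s) -> 2 * (Ub %/ gap) + 2 <= M ->
  run chainS s (fun s' t => [/\ t <= M * (132 * (Ub + 4) ^ 3) + 1, sameG (lst s) (lst s'),
    agree 16 s s' & inv Q (lst s') (cel s') u wl sl a b]).
Proof.
move=> P0 ex em md12 I pr leM; have [W1 W2 W8] := W_facts hw.
have C : chI s s x md.
  constructor => //; first by case/orP: md12 => /eqP->.
  by move=> q; have [] := pr q.
have [_ _ bd] := chI_bounds C P0.
have T0 : 1 <= (Ub + 4) ^ 3 by rewrite expn_gt0; lia.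
have BU : B <= Ub by apply: leq_trans (Bu x x) (hUb x x).
have cmM : cm s <= M.
  apply: leq_trans leM; rewrite /cm em ex; case: eqP => // _.
  case: eqP => _; first by rewrite leq_add2r leq_mul2l leq_div2r.
  by apply: leq_add => //; rewrite leq_mul2l leq_div2r //; lia.
apply: run_mono (@run_while n w hw (fun s' => exists x' md', chI s s' x' md') cm
  (130 * (Ub + 4) ^ 3 + 1) (EV 17) (HIf (eeq (EV 17) (EC 1)) incS decS) s _ _) _.
- move=> s1 [x1 [md1 C1]]; split; first by [].
  rewrite /= (ch_m C1) => m0; apply: run_if; first by split => //; apply: leq_trans W8.
  rewrite /= (ch_m C1); have := ch_md C1; case: md1 C1 m0 => [|[|[|]]] //= C1 _ _.
    by apply: run_mono (inc_run P0 C1) _ => s2 t [le ex2 lt]; split => //; lia.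
  by apply: run_mono (dec_run P0 C1) _ => s2 t [le ex2 lt]; split => //; lia.
- by exists x, md.
move=> s1 t1 [[x1 [md1 C1]]]; rewrite /= (ch_m C1) => m0 le1; rewrite m0 in C1.
have [pa0 pb0] : pa 0 x1 = a /\ pb 0 x1 = b.
  by split; apply: functional_extensionality => y; rewrite /pa /pb addn0.
split; [|exact: (ch_G C1)|exact: (ch_ag C1)|by have := ch_I C1; rewrite pa0 pb0].
apply: leq_trans le1 _; rewrite leq_add2r; apply: leq_mul cmM _.
by move: T0; clear; lia.
Qed.
End Run.
End Params.
End Chains.

(** * Thresholds and edge updates *)

(* The least b >= Q with Q ^ 8 * N <= b ^ 8. *)
Definition Bf Q N := Q + find (fun b => Q ^ 8 * N <= (Q + b) ^ 8) (iota 0 (Q * N).+1).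

Lemma Bf_ge Q N : Q <= Bf Q N. Proof. exact: leq_addr. Qed.

Lemma Bf_has Q N : has (fun b => Q ^ 8 * N <= (Q + b) ^ 8) (iota 0 (Q * N).+1).
Proof.
apply/hasP; exists (Q * N); first by rewrite mem_iota /=; lia.
rewrite -mulnS expnMn leq_mul2l; apply/orP; right.
apply: leq_trans (leqnSn N) _; rewrite -{1}[N.+1]expn1 leq_pexp2l //.
Qed.

Lemma Bf_ok Q N : Q ^ 8 * N <= Bf Q N ^ 8.
Proof.
have := nth_find 0 (Bf_has Q N); rewrite nth_iota //.
by have := Bf_has Q N; rewrite has_find size_iota.
Qed.

Lemma Bf_min Q N b : Q <= b -> b < Bf Q N -> b ^ 8 < Q ^ 8 * N.
Proof.
move=> Qb; rewrite /Bf => lt.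
have lt2 : b - Q < find (fun b => Q ^ 8 * N <= (Q + b) ^ 8) (iota 0 (Q * N).+1) by lia.
have := before_find 0 lt2; rewrite nth_iota ?add0n.
  by rewrite subnKC // ltnNge => ->.
by apply: leq_trans lt2 _; have := find_size (fun b => Q ^ 8 * N <= (Q + b) ^ 8) (iota 0 (Q * N).+1);
  rewrite size_iota.
Qed.

Lemma Bf_le Q N b : Q <= b -> Q ^ 8 * N <= b ^ 8 -> Bf Q N <= b.
Proof. by move=> Qb le; rewrite leqNgt; apply/negP => /(Bf_min Qb); rewrite ltnNge le. Qed.

Lemma Bf_mono Q N N' : N <= N' -> Bf Q N <= Bf Q N'.
Proof.
move=> le; apply: Bf_le (Bf_ge _ _) _; apply: leq_trans (Bf_ok Q N').
by rewrite leq_mul2l le orbT.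
Qed.

(** Doubling the base multiplies its eighth power by 256, and the summand 8 is absorbed because the
    base is at least [Q]. This is why twice the current base bounds all outdated thresholds. *)
Lemma Bf_double Q N : Bf Q (2 * N + 8) <= 2 * Bf Q N.
Proof.
apply: Bf_le; first by have := Bf_ge Q N; lia.
have := Bf_ok Q N; have : Q ^ 8 <= Bf Q N ^ 8 by rewrite leq_exp2r // Bf_ge.
rewrite expnMn mulnDr mulnCA; have -> : 2 ^ 8 = 256 by [].
by move: (Q ^ 8) (Q ^ 8 * N) (Bf Q N ^ 8) => a b c; clear; lia.
Qed.

Section Links.
Variables (n Q : nat).
Notation hT := (@hT n).
Notation arc := (@arc n).
Notation str := (str n).
Notation inv := (@inv n).
Implicit Types (L : nat -> seq nat) (x y p q : 'I_n).

Definition pair x y p q := ((p == x) && (q == y)) || ((p == y) && (q == x)).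
Definition upf (f : 'I_n -> 'I_n -> nat) x y v p q := if pair x y p q then v else f p q.
Definition z0 : 'I_n -> nat := fun=> 0.

Lemma arcn_inj x y p q : arcn x y = arcn p q -> x = p /\ y = q.
Proof.
rewrite /arcn => -[E]; have xn := ltn_ord x; have yn := ltn_ord y; have qn := ltn_ord q.
have n0 : 0 < n by lia.
have E1 : x = p :> nat.
  have := congr1 (divn^~ n) E; rewrite !divnMDl // !divn_small // !addn0; exact.
by split; apply: val_inj => //; move: E; rewrite E1 => /addnI.
Qed.

Lemma arcn_le x y : 0 < arcn x y <= n * n.
Proof.
have xn := ltn_ord x; have yn := ltn_ord y; rewrite /arcn ltnS leq0n /=.
apply: leq_trans (_ : x * n + n <= _); first by lia.
by rewrite -mulSnr leq_mul2r xn orbT.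
Qed.

Lemma str_size L : str L -> size (L (2 * n)) <= n * n.
Proof.
move=> S; have /= /andP[_ u] := st_u S (leqnn _).
have : {subset L (2 * n) <= iota 1 (n * n)}.
  by move=> e /(st_arcn S)[x [y ->]]; rewrite mem_iota add1n ltnS arcn_le.
by move/(uniq_leq_size u); rewrite size_iota.
Qed.

(** New entries go to the end, so no old entry loses a position. *)
Definition linkL L x y : nat -> seq nat := fun k =>
  if k == x then rcons (L k) y.+1 else if k == y then rcons (L k) x.+1 else
  if k == 2 * n then rcons (rcons (L k) (arcn x y)) (arcn y x) else L k.
Definition unlinkL L x y : nat -> seq nat := fun k =>
  if k == x then rem y.+1 (L k) else if k == y then rem x.+1 (L k) else
  if k == 2 * n then rem (arcn y x) (rem (arcn x y) (L k)) else L k.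

Lemma ord_top x : (2 * n == x) = false. Proof. by apply: gtn_eqF; have := ltn_ord x; lia. Qed.
Lemma link_H L x y k : n <= k < 2 * n -> linkL L x y k = L k /\ unlinkL L x y k = L k.
Proof.
move=> /andP[k1 k2]; have kx (z : 'I_n) : (k == z) = false.
  by apply: gtn_eqF; apply: leq_trans (ltn_ord z) k1.
by rewrite /linkL /unlinkL !kx (ltn_eqF k2).
Qed.
Lemma link_top L x y : linkL L x y (2 * n) = rcons (rcons (L (2 * n)) (arcn x y)) (arcn y x) /\
  unlinkL L x y (2 * n) = rem (arcn y x) (rem (arcn x y) (L (2 * n))).
Proof. by rewrite /linkL /unlinkL !ord_top eqxx. Qed.
Lemma link_low L x y p : x != y ->
  linkL L x y p = (if p == x then rcons (L p) y.+1 else if p == y then rcons (L p) x.+1 else L p) /\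
  unlinkL L x y p = (if p == x then rem y.+1 (L p) else if p == y then rem x.+1 (L p) else L p).
Proof.
by move=> xy; rewrite /linkL /unlinkL !(inj_eq val_inj) [_ == 2 * n]eq_sym ord_top.
Qed.
Lemma link_hT L x y p q : hT (linkL L x y) p q = hT L p q /\ hT (unlinkL L x y) p q = hT L p q.
Proof.
have k1 : n <= n + val p < 2 * n by have := ltn_ord p; rewrite leq_addr /=; lia.
by rewrite /hT (link_H L x y k1).1 (link_H L x y k1).2.
Qed.

Lemma arc_link L x y p q : x != y -> arc (linkL L x y) p q = arc L p q || pair x y p q.
Proof.
move=> xy; rewrite /arc (link_low L p xy).1 /pair.
case: (eqVneq p x) => [->|px]; rewrite ?(negPf xy) /=.
  by rewrite mem_rcons inE eqSS (inj_eq val_inj) orbF orbC.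
by case: (eqVneq p y) => [->|py]; rewrite ?mem_rcons ?inE ?eqSS ?(inj_eq val_inj) ?orbF // orbC.
Qed.

Lemma arc_unlink L x y p q : str L -> x != y ->
  arc (unlinkL L x y) p q = arc L p q && ~~ pair x y p q.
Proof.
move=> S xy; rewrite /arc (link_low L p xy).2 /pair.
have [_ ux] := str_uniq x S; have [_ uy] := str_uniq y S.
case: (eqVneq p x) => [->|px]; rewrite ?(negPf xy) /=.
  by rewrite mem_rem_uniq // inE eqSS (inj_eq val_inj) orbF andbC.
case: (eqVneq p y) => [->|py]; rewrite ?andbT //.
by rewrite mem_rem_uniq // inE eqSS (inj_eq val_inj) andbC.
Qed.

Lemma pair_sym x y p q : pair x y p q = pair x y q p.
Proof. by rewrite /pair orbC andbC [(p == x) && _]andbC. Qed.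

Lemma uniq0_rcons (s : seq nat) e : uniq (0 :: s) -> e != 0 -> e \notin s -> uniq (0 :: rcons s e).
Proof.
by move=> /= /andP[s0 us] e0 es; rewrite mem_rcons inE rcons_uniq us es eq_sym (negPf e0) s0.
Qed.
Lemma uniq0_rem (s : seq nat) e : uniq (0 :: s) -> uniq (0 :: rem e s).
Proof.
by move=> /= /andP[s0 us]; rewrite rem_uniq // andbT; apply: contra s0; apply: mem_rem.
Qed.

Lemma str_link L x y : str L -> x != y -> ~~ arc L x y -> str (linkL L x y).
Proof.
move=> S xy nA; have nA' : ~~ arc L y x by rewrite (st_sym S).
have yx : y != x by rewrite eq_sym.
have axy : arcn y x != arcn x y by apply/eqP => /arcn_inj[E]; rewrite E eqxx in xy.
constructor.
- move=> k k2; have := st_u S k2; rewrite /linkL.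
  case: eqP => [->|_ u]; first by move=> u; apply: uniq0_rcons.
  case: eqP u => [-> u|_ u]; first by apply: uniq0_rcons.
  case: eqP u => [-> u|_ //]; apply: uniq0_rcons; first by apply: uniq0_rcons; rewrite ?(st_arc S).
    by [].
  by rewrite mem_rcons inE (negPf axy) (st_arc S).
- move=> p e; rewrite (link_low L p xy).1; case: eqP => _; last case: eqP => _; last exact: (st_node S).
    by rewrite mem_rcons inE => /predU1P[->|/(st_node S)] //; exists y.
  by rewrite mem_rcons inE => /predU1P[->|/(st_node S)] //; exists x.
- move=> p e; rewrite (link_H _ _ _ _).1; first exact: (st_hnode S).
  by have := ltn_ord p; rewrite leq_addr /=; lia.
- by move=> p q; rewrite !arc_link // (st_sym S) pair_sym.
- move=> p; rewrite arc_link // (st_irr S) /pair /=; apply/negP => /orP[]/andP[/eqP-> E];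
    by rewrite (eqP E) eqxx in xy.
- by move=> p q; rewrite (link_hT L x y p q).1 arc_link // => /(st_sub S)->.
- by move=> p q; rewrite !(link_hT L x y _ _).1 (st_hsym S).
- move=> p q; rewrite (link_top L x y).1 arc_link // mem_rcons inE mem_rcons inE (st_arc S) /pair.
  have E r t : (arcn p q == arcn r t) = (p == r) && (q == t).
    by apply/eqP/andP => [/arcn_inj[-> ->]|[/eqP-> /eqP->]].
  by rewrite !E; case: (arc _ _ _); rewrite ?orbT //= orbF orbC.
- move=> e; rewrite (link_top L x y).1 mem_rcons inE mem_rcons inE => /or3P[/eqP->|/eqP->|/(st_arcn S)] //.
    by exists y, x.
  by exists x, y.
Qed.

Lemma str_unlink L x y : str L -> x != y -> ~~ hT L x y -> str (unlinkL L x y).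
Proof.
move=> S xy nh; constructor.
- move=> k k2; have u := st_u S k2; rewrite /unlinkL.
  case: eqP => _; first exact: uniq0_rem.
  by case: eqP => _; [|case: eqP => _ //]; do ?apply: uniq0_rem.
- move=> p e; rewrite (link_low L p xy).2.
  by case: eqP => _; last case: eqP => _; try move/mem_rem; apply: (st_node S).
- move=> p e; rewrite (link_H _ _ _ _).2; first exact: (st_hnode S).
  by have := ltn_ord p; rewrite leq_addr /=; lia.
- by move=> p q; rewrite !arc_unlink // (st_sym S) pair_sym.
- by move=> p; rewrite arc_unlink // (st_irr S).
- move=> p q; rewrite (link_hT L x y p q).2 arc_unlink // => /[dup] h /(st_sub S)->/=.
  by apply: contraTN h => /orP[]/andP[/eqP-> /eqP->]; rewrite // (st_hsym S).
- by move=> p q; rewrite !(link_hT L x y _ _).2 (st_hsym S).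
- have u : uniq (L (2 * n)) by case/andP: (st_u S (leqnn _)).
  move=> p q; rewrite (link_top L x y).2 arc_unlink // mem_rem_uniq ?rem_uniq // inE mem_rem_uniq // inE.
  have E r t : (arcn p q == arcn r t) = (p == r) && (q == t).
    by apply/eqP/andP => [/arcn_inj[-> ->]|[/eqP-> /eqP->]].
  by rewrite !E (st_arc S) /pair negb_or; case: (arc _ _ _); rewrite ?andbF //= andbT andbC.
- by move=> e; rewrite (link_top L x y).2 => /mem_rem/mem_rem/(st_arcn S).
Qed.

Lemma minv_hT L L' c : (forall p q, hT L' p q = hT L p q) -> minv n L c -> minv n L' c.
Proof.
move=> EH [f [ef [fI fh] na]]; exists f; split => //.
  by split => // x /fh; rewrite EH.
move=> u v Xu Xv; have [n1 n3 n5] := na u v Xu Xv.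
by split; [move: n1 | move=> x; move: (n3 x) | move=> x y; move: (n5 x y)];
  rewrite /aug1 /aug3 /aug5 !EH.
Qed.

Lemma inv_link L c u u' wl wl' sl a b x y : inv Q L c u wl sl a b -> x != y -> ~~ arc L x y ->
  (forall p q, arc L p q -> u p q <= u' p q) ->
  (forall p q, arc L p q -> wl' p q <= wl p q) ->
  inv Q (linkL L x y) c u' (upf wl' x y 0) sl a b.
Proof.
move=> I xy nA hu hwl; have S := i_str I; constructor.
- exact: str_link.
- by apply: minv_hT (i_m I) => p q; rewrite (link_hT L x y p q).1.
- move=> p q; rewrite (link_hT L x y p q).1 => h.
  by apply: leq_trans (i_1 I h) (hu _ _ (st_sub S h)).
- move=> p q; rewrite (link_hT L x y p q).1 arc_link // /upf; case: ifP => // _.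
  rewrite orbF => A nh; apply: leq_trans (pot_mono _ _ (hwl _ _ A)) _.
  apply: leq_trans (i_2 I A nh) _.
  have H r t : arc L r t -> behind (L r) t.+1 <= behind (linkL L x y r) t.+1.
    rewrite /arc (link_low L r xy).1 => rt.
    by case: eqP => _; [|case: eqP => _]; rewrite ?behind_rcons.
  have := H p q A; have := H q p; rewrite (st_sym S) => /(_ A); rewrite /rhs.
  by move: (behind (linkL L x y p) _) (behind (linkL L x y q) _) (behind (L p) _) (behind (L q) _); clear; lia.
- move=> p; rewrite (link_H _ _ _ _).1; first exact: (i_b I).
  by have := ltn_ord p; rewrite leq_addr /=; lia.
Qed.

(** A deletion costs the entries in front of the deleted one a single position, and among the queues
    of vertices only those of [x] and [y] are affected; [sl] records the loan. *)
Lemma inv_unlink L c u u' wl wl' a b x y : inv Q L c u wl z0 a b -> x != y -> ~~ hT L x y ->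
  (forall p q, arc L p q -> ~~ pair x y p q -> u p q <= u' p q) ->
  (forall p q, arc L p q -> ~~ pair x y p q -> wl' p q <= wl p q) ->
  inv Q (unlinkL L x y) c u' wl' (fun p => (p == x) + (p == y)) a b.
Proof.
move=> I xy nh hu hwl; have S := i_str I; constructor.
- exact: str_unlink.
- by apply: minv_hT (i_m I) => p q; rewrite (link_hT L x y p q).2.
- move=> p q; rewrite (link_hT L x y p q).2 => h.
  apply: leq_trans (i_1 I h) (hu _ _ (st_sub S h) _).
  by apply: contraTN h => /orP[]/andP[/eqP-> /eqP->]; rewrite // (st_hsym S).
- move=> p q; rewrite (link_hT L x y p q).2 arc_unlink // => /andP[A np] nhp.
  apply: leq_trans (pot_mono _ _ (hwl _ _ A np)) _.
  apply: leq_trans (i_2 I A nhp) _.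
  have H (r t : 'I_n) : arc L r t -> ~~ pair x y r t ->
      behind (L r) t.+1 <= behind (unlinkL L x y r) t.+1 + ((r == x) + (r == y)).
    rewrite /arc (link_low L r xy).2 /pair => rt.
    case: (eqVneq r x) => [E|rx] /=; rewrite ?E ?(negPf xy) /=.
      by rewrite orbF => ty; rewrite addn1; apply: behind_rem; rewrite -?E ?eqSS.
    case: (eqVneq r y) => [E|ry] /=; last by move=> _; rewrite !addn0.
    by move=> tx; rewrite add0n addn1; apply: behind_rem; rewrite ?eqSS.
  have := H p q A np; have := H q p; rewrite (st_sym S) pair_sym => /(_ A np).
  rewrite /rhs /z0; set e1 := nat_of_bool _; set e2 := nat_of_bool _; set e3 := nat_of_bool _; set e4 := nat_of_bool _.
  by move: (behind (unlinkL L x y p) _) (behind (unlinkL L x y q) _) (behind (L p) _) (behind (L q) _) e1 e2 e3 e4; clear; lia.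
- move=> p; rewrite (link_H _ _ _ _).2; first exact: (i_b I).
  by have := ltn_ord p; rewrite leq_addr /=; lia.
Qed.

Lemma inv_rotG L c u wl sl a b : inv Q L c u wl sl a b -> inv Q (rotL L (2 * n)) c u wl sl a b.
Proof.
move=> I; have low (p : 'I_n) : rotL L (2 * n) p = L p by rewrite /rotL eq_sym ord_top.
constructor.
- by apply: str_perm (i_str I) => k _; apply: rotL_perm.
- by apply: minv_perm (i_m I) => k; apply: rotL_perm.
- by move=> p q; rewrite hT_rotL; apply: (i_1 I).
- by move=> p q; rewrite hT_rotL arc_rotL /rhs !low; apply: (i_2 I).
- by move=> p; have /perm_size -> := rotL_perm L (2 * n) (n + p); apply: (i_b I).
Qed.
End Links.

(** * Checking an edge *)

Definition bothS md :=
  HAsg 16 (EV 13) ;; HAsg 17 (EC md) ;; chainS ;; HAsg 16 (EV 14) ;; HAsg 17 (EC md) ;; chainS.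
Definition checkS :=
  HIf (EFlg (hk (EV 13)) (esuc (EV 14)))
    (HIf (elt (EV 6) (eadd (Dg (EV 13)) (Dg (EV 14))))
       (HAsg 21 (EV 13) ;; HAsg 22 (EV 14) ;; remHS ;; bothS 2) HSkip)
    (HIf (elt (eadd (Dg (EV 13)) (Dg (EV 14))) (EV 7))
       (HAsg 21 (EV 13) ;; HAsg 22 (EV 14) ;; addHS ;; bothS 1) HSkip).
Definition touchS v :=
  rotS (EV v) 12 ;; HIf (EV 12) (HAsg 13 (EV v) ;; HAsg 14 (epre (EV 12)) ;; checkS) HSkip.
Definition k2 := emul (EC 2) (EV 0).
Definition touchG :=
  rotS k2 12 ;; HIf (EV 12) (HAsg 13 (EO Div (epre (EV 12)) (EV 0)) ;;
    HAsg 14 (EO Mod (epre (EV 12)) (EV 0)) ;; checkS) HSkip.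

Section Check.
Variables (n w : nat).
Hypothesis hw : 2 * n + 4 * ((2 * n).+1 * (n * n).+1) < 2 ^ w.
Notation run := (run n w).
Notation hT := (@hT n).
Notation arc := (@arc n).
Notation inv := (@inv n).
Notation z0 := (@z0 n).
Implicit Types (L : nat -> seq nat) (x y p q : 'I_n).
Variables (Q B Ub M : nat).
Hypothesis gap0 : 0 < B %/ Q.
Hypothesis Ub3 : 3 <= Ub.
Hypothesis BU : B <= Ub.
Hypothesis W_Ub : 2 * Ub + 10 < 2 ^ w.
Hypothesis W_Y : B ^ 3 < 2 ^ w.
Hypothesis hM : 2 * (Ub %/ (B %/ Q)) + 2 <= M.
Notation params := (params n Q B).
Notation sameG := (sameG n).

Definition bnd (u wl : 'I_n -> 'I_n -> nat) :=
  [/\ forall x y, u x y <= Ub, forall x y, B <= u x y & forall x y, wl x y <= B].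

Definition Tb := 2 * (M * (132 * (Ub + 4) ^ 3) + 1) + 4.
Definition Tc := Tb + 100 * (Ub + 4) ^ 3 + 6.

Lemma params_agree s s' : params s -> agree 9 s s' -> params s'.
Proof. by move=> [e0 e6 e7 e8] ag; split; rewrite ag. Qed.

Lemma both_run s x y md u wl sl : bnd u wl -> params s -> env s 13 = x -> env s 14 = y ->
  (md == 1) || (md == 2) ->
  inv Q (lst s) (cel s) u wl sl (pa (pa z0 md y) md x) (pb (pb z0 md y) md x) ->
  (md = 1 -> hT (lst s) x y /\ cel s 1 x + cel s 1 y < lowf Q B) ->
  run (bothS md) s (fun s' t => [/\ t <= Tb, sameG (lst s) (lst s'), agree 16 s s' &
    inv Q (lst s') (cel s') u wl sl z0 z0]).
Proof.
move=> [u1 u2 u3] P0 ex ey md12 I hp; have [W1 W2 W8] := W_facts hw.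
have mdW : md < 2 ^ w by case/orP: md12 => /eqP->; lia.
apply: run_seq; apply: run_asg => //=; apply: run_seq; apply: run_asg => //=.
rewrite /= ex; set s1 := setv _ 17 _.
have ag1 : agree 16 s s1 by move=> r r16; rewrite /s1 /= /upd !ltn_eqF //; lia.
apply: run_seq.
apply: run_mono (chain_run (s := s1) (x := x) (md := md) (a := pa z0 md y) (b := pb z0 md y)
  hw u1 Ub3 gap0 u2 u3 _ W_Ub W_Y _ _ _ md12 I _ hM) _ => //.
- by move=> p; rewrite /pb /z0; case: (_ && _).
(* The edge just added is light and so protects [y] while the chain from [x] runs. *)
- move=> p; rewrite /pa /z0; case: (boolP ((md == 1) && _)) => [/andP[/eqP m1 /eqP->]|_]; split => // _.
  by have [h lt] := hp m1; exists x; [rewrite (st_hsym (i_str I)) | rewrite addnC].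
move=> s2 t2 [le2 G2 ag2 I2].
have ag02 := agree_trans ag1 ag2.
apply: run_seq; apply: run_asg => //=; apply: run_seq; apply: run_asg => //=.
rewrite ag02 // ey; set s3 := setv _ 17 _.
have ag3 : agree 16 s s3 by move=> r r16; rewrite /s3 /= /upd !ltn_eqF ?ag02 //; lia.
apply: run_mono (chain_run (s := s3) (x := y) (md := md) (a := z0) (b := z0)
  hw u1 Ub3 gap0 u2 u3 _ W_Ub W_Y _ _ _ md12 I2 _ hM) _ => //; try by [apply: params_agree P0 (agreeW _ ag3) | move=> p; split].
move=> s4 t4 [le4 G4 ag4 I4]; split => //.
- by rewrite /Tb; move: le2 le4; clear; lia.
- exact: sameG_trans G2 G4.
- exact: agree_trans ag3 ag4.
Qed.

Lemma check_run s x y u wl sl : bnd u wl -> params s -> env s 13 = x -> env s 14 = y ->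
  inv Q (lst s) (cel s) u wl sl z0 z0 -> arc (lst s) x y ->
  run checkS s (fun s' t => [/\ t <= Tc, sameG (lst s) (lst s'), agree 15 s s' &
    inv Q (lst s') (cel s') (upf u x y B) (upf wl x y B) sl z0 z0]).
Proof.
move=> bd P0 ex ey I A; have [W1 W2 W8] := W_facts hw; have [u1 u2 u3] := bd.
have [e0 e6 e7 e8] := P0; have S := i_str I.
have xn := ltn_ord x; have yn := ltn_ord y; have nn : n <= n * n by rewrite leq_pmulr //; lia.
have xy : x != y by apply: contraTneq A => ->; rewrite (st_irr S).
have bd1 : bnd (upf u x y B) (upf wl x y B).
  by split=> p q; rewrite /upf; case: ifP.
have dU p : cel s 1 p <= Ub by have [] := inv_bound (x := p) I u1 Ub3 (isT : z0 p <= 3) (isT : z0 p <= 2).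
have T0 : 1 <= (Ub + 4) ^ 3 by rewrite expn_gt0; lia.
have lowB : lowf Q B <= B by rewrite leq_subr.
have nz p : 0 <= 2 /\ 0 <= 3 by [].
have skip : (hT (lst s) x y -> cel s 1 x + cel s 1 y <= B) ->
    (~~ hT (lst s) x y -> lowf Q B <= cel s 1 x + cel s 1 y) ->
    inv Q (lst s) (cel s) (upf u x y B) (upf wl x y B) sl z0 z0.
  move=> h1 h2; apply: inv_weak I _ _ => p q; rewrite /upf /pair => H.
    case: ifP => [/orP[]/andP[/eqP E1 /eqP E2]|_]; [right|right|by left].
      by rewrite E1 E2 in H *; apply: h1.
    by rewrite E1 E2 in H *; rewrite addnC h1 // (st_hsym S).
  case: ifP => [/orP[]/andP[/eqP-> /eqP->]|_]; last exact: Or31.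
    by case: (boolP (hT (lst s) x y)) => [h|/h2 h]; [apply: Or32|apply: Or33].
  rewrite addnC (st_hsym S).
  by case: (boolP (hT (lst s) x y)) => [h|/h2 h]; [apply: Or32|apply: Or33].
have fin s' t s1 t1 : agree 15 s s1 -> lst s' = lst s' ->
  t1 <= 100 * (Ub + 4) ^ 3 + 4 -> sameG (lst s) (lst s1) ->
  [/\ t <= Tb, sameG (lst s1) (lst s'), agree 16 s1 s' &
     inv Q (lst s') (cel s') (upf u x y B) (upf wl x y B) sl z0 z0] ->
  [/\ t1 + t + 2 <= Tc, sameG (lst s) (lst s'), agree 15 s s' &
     inv Q (lst s') (cel s') (upf u x y B) (upf wl x y B) sl z0 z0].
  move=> ag1 _ le1 G1 [le G ag I1]; split => //; first by rewrite /Tc; move: le le1; clear; lia.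
    exact: sameG_trans G1 G.
  exact: agree_trans ag1 (agreeW _ ag).
have pairF p q : ~~ ((p == x) && (q == y)) -> ~~ ((p == y) && (q == x)) -> pair x y p q = false.
  by move=> /negPf a /negPf b; rewrite /pair a b.
have pairT : pair x y x y /\ pair x y y x by rewrite /pair !eqxx orbT.
apply: run_if.
  by rewrite /= e0 ex ey addn1; do !split => //; lia.
rewrite /= e0 ex ey addn1 -[_ \in _]/(hT (lst s) x y); case: (boolP (hT (lst s) x y)) => h /=.
  apply: run_if; first by rewrite /= ex ey; do !split => //; have := dU x; have := dU y; lia.
  rewrite /= e6 ex ey; case: ltnP => lt /=; last first.
    apply: run_skip; split => //; first by rewrite /Tc /Tb; move: T0; clear; lia.
    by apply: skip; rewrite ?h.
  apply: run_seq; apply: run_asg => //=; apply: run_seq; apply: run_asg => //=.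
  rewrite /= /upd /= ex ey; set s1 := setv _ 22 _; apply: run_seq.
  apply: run_mono (remH_inv hw (s := s1) (p := x) (q := y) (wl' := upf wl x y B) (u' := upf u x y B)
    (a' := pa (pa z0 2 y) 2 x) (b' := pb (pb z0 2 y) 2 x) u1 Ub3 I e0 _ _ nz h _ _ _ _ _) _ => //.
  - by rewrite /upf pairT.1; apply: leq_trans lowB (ltnW lt).
  - by rewrite /upf pairT.2; apply: leq_trans lowB (ltnW lt).
  - by move=> p q n1 n2; rewrite /upf pairF.
  - by move=> p q n1 n2; rewrite /upf pairF.
  - by move=> p; rewrite /pa /pb /z0 /=; lia.
  move=> s2 t2 [le2 l2 c2 ag2 I2].
  have ag02 : agree 15 s s2.
    move=> r r15; rewrite ag2; last by lia.
    by rewrite /s1 /= /upd !ltn_eqF //; lia.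
  apply: run_mono (both_run (md := 2) bd1 _ _ _ isT I2 _) _ => //.
  - by apply: params_agree P0 (agreeW _ ag02).
  - by rewrite ag02.
  - by rewrite ag02.
  move=> s3 t3 H; have := @fin s3 t3 s2 (t2 + 4) ag02 erefl _ _ H.
  rewrite l2 => /(_ _ (sameG_rem _ _ _)) [|a1 a2 a3 a4]; first by lia.
  by split => //; move: a1; clear; lia.
apply: run_if; first by rewrite /= ex ey; do !split => //; have := dU x; have := dU y; lia.
rewrite /= e7 ex ey; case: ltnP => lt /=; last first.
  apply: run_skip; split => //; first by rewrite /Tc /Tb; move: T0; clear; lia.
  by apply: skip; rewrite ?(negPf h).
apply: run_seq; apply: run_asg => //=; apply: run_seq; apply: run_asg => //=.
rewrite /= /upd /= ex ey; set s1 := setv _ 22 _; apply: run_seq.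
apply: run_mono (addH_inv hw (s := s1) (p := x) (q := y) (wl' := upf wl x y B) (u' := upf (fun _ _ => Ub) x y B)
  (a' := pa (pa z0 1 y) 1 x) (b' := pb (pb z0 1 y) 1 x) u1 Ub3 I e0 _ _ nz A h _ _ _ _ _) _ => //.
- by rewrite /upf pairT.1; apply: leq_trans (ltnW lt) lowB.
- by rewrite /upf pairT.2; apply: leq_trans (ltnW lt) lowB.
- move=> p q hpq; rewrite /upf /pair; case: ifP => // /orP[]/andP[/eqP E1 /eqP E2]; exfalso.
    by move: h; rewrite -E1 -E2 hpq.
  by move: h; rewrite (st_hsym S) -E1 -E2 hpq.
- by move=> p q n1 n2; rewrite /upf pairF.
- by move=> p; rewrite /pa /pb /z0 /=; lia.
move=> s2 t2 [le2 l2 c2 ag2 I2'].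
have I2 : inv Q (lst s2) (cel s2) (upf u x y B) (upf wl x y B) sl (pa (pa z0 1 y) 1 x) (pb (pb z0 1 y) 1 x).
  apply: inv_weak I2' _ _ => p q; last by move=> _; apply: Or31.
  rewrite l2 hT_addL // /upf /pair => hpq; case: ifP hpq => [_ _|pr hpq]; first by left.
  by rewrite orbF in hpq; right; rewrite c2; apply: (i_1 I).
have ag02 : agree 15 s s2.
  move=> r r15; rewrite ag2; last by lia.
  by rewrite /s1 /= /upd !ltn_eqF //; lia.
apply: run_mono (both_run (md := 1) bd1 _ _ _ isT I2 _) _ => //.
- by apply: params_agree P0 (agreeW _ ag02).
- by rewrite ag02.
- by rewrite ag02.
- by move=> _; rewrite l2 c2 hT_addL // !eqxx /= orbT.
move=> s3 t3 H; have := @fin s3 t3 s2 (t2 + 4) ag02 erefl _ _ H.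
rewrite l2 => /(_ _ (sameG_add _ _ _)) [|a1 a2 a3 a4]; first by lia.
by split => //; move: a1; clear; lia.
Qed.

(** One rotation of the queue of [x] repays the loan at [x]. The arc that moves to the end gains
    nothing, but it is checked. *)
Lemma touch_run s v x u wl sl sl' : v < 6 -> bnd u wl -> params s -> env s v = x ->
  inv Q (lst s) (cel s) u wl sl z0 z0 -> (forall y, sl y <= sl' y + (y == x)) ->
  run (touchS v) s (fun s' t => [/\ t <= Tc + 10, sameG (lst s) (lst s'), agree 12 s s' &
    inv Q (lst s') (cel s') u wl sl' z0 z0]).
Proof.
move=> v6 bd P0 ev I hsl; have [W1 W2 W8] := W_facts hw; have [u1 u2 u3] := bd.
have S := i_str I; have xn := ltn_ord x; have nn : n <= n * n by rewrite leq_pmulr //; lia.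
have xk : x <= 2 * n by lia.
have v40 : v < 40 by lia.
apply: run_seq; apply: run_mono (rot_run hw (x := 12) (K := x) isT xk (st_u S xk) _ _) _.
- by move=> e /(st_node S)[y ->]; have := ltn_ord y; lia.
- by move=> s2 _ e2; rewrite /= e2 ?ltn_eqF //; lia.
move=> s2 t2 [Es2 le2].
have ag2 : agree 12 s s2 by move=> y y18; rewrite Es2 /= /upd ltn_eqF.
have [L2 c2] : lst s2 = rotL (lst s) x /\ cel s2 = cel s by rewrite Es2.
have E12 : env s2 12 = head 0 (lst s x) by rewrite Es2 /= /upd.
have evv : env s2 v = x by rewrite ag2 //; lia.
clear Es2; apply: run_if => //; case E : (lst s x) E12 => [|e l] E12; rewrite /= E12 /=.
  apply: run_skip; have L1 : lst s2 = lst s.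
    rewrite L2; apply: functional_extensionality => j; rewrite /rotL.
    by case: eqP => // ->; rewrite E.
  split => //; rewrite ?L1 ?c2 //; first by rewrite /Tc; lia.
  by apply: inv_rot0 I E _ => y yx; have := hsl y; rewrite (negPf yx) addn0.
have [z Ez] : exists z : 'I_n, e = z.+1 by apply: (st_node S (x := x)); rewrite E mem_head.
have zn := ltn_ord z; rewrite Ez /= in E12 *; rewrite Ez in E.
have Ax : arc (lst s) x z by rewrite !arc_mem E mem_head.
have xz : x != z by apply: contraTneq Ax => ->; rewrite (st_irr S).
have mv : minv n (rotL (lst s) x) (cel s 0).
  by apply: minv_perm (i_m I) => k; apply: rotL_perm.
have Iz : inv Q (lst s2) (cel s2) u (upf wl x z 0) sl' z0 z0.
  rewrite L2 c2; apply: inv_rot I E _ _ _ hsl mv.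
  - by move=> p q /negPf n1 /negPf n2; rewrite /upf /pair n1 [(p == z) && _]andbC n2.
  - by rewrite /upf /pair !eqxx.
  - by rewrite /upf /pair !eqxx orbT.
apply: run_seq; apply: run_asg => //=; apply: run_seq; apply: run_asg.
  by rewrite /= /upd /= E12; do !split => //; lia.
rewrite /= /upd /= E12 subn1 /= evv; set s3 := setv _ 14 _.
have ag3 : agree 12 s s3.
  by move=> r r12; rewrite /s3 /= /upd !ltn_eqF ?ag2 //; lia.
apply: run_mono (check_run (s := s3) (x := x) (y := z) _ _ _ _ Iz _) _ => //.
- by split=> // p q; rewrite /upf; case: ifP.
- by apply: params_agree P0 (agreeW _ ag3).
- by rewrite /= L2 arc_rotL.
move=> s4 t4 [le4 G4 ag4 I4]; split => //.
- by move: le2 le4; clear; lia.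
- by rewrite /= L2 in G4; apply: sameG_trans (sameG_rot (lst s) x) G4.
- exact: agree_trans ag3 (agreeW _ ag4).
apply: inv_weak I4 _ _ => p q; rewrite /upf => _.
  by left; case: ifP.
by apply: Or31; case: (pair x z p q).
Qed.

Lemma touchG_run s u wl u' wl' : bnd u wl -> params s ->
  inv Q (lst s) (cel s) u wl z0 z0 z0 ->
  (forall p q, B <= u' p q /\ wl' p q <= B) ->
  (forall p q, arc (lst s) p q -> arcn p q != head 0 (lst s (2 * n)) ->
     u p q <= u' p q /\ wl' p q <= wl p q) ->
  run touchG s (fun s' t => [/\ t <= Tc + 10, lst s' (2 * n) = rot 1 (lst s (2 * n)),
    forall k, k < n -> perm_eq (lst s' k) (lst s k), agree 12 s s' &
    inv Q (lst s') (cel s') u' wl' z0 z0 z0]).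
Proof.
move=> bd P0 I hb hu; have [W1 W2 W8] := W_facts hw; have [u1 u2 u3] := bd.
have S := i_str I; have [e0 _ _ _] := P0.
apply: run_seq; apply: run_mono (rot_run hw (x := 12) (K := 2 * n) isT (leqnn _) (st_u S (leqnn _)) _ _) _.
- by move=> e /(st_arcn S)[x [y ->]]; case/andP: (arcn_le x y).
- by move=> s2 _ e2; rewrite /= e2 // e0; do !split => //; lia.
move=> s2 t2 [Es2 le2].
have ag2 : agree 12 s s2 by move=> y y18; rewrite Es2 /= /upd ltn_eqF.
have [L2 c2] : lst s2 = rotL (lst s) (2 * n) /\ cel s2 = cel s by rewrite Es2.
have E12 : env s2 12 = head 0 (lst s (2 * n)) by rewrite Es2 /= /upd.
have I2 : inv Q (lst s2) (cel s2) u wl z0 z0 z0 by rewrite L2 c2; apply: inv_rotG.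
have S2 := i_str I2.
have top : lst s2 (2 * n) = rot 1 (lst s (2 * n)) by rewrite L2 /rotL eqxx.
have prm k : perm_eq (lst s2 k) (lst s k) by rewrite L2; apply: rotL_perm.
clear Es2; apply: run_if => //; case E : (lst s (2 * n)) E12 => [|e l] E12; rewrite /= E12 /=.
  apply: run_skip; split => //; [by rewrite /Tc; lia|by rewrite top E|].
  apply: inv_weak I2 _ _ => p q.
    by move/(st_sub S2); rewrite -(st_arc S2) top E.
  by rewrite -(st_arc S2) top E.
have [x [y Ez]] : exists x y, e = arcn x y by apply: (st_arcn S); rewrite E mem_head.
have xn := ltn_ord x; have yn := ltn_ord y; rewrite Ez /= in E12 *; rewrite Ez in E.
have n0 : 0 < n by lia.
have Axy : arc (lst s) x y by rewrite -(st_arc S) E mem_head.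
have [dv md] : (x * n + y) %/ n = x /\ (x * n + y) %% n = y.
  by rewrite divnMDl // divn_small // addn0 modnMDl modn_small.
have P2 := arcn_le x y.
apply: run_seq; apply: run_asg; first by rewrite /= E12; do !split => //; lia.
rewrite /= E12 subn1 /= (ag2 0) // e0 dv; apply: run_seq; apply: run_asg.
  by rewrite /= /upd /= E12; do !split => //; lia.
rewrite /= /upd /= E12 subn1 /= (ag2 0) // e0 md; set s3 := setv _ 14 _.
have ag3 : agree 12 s s3.
  by move=> r r12; rewrite /s3 /= /upd !ltn_eqF ?ag2 //; lia.
apply: run_mono (check_run (s := s3) (x := x) (y := y) bd _ _ _ I2 _) _ => //.
- by apply: params_agree P0 (agreeW _ ag3).
- by rewrite /= !arc_mem (perm_mem (prm _)).
move=> s4 t4 [le4 [G4 top4] ag4 I4]; split => //.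
- by move: le2 le4; clear; lia.
- by rewrite top4 /= top E.
- by move=> k kn; apply: perm_trans (G4 k kn) (prm k).
- exact: agree_trans ag3 (agreeW _ ag4).
have S4 := i_str I4.
have A4 p q : arc (lst s4) p q = arc (lst s) p q.
  by rewrite !arc_mem (perm_mem (G4 _ (ltn_ord p))) /= (perm_mem (prm _)).
have ne p q : pair x y p q = false -> arcn p q != head 0 (lst s (2 * n)).
  by move=> /negbT; apply: contraNneq; rewrite E /= => /arcn_inj[-> ->]; rewrite /pair !eqxx.
apply: inv_weak I4 _ _ => p q; rewrite /upf.
  move=> /(st_sub S4); rewrite A4 => A; left.
  case: ifP => pr; first by have [] := hb p q.
  by have [] := hu p q A (ne _ _ pr).
rewrite A4 => A; apply: Or31; case: ifP => pr; first by have [] := hb p q.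
by have [] := hu p q A (ne _ _ pr).
Qed.
End Check.

(** * Processing an update *)

Definition pow8 e := emul (emul (emul e e) (emul e e)) (emul (emul e e) (emul e e)).
(** The base is found again from scratch in O(B) steps, which is cheap next to [B ^ 3]. *)
Definition calcS Q :=
  HAsg 6 (EC Q) ;;
  HWhile (elt (pow8 (EV 6)) (emul (EC (Q ^ 8)) (ELen k2))) (HAsg 6 (esuc (EV 6))) ;;
  HAsg 7 (esub (EV 6) (EO Div (EV 6) (EC Q))) ;;
  HAsg 8 (emul (EV 6) (emul (EV 6) (EV 6))).
(** An update changes the number of arcs by two. With [8 * Q] inspections the quotients by [4 * Q]
    in the outdated thresholds advance by two as well; two more inspections make up for the arcs
    deleted from the global queue. *)
Definition sweepS Q :=
  HAsg 10 (EC (8 * Q + 2)) ;; HWhile (EV 10) (touchG ;; HAsg 10 (epre (EV 10))).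
Definition arcE a b := esuc (eadd (emul (EV a) (EV 0)) (EV b)).
Definition linkS :=
  HIns (EV 2) (esuc (EV 3)) ;; HIns (EV 3) (esuc (EV 2)) ;; HIns k2 (arcE 2 3) ;; HIns k2 (arcE 3 2).
Definition unlinkS :=
  HDel (EV 2) (esuc (EV 3)) ;; HDel (EV 3) (esuc (EV 2)) ;; HDel k2 (arcE 2 3) ;; HDel k2 (arcE 3 2).
Definition insS Q :=
  linkS ;; calcS Q ;; HAsg 13 (EV 2) ;; HAsg 14 (EV 3) ;; checkS ;; sweepS Q.
Definition delrS Q :=
  unlinkS ;; calcS Q ;; HIf (EV 9) (HAsg 13 (EV 2) ;; HAsg 14 (EV 3) ;; bothS 2) HSkip ;;
  touchS 2 ;; touchS 3 ;; sweepS Q.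
(** The edge leaves H and the matching before it leaves G. The decrements of its ends, if any, are
    worked off only after the new base is known. *)
Definition delS Q :=
  HAsg 9 (EFlg (hk (EV 2)) (esuc (EV 3))) ;;
  HIf (EV 9) (HAsg 21 (EV 2) ;; HAsg 22 (EV 3) ;; remHS) HSkip ;; delrS Q.
Definition mainS Q := HIf (EV 1) (insS Q) (delS Q).

Section Main.
Variables (n w : nat).
Hypothesis hw : 2 * n + 4 * ((2 * n).+1 * (n * n).+1) < 2 ^ w.
Notation run := (run n w).
Notation hT := (@hT n).
Notation arc := (@arc n).
Notation inv := (@inv n).
Notation str := (str n).
Notation z0 := (@z0 n).
Implicit Types (L : nat -> seq nat) (x y p q : 'I_n).
Variables (Q : nat).
Hypothesis Q3 : 3 <= Q.
Hypothesis WB : (4 * Bf Q (n * n) + 10) ^ 8 < 2 ^ w.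

(** An arc with k arcs behind it was last checked about k / (8 * Q) updates ago, and each update
    changed the number of arcs by two. So the number at that time differs from [N] by at most about
    k / (4 * Q). [S] counts the inspections still owed in the current update. *)
Definition uf N l S : 'I_n -> 'I_n -> nat := fun p q => Bf Q (N + (behind l (arcn p q) + S) %/ (4 * Q)).
Definition wf N l S : 'I_n -> 'I_n -> nat := fun p q => Bf Q (N - (behind l (arcn p q) + S) %/ (4 * Q)).
Definition good L c :=
  inv Q L c (uf (size (L (2 * n))) (L (2 * n)) 0) (wf (size (L (2 * n))) (L (2 * n)) 0) z0 z0 z0.

Lemma W_bounds N : N <= n * n -> [/\ 0 < Bf Q N %/ Q, 2 * (2 * Bf Q N) + 10 < 2 ^ w,
  Bf Q N ^ 3 < 2 ^ w, 2 * ((2 * Bf Q N) %/ (Bf Q N %/ Q)) + 2 <= 8 * Q + 2 & Bf Q N ^ 8 < 2 ^ w].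
Proof.
move=> le; have QB := Bf_ge Q N; have g0 : 0 < Bf Q N %/ Q by rewrite divn_gt0 //; lia.
have mono := Bf_mono Q le.
have pw k : 0 < k -> k <= 8 -> forall b, b <= 4 * Bf Q (n * n) + 10 -> b ^ k < 2 ^ w.
  move=> k0 k8 b bl; apply: leq_ltn_trans WB; apply: leq_trans (_ : (4 * Bf Q (n * n) + 10) ^ k <= _).
    by rewrite leq_exp2r.
  by rewrite leq_pexp2l //; lia.
split => //.
- by rewrite -[X in X < _]expn1; apply: pw => //; lia.
- by apply: pw => //; lia.
(* As [B / Q] is at least one, [B] is below [2 * Q] times this quotient, which bounds the length of
   a chain by a constant. *)
- rewrite leq_add2r (_ : 8 * Q = 2 * (4 * Q)) ?leq_mul2l /=; last by lia.
  have lt := ltn_ceil (Bf Q N) (_ : 0 < Q); have {}lt := lt (leq_trans (isT : 0 < 3) Q3).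
  apply: leq_trans (leq_div2r _ (_ : _ <= 4 * Q * (Bf Q N %/ Q))) _; last by rewrite mulnK.
  by move: (Bf Q N) (Bf Q N %/ Q) lt g0; clear; nia.
- by apply: pw => //; lia.
Qed.

Lemma uf_bnd N l S : size l = N -> S <= 8 * Q + 2 -> bnd (Bf Q N) (2 * Bf Q N) (uf N l S) (wf N l S).
Proof.
move=> sz S8; split=> p q; [|by apply: Bf_mono; apply: leq_addr|by apply: Bf_mono; apply: leq_subr].
apply: leq_trans (Bf_double Q N); apply: Bf_mono.
have := behind_le l (arcn p q); rewrite sz => le.
have : (behind l (arcn p q) + S) %/ (4 * Q) <= N + 8.
  apply: leq_trans (leq_div2r _ (_ : _ <= (N + 8) * (4 * Q))) _; last by rewrite mulnK //; lia.
  by move: le S8 Q3; clear; nia.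
by lia.
Qed.

Lemma calc_run s N : env s 0 = n -> size (lst s (2 * n)) = N -> N <= n * n ->
  run (calcS Q) s (fun s' t => [/\ t <= 4 * Bf Q N + 10, lst s' = lst s, cel s' = cel s,
    forall r, (r < 6) || (r == 9) -> env s' r = env s r & params n Q (Bf Q N) s']).
Proof.
move=> e0 sz Nn; have [g0 w1 w3 _ w8] := W_bounds Nn; have QB := Bf_ge Q N.
have [W1 W2 W8] := W_facts hw.
have Qw : Q < 2 ^ w by lia.
have Q8 : Q ^ 8 < 2 ^ w by apply: leq_ltn_trans w8; rewrite leq_exp2r.
have QN : Q ^ 8 * N < 2 ^ w by apply: leq_ltn_trans w8; apply: Bf_ok.
apply: run_seq; apply: run_asg => //=; set s1 := setv s 6 Q.
pose I s' := [/\ lst s' = lst s, cel s' = cel s, forall r, r != 6 -> env s' r = env s r &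
  Q <= env s' 6 <= Bf Q N].
have EVV s' : I s' -> eval s' (elt (pow8 (EV 6)) (emul (EC (Q ^ 8)) (ELen k2))) = (env s' 6 ^ 8 < Q ^ 8 * N).
  move=> [l' c' e' _]; rewrite /= l' (e' 0) // e0 sz !mulnn -!expnM.
  by have -> : 2 * (2 * 2) = 8 by [].
apply: run_seq; apply: run_mono (@run_while n w hw I (fun s' => Bf Q N - env s' 6) 1
  (elt (pow8 (EV 6)) (emul (EC (Q ^ 8)) (ELen k2))) (HAsg 6 (esuc (EV 6))) s1 _ _) _.
- move=> s' I'; have [l' c' e' /andP[b1 b2]] := I'; split.
    have bp k : 0 < k -> k <= 8 -> env s' 6 ^ k < 2 ^ w.
      move=> k0 k8; apply: leq_ltn_trans w8; apply: leq_trans (_ : Bf Q N ^ k <= _).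
        by rewrite leq_exp2r.
      by rewrite leq_pexp2l //; lia.
    have := bp 2 isT isT; have := bp 4 isT isT; have := bp 8 isT isT => h8 h4 h2.
    rewrite /= l' (e' 0) // e0 sz !mulnn -!expnM.
    by do !split => //; lia.
  rewrite EVV //; case: ltnP => // lt _; have bB : env s' 6 < Bf Q N.
    rewrite ltn_neqAle b2 andbT; apply: contraTneq lt => ->; rewrite -leqNgt; exact: Bf_ok.
  apply: run_asg; first by rewrite /=; do !split => //; lia.
  split => //; last by rewrite /= /upd /=; lia.
  split => //; last by rewrite /= /upd /=; lia.
  by move=> r r6; rewrite /= /upd (negPf r6) e'.
- split => //; last by rewrite /s1 /= /upd /= leqnn.
  by move=> r r6; rewrite /s1 /= /upd (negPf r6).
move=> s2 t2 [I2 ez le2]; rewrite EVV // in ez; have [l2 c2 e2 /andP[b1 b2]] := I2.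
have E6 : env s2 6 = Bf Q N.
  apply/eqP; rewrite eqn_leq b2 /=; apply: Bf_le => //.
  by move: ez; case: ltnP.
apply: run_seq; apply: run_asg.
  by rewrite /= E6; do !split => //; rewrite leq_div.
apply: run_asg.
  have BB : Bf Q N * Bf Q N < 2 ^ w.
    by apply: leq_ltn_trans w3; rewrite mulnn leq_pexp2l //; move: Q3 QB; clear; lia.
  have BBB : Bf Q N * (Bf Q N * Bf Q N) < 2 ^ w by rewrite mulnn -expnS.
  by rewrite /= /upd /= E6; do !split.
rewrite /= /upd /= E6; split => //.
- by move: le2; rewrite /s1 /= /upd /=; clear; lia.
- by move=> r /orP[r6|/eqP->]; rewrite /= ?ltn_eqF ?e2 //; lia.
by split; rewrite /= /upd /=; [rewrite e2|rewrite E6| |rewrite mulnn -expnS].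
Qed.

Lemma sweep_run s N : params n Q (Bf Q N) s -> size (lst s (2 * n)) = N -> N <= n * n ->
  inv Q (lst s) (cel s) (uf N (lst s (2 * n)) (8 * Q + 2)) (wf N (lst s (2 * n)) (8 * Q + 2)) z0 z0 z0 ->
  run (sweepS Q) s (fun s' t => [/\ t <= (8 * Q + 2) * (Tc (2 * Bf Q N) (8 * Q + 2) + 13) + 2,
    perm_eq (lst s' (2 * n)) (lst s (2 * n)), forall k, k < n -> perm_eq (lst s' k) (lst s k) &
    good (lst s') (cel s')]).
Proof.
move=> P0 sz Nn I; have [g0 w1 w3 hM w8] := W_bounds Nn; have QB := Bf_ge Q N.
have [W1 W2 W8] := W_facts hw; have BU : Bf Q N <= 2 * Bf Q N by lia.
have Ub3 : 3 <= 2 * Bf Q N by lia.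
have W_S : 8 * Q + 2 < 2 ^ w.
  apply: leq_ltn_trans w8; apply: leq_trans (_ : Q ^ 8 <= _); last by rewrite leq_exp2r.
  rewrite expnS; have : 3 ^ 7 <= Q ^ 7 by rewrite leq_exp2r.
  have -> : 3 ^ 7 = 2187 by []. move: (Q ^ 7) Q3 => X; clear; nia.
apply: run_seq; apply: run_asg => //; set s1 := setv s 10 _.
pose J s' := [/\ params n Q (Bf Q N) s', perm_eq (lst s' (2 * n)) (lst s (2 * n)),
  forall k, k < n -> perm_eq (lst s' k) (lst s k), env s' 10 <= 8 * Q + 2 &
  inv Q (lst s') (cel s') (uf N (lst s' (2 * n)) (env s' 10)) (wf N (lst s' (2 * n)) (env s' 10)) z0 z0 z0].
apply: run_mono (@run_while n w hw J (fun s' => env s' 10) (Tc (2 * Bf Q N) (8 * Q + 2) + 11)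
  (EV 10) (touchG ;; HAsg 10 (epre (EV 10))) s1 _ _) _.
- move=> s' [P' p2 pk S8 I']; split; first by [].
  rewrite /=; case E10 : (env s' 10) S8 I' => [|S] // S8 I' _.
  have sz' : size (lst s' (2 * n)) = N by rewrite (perm_size p2).
  apply: run_seq; apply: run_mono (touchG_run hw g0 Ub3 BU w1 w3 hM
    (u' := uf N (rot 1 (lst s' (2 * n))) S) (wl' := wf N (rot 1 (lst s' (2 * n))) S)
    (uf_bnd sz' S8) P' I' _ _) _.
  + by move=> p q; split; apply: Bf_mono; rewrite ?leq_addr ?leq_subr.
  + move=> p q A ne; have S' := i_str I'.
    have mem : arcn p q \in lst s' (2 * n) by rewrite (st_arc S').
    have E : behind (rot 1 (lst s' (2 * n))) (arcn p q) = (behind (lst s' (2 * n)) (arcn p q)).+1.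
      have /andP[_ us] := st_u S' (leqnn (2 * n)).
      by case: (lst s' (2 * n)) mem ne us => // e l; move=> mem ne us; apply: behind_rot.
    by rewrite /uf /wf E addSnnS.
  move=> s2 t2 [le2 top2 pk2 ag2 I2].
  have E2 : env s2 10 = S.+1 by rewrite ag2.
  apply: run_asg; first by rewrite /= E2; do !split => //; lia.
  split; [|by rewrite /= /upd /= E2; lia|by lia].
  split.
  + by case: P' => a1 a2 a3 a4; split; rewrite /= /upd /= ag2.
  + by rewrite /= top2 perm_rot.
  + by move=> k kn; apply: perm_trans (pk2 k kn) (pk k kn).
  + by rewrite /= /upd /= E2; lia.
  + by rewrite /= /upd /= E2 subn1 /= top2.
- split => //; by case: P0 => a1 a2 a3 a4; split.
move=> s2 t2 [[P2 p2 pk2 S2 I2] z2 le2]; rewrite /= in z2; rewrite /s1 /= /upd /= in le2.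
split => //; last by rewrite /good (perm_size p2) sz; move: I2; rewrite z2.
by move: le2; clear; lia.
Qed.

Lemma link_run s x y : env s 0 = n -> env s 2 = x -> env s 3 = y -> x != y ->
  str (lst s) -> ~~ arc (lst s) x y ->
  run linkS s (fun s' t => s' = HSt (env s) (linkL (lst s) x y) (cel s) /\ t = 4).
Proof.
move=> e0 e2 e3 xy S nA; have [W1 W2 W8] := W_facts hw.
have xn := ltn_ord x; have yn := ltn_ord y; have nn : n <= n * n by rewrite leq_pmulr //; lia.
have nA' : ~~ arc (lst s) y x by rewrite (st_sym S).
have axy : arcn y x != arcn x y.
  by apply/eqP => /arcn_inj[E]; rewrite E eqxx in xy.
have yx : ((y : nat) == x) = false by rewrite (inj_eq val_inj) eq_sym (negPf xy).
have [tx ty] : (2 * n == x) = false /\ (2 * n == y) = false by rewrite !ord_top.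
have /andP[b1 b2] := arcn_le x y; have /andP[b3 b4] := arcn_le y x.
have m1 : arcn x y \notin lst s (2 * n) by rewrite (st_arc S).
have m2 : arcn y x \notin rcons (lst s (2 * n)) (arcn x y).
  by rewrite mem_rcons inE (negPf axy) (st_arc S).
have xl : x * n < 2 ^ w by move: b2; rewrite /arcn; lia.
have yl : y * n < 2 ^ w by move: b4; rewrite /arcn; lia.
apply: run_seq; apply: run_ins; rewrite /= ?e0 ?e2 ?e3 ?addn1 //=; try by [do ?split; lia | lia].
apply: run_seq; apply: run_ins; rewrite /= ?e0 ?e2 ?e3 ?addn1 ?yx //=; try by [do ?split; lia | lia].
have ex : x * n + y + 1 = arcn x y by rewrite /arcn addn1.
have ey : y * n + x + 1 = arcn y x by rewrite /arcn addn1.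
apply: run_seq; apply: run_ins; rewrite /= ?e0 ?e2 ?e3 ?ex ?ty ?tx //=; try by [do ?split; move: b2; rewrite -?ex; lia | lia].
apply: run_ins; rewrite /= ?e0 ?e2 ?e3 ?ey ?ty ?tx ?eqxx ?ex //=; try by [do ?split; move: b4; rewrite -?ey; lia | lia].
split => //; rewrite /setl /=; congr (HSt _ _ _); apply: functional_extensionality => j.
rewrite /linkL; case: (eqVneq j (2 * n)) => [->|j2].
  by rewrite tx ty.
case: (eqVneq j y) => [->|jy]; first by rewrite yx.
by case: (eqVneq j x) => [->|].
Qed.

Lemma unlink_run s x y : env s 0 = n -> env s 2 = x -> env s 3 = y -> x != y ->
  str (lst s) -> arc (lst s) x y ->
  run unlinkS s (fun s' t => s' = HSt (env s) (unlinkL (lst s) x y) (cel s) /\ t = 4).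
Proof.
move=> e0 e2 e3 xy S A; have [W1 W2 W8] := W_facts hw.
have xn := ltn_ord x; have yn := ltn_ord y; have nn : n <= n * n by rewrite leq_pmulr //; lia.
have A' : arc (lst s) y x by rewrite (st_sym S).
have axy : arcn y x != arcn x y.
  by apply/eqP => /arcn_inj[E]; rewrite E eqxx in xy.
have yx : ((y : nat) == x) = false by rewrite (inj_eq val_inj) eq_sym (negPf xy).
have [tx ty] : (2 * n == x) = false /\ (2 * n == y) = false by rewrite !ord_top.
have /andP[b1 b2] := arcn_le x y; have /andP[b3 b4] := arcn_le y x.
have u : uniq (lst s (2 * n)) by case/andP: (st_u S (leqnn _)).
have m1 : arcn x y \in lst s (2 * n) by rewrite (st_arc S).
have m2 : arcn y x \in rem (arcn x y) (lst s (2 * n)).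
  by rewrite mem_rem_uniq // inE axy (st_arc S).
have xl : x * n < 2 ^ w by move: b2; rewrite /arcn; lia.
have yl : y * n < 2 ^ w by move: b4; rewrite /arcn; lia.
apply: run_seq; apply: run_del; rewrite /= ?e0 ?e2 ?e3 ?addn1 //=; try by [do ?split; lia | lia].
apply: run_seq; apply: run_del; rewrite /= ?e0 ?e2 ?e3 ?addn1 ?yx //=; try by [do ?split; lia | lia].
have ex : x * n + y + 1 = arcn x y by rewrite /arcn addn1.
have ey : y * n + x + 1 = arcn y x by rewrite /arcn addn1.
apply: run_seq; apply: run_del; rewrite /= ?e0 ?e2 ?e3 ?ex ?ty ?tx //=; try by [do ?split; move: b2; rewrite -?ex; lia | lia].
apply: run_del; rewrite /= ?e0 ?e2 ?e3 ?ey ?ty ?tx ?eqxx ?ex //=; try by [do ?split; move: b4; rewrite -?ey; lia | lia].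
split => //; rewrite /setl /=; congr (HSt _ _ _); apply: functional_extensionality => j.
rewrite /unlinkL; case: (eqVneq j (2 * n)) => [->|j2].
  by rewrite tx ty.
case: (eqVneq j y) => [->|jy]; first by rewrite yx.
by case: (eqVneq j x) => [->|].
Qed.

Definition CT := (8 * Q + 10) * (264 * (8 * Q + 2) + 400).

Lemma time_bound B t : 3 <= B -> t <= (8 * Q + 2) * (Tc (2 * B) (8 * Q + 2) + 13)
  + 3 * (Tc (2 * B) (8 * Q + 2) + 20) + 4 * B + 100 * (4 * B + 4) ^ 3 + 40 ->
  t <= CT * (4 * B + 4) ^ 3.
Proof.
move=> B3 le; apply: leq_trans le _; rewrite /CT /Tc /Tb.
set T := (4 * B + 4) ^ 3; set T' := (2 * B + 4) ^ 3; set M := 8 * Q + 2.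
have T1 : 4 * B + 4 <= T by rewrite /T -{1}[4 * B + 4]expn1 leq_pexp2l //; lia.
have TT : T' <= T by rewrite leq_exp2r //; lia.
have -> : 8 * Q + 10 = M + 8 by rewrite /M; lia.
set X := (X in M * (X + 13)); rewrite -mulnA; set Y := (264 * M + 400) * T.
have XY : X + 40 <= (264 * M + 200) * T.
  have mM : M * T' <= M * T by rewrite leq_mul2l TT orbT.
  rewrite /X mulnDl -mulnA [M * (132 * T')]mulnCA; clearbody T T'.
  by move: (M * T) (M * T') mM TT T1; clear; lia.
have YY : (264 * M + 200) * T + 200 * T = Y by rewrite /Y -mulnDl; congr (_ * _); lia.
have h1 : M * (X + 13) <= M * Y by rewrite leq_mul2l; apply/orP; right; lia.
rewrite -/X mulnDl; clearbody X Y T; move: (M * Y) (M * (X + 13)) h1 XY YY T1 => a b; clear; lia.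
Qed.

Lemma uf_shift b S N : S = 8 * Q + 2 ->
  [/\ N + b %/ (4 * Q) <= N + 2 + (b + 2 + S) %/ (4 * Q),
      N + 2 - (b + 2 + S) %/ (4 * Q) <= N - b %/ (4 * Q) &
      forall d, b <= d + 2 -> 2 <= N ->
       N + b %/ (4 * Q) <= N - 2 + (d + S) %/ (4 * Q) /\
       N - 2 - (d + S) %/ (4 * Q) <= N - b %/ (4 * Q)].
Proof.
move=> ->; have Q0 : 0 < 4 * Q by lia.
have D k : b <= k -> b %/ (4 * Q) + 2 <= (k + 8 * Q) %/ (4 * Q).
  move=> bk; have -> : 8 * Q = 2 * (4 * Q) by lia.
  have -> : k + 2 * (4 * Q) = 2 * (4 * Q) + k by lia.
  by rewrite divnMDl // addnC leq_add2l leq_div2r.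
have := D (b + 4) (leq_addr _ _); have -> : b + 4 + 8 * Q = b + 2 + (8 * Q + 2) by lia.
move=> d1; split; [by move: d1; clear; lia|by move: d1; clear; lia|move=> d bd N2].
have := D _ bd; have -> : d + 2 + 8 * Q = d + (8 * Q + 2) by lia.
by move: N2; clear; lia.
Qed.

Lemma ins_run s x y : env s 0 = n -> env s 2 = x -> env s 3 = y -> x != y ->
  good (lst s) (cel s) -> ~~ arc (lst s) x y ->
  run (insS Q) s (fun s' t => [/\ t <= CT * (4 * Bf Q (size (lst s' (2 * n))) + 4) ^ 3,
    good (lst s') (cel s') & forall p q, arc (lst s') p q = arc (lst s) p q || pair x y p q]).
Proof.
move=> e0 e2 e3 xy I nA; have S := i_str I; have [W1 W2 W8] := W_facts hw.
apply: run_seq; apply: run_mono (link_run e0 e2 e3 xy S nA) _ => s1 t1 [Es1 ->].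
have [E0 E2 E3] : [/\ env s1 0 = n, env s1 2 = x & env s1 3 = y] by rewrite Es1.
have L1 : lst s1 = linkL (lst s) x y by rewrite Es1.
have c1 : cel s1 = cel s by rewrite Es1.
clear Es1; set N0 := size (lst s (2 * n)) in I.
have top1 := (link_top (lst s) x y).1.
have sz : size (lst s1 (2 * n)) = N0 + 2 by rewrite L1 top1 !size_rcons addn2.
have Nn : N0 + 2 <= n * n by rewrite -sz L1; apply: str_size (str_link S xy nA).
have [g0 w1 w3 hM w8] := W_bounds Nn; have QB := Bf_ge Q (N0 + 2).
set B := Bf Q (N0 + 2) in g0 w1 w3 hM w8 QB.
have BU : B <= 2 * B by rewrite leq_pmull.
have Ub3 : 3 <= 2 * B by apply: leq_trans BU; apply: leq_trans QB.
apply: run_seq; apply: run_mono (calc_run E0 sz Nn) _ => s2 t2 [le2 l2 c2 ag2 P2].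
apply: run_seq; apply: run_asg => //=; apply: run_seq; apply: run_asg => //=.
rewrite /= !ag2 //= /upd /= E2 ag2 // E3; set s3 := setv _ 14 _.
have bd := uf_bnd sz (leqnn (8 * Q + 2)).
set u := uf _ _ _ in bd; set wl := wf _ _ _ in bd.
have P3 : params n Q B s3 by case: P2 => a1 a2 a3 a4; split.
have bh p q : arc (lst s) p q ->
    behind (lst s1 (2 * n)) (arcn p q) = behind (lst s (2 * n)) (arcn p q) + 2.
  rewrite -(st_arc S) => m; rewrite L1 top1 !behind_rcons ?addn2 //.
  by rewrite mem_rcons inE m orbT.
have I3 : inv Q (lst s3) (cel s3) u (upf wl x y 0) z0 z0 z0.
  rewrite /= l2 c2 L1 c1; apply: inv_link I xy nA _ _ => p q A.
    by rewrite /u /uf (bh p q A) addn0; apply: Bf_mono; have [] := uf_shift (behind (lst s (2 * n)) (arcn p q)) N0 erefl.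
  by rewrite /wl /wf (bh p q A) addn0; apply: Bf_mono; have [] := uf_shift (behind (lst s (2 * n)) (arcn p q)) N0 erefl.
have [bd1 bd2 bd3] := bd.
apply: run_seq; apply: run_mono (check_run hw g0 Ub3 BU w1 w3 hM (s := s3) (x := x) (y := y) _ P3 _ _ I3 _) _ => //.
- by split=> // p q; rewrite /upf; case: ifP.
- by rewrite /= l2 L1 arc_link // /pair !eqxx orbT.
move=> s4 t4 [le4 [G4 top4] ag4 I4].
have sz4 : size (lst s4 (2 * n)) = N0 + 2 by rewrite top4 /= l2.
have P4 : params n Q B s4 by case: P3 => a1 a2 a3 a4; split; rewrite ag4.
have I5 : inv Q (lst s4) (cel s4) (uf (N0 + 2) (lst s4 (2 * n)) (8 * Q + 2))
    (wf (N0 + 2) (lst s4 (2 * n)) (8 * Q + 2)) z0 z0 z0.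
  have Eu : uf (N0 + 2) (lst s4 (2 * n)) (8 * Q + 2) = u by rewrite top4 /= l2.
  have Ew : wf (N0 + 2) (lst s4 (2 * n)) (8 * Q + 2) = wl by rewrite top4 /= l2.
  rewrite Eu Ew; apply: inv_weak I4 _ _ => p q; rewrite /upf => _; first by left; case: ifP.
  by apply: Or31; case: (pair x y p q).
apply: run_mono (sweep_run P4 sz4 Nn I5) _ => s5 t5 [le5 p5 pk5 G5]; split => //.
  rewrite (perm_size p5) sz4; apply: time_bound; first exact: leq_trans Q3 QB.
  by rewrite -/B in le2 le5 *; move: le2 le4 le5; clear; lia.
move=> p q; rewrite !arc_mem (perm_mem (pk5 _ (ltn_ord p))) (perm_mem (G4 _ (ltn_ord p))) /= l2 L1.
exact: arc_link.
Qed.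

Lemma delr_run s x y fl : env s 0 = n -> env s 2 = x -> env s 3 = y -> env s 9 = nat_of_bool fl ->
  x != y -> 2 <= size (lst s (2 * n)) ->
  inv Q (lst s) (cel s) (uf (size (lst s (2 * n))) (lst s (2 * n)) 0)
    (upf (wf (size (lst s (2 * n))) (lst s (2 * n)) 0) x y 0) z0 z0
    (if fl then pb (pb z0 2 y) 2 x else z0) ->
  arc (lst s) x y -> ~~ hT (lst s) x y ->
  run (delrS Q) s (fun s' t => [/\ size (lst s' (2 * n)) + 2 = size (lst s (2 * n)),
    t <= (8 * Q + 2) * (Tc (2 * Bf Q (size (lst s' (2 * n)))) (8 * Q + 2) + 13)
      + 3 * (Tc (2 * Bf Q (size (lst s' (2 * n)))) (8 * Q + 2) + 20)
      + 4 * Bf Q (size (lst s' (2 * n))) + 30,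
    good (lst s') (cel s') & forall p q, arc (lst s') p q = arc (lst s) p q && ~~ pair x y p q]).
Proof.
move=> e0 e2 e3 e9 xy N2 I A nh; have S := i_str I; have [W1 W2 W8] := W_facts hw.
apply: run_seq; apply: run_mono (unlink_run e0 e2 e3 xy S A) _ => s1 t1 [Es1 ->].
have [E0 E2 E3 E9] : [/\ env s1 0 = n, env s1 2 = x, env s1 3 = y & env s1 9 = nat_of_bool fl] by rewrite Es1.
have L1 : lst s1 = unlinkL (lst s) x y by rewrite Es1.
have c1 : cel s1 = cel s by rewrite Es1.
clear Es1; set N0 := size (lst s (2 * n)) in N2 I *.
have top1 := (link_top (lst s) x y).2.
have us : uniq (lst s (2 * n)) by case/andP: (st_u S (leqnn _)).
have axy : arcn y x != arcn x y by apply/eqP => /arcn_inj[E]; rewrite E eqxx in xy.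
have sz : size (lst s1 (2 * n)) = N0 - 2.
  rewrite L1 top1 size_rem; last by rewrite mem_rem_uniq // inE axy (st_arc S) (st_sym S).
  by rewrite size_rem ?(st_arc S) // subn2.
have Nn : N0 - 2 <= n * n by rewrite -sz L1; apply: str_size (str_unlink S xy nh).
have [g0 w1 w3 hM w8] := W_bounds Nn; have QB := Bf_ge Q (N0 - 2).
set B := Bf Q (N0 - 2) in g0 w1 w3 hM w8 QB.
have BU : B <= 2 * B by rewrite leq_pmull.
have Ub3 : 3 <= 2 * B by apply: leq_trans BU; apply: leq_trans QB.
apply: run_seq; apply: run_mono (calc_run E0 sz Nn) _ => s2 t2 [le2 l2 c2 ag2 P2].
have bd := uf_bnd sz (leqnn (8 * Q + 2)).
set u := uf _ _ _ in bd; set wl := wf _ _ _ in bd.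
have bh p q : arc (lst s) p q -> ~~ pair x y p q ->
    behind (lst s (2 * n)) (arcn p q) <= behind (lst s1 (2 * n)) (arcn p q) + 2.
  rewrite -(st_arc S) => m np; rewrite L1 top1.
  have n1 : arcn p q != arcn x y by apply: contraNneq np => /arcn_inj[-> ->]; rewrite /pair !eqxx.
  have n2 : arcn p q != arcn y x by apply: contraNneq np => /arcn_inj[-> ->]; rewrite /pair !eqxx orbT.
  have m1 : arcn p q \in rem (arcn x y) (lst s (2 * n)) by rewrite mem_rem_uniq // inE n1.
  by rewrite addn2; apply: leq_trans (behind_rem m n1) _; rewrite ltnS; apply: behind_rem m1 n2.
pose sl := fun p : 'I_n => (p == x) + (p == y).
have I2 : inv Q (lst s2) (cel s2) u wl sl z0 (if fl then pb (pb z0 2 y) 2 x else z0).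
  rewrite l2 c2 L1 c1; apply: inv_unlink I xy nh _ _ => p q Ap np;
    have [_ _ H] := uf_shift (behind (lst s (2 * n)) (arcn p q)) N0 erefl;
    have [h1 h2] := H _ (bh p q Ap np) N2.
    by rewrite /u /uf addn0; apply: Bf_mono.
  by rewrite /wl /wf /upf (negPf np) addn0; apply: Bf_mono.
have [F0 F2 F3 F9] : [/\ env s2 0 = n, env s2 2 = x, env s2 3 = y & env s2 9 = nat_of_bool fl].
  by rewrite !ag2.
have step : run (HIf (EV 9) (HAsg 13 (EV 2) ;; HAsg 14 (EV 3) ;; bothS 2) HSkip) s2
    (fun s' t => [/\ t <= Tc (2 * B) (8 * Q + 2), sameG n (lst s2) (lst s'), agree 9 s2 s' &
       inv Q (lst s') (cel s') u wl sl z0 z0]).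
  apply: run_if => //; rewrite /= F9; case: (fl) I2 => /= I2; last first.
    by apply: run_skip; split => //; rewrite /Tc; clear; lia.
  apply: run_seq; apply: run_asg => //=; apply: run_seq; apply: run_asg => //=.
  rewrite /= /upd /= F2 F3; set s3 := setv _ 14 _.
  apply: run_mono (both_run hw g0 Ub3 BU w1 w3 hM (s := s3) (x := x) (y := y) (md := 2) bd _ _ _ isT I2 _) _ => //.
  move=> s4 t4 [le4 G4 ag4 I4]; split => //; first by rewrite /Tc; lia.
  by move=> r r9; rewrite ag4 /= /upd ?ltn_eqF //; lia.
apply: run_seq; apply: run_mono step _ => s3 t3 [le3 G3 ag3 I3].
have P3 := params_agree P2 ag3.
have H2 : env s3 2 = x by rewrite ag3.
apply: run_seq; apply: run_mono (touch_run hw g0 Ub3 BU w1 w3 hM (v := 2) (x := x)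
  (sl' := fun p => (p == y : nat)) isT bd P3 H2 I3 _) _.
  by move=> p; rewrite /sl addnC.
move=> s4 t4 [le4 G4 ag4 I4].
have P4 := params_agree P3 (agreeW (isT : 9 <= 12) ag4).
have H3 : env s4 3 = y by rewrite ag4 // ag3.
apply: run_seq; apply: run_mono (touch_run hw g0 Ub3 BU w1 w3 hM (v := 3) (x := y)
  (sl' := z0) isT bd P4 H3 I4 _) _ => //.
move=> s5 t5 [le5 G5 ag5 I5].
have P5 := params_agree P4 (agreeW (isT : 9 <= 12) ag5).
have [G25 top5] := sameG_trans G3 (sameG_trans G4 G5).
have sz5 : size (lst s5 (2 * n)) = N0 - 2 by rewrite top5 l2.
have I6 : inv Q (lst s5) (cel s5) (uf (N0 - 2) (lst s5 (2 * n)) (8 * Q + 2))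
    (wf (N0 - 2) (lst s5 (2 * n)) (8 * Q + 2)) z0 z0 z0 by rewrite top5 l2.
apply: run_mono (sweep_run P5 sz5 Nn I6) _ => s6 t6 [le6 p6 pk6 G6].
have sz6 : size (lst s6 (2 * n)) = N0 - 2 by rewrite (perm_size p6).
split => //; first by rewrite sz6 subnK.
  by rewrite sz6; rewrite -/B in le2 le6 *; move: le2 le3 le4 le5 le6; clear; lia.
move=> p q; rewrite !arc_mem (perm_mem (pk6 _ (ltn_ord p))) (perm_mem (G25 _ (ltn_ord p))) l2 L1.
exact: arc_unlink.
Qed.

Lemma del_run s x y : env s 0 = n -> env s 2 = x -> env s 3 = y ->
  good (lst s) (cel s) -> arc (lst s) x y ->
  run (delS Q) s (fun s' t => [/\ t <= CT * (4 * Bf Q (size (lst s' (2 * n))) + 4) ^ 3,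
    good (lst s') (cel s') & forall p q, arc (lst s') p q = arc (lst s) p q && ~~ pair x y p q]).
Proof.
move=> e0 e2 e3 I A; have S := i_str I; have [W1 W2 W8] := W_facts hw.
have xn := ltn_ord x; have yn := ltn_ord y; have nn : n <= n * n by rewrite leq_pmulr //; lia.
have xy : x != y by apply: contraTneq A => ->; rewrite (st_irr S).
have axy : arcn y x != arcn x y by apply/eqP => /arcn_inj[E]; rewrite E eqxx in xy.
have N2 : 2 <= size (lst s (2 * n)).
  have : {subset [:: arcn y x; arcn x y] <= lst s (2 * n)}.
    by move=> e; rewrite !inE => /orP[]/eqP->; rewrite (st_arc S) // (st_sym S).
  by apply: uniq_leq_size; rewrite /= inE axy.
apply: run_seq; apply: run_asg; first by rewrite /= e0 e2 e3; do !split => //; lia.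
rewrite /= e0 e2 e3 addn1 -[_ \in _]/(hT (lst s) x y).
set s1 := setv s 9 _; have [D0 D2 D3] : [/\ env s1 0 = n, env s1 2 = x & env s1 3 = y] by [].
have D9 : env s1 9 = hT (lst s) x y by [].
set N0 := size (lst s (2 * n)) in N2 I *.
have szN : N0 <= n * n by apply: str_size S.
have [g0 w1 w3 hM w8] := W_bounds szN; have QB := Bf_ge Q N0.
have [u1 u2 u3] := uf_bnd (erefl N0) (leq0n (8 * Q + 2)).
have Ub3 : 3 <= 2 * Bf Q N0 by apply: leq_trans (leq_pmull _ _) => //; apply: leq_trans QB.
pose wl := upf (wf N0 (lst s (2 * n)) 0) x y 0.
have step : run (HIf (EV 9) (HAsg 21 (EV 2) ;; HAsg 22 (EV 3) ;; remHS) HSkip) s1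
    (fun s' t => [/\ t <= 100 * (2 * Bf Q N0 + 4) ^ 3 + 4, sameG n (lst s) (lst s'), agree 10 s1 s',
      ~~ hT (lst s') x y &
      inv Q (lst s') (cel s') (uf N0 (lst s (2 * n)) 0) wl z0 z0
        (if hT (lst s) x y then pb (pb z0 2 y) 2 x else z0)]).
  apply: run_if => //; rewrite /= /upd /=; case: (boolP (hT (lst s) x y)) => h /=; last first.
    apply: run_skip; split => //; first by lia.
    apply: inv_weak I _ _ => p q _; first by left.
    by apply: Or31; rewrite /wl /upf; case: ifP.
  apply: run_seq; apply: run_asg => //=; apply: run_seq; apply: run_asg => //=.
  rewrite /= /upd /= e2 e3; set s2 := setv _ 22 _.
  apply: run_mono (remH_inv hw (s := s2) (p := x) (q := y) (wl' := wl) (u' := uf N0 (lst s (2 * n)) 0)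
    (a' := z0) (b' := pb (pb z0 2 y) 2 x) u1 Ub3 I e0 _ _ _ h _ _ _ _ _) _ => //.
  - by rewrite /wl /upf /pair !eqxx.
  - by rewrite /wl /upf /pair !eqxx orbT.
  - by move=> p q /negPf n1 /negPf n2; rewrite /wl /upf /pair n1 n2.
  - by move=> p; rewrite /pb /z0 /=; lia.
  move=> s3 t3 [le3 l3 c3 ag3 I3]; split => //; first by lia.
  - by rewrite l3; apply: sameG_rem.
  - move=> r r10; have ne k : 20 < k -> (r == k) = false.
      by move=> k20; apply: ltn_eqF; apply: leq_trans k20; apply: leq_trans r10 _.
    rewrite ag3; last by apply: leq_trans r10 _.
    by rewrite /s2 /= /upd (ne 22) // (ne 21).
  have [up _] := str_uniq x S; have [uq _] := str_uniq y S.
  by rewrite l3 hT_remL // !eqxx /= andbF.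
apply: run_seq; apply: run_mono step _ => s2 t2 [le2 [G2 top2] ag2 nh2 I2].
have A2 p q : arc (lst s2) p q = arc (lst s) p q.
  by rewrite !arc_mem (perm_mem (G2 _ (ltn_ord p))).
apply: run_mono (delr_run (s := s2) (x := x) (y := y) (fl := hT (lst s) x y) _ _ _ _ xy _ _ _ nh2) _.
- by rewrite ag2.
- by rewrite ag2.
- by rewrite ag2.
- by rewrite ag2.
- by rewrite top2.
- by rewrite top2.
- by rewrite A2.
move=> s3 t3 [sz3 le3 G3 A3]; split => //; last by move=> p q; rewrite A3 A2.
rewrite top2 -/N0 in sz3.
apply: time_bound; first by apply: leq_trans Q3 (Bf_ge _ _).
(* The edge leaves H under the old base, while the time is measured by the new one. *)
have leB : 2 * Bf Q N0 + 4 <= 4 * Bf Q (size (lst s3 (2 * n))) + 4.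
  have := Bf_double Q (size (lst s3 (2 * n))).
  have : Bf Q N0 <= Bf Q (2 * size (lst s3 (2 * n)) + 8).
    by apply: Bf_mono; move: sz3; clear; lia.
  by clear; lia.
have : (2 * Bf Q N0 + 4) ^ 3 <= (4 * Bf Q (size (lst s3 (2 * n))) + 4) ^ 3 by rewrite leq_exp2r.
by move: le2 le3; clear; lia.
Qed.

Lemma main_run s x y (ins : bool) : env s 0 = n -> env s 1 = ins -> env s 2 = x -> env s 3 = y ->
  x != y -> good (lst s) (cel s) -> arc (lst s) x y = ~~ ins ->
  run (mainS Q) s (fun s' t => [/\ t <= (CT * (4 * Bf Q (size (lst s' (2 * n))) + 4) ^ 3).+1,
    good (lst s') (cel s') & forall p q, arc (lst s') p q =
      if ins then arc (lst s) p q || pair x y p q else arc (lst s) p q && ~~ pair x y p q]).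
Proof.
move=> e0 e1 e2 e3 xy I A; apply: run_if => //; rewrite /= e1; case: (ins) A => /= A.
  by apply: run_mono (ins_run e0 e2 e3 xy I _) _; rewrite ?A // => s' t [].
by apply: run_mono (del_run e0 e2 e3 I _) _; rewrite ?A // => s' t [].
Qed.
End Main.

(** * Quality of the sparsifier *)

Lemma size_nodes n (l : seq nat) : uniq l -> (forall e, e \in l -> exists y : 'I_n, e = y.+1) ->
  size l = #|[set y : 'I_n | y.+1 \in l]|.
Proof.
move=> ul nd; rewrite cardE -(size_map (fun y : 'I_n => (val y).+1)).
apply: perm_size; apply: uniq_perm => //.
  by rewrite map_inj_uniq ?enum_uniq // => a b [/val_inj].
move=> e; apply/idP/mapP => [el|[y]].
  by have [y E] := nd _ el; exists y => //; rewrite mem_enum inE -E.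
by rewrite mem_enum inE => yl ->.
Qed.

(** The last [size bad + 1] entries are distinct, so they cannot all be in [bad]. *)
Lemma behind_avoid (l bad : seq nat) : uniq l -> size bad < size l ->
  exists e, [/\ e \in l, e \notin bad & behind l e <= size bad].
Proof.
move=> ul lt; pose k := size l - (size bad).+1; pose d := drop k l.
have sd : size d = (size bad).+1 by rewrite size_drop /k; lia.
have ud : uniq d by rewrite drop_uniq.
have [all|] := boolP (all (fun e => e \in bad) d).
  by have := uniq_leq_size ud (allP all); rewrite sd ltnn.
move=> /allPn[e ed nb]; exists e; split => //; first exact: mem_drop ed.
have ne : e \notin take k l.
  by move: ul; rewrite -{1}(cat_take_drop k l) cat_uniq => /and3P[_ /hasPn H _]; apply: H.
rewrite /behind -{2}(cat_take_drop k l) index_cat (negPf ne) size_take.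
have -> : (if k < size l then k else size l) = k by rewrite /k; case: ifP; lia.
by rewrite /k; move: lt (index e (drop k l)); clear; lia.
Qed.

Section Approx.
Variables (n Q : nat).
Hypothesis Qbig : 20 * 4000 <= Q.
Variables (L : nat -> seq nat) (c : nat -> nat -> nat) (f g : 'I_n -> 'I_n).
Hypothesis gd : good n Q L c.
Notation h := (@hT n L).
Hypothesis mf : mtch h f.
Hypothesis na : no_aug h f xpred0.
Hypothesis gI : involutive g.
Hypothesis gA : forall x, g x != x -> arc L x (g x).
Implicit Types (x y p q : 'I_n).

Let S : str n L := i_str gd.
Let N := size (L (2 * n)).
Let D x := size (L (n + x)).
Let d x := size (L x).
(** The extreme outdated thresholds: no arc has more than [N] arcs behind it in the global queue. *)
Let B0 := Bf Q (N - N %/ (4 * Q)).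
Let B1 := Bf Q (N + N %/ (4 * Q)).

Lemma D_c x : c 1 x = D x.
Proof. by have := i_b gd x; rewrite /z0 !addn0. Qed.

Lemma D_deg x : nbr h [set: 'I_n] x = D x.
Proof.
rewrite /D (size_nodes (n := n)); first by apply: eq_card => y; rewrite !inE.
  by have [] := str_uniq x S.
by move=> e; apply: (st_hnode S).
Qed.

Lemma d_card x : d x = #|[set y | arc L x y]|.
Proof.
rewrite /d (size_nodes (n := n)); first by apply: eq_card => y; rewrite !inE.
  by have [] := str_uniq x S.
by move=> e; apply: (st_node S).
Qed.

Lemma sum_d (R : {set 'I_n}) : \sum_(x in R) d x <= N.
Proof.
pose A := [set pq : 'I_n * 'I_n | (pq.1 \in R) && arc L pq.1 pq.2].
have -> : \sum_(x in R) d x = #|A|.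
  rewrite -sum1_card (eq_bigl (fun pq : 'I_n * 'I_n => (pq.1 \in R) && arc L pq.1 pq.2)); last first.
    by move=> pq; rewrite inE.
  rewrite -(pair_big_dep (fun x => x \in R) (fun x y => arc L x y) (fun _ _ => 1)) /=.
  by apply: eq_bigr => x _; rewrite d_card -sum1_card; apply: eq_bigl => y; rewrite inE.
rewrite cardE -(size_map (fun pq : 'I_n * 'I_n => arcn pq.1 pq.2)); apply: uniq_leq_size.
  rewrite map_inj_uniq ?enum_uniq // => -[p q] [p' q'] /= /arcn_inj[-> ->]; done.
by move=> e /mapP[[p q]]; rewrite mem_enum inE /= => /andP[_ A1] ->; rewrite (st_arc S).
Qed.

Lemma sums_le x y : h x y -> D x + D y <= B1.
Proof.
move=> hxy; have := i_1 gd hxy; rewrite !D_c; move/leq_trans; apply; apply: Bf_mono.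
by rewrite leq_add2l addn0 leq_div2r // behind_le.
Qed.

Lemma pot_le x y : arc L x y -> ~~ h x y ->
  B0 ^ 3 * (lowf Q B0 - (D x + D y)) <= behind (L x) y.+1 + behind (L y) x.+1.
Proof.
move=> A nh; have := i_2 gd A nh; rewrite !D_c /rhs /z0 !addn0; apply: leq_trans.
apply: pot_mono; apply: Bf_mono; rewrite leq_sub2l //.
by rewrite addn0 leq_div2r // behind_le.
Qed.

Lemma Q_B0 : Q <= B0. Proof. exact: Bf_ge. Qed.

(** The two numbers of arcs differ by a factor of about [1 + 1 / (2 * Q)], so a ratio of [1 + 1 / Q]
    between the bases would be too large: one of its eight factors already gives a contradiction. *)
Lemma B1_B0 : B0 <= B1 /\ Q * B1 <= Q * B0 + B0 + Q.
Proof.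
split; first by apply: Bf_mono; apply: leq_trans (leq_subr _ _) (leq_addr _ _).
have Q0 : 0 < Q by apply: leq_trans Qbig.
have [le|gt] := leqP B1 Q.
  by apply: leq_trans (_ : Q * B0 <= _); [rewrite leq_mul2l (leq_trans le Q_B0) orbT | rewrite -addnA leq_addr].
pose b := B1.-1; have b1 : B1 = b.+1 by rewrite /b prednK //; apply: leq_ltn_trans gt.
have Qb : Q <= b by rewrite -ltnS -b1.
have lt : b ^ 8 < Q ^ 8 * (N + N %/ (4 * Q)) by apply: Bf_min => //; rewrite -/B1 b1.
have ok : Q ^ 8 * (N - N %/ (4 * Q)) <= B0 ^ 8 by apply: Bf_ok.
rewrite b1 mulnS addnC leq_add2r leqNgt; apply/negP => gt2.
have le8 : (B0 * Q.+1) ^ 8 <= (Q * b) ^ 8.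
  by rewrite leq_exp2r // mulnS addnC [B0 * Q]mulnC; apply: ltnW.
rewrite !expnMn in le8.
have le7 : B0 ^ 8 * Q.+1 <= Q * b ^ 8.
  rewrite -(leq_pmul2l (_ : 0 < Q ^ 7)) ?expn_gt0 ?Q0 //.
  rewrite [X in _ <= X]mulnA -expnSr; apply: leq_trans le8.
  rewrite mulnCA leq_mul2l (expnSr Q.+1 7) leq_mul2r leq_exp2r // leqnSn !orbT //.
have q8 : 0 < Q ^ 8 by rewrite expn_gt0 Q0.
have k4 : N %/ (4 * Q) * (4 * Q) <= N by apply: leq_trunc_div.
set k := N %/ (4 * Q) in lt ok k4.
have h1 : Q ^ 8 * ((N - k) * Q.+1) < Q ^ 8 * (Q * (N + k)).
  rewrite mulnA; apply: leq_ltn_trans (leq_mul ok (leqnn _)) _.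
  by apply: leq_ltn_trans le7 _; rewrite [Q ^ 8 * _]mulnCA ltn_mul2l Q0.
rewrite ltn_mul2l q8 /= mulnS mulnBl mulnDr [Q * N]mulnC [Q * k]mulnC in h1.
have kQ : k <= k * Q by rewrite leq_pmulr.
have k4' : 4 * (k * Q) <= N by rewrite mulnCA.
have kQN : k * Q <= N * Q by rewrite leq_mul2r leq_div orbT.
have aux (m j e r : nat) : j <= e -> 4 * e <= m -> m - j + (r - e) < r + e -> e <= r -> False by clear; lia.
exact: aux kQ k4' h1 kQN.
Qed.

(** Of the three parts [B0 / Q], two cover the positions in the queues of the two ends, and one the
    degree of the light free neighbour used in [rich_deg]. *)
Let b2 := lowf Q B0 - (3 * B0) %/ Q.

Lemma b2_close : [/\ b2 <= B1, 4000 <= B1 & 3999 * B1 <= 4000 * b2].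
Proof.
have [le1 le2] := B1_B0; have QB := Q_B0.
have Q0 : 0 < Q by apply: leq_trans Qbig.
have d1 := leq_trunc_div B0 Q; have d3 := leq_trunc_div (3 * B0) Q.
have lt := ltn_ceil B0 Q0; rewrite mulSn mulnC in lt.
have d2 : B1 < B0 + B0 %/ Q + 2.
  have aux (a b e r z : nat) : a <= b + z + r -> z < r + e -> a < b + e + r * 2 by clear; lia.
  by rewrite -(ltn_pmul2l Q0) [Q * (_ + 2)]mulnDr [Q * (B0 + _)]mulnDr; apply: aux le2 lt.
have t3 : (3 * B0) %/ Q < 3 * (B0 %/ Q) + 3.
  rewrite ltn_divLR // mulnDl -mulnA [B0 %/ Q * Q]mulnC.
  have aux (e r z : nat) : z < r + e -> 3 * z < 3 * e + 3 * r by clear; lia.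
  exact: aux lt.
have qe : 20 * 4000 * (B0 %/ Q) <= B0.
  by apply: leq_trans d1; rewrite mulnC leq_mul2l Qbig orbT.
have qb : 20 * 4000 <= B0 := leq_trans Qbig QB.
split; first by apply: leq_trans (leq_subr _ _) _; apply: leq_trans (leq_subr _ _) le1.
  by apply: leq_trans le1; apply: leq_trans qb; rewrite leq_pmull.
have aux (a b e t : nat) : a < b + e + 2 -> t < 3 * e + 3 -> 20 * 4000 * e <= b -> 20 * 4000 <= b ->
  3999 * a <= 4000 * (b - e - t) by clear; lia.
exact: aux d2 t3 qe qb.
Qed.

Let rich := [set x | B0 ^ 4 <= Q * d x].
Let F := [set x | f x != x].

(** Each of the two queues is shorter than [B0 ^ 4 / Q]; dividing the potential by [B0 ^ 3] leaves a
    deficit of at most [2 * B0 / Q]. *)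
Lemma poor_sum x y : arc L x y -> ~~ h x y -> x \notin rich -> y \notin rich -> b2 <= D x + D y.
Proof.
move=> A nh; rewrite !inE -!ltnNge => px py; have := pot_le A nh.
have Q0 : 0 < Q by apply: leq_trans Qbig.
have B00 : 0 < B0 by apply: leq_trans Q0 Q_B0.
have := behind_le (L x) y.+1; have := behind_le (L y) x.+1; rewrite -/(d x) -/(d y) => l1 l2 l3.
have l4 : Q * (B0 ^ 3 * (lowf Q B0 - (D x + D y))) <= 2 * B0 ^ 4.
  apply: leq_trans (_ : Q * (d x + d y) <= _); first by rewrite leq_mul2l; apply/orP; right; lia.
  by rewrite mulnDr; lia.
rewrite mulnCA (expnSr B0 3) [2 * _]mulnCA leq_pmul2l ?expn_gt0 ?B00 // in l4.
have : lowf Q B0 - (D x + D y) <= (3 * B0) %/ Q by rewrite leq_divRL // mulnC; lia.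
by rewrite /b2; lia.
Qed.

(** The degrees in G sum to at most [N], which is at most [2 * B0 ^ 8 / Q ^ 8] by the choice of the
    base. *)
Lemma rich_few : #|rich| * Q ^ 7 <= 2 * B0 ^ 4.
Proof.
have Q0 : 0 < Q by apply: leq_trans Qbig.
have B00 : 0 < B0 by apply: leq_trans Q0 Q_B0.
have s1 : #|rich| * B0 ^ 4 <= Q * N.
  apply: leq_trans (leq_mul (leqnn Q) (sum_d rich)); rewrite big_distrr /= -sum_nat_const.
  by apply: leq_sum => x; rewrite inE.
have ok : Q ^ 8 * (N - N %/ (4 * Q)) <= B0 ^ 8 by apply: Bf_ok.
have k4 : N <= 2 * (N - N %/ (4 * Q)).
  have : N %/ (4 * Q) * 4 <= N.
    apply: leq_trans (leq_trunc_div N (4 * Q)); rewrite mulnA leq_pmulr //.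
  by move: (N %/ _); clear; lia.
rewrite -(leq_pmul2r (_ : 0 < B0 ^ 4)) ?expn_gt0 ?B00 // -[2 * _ * _]mulnA -expnD mulnAC.
apply: leq_trans (leq_mul s1 (leqnn _)) _; rewrite mulnAC -expnS.
by apply: leq_trans (leq_mul (leqnn _) k4) _; rewrite mulnCA leq_mul2l ok orbT.
Qed.

(** [F] is here the set of matched vertices. A rich vertex has more neighbours than there are
    vertices that are rich, matched, free of large degree, or adjacent to it in H. So one of the
    last entries of its queue is none of these. The deficit at this edge is small, and as the
    neighbour has a tiny degree, the degree of [x] must be large by itself. *)
Lemma rich_deg x : #|F| < 16 * 1000 * #|rich| -> x \in rich -> b2 <= D x.
Proof.
move=> Fl xr; have Q0 : 0 < Q by apply: leq_trans Qbig.
have [le1 le2] := B1_B0; have QB := Q_B0; have B00 : 0 < B0 by apply: leq_trans Q0 QB.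
have B12 : B1 <= 2 * B0.
  by rewrite -(leq_pmul2l Q0); apply: leq_trans le2 _; nia.
have DB y : D y <= B1.
  case E : (L (n + y)) => [|e l]; first by rewrite /D E.
  have [z ez] : exists z : 'I_n, e = z.+1 by apply: (st_hnode S (x := y)); rewrite E mem_head.
  by have := sums_le (x := y) (y := z); rewrite /hT E ez mem_head => /(_ isT); apply: leq_trans; apply: leq_addr.
(* Free vertices of degree above [B0 / Q] in H. They are few, because all their edges in H end in
   matched vertices, of degree at most [2 * B0]. *)
pose T := [set y | (f y == y) && (B0 < Q * D y)].
have Tle : #|T| <= 2 * Q * #|F|.
  have s1 : #|T| * B0 <= Q * \sum_(y in T) D y.
    rewrite big_distrr /= -sum_nat_const; apply: leq_sum => y; rewrite inE => /andP[_]; exact: ltnW.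
  have s2 : \sum_(y in T) D y <= \sum_(v in F) D v.
    have E1 y : D y = \sum_(v : 'I_n) h y v.
      by rewrite -D_deg /nbr -sum1_card big_mkcond /=; apply: eq_bigr => v _; rewrite !inE /=; case: (h y v).
    apply: leq_trans (_ : \sum_(y in T) \sum_(v in F) h y v <= _).
      apply: leq_sum => y; rewrite inE => /andP[fy _]; rewrite E1 [X in _ <= X]big_mkcond /=.
      apply: leq_sum => v _; rewrite inE; case: ifP => // /negbT/negPn fv.
      case hv : (h y v) => //; have [a1 _ _] := na (u := y) (v := v) isT isT.
      case/negP: a1; rewrite /aug1 fy fv hv andbT /=; apply: contraTneq hv => ->.
      by apply/negP => /(st_sub S); rewrite (st_irr S).
    rewrite exchange_big /=; apply: leq_sum => v _; rewrite E1 big_mkcond /=.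
    by apply: leq_sum => y _; case: ifP => // _; rewrite (st_hsym S).
  have s3 : \sum_(v in F) D v <= #|F| * (2 * B0).
    by rewrite -sum_nat_const; apply: leq_sum => v _; apply: leq_trans (DB v) B12.
  rewrite -(leq_pmul2r B00); apply: leq_trans s1 _.
  apply: leq_trans (leq_mul (leqnn Q) (leq_trans s2 s3)) _.
  by rewrite -!mulnA [#|F| * (2 * B0)]mulnCA mulnCA.
pose bad := rich :|: F :|: T :|: [set y | h x y].
pose bl := [seq (val y).+1 | y <- enum bad].
have szb : size bl = #|bad| by rewrite size_map -cardE.
have cb : #|bad| <= #|rich| + #|F| + #|T| + B1.
  apply: leq_trans (leq_card_setU _ _) _; apply: leq_add.
    apply: leq_trans (leq_card_setU _ _) _; apply: leq_add => //.
    exact: leq_card_setU.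
  apply: leq_trans (DB x); rewrite -D_deg /nbr; apply: eq_leq; apply: eq_card => y; by rewrite !inE.
(* The rich vertices number at most [2 * B0 ^ 4 / Q ^ 7]; three powers of [Q] absorb the constants
   and the factor [2 * Q] from [T]. *)
have big : Q * #|bad| < B0 ^ 4.
  have QQ : 16 * 1000 + 1 + 2 * Q * (16 * 1000) <= Q ^ 3.
    have a1 : 20 * 4000 * Q <= Q * Q by rewrite leq_mul2r Qbig orbT.
    have a2 : 20 * 4000 * (Q * Q) <= Q * (Q * Q) by rewrite leq_mul2r Qbig orbT.
    by rewrite !expnS expn0 muln1; move: (Q * (Q * Q)) (Q * Q) a1 a2 Qbig; clear; lia.
  have c1 : #|bad| <= Q ^ 3 * #|rich| + 2 * B0.
    apply: leq_trans cb _; apply: leq_add B12; apply: leq_trans (_ : _ <= #|rich| + #|F| + 2 * Q * #|F|) _.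
      by rewrite leq_add2l.
    have aux (R F0 A r M3 : nat) : F0 < A * R -> A + 1 + r * A <= M3 -> R + F0 + r * F0 <= M3 * R.
      move=> h1 h2; apply: leq_trans (leq_mul h2 (leqnn R)).
      have m1 : r * F0 <= r * (A * R) by rewrite leq_mul2l ltnW ?orbT.
      by rewrite !mulnDl mul1n -[r * A * R]mulnA; move: (r * F0) (r * (A * R)) (A * R) m1 h1; clear; lia.
    exact: (@aux #|rich| #|F| (16 * 1000) (2 * Q) (Q ^ 3) Fl QQ).
  have rf := rich_few.
  have r8 : 8 * (Q ^ 4 * #|rich|) <= 2 * B0 ^ 4.
    apply: leq_trans rf; rewrite (_ : Q ^ 7 = Q ^ 3 * Q ^ 4); last by rewrite -expnD.
    rewrite [Q ^ 4 * #|rich|]mulnC [#|rich| * (_ * _)]mulnCA leq_mul2r; apply/orP; right.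
    by rewrite (_ : 8 = 2 ^ 3) // leq_exp2r //; apply: leq_trans Qbig.
  have b8 : 16 * (Q * B0) <= B0 ^ 4.
    rewrite (_ : B0 ^ 4 = B0 * B0 * (B0 * B0)); last by rewrite !mulnn -expnM.
    apply: leq_mul; last by rewrite leq_mul2r QB orbT.
    by apply: (@leq_mul 4 4); apply: leq_trans QB; apply: leq_trans Qbig.
  have b0 : 0 < B0 ^ 4 by rewrite expn_gt0 B00.
  apply: leq_ltn_trans (leq_mul (leqnn Q) c1) _; rewrite mulnDr mulnA -expnS [Q * (2 * _)]mulnCA.
  by move: (Q ^ 4 * _) (Q * B0) (B0 ^ 4) r8 b8 b0; clear; lia.
have [||e [el nb bh]] := @behind_avoid (L x) bl.
- by have [] := str_uniq x S.
- by rewrite szb; move: xr; rewrite inE => xr; rewrite -(ltn_pmul2l Q0); apply: leq_trans big xr.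
have [y ey] := st_node S el; rewrite ey in el nb bh.
have : y \notin bad by apply: contra nb => yb; apply/mapP; exists y; rewrite ?mem_enum.
rewrite !inE !negb_or => /andP[/andP[/andP[yr yF] yT] hxy].
move: yF yT; rewrite negbK => -> /=; rewrite -leqNgt => Dy.
rewrite -ltnNge in yr.
have pl := pot_le (el : arc L x y) hxy; have l2 := behind_le (L y) x.+1; rewrite -/(d y) in l2.
have l4 : Q * (B0 ^ 3 * (lowf Q B0 - (D x + D y))) <= 2 * B0 ^ 4.
  apply: leq_trans (_ : Q * (#|bad| + d y) <= _); last by rewrite mulnDr; lia.
  rewrite leq_mul2l; apply/orP; right; apply: leq_trans pl _; rewrite szb in bh; exact: leq_add.
rewrite mulnCA (expnSr B0 3) [2 * _]mulnCA leq_pmul2l ?expn_gt0 ?B00 // in l4.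
have : lowf Q B0 - D x <= (3 * B0) %/ Q.
  rewrite leq_divRL // mulnC; apply: leq_trans (_ : Q * (lowf Q B0 - (D x + D y)) + Q * D y <= _).
    by rewrite -mulnDr leq_mul2l; apply/orP; right; clear; lia.
  by move: l4 Dy; clear; lia.
by rewrite /b2; clear; lia.
Qed.

(** If the matching is large, dropping the edges of [g] at rich vertices uncovers at most
    [2 * #|rich| <= #|F| / 8000] vertices, half of the gain [1 / 4000]. If it is small, [rich_deg]
    gives the lower bound at these edges too. *)
Lemma good_approx : 2 * 4000 * #|[set x | g x != x]| + #|F| <= 2 * (2 * 4000 * #|F|).
Proof.
have hs : symmetric h := st_hsym S.
have hi : irreflexive h by move=> x; apply/negP => /(st_sub S); rewrite (st_irr S).
have [c1 c2 c3] := b2_close.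
have P1 x y : h x y -> nbr h [set: 'I_n] x + nbr h [set: 'I_n] y <= B1.
  by rewrite !D_deg; apply: sums_le.
have [Rl|Rl] := leqP (16 * 1000 * #|rich|) #|F|.
  pose g' x := if (x \in rich) || (g x \in rich) then x else g x.
  have g'I : involutive g'.
    move=> x; rewrite /g'; case E : ((x \in rich) || (g x \in rich)); first by rewrite E.
    by rewrite gI orbC E.
  have P2 x : g' x != x -> ~~ h x (g' x) -> b2 <= nbr h [set: 'I_n] x + nbr h [set: 'I_n] (g' x).
    rewrite !D_deg /g'; case: ifP => [_|/norP[nx ny] gx nh]; first by rewrite eqxx.
    by apply: poor_sum => //; apply: gA.
  have := sparsifier_bound hs hi mf na g'I P1 P2 c1 c2 c3; rewrite -/F => sb.
  have : #|[set x | g x != x]| <= #|[set x | g' x != x]| + 2 * #|rich|.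
    apply: leq_trans (_ : #|[set x | g' x != x] :|: (rich :|: [set g x | x in rich])| <= _).
      apply: subset_leq_card; apply/subsetP => x; rewrite inE => gx; rewrite in_setU in_setU in_set /g'.
      case: (boolP (x \in rich)) => [|_] /=; first by rewrite orbT.
      case: (boolP (g x \in rich)) => [gr|_]; last by rewrite gx.
      by apply/orP; right; apply/imsetP; exists (g x) => //; rewrite gI.
    apply: leq_trans (leq_card_setU _ _) _; rewrite leq_add2l mul2n -addnn.
    by apply: leq_trans (leq_card_setU _ _) _; rewrite leq_add2l leq_imset_card.
  move: sb Rl; move: #|[set x | g x != x]| #|[set x | g' x != x]| #|rich| #|F|; clear; lia.
have P2 x : g x != x -> ~~ h x (g x) -> b2 <= nbr h [set: 'I_n] x + nbr h [set: 'I_n] (g x).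
  move=> gx nh; rewrite !D_deg.
  case: (boolP (x \in rich)) => [/(rich_deg Rl)/leq_trans|nx]; first by apply; apply: leq_addr.
  case: (boolP (g x \in rich)) => [/(rich_deg Rl)/leq_trans|ny]; first by apply; apply: leq_addl.
  by apply: poor_sum => //; apply: gA.
have := sparsifier_bound hs hi mf na gI P1 P2 c1 c2 c3; rewrite -/F.
by move: #|[set x | g x != x]| #|F|; clear; lia.
Qed.
End Approx.

(** * The dynamic algorithm *)

From mathcomp Require Import all_order all_algebra.
From mathcomp Require Import reals exp.
From mathcomp Require Import lra.
Require Import Defs.
Import Order.TTheory GRing.Theory Num.Theory.
Local Open Scope nat_scope.

(** Register 5 is prepared for address computations, and register 4 points to the mates, which start
    at address 0. *)
Definition proS := Seq (Op Mul 5 0 0) (Seq (Const 40 1) (Seq (Op Add 5 5 40) (Const 4 0))).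
Definition prog Q := Seq proS (compile (mainS Q)).

Section Edges.
Variables (n : nat).
Implicit Types (E M : graph n) (x y p q : 'I_n).

Lemma set2_pair x y p q : x != y -> ([set p; q] == [set x; y]) = pair x y p q.
Proof.
move=> xy; apply/eqP/orP => [E|[]/andP[/eqP-> /eqP->] //]; last by rewrite setUC.
have xp : x \in [set p; q] by rewrite E set21.
have yp : y \in [set p; q] by rewrite E set22.
move: xp yp; rewrite !inE => /orP[]/eqP ex /orP[]/eqP ey.
- by rewrite ex ey eqxx in xy.
- by left; rewrite ex ey !eqxx.
- by right; rewrite ex ey !eqxx.
- by rewrite ex ey eqxx in xy.
Qed.

Definition simple E := forall e, e \in E -> exists x y, x != y /\ e = [set x; y].

Lemma simple_card E M : simple E -> is_matching E M -> #|cover M| = 2 * #|M|.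
Proof.
move=> sE /andP[/subsetP sub /eqP <-]; rewrite (eq_bigr (fun=> 2)).
  by rewrite sum_nat_const mulnC.
by move=> B /sub/sE[x [y [xy ->]]]; rewrite cards2 xy.
Qed.

Definition other M x := odflt x [pick y | ([set x; y] \in M) && (x != y)].

Lemma trivI_other M x y z : trivIset M -> [set x; y] \in M -> [set x; z] \in M ->
  x != y -> x != z -> y = z.
Proof.
move=> /trivIsetP tM my mz xy xz; case: (eqVneq [set x; y] [set x; z]) => [E|ne].
  have : y \in [set x; z] by rewrite -E set22.
  by rewrite !inE => /orP[]/eqP // E1; rewrite E1 eqxx in xy.
have /pred0P/(_ x) /= := tM _ _ my mz ne; by rewrite !inE eqxx.
Qed.

Lemma otherP M x : trivIset M ->
  (other M x != x -> [set x; other M x] \in M) /\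
  (forall y, [set x; y] \in M -> x != y -> other M x = y).
Proof.
move=> tM; rewrite /other; case: pickP => [z /andP[mz xz]|none] /=; split => //.
- by move=> y my xy; apply: trivI_other mz my xz xy.
- by rewrite eqxx.
- by move=> y my xy; have := none y; rewrite my xy.
Qed.

Lemma other_inv M : trivIset M -> involutive (other M).
Proof.
move=> tM x; case: (eqVneq (other M x) x) => [e|ne]; first by rewrite !e.
have [m _] := otherP x tM; have [_ u] := otherP (other M x) tM.
by apply: u; rewrite // setUC m.
Qed.

Definition pairs (f : 'I_n -> 'I_n) : graph n := [set [set x; f x] | x in [set x | f x != x]].

Lemma pairs_triv f : involutive f -> trivIset (pairs f).
Proof.
move=> fI; apply/trivIsetP => A B /imsetP[x _ ->] /imsetP[y _ ->] ne.
apply/pred0P => z /=; apply/negP => /andP[]; rewrite !inE => zx zy; case/negP: ne; apply/eqP.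
have H u : (z == u) || (z == f u) -> [set u; f u] = [set z; f z].
  by case/orP => /eqP->; rewrite ?fI // setUC.
by rewrite (H _ zx) (H _ zy).
Qed.

Lemma pairs_cover f : involutive f -> cover (pairs f) = [set x | f x != x].
Proof.
move=> fI; apply/setP => z; apply/bigcupP/idP => [[A /imsetP[x]]|fz]; rewrite ?inE.
  move=> fx ->; rewrite !inE => /orP[]/eqP-> //.
  by rewrite fI eq_sym.
by exists [set z; f z]; [apply: imset_f | rewrite set21].
Qed.
End Edges.

Section Step.
Variables (n w Q : nat).
Hypothesis hw : 2 * n + 4 * ((2 * n).+1 * (n * n).+1) < 2 ^ w.
Hypothesis Qbig : 20 * 4000 <= Q.
Hypothesis WB : (4 * Bf Q (n * n) + 10) ^ 8 < 2 ^ w.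
Implicit Types (E M : graph n) (x y p q : 'I_n).

(** Between updates the registers only have to hold words; all information is in the memory. *)
Record minvE E (s : state) L c : Prop := MinvE {
  m_reg : forall r, r < 40 -> regs s r < 2 ^ w;
  m_cel : forall t i, t < 2 -> i < n -> mem s (t * n + i) = c t i /\ c t i < 2 ^ w;
  m_lst : forall k, k <= 2 * n ->
    lrep n (fun i : nat => mem s (addr n 0 k i)) (fun i : nat => mem s (addr n 1 k i))
           (fun i : nat => mem s (addr n 2 k i)) (mem s (addr n 3 k 0)) (L k);
  m_good : good n Q L c;
  m_arc : forall x y, arc L x y = ([set x; y] \in E);
  m_simple : simple E }.

Lemma minvE0 : minvE set0 state0 (fun=> [::]) (fun _ _ => 0).
Proof.
have w0 : 0 < 2 ^ w by rewrite expn_gt0.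
have hF x y : @hT n (fun=> [::]) x y = false by [].
constructor => //.
- constructor => //.
  exists id; split => //; first by move=> x; rewrite eqxx.
    by split => // x; rewrite eqxx.
  move=> u v _ _; split; first by rewrite /aug1 hF !andbF.
    by move=> a; rewrite /aug3 !hF !andbF.
  by move=> a e; rewrite /aug5 !hF !andbF.
- by move=> x y; rewrite !inE.
- by move=> e; rewrite inE.
Qed.

(** Arcs are injected into pairs of an edge and a direction, given by comparing the ends. *)
Lemma size_arcs E s L c : minvE E s L c -> size (L (2 * n)) <= 2 * #|E|.
Proof.
move=> m; have S := i_str (m_good m).
pose A := [set pq : 'I_n * 'I_n | arc L pq.1 pq.2].
have uL : uniq (L (2 * n)) by case/andP: (st_u S (leqnn _)).
have l1 : size (L (2 * n)) <= #|A|.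
  rewrite cardE -(size_map (fun pq : 'I_n * 'I_n => arcn pq.1 pq.2)); apply: uniq_leq_size => //.
  move=> e eL; have [x [y E1]] := st_arcn S eL; apply/mapP; exists (x, y) => //.
  by rewrite mem_enum inE /= -(st_arc S) -E1.
apply: leq_trans l1 _; pose phi (pq : 'I_n * 'I_n) := ([set pq.1; pq.2], pq.1 < pq.2).
have inj : {in A &, injective phi}.
  move=> [x y] [p q]; rewrite !inE /= => A1 A2 [E1 E2].
  have xy : x != y by apply: contraTneq A1 => ->; rewrite (st_irr S).
  have := set2_pair p q xy; rewrite E1 eqxx => /esym/orP[]/andP[/eqP E3 /eqP E4]; first by rewrite E3 E4.
  move: E2; rewrite E3 E4 => /(congr1 negb); rewrite -!leqNgt leq_eqVlt.
  rewrite (inj_eq val_inj) eq_sym (negPf xy) /=; case: (ltngtP x y) => //.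
rewrite -(card_in_imset inj).
have : phi @: A \subset setX E [set: bool].
  apply/subsetP => e /imsetP[[x y]]; rewrite inE /= => A1 ->.
  by rewrite inE /= inE andbT -(m_arc m).
by move/subset_leq_card; rewrite cardsX cardsT card_bool mulnC.
Qed.

Lemma output E s L c : minvE E s L c -> regs s 4 = 0 -> exists M,
  [/\ stores s M, is_matching E M & 2 * 4000 * mu E + #|M| <= 2 * (2 * 4000 * #|M|)].
Proof.
move=> m r4; have gd := m_good m; have S := i_str gd.
have [f [ef mf na]] := i_m gd; have [fI fh] := mf.
have mat : is_matching E (pairs f).
  apply/andP; split; last exact: pairs_triv.
  apply/subsetP => e /imsetP[x]; rewrite inE => fx ->; rewrite -(m_arc m).
  by apply: (st_sub S); apply: fh.
have card F0 : F0 = pairs f -> #|[set x | f x != x]| = 2 * #|F0|.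
  by move=> ->; rewrite -(pairs_cover fI); apply: simple_card (m_simple m) mat.
exists (pairs f); split => //.
  move=> v; rewrite r4 add0n; have [E1 _] := m_cel m (isT : 0 < 2) (ltn_ord v).
  rewrite mul0n add0n in E1; rewrite E1 ef; case: (eqVneq (f v) v) => fv.
    by rewrite pairs_cover // inE fv eqxx.
  by exists (f v) => //; apply: imset_f; rewrite inE.
suff H M : is_matching E M -> 2 * 4000 * #|M| + #|pairs f| <= 2 * (2 * 4000 * #|pairs f|).
  rewrite /mu; apply: (big_ind (fun k => 2 * 4000 * k + #|pairs f| <= 2 * (2 * 4000 * #|pairs f|))).
  - have m0 : is_matching E (set0 : graph n).
      by rewrite /is_matching sub0set; apply/trivIsetP => A B; rewrite inE.
    by have := H _ m0; rewrite cards0.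
  - by move=> i j hi hj; rewrite /maxn; case: ifP.
  - by move=> M; apply: H.
move=> mM; have /andP[/subsetP sub tM] := mM.
have gA x : other M x != x -> arc L x (other M x).
  by move=> /(otherP x tM).1/sub; rewrite (m_arc m).
have := good_approx Qbig gd mf na (other_inv tM) gA; rewrite (card _ erefl).
have : 2 * #|M| <= #|[set x | other M x != x]|.
  rewrite -(simple_card (m_simple m) mM); apply: subset_leq_card; apply/subsetP => z /bigcupP[B BM zB].
  have [x [y [xy EB]]] := m_simple m (sub _ BM); rewrite EB in BM zB.
  move: zB; rewrite !inE => /orP[]/eqP->.
    by rewrite ((otherP x tM).2 y BM xy) eq_sym.
  by rewrite ((otherP y tM).2 x _ _) ?[y == x]eq_sym // setUC.
by move: #|M| #|pairs f| #|[set x | other M x != x]|; clear; lia.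
Qed.

Definition tbound e := 4 + kost (mainS Q) * (CT Q * (4 * Bf Q (2 * e) + 4) ^ 3).+1.

Lemma step E s L c a : minvE E s L c -> legal E a -> exists s' t L' c',
  [/\ exec w (prog Q) (input a s) s' t, minvE (apply E a) s' L' c', regs s' 4 = 0 &
      t <= tbound #|apply E a|].
Proof.
move=> m lg; have gd := m_good m; have S := i_str gd; have [W1 W2 W8] := W_facts hw.
have [x [y [ins [ea xy Axy aE]]]] : exists x y (ins : bool),
    [/\ input a s = set_reg (set_reg (set_reg (set_reg s 0 n) 1 ins) 2 x) 3 y, x != y,
     arc L x y = ~~ ins & apply E a = if ins then [set x; y] |: E else E :\ [set x; y]].
  case: a lg => x y /=.
    by move=> /andP[xy nE]; exists x, y, true; split => //; rewrite (m_arc m) (negPf nE).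
  move=> xyE; exists x, y, false; split => //; last by rewrite (m_arc m) xyE.
  have [p [q [pq E1]]] := m_simple m xyE; apply: contraTneq pq => exy.
  have : p \in [set x; y] by rewrite E1 set21.
  have : q \in [set x; y] by rewrite E1 set22.
  by rewrite exy !inE !orbb => /eqP-> /eqP->; rewrite eqxx.
set s1 := input a s in ea *.
have nn1 : (n * n).+1 < 2 ^ w by move: hw; rewrite mulSn; clear; lia.
have w1 : 1 %% 2 ^ w = 1 by rewrite modn_small //; lia.
pose s2 := set_reg (set_reg (set_reg (set_reg s1 5 (n * n)) 40 1) 5 (n * n).+1) 4 0.
have X1 : exec w proS s1 s2 (1 + (1 + (1 + 1))).
  have E0 : regs s1 0 = n by rewrite ea.
  apply: ExecSeq (_ : exec w _ _ (set_reg s1 5 (n * n)) _) _.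
    have := ExecOp w Mul 5 0 0 s1; rewrite E0 /eval_op modn_small //; exact.
  apply: ExecSeq (_ : exec w _ _ (set_reg (set_reg s1 5 (n * n)) 40 1) _) _.
    by have := ExecConst w 40 1 (set_reg s1 5 (n * n)); rewrite w1; apply.
  apply: ExecSeq (_ : exec w _ _ (set_reg (set_reg (set_reg s1 5 (n * n)) 40 1) 5 (n * n).+1) _) _.
    have := ExecOp w Add 5 5 40 (set_reg (set_reg s1 5 (n * n)) 40 1).
    by rewrite /= /upd /= /eval_op addn1 modn_small //; apply.
  by have := ExecConst w 4 0 (set_reg (set_reg (set_reg s1 5 (n * n)) 40 1) 5 (n * n).+1);
    rewrite mod0n; apply.
have xn := ltn_ord x; have yn := ltn_ord y.
pose h := HSt (regs s2) L c.
have mem1 : mem s1 = mem s by rewrite ea.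
have R : rep n w h s2.
  constructor => //=.
  - move=> r r40; rewrite /s2 ea /= /upd; have := m_reg m r40; do !case: eqP => _ //; try lia.
  - by rewrite ea.
  - by move=> t i t2 i2; rewrite mem1; case: (m_cel m t2 i2).
  - by move=> t i t2 i2; case: (m_cel m t2 i2).
  - by move=> k k2; rewrite mem1; apply: (m_lst m).
have Q3 : 3 <= Q by apply: leq_trans Qbig.
have [||||h' [t [X2 [le2 G2 A2]]]] := @main_run n w hw Q Q3 WB h x y ins _ _ _ _ xy gd Axy;
  try by rewrite /= /s2 ea.
have wf : wfs (mainS Q) by [].
have [s3 [t3 [X3 R3 le3]]] := compile_exec hw X2 wf R.
have m3 : minvE (apply E a) s3 (lst h') (cel h').
  constructor => //.
  - by move=> r r40; rewrite (r_reg R3) //; apply: (r_bnd R3).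
  - by move=> t' i t2 i2; split; [apply: (r_cel R3) | apply: (r_celb R3)].
  - exact: (r_lst R3).
  - move=> p q; rewrite A2 aE /= (m_arc m); case: (ins); rewrite !inE set2_pair // 1?orbC //.
    by rewrite andbC.
  - move=> e; rewrite aE; case: (ins); rewrite !inE; last by case/andP => _; apply: (m_simple m).
    by case/predU1P => [->|]; [exists x, y | apply: (m_simple m)].
exists s3, (1 + (1 + (1 + 1)) + t3), (lst h'), (cel h'); split => //.
- exact: ExecSeq X1 X3.
- have ag := hexec_frame (l := 6) X2 isT.
  by rewrite (r_reg R3) // ag.
rewrite /tbound leq_add2l; apply: leq_trans le3 _; rewrite leq_mul2l; apply/orP; right.
apply: leq_trans le2 _; rewrite ltnS leq_mul2l; apply/orP; right; rewrite leq_exp2r // leq_add2r leq_mul2l /=.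
by apply: Bf_mono; apply: size_arcs m3.
Qed.

Lemma reachable_minv E s : reachable w (prog Q) E s -> exists L c, minvE E s L c.
Proof.
elim=> [|E' s' a s'' t _ [L [c m]] lg X]; first by exists (fun=> [::]), (fun _ _ => 0); apply: minvE0.
have [s3 [t3 [L' [c' [X3 m3 _ _]]]]] := step m lg.
(* Determinism identifies the given run with the one constructed in [step]. *)
by have [-> _] := exec_det X X3; exists L', c'.
Qed.
End Step.

(** The constant factor [(14 * Q) ^ 8] is dominated by a power of [n.+2] with that exponent, as
    [n.+2] is at least two; the 16 comes from the eighth power of [n.+2 ^ 2]. *)
Lemma words_ok Q n w : word_size_ok (16 + (14 * Q) ^ 8) w n -> 0 < Q ->
  2 * n + 4 * ((2 * n).+1 * (n * n).+1) < 2 ^ w /\ (4 * Bf Q (n * n) + 10) ^ 8 < 2 ^ w.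
Proof.
rewrite /word_size_ok => le Q0; set a := n.+2 in le; have a2 : 1 < a by [].
split; apply: leq_trans le.
  apply: leq_trans (_ : a ^ 7 <= _); last by rewrite leq_pexp2l //; lia.
  rewrite (_ : a ^ 7 = a ^ 4 * a ^ 3); last by rewrite -expnD.
  apply: leq_trans (_ : 2 ^ 4 * a ^ 3 <= _); last by rewrite leq_mul2r leq_exp2r // a2 orbT.
  rewrite !expnS expn0 !muln1 /a; clear; nia.
apply: leq_ltn_trans (_ : (14 * Q * a ^ 2) ^ 8 < _).
  rewrite leq_exp2r //; have : Bf Q (n * n) <= Q * (n * n).+1.
    apply: Bf_le; first by rewrite leq_pmulr.
    rewrite expnMn leq_mul2l; apply/orP; right; apply: leq_trans (leqnSn _) _.
    by rewrite -{1}[(n * n).+1]expn1 leq_pexp2l.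
  have : (n * n).+1 <= a ^ 2 by rewrite /a -mulnn; nia.
  have : 1 <= a ^ 2 by rewrite expn_gt0.
  move: (a ^ 2) (n * n) (Bf Q _) Q0 => A N B; clear; nia.
rewrite expnMn -expnM -addnS expnD mulnC ltn_mul2l expn_gt0 /=.
by apply: leq_trans (ltn_expl _ a2) _; rewrite leq_pexp2l.
Qed.

(** Eighth powers keep the estimate within natural numbers until the real power is taken at the very
    end. *)
Lemma tbound_pow Q m t e : 3 < Q -> 0 < m -> e <= m -> t <= tbound Q e ->
  t ^ 8 <= (4 + kost (mainS Q) * (CT Q * 125).+1) ^ 8 * (512 * Q ^ 8) ^ 3 * m ^ 3.
Proof.
move=> Q3 m0 em le; set b := Bf Q (2 * m); have Qb : Q <= b by apply: Bf_ge.
(* Above [Q], minimality bounds [(b - 1) ^ 8] by [Q ^ 8 * (2 * m)]; with [b <= 2 * (b - 1)] this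
   gives the factor 2^9. *)
have b8 : b ^ 8 <= 512 * Q ^ 8 * m.
  have [E|ne] := eqVneq b Q.
    rewrite E -mulnA mulnCA leq_pmulr // muln_gt0 m0; done.
  pose b' := b.-1; have E : b = b'.+1 by rewrite /b' prednK //; apply: leq_trans Qb; lia.
  have Qb' : Q <= b' by move: ne Qb; rewrite E; clear; lia.
  have lt : b' ^ 8 < Q ^ 8 * (2 * m) by apply: Bf_min => //; rewrite -/b E.
  apply: leq_trans (_ : (2 * b') ^ 8 <= _).
    by rewrite leq_exp2r // E; move: Qb' Q3; clear; lia.
  rewrite expnMn; apply: leq_trans (leq_mul (leqnn (2 ^ 8)) (ltnW lt)) _.
  move: (Q ^ 8) => X; rewrite (mulnCA X 2 m) [2 ^ 8 * (2 * _)]mulnA -[512 * X * m]mulnA.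
  exact: leq_mul.
have bt : t <= (4 + kost (mainS Q) * (CT Q * 125).+1) * b ^ 3.
  apply: leq_trans le _; rewrite /tbound; set be := Bf Q (2 * e).
  have beb : be <= b by apply: Bf_mono; rewrite leq_mul2l em orbT.
  have b3 : 1 <= b ^ 3 by rewrite expn_gt0 (leq_trans _ Qb) //; lia.
  have h1 : (4 * be + 4) ^ 3 <= 125 * b ^ 3.
    rewrite (_ : 125 = 5 ^ 3) // -expnMn leq_exp2r //; move: beb Qb Q3; clear; lia.
  rewrite mulnDl; apply: leq_add; first by rewrite leq_pmulr.
  rewrite -[kost _ * _ * _]mulnA leq_mul2l; apply/orP; right.
  rewrite [(CT Q * 125).+1 * _]mulSn -[CT Q * 125 * _]mulnA -add1n; apply: leq_add b3 _.
  by rewrite leq_mul2l h1 orbT.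
apply: leq_trans (_ : ((4 + kost (mainS Q) * (CT Q * 125).+1) * b ^ 3) ^ 8 <= _).
  by rewrite leq_exp2r.
rewrite expnMn -mulnA leq_mul2l; apply/orP; right; rewrite -expnM mulnC expnM -expnMn.
by rewrite leq_exp2r.
Qed.

Local Open Scope ring_scope.

Lemma dynamic_matching (R : realType) (Q : nat) : (20 * 4000 <= Q)%N ->
  exists (p : program) (c : nat) (C : R),
    forall w n : nat, word_size_ok c w n ->
      maintains_matching (2 - 10 ^- 6 : R) w n p /\
      update_time_le (fun m : nat => C * m%:R `^ (3 / 8)) w n p.
Proof.
move=> Qbig; have Q3 : (3 < Q)%N by apply: leq_trans Qbig.
pose C0 := ((4 + kost (mainS Q) * (CT Q * 125).+1) ^ 8 * (512 * Q ^ 8) ^ 3)%N.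
exists (prog Q), (16 + (14 * Q) ^ 8)%N, ((C0%:R : R) `^ (8^-1)) => w n ok.
have [hw WB] := words_ok ok (leq_trans (isT : 0 < 4)%N Q3).
split.
  move=> E s a /(reachable_minv hw Qbig WB)[L [c m]] lg.
  have [s' [t [L' [c' [X m' r4 _]]]]] := step hw Qbig WB m lg.
  have [M [st mM le]] := output Qbig m' r4.
  exists s', t; split => //; exists M; split => //.
  have le' : (2 * 4000 * (mu (apply E a))%:R + #|M|%:R <= 2 * (2 * 4000 * #|M|%:R) :> R)%R.
    by rewrite -!natrM -natrD ler_nat.
  have M0 : (0 <= #|M|%:R :> R)%R by apply: ler0n.
  (* The ratio reached is [2 - 1 / 8000], stronger than required. *)
  apply: le_trans (_ : (2 - (2 * 4000)^-1) * #|M|%:R <= _); first by lra.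
  apply: ler_wpM2r => //; rewrite lerD2l lerN2 lef_pV2 ?posrE ?exprn_gt0 ?mulr_gt0 ?ltr0n //.
  by rewrite -natrM -natrX ler_nat; apply: leq_trans (_ : (10 ^ 4 <= _)%N); rewrite ?leq_pexp2l.
move=> E s a s' t re lg X.
have [L [c m]] := reachable_minv hw Qbig WB re.
have [s2 [t2 [L' [c' [X2 m' r4 le]]]]] := step hw Qbig WB m lg.
have [_ E2] := exec_det X X2; rewrite -{}E2 in le; set mm := maxn _ _.
have mm0 : (0 < mm)%N.
  rewrite /mm leq_max; case: a lg {X X2 le m' mm} => x y /=.
    move=> _; apply/orP; right; rewrite card_gt0; apply/set0Pn; exists [set x; y].
    by rewrite !inE eqxx.
  by move=> xyE; apply/orP; left; rewrite card_gt0; apply/set0Pn; exists [set x; y].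
have := tbound_pow Q3 mm0 (leq_maxr _ _) le; rewrite -/C0 => le8.
have le8' : (t%:R ^+ 8 <= C0%:R * mm%:R ^+ 3 :> R)%R by rewrite -!natrX -natrM ler_nat.
have t0 : (0 <= t%:R :> R)%R by apply: ler0n.
have m0 : (0 <= mm%:R :> R)%R by apply: ler0n.
have Et : (t%:R ^+ 8 : R) `^ (8^-1) = t%:R.
  by rewrite -powR_mulrn // -powRrM mulfV ?powRr1 // pnatr_eq0.
have Em : (mm%:R ^+ 3 : R) `^ (8^-1) = mm%:R `^ (3 / 8).
  by rewrite -powR_mulrn // -powRrM.
rewrite -Et -Em -powRM ?exprn_ge0 // ?ler0n //.
by apply: ge0_ler_powR; rewrite ?nnegrE ?invr_ge0 ?exprn_ge0 ?mulr_ge0 ?exprn_ge0 ?ler0n.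
Qed.

Theorem theorem1p1 (R : realType) :
  exists (p : program) (c : nat) (C : R),
    forall w n : nat, word_size_ok c w n ->
      maintains_matching (2 - 10 ^- 6 : R) w n p /\
      update_time_le (fun m : nat => C * m%:R `^ (3 / 8)) w n p.
Proof. exact: dynamic_matching (leqnn (20 * 4000)). Qed.
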